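(* Let $\psi$ be a unit vector in $A^2$, let $\psi^\alpha=V^\alpha\psi$ for $\alpha>-1$, and let $f$ be a non-negative function in $L^1(\mathbb D,d\lambda)\cap L^\infty(\mathbb D)$. Then $$\lim_{\alpha\to\infty}\|\mathbf L_f^{\psi^\alpha,\alpha}\|_{A_\alpha^2}=\|f\|_\infty,$$ where $\|\cdot\|_{A^2_\alpha}$ denotes the operator norm on $A_\alpha^2$.
   Context: $\mathbb D$ is the open unit disc, $dA$ is area measure, $d\lambda(z)=\frac{dA(z)}{\pi(1-|z|^2)^2}$ on $\mathbb D$. For $\alpha>-1$, $A_\alpha^2$ is the Hilbert space of analytic functions $u$ on $\mathbb D$ with $\|u\|_{A^2_\alpha}^2=\int_{\mathbb D}|u|^2\,dA_\alpha<\infty$, where $dA_\alpha(z)=\frac{\alpha+1}{\pi}(1-|z|^2)^\alpha dA(z)$; $A^2=A_0^2$. The unitary operator $V^\alpha:A^2\to A_\alpha^2$ is $$V^\alpha\Big(\sum_{n\ge0}a_nz^n\Big)=\sum_{n\ge0}\frac{a_n}{\sqrt{n+1}}\sqrt{\frac{\Gamma(n+\alpha+2)}{n!\,\Gamma(\alpha+2)}}\,z^n.$$ For $z\in\mathbb D$, the unitary operator $U_z^\alpha$ on $A_\alpha^2$ is $$U_z^\alpha u(\zeta)=u(\varphi_z(\zeta))\frac{(1-|z|^2)^{(2+\alpha)/2}}{(1-\bar z\zeta)^{2+\alpha}},\qquad\varphi_z(\zeta)=\frac{\zeta-z}{1-\bar z\zeta}$$ (principal branch). Write $u_\theta(\zeta)=u(e^{i\theta}\zeta)$.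 For $\psi\in A_\alpha^2$ and $f\in L^\infty(\mathbb D)$ (regarded as a function on $\mathbb T\times\mathbb D$, $\mathbb T=\partial\mathbb D$, independent of the first variable) the localization operator $\mathbf L_f^{\psi,\alpha}$ on $A^2_\alpha$ is defined by $$\langle\mathbf L_f^{\psi,\alpha}g,h\rangle_{A_\alpha^2}=(\alpha+1)\int_0^{2\pi}\frac{d\theta}{2\pi}\int_{\mathbb D}f(z)\langle g,U_z^\alpha\psi_\theta\rangle_{A_\alpha^2}\langle U_z^\alpha\psi_\theta,h\rangle_{A_\alpha^2}\,d\lambda(z),\quad g,h\in A_\alpha^2.$$ *)

(* Defs.v *)
From HB Require Import structures.
From mathcomp Require Import all_boot all_order all_algebra.
From mathcomp Require Import all_classical all_reals all_analysis.
From mathcomp Require Import measurable_realfun complex.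
Set Implicit Arguments.
Unset Strict Implicit.
Unset Printing Implicit Defensive.
Import Order.TTheory GRing.Theory Num.Theory.
Import numFieldNormedType.Exports.

Local Open Scope classical_set_scope.
Local Open Scope ring_scope.
Local Open Scope complex_scope.

(* The complex numbers are R[i] for R : realType; their topology is that of
   the numFieldType R[i], reached through the regular module R[i]^o. A function
   on the unit disc is a function R[i] -> R[i] (or R[i] -> R) whose values
   outside the disc never matter. Area measure is the product of two copies of
   Lebesgue measure, on coordinates (x, y) standing for x + i y. *)

Section Disc.
Variable R : realType.
Let mR := measurableTypeR R.

Definition of_coord (p : mR * mR) : R[i] := (p.1 : R) +i* (p.2 : R).

(* Real-valued squared modulus (the norm `|z| of R[i] has values in R[i]). *)
Definition sqmod (z : R[i]) : R := complex.Re z ^+ 2 + complex.Im z ^+ 2.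

Definition unit_disc : set R[i] := [set z | sqmod z < 1].

Definition disc_coord : set (mR * mR) := of_coord @^-1` unit_disc.

Lemma measurable_disc_coord : measurable disc_coord.
Proof.
rewrite /disc_coord /of_coord /unit_disc /sqmod /preimage /=.
rewrite -[X in measurable X]setTI.
have mf : measurable_fun setT (fun p : mR * mR => (p.1 : R) ^+ 2 + (p.2 : R) ^+ 2 : mR).
  apply: measurable_funD; apply: measurable_funX.
  - exact: measurable_fst.
  - exact: measurable_snd.
have := mf measurableT _ (measurable_itv `]-oo, (1 : R)[).
by congr measurable; apply/seteqP; split => p /=; rewrite in_itv.
Qed.

Definition area : {measure set (mR * mR) -> \bar R} :=
  (@lebesgue_measure R \x @lebesgue_measure R)%E.

Definition disc_area : {measure set (mR * mR) -> \bar R} :=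
  mrestr area measurable_disc_coord.

Definition disc_int (F : R[i] -> R) : R :=
  \int[area]_(p in disc_coord) F (of_coord p).

Definition disc_cint (F : R[i] -> R[i]) : R[i] :=
  disc_int (fun z => complex.Re (F z)) +i* disc_int (fun z => complex.Im (F z)).

(* Density of the hyperbolic measure dlambda with respect to dA. *)
Definition lambda_density (z : R[i]) : R := (pi * (1 - sqmod z) ^+ 2)^-1.

(* Density of dA_alpha with respect to dA. *)
Definition bergman_density (alpha : R) (z : R[i]) : R :=
  (alpha + 1) / pi * (1 - sqmod z) `^ alpha.

Definition nonneg_on_disc (f : R[i] -> R) : Prop :=
  {ae disc_area, forall p, 0 <= f (of_coord p)}.

Definition in_L1_lambda (f : R[i] -> R) : Prop :=
  measurable_fun disc_coord (f \o of_coord) /\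
  area.-integrable disc_coord
    (fun p => (f (of_coord p) * lambda_density (of_coord p))%:E).

Definition Linfty_norm (f : R[i] -> R) : \bar R :=
  'N[disc_area]_+oo [EFin \o (f \o of_coord)]%E.

Definition in_Linfty (f : R[i] -> R) : Prop :=
  measurable_fun disc_coord (f \o of_coord) /\ (Linfty_norm f < +oo)%E.

End Disc.

Section Bergman.
Variable R : realType.
Implicit Types (alpha : R) (u v : R[i] -> R[i]) (z w : R[i]).

Definition analytic_on_disc u : Prop :=
  forall z, z \in @unit_disc R -> derivable (u : R[i]^o -> R[i]^o) z 1.

Definition bergman alpha u : Prop :=
  analytic_on_disc u /\
  (\int[@area R]_(p in @disc_coord R)
     (sqmod (u (of_coord p)) * bergman_density alpha (of_coord p))%:E
   < +oo)%E.

Definition bergman_norm alpha u : R :=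
  Num.sqrt (disc_int (fun z => sqmod (u z) * bergman_density alpha z)).

Definition bergman_inner alpha u v : R[i] :=
  disc_cint (fun z => u z * (v z)^* * (bergman_density alpha z)%:C).

Definition sums_on_disc (a : nat -> R[i]) u : Prop :=
  forall z, z \in @unit_disc R ->
    series (fun n => a n * z ^+ n : R[i]^o) @ \oo --> (u z : R[i]^o).

(* The Taylor coefficients of u at 0, for u analytic on the disc. *)
Definition power_coef u : nat -> R[i] :=
  xget (fun=> 0) [set a | sums_on_disc a u].

Definition Gamma (x : R) : R :=
  \int[@lebesgue_measure R]_(t in `]0, +oo[) (t `^ (x - 1) * expR (- t)).

Definition V_factor alpha (n : nat) : R :=
  (Num.sqrt n.+1%:R)^-1 *
  Num.sqrt (Gamma (n%:R + alpha + 2) / (n`!%:R * Gamma (alpha + 2))).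

Definition V alpha u : R[i] -> R[i] := fun z =>
  limn (series (fun n => power_coef u n * (V_factor alpha n)%:C * z ^+ n
                         : R[i]^o)).

Definition cis (t : R) : R[i] := cos t +i* sin t.

(* Principal argument, in ]-pi, pi] for w != 0. *)
Definition principal_arg w : R :=
  let t := acos (complex.Re w / Num.sqrt (sqmod w)) in
  if 0 <= complex.Im w then t else - t.

(* Principal branch of w ^ s for w != 0 and a real exponent s. *)
Definition cpow w (s : R) : R[i] :=
  (Num.sqrt (sqmod w) `^ s)%:C * cis (s * principal_arg w).

Definition moebius z w : R[i] := (w - z) / (1 - z^* * w).

Definition U alpha z u : R[i] -> R[i] := fun w =>
  u (moebius z w) *
  (((1 - sqmod z) `^ ((2 + alpha) / 2))%:C / cpow (1 - z^* * w) (2 + alpha)).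

Definition rotate (t : R) u : R[i] -> R[i] := fun w => u (cis t * w).

Definition angle_mean (F : R -> R[i]) : R[i] :=
  (\int[@lebesgue_measure R]_(t in `[0, 2 * pi]) (complex.Re (F t) / (2 * pi)))
  +i*
  (\int[@lebesgue_measure R]_(t in `[0, 2 * pi]) (complex.Im (F t) / (2 * pi))).

Definition localization_form alpha (psi : R[i] -> R[i]) (f : R[i] -> R)
    (g h : R[i] -> R[i]) : R[i] :=
  (alpha + 1)%:C *
  angle_mean (fun t => disc_cint (fun z =>
    (f z)%:C * bergman_inner alpha g (U alpha z (rotate t psi))
    * bergman_inner alpha (U alpha z (rotate t psi)) h
    * (lambda_density z)%:C)).

(* For g in the Bergman space, the element u of that space (unique on the disc)
   such that <u, h> = localization_form g h for every h. *)
Definition localization_op alpha (psi : R[i] -> R[i]) (f : R[i] -> R)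
    (g : R[i] -> R[i]) : R[i] -> R[i] :=
  xget (fun=> 0)
    [set u | bergman alpha u /\
       forall h, bergman alpha h ->
         bergman_inner alpha u h = localization_form alpha psi f g h].

Definition bergman_opnorm alpha (T : (R[i] -> R[i]) -> (R[i] -> R[i])) : \bar R :=
  ereal_sup [set (bergman_norm alpha (T g))%:E | g in
    [set g | bergman alpha g /\ bergman_norm alpha g <= 1]].

End Bergman.

(* Main.v *)
(* Let p(t, z) = <g, U_z psi_t>, psi = psi^alpha a unit vector.

   Upper bound. The orthogonality relation
     (alpha + 1) int dt/2pi int |p(t, z)|^2 dlambda(z) = |g|^2 |psi|^2
   bounds the form by |f|_oo. Averaging over t and Parseval on circles reduce it
   to psi = z^n; there the integrals are the Taylor coefficients in |zeta|^2 of
     int dlambda(z) int dt |U_(-z) g (e^(it) zeta)|^2,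
   which by Moebius invariance of dlambda depends on g only through |g|^2, so
   that they may be computed at g = 1.

   Lower bound. Let k_w = U_w 1 be the normalized kernels. By the reproducing
   property, <L k_w, k_w> is the average of f(z) against a probability kernel
   depending only on phi_z(w), and this kernel is the radial average of the mass
   |psi^alpha|^2 dA_alpha, which concentrates at 0 as alpha -> oo since
   |V^alpha psi|^2 = sum |c_n|^2 / (n + 1) coefficientwise and
   |z^(n+1)|^2 / |z^n|^2 = (n + 1) / (n + alpha + 2). Integrating
   <L k_w, k_w> <= |L| over w in a set E whose complement is at positive distance
   from some F in {f > |f|_oo - eps}, with lambda(E \ F) small, gives
   |L| lambda(E) >= (1 - o(1)) int_F f dlambda. *)

(* Two choices in the definitions shape the proof. [localization_op] and [power_coef] are picked by
   [xget], so nothing is known of them before existence is proved: the form must be bounded and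
   represented by an element of the space ([riesz]), and each square-integrable analytic function
   must be given a power series. The latter comes from the reproducing property: at [alpha = 0] the
   kernel is [(1 - z^* w)^-2], whose partial sums converge uniformly in [w], and dilations [u (k z)]
   bring the other weights to that case. Underneath lies the mean value property, proved by
   Goursat's subdivision in polar coordinates. Integrals are exchanged for nonnegative functions
   only. Signed and complex quantities enter by polarization of squared norms, and Cauchy-Schwarz
   takes the form of an arithmetic-geometric mean bound after rescaling. The number [wn alpha n] is
   the squared norm of [z^n]; through it all norms, [V] and the orthogonality relation are read off
   Taylor coefficients. As the limit is at infinity, only [alpha >= 0] is treated. *)
From HB Require Import structures.
Require Import Defs.
From mathcomp Require Import all_boot all_order all_algebra.
From mathcomp Require Import all_classical all_reals all_analysis.
From mathcomp Require Import measurable_realfun complex ess_sup_inf.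
From mathcomp Require Import ring lra.
Set Implicit Arguments.
Unset Strict Implicit.
Unset Printing Implicit Defensive.
Import Order.TTheory GRing.Theory Num.Theory.
Import numFieldNormedType.Exports.
Local Open Scope classical_set_scope.
Local Open Scope ring_scope.
Local Open Scope complex_scope.

(** * Changes of variables for Lebesgue and area measure *)

Section WeightedPushforward.
Context d1 d2 (T : measurableType d1) (U : measurableType d2) (R : realType).
Variables (mu : {measure set T -> \bar R}) (phi : T -> U) (h : T -> R).
Hypotheses (mphi : measurable_fun setT phi) (mh : measurable_fun setT h).
Hypothesis h0 : forall x, 0 <= h x.
Local Open Scope ereal_scope.

(** The image under [phi] of the measure with density [h]. A change of variables with Jacobian [h]
    is the statement that this image is a given measure. *)
Definition wpush (A : set U) : \bar R := \int[mu]_x ((h x)%:E * (\1_A (phi x))%:E).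

Let mwI A : measurable A ->
  measurable_fun setT (fun x => (h x)%:E * (\1_A (phi x))%:E).
Proof.
move=> mA; apply: emeasurable_funM; first exact/measurable_EFinP.
apply/measurable_EFinP; apply: (measurableT_comp _ mphi).
exact: measurable_indic.
Qed.

Let wI0 A x : 0 <= (h x)%:E * (\1_A (phi x))%:E.
Proof. by rewrite mule_ge0 ?lee_fin. Qed.

Let wpush0 : wpush set0 = 0.
Proof. by rewrite /wpush integral0_eq// => x _; rewrite indic0 mule0. Qed.

Let wpush_ge0 A : 0 <= wpush A.
Proof. by apply: integral_ge0 => x _; exact: wI0. Qed.

Let wpush_sigma : semi_sigma_additive wpush.
Proof.
move=> F mF tF mUF.
rewrite [X in _ --> X](_ : _ = \sum_(n <oo) wpush (F n)).
  by apply/cvg_closeP; split; [exact: is_cvg_nneseries|rewrite closeE].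
rewrite /wpush -integral_nneseries//; last by move=> n; exact: mwI.
apply: eq_integral => x _; rewrite nneseriesZl//.
by rewrite -indic_bigcup.
Qed.

HB.instance Definition _ := isMeasure.Build _ _ _ wpush wpush0 wpush_ge0 wpush_sigma.

Definition wpush_measure : {measure set U -> \bar R} := wpush.

Import HBNNSimple.

(** Equality on sets passes to integrals: both sides are limits along the same increasing simple
    functions, for which the claim is a finite sum over indicators. *)
Lemma integral_wpush (nu : {measure set U -> \bar R}) :
  (forall A, measurable A -> wpush A = nu A) ->
  forall f : U -> \bar R, measurable_fun setT f -> (forall y, 0 <= f y) ->
  \int[mu]_x ((h x)%:E * f (phi x)) = \int[nu]_y f y.
Proof.
move=> wnu f mf f0; pose f_ := nnsfun_approx measurableT mf.
have cf y : (f_ n y)%:E @[n --> \oo] --> f y by exact: cvg_nnsfun_approx.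
have mh' : measurable_fun setT (EFin \o h) by exact/measurable_EFinP.
have mfphi n : measurable_fun setT (fun x => (f_ n (phi x))%:E).
  by apply/measurable_EFinP; apply: (measurableT_comp _ mphi).
have Hge n r y : 0 <= (r * \1_(f_ n @^-1` [set r]) y)%:E.
  by rewrite EFinM nnfun_muleindic_ge0.
transitivity (limn (fun n => \int[mu]_x ((h x)%:E * (f_ n (phi x))%:E))).
  rewrite -monotone_convergence//; first last.
  - by move=> x _ m n mn; apply: lee_wpmul2l; rewrite lee_fin//; exact/lefP/nd_nnsfun_approx.
  - by move=> n x _; rewrite mule_ge0 ?lee_fin.
  - by move=> n; exact: emeasurable_funM.
  apply: eq_integral => x _; apply/esym/cvg_lim => //.
  by apply: cvgeZl => //; exact: cf.
transitivity (limn (fun n => \int[nu]_y (f_ n y)%:E)); last first.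
  rewrite -monotone_convergence//; first last.
  - by move=> x _ m n mn; rewrite lee_fin//; exact/lefP/nd_nnsfun_approx.
  - by move=> n x _; rewrite lee_fin.
  - by move=> n; exact/measurable_EFinP.
  by apply: eq_integral => x _; apply/cvg_lim => //; exact: cf.
congr (limn _); apply/funext => n.
under eq_integral do rewrite fimfunE -fsumEFin//.
under [RHS]eq_integral do rewrite fimfunE -fsumEFin//.
rewrite [RHS]ge0_integral_fsum//; last 2 first.
- by move=> y; exact/measurable_EFinP/measurable_funM.
- by move=> y x _; exact: Hge.
under eq_integral => x _.
  rewrite ge0_mule_fsumr; last by move=> r; exact: Hge.
  over.
rewrite /= ge0_integral_fsum//; last 2 first.
- move=> y; apply: emeasurable_funM => //; apply/measurable_EFinP.
  by apply: measurable_funM => //; apply: (measurableT_comp _ mphi).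
- by move=> y x _; rewrite mule_ge0 ?lee_fin//; exact: Hge.
apply: eq_fsbigr => r _.
rewrite integralZl_indic_nnsfun//= integral_indic// setIT -wnu// /wpush.
have [r0|r0] := leP 0%R r.
  rewrite -ge0_integralZl//; last exact: mwI.
  by apply: eq_integral => x _; rewrite EFinM muleCA.
rewrite preimage_nnfun0//.
by rewrite !integral0_eq ?mule0// => x _; rewrite indic0 ?mulr0 mule0.
Qed.

End WeightedPushforward.

(** * Translation, scaling and inversion of the real line *)

Section Substitution1.
Variable R : realType.
Local Notation mR := (measurableTypeR R).
Local Notation leb := (@lebesgue_measure R).
Local Open Scope ereal_scope.

(** By uniqueness of Lebesgue measure a substitution need only be checked on half-open intervals,
    where it is an elementary computation. *)
Lemma leb_subst (phi h : mR -> mR) (f : mR -> \bar R) :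
  measurable_fun setT phi -> measurable_fun setT h -> (forall x, 0 <= h x)%R ->
  (forall a b : R, (a < b)%R ->
    \int[leb]_x ((h x)%:E * (\1_(`]a, b]%classic : set R) (phi x))%:E) = (b - a)%:E) ->
  measurable_fun setT f -> (forall y, 0 <= f y) ->
  \int[leb]_x ((h x)%:E * f (phi x)) = \int[leb]_x f x.
Proof.
move=> mphi mh h0 hab mf f0.
apply: (integral_wpush mphi mh h0) => //= A mA.
apply/esym/(@lebesgue_measure_unique R
  (wpush leb phi h : {measure set mR -> \bar R})) => //= _ [[a b]] _ <- /=.
rewrite lebesgue_measure_itv/= lte_fin; case: ifPn => ab.
  by rewrite /wpush hab.
rewrite set_itv_ge ?bnd_simp//; exact/esym/measure0.
Qed.

Lemma integral_indic_itv (i : interval R) :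
  \int[leb]_x (\1_([set` i] : set R) x)%:E = leb [set` i].
Proof. by rewrite integral_indic// setIT. Qed.

Lemma leb_shift (a : R) (f : mR -> \bar R) :
  measurable_fun setT f -> (forall y, 0 <= f y) ->
  \int[leb]_x f (x + a)%R = \int[leb]_x f x.
Proof.
move=> mf f0; rewrite -[RHS](@leb_subst (fun x => x + a)%R (cst 1%R))//=.
- by apply: eq_integral => x _; rewrite mul1e.
- by apply: measurable_funD.
- move=> u v uv.
  rewrite (_ : (fun _ => _) = (fun x : R => (\1_(`]u - a, v - a]%classic) x)%:E)).
    by rewrite integral_indic_itv lebesgue_measure_itv/= lte_fin ltrD2r uv -EFinB; congr (_%:E); ring.
  apply/funext => x; rewrite mul1e !indicE !mem_setE !in_itv/=.
  by rewrite ltrBlDr lerBrDr.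
Qed.

Lemma leb_scale (c : R) (f : mR -> \bar R) : c != 0%R ->
  measurable_fun setT f -> (forall y, 0 <= f y) ->
  \int[leb]_x (`|c|%:E * f (c * x)%R) = \int[leb]_x f x.
Proof.
move=> c0 mf f0; rewrite -[RHS](@leb_subst (fun x => c * x)%R (cst `|c|%R))//=.
  by apply: measurable_funM.
move=> u v uv.
rewrite ge0_integralZl//=; last first.
  apply/measurable_EFinP; apply: (@measurableT_comp _ _ _ mR mR mR (\1_(`]u, v]%classic)))%R.
    exact: measurable_indic.
  by apply: measurable_funM.
have [cp|cn] := ltP 0%R c.
  rewrite (_ : (fun _ => _) = (fun x : R => (\1_(`]u / c, v / c]%classic) x)%:E)).
    rewrite integral_indic_itv lebesgue_measure_itv/= lte_fin ltr_pM2r ?invr_gt0// uv.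
    by rewrite -EFinB -EFinM gtr0_norm//; congr (_%:E); field.
  apply/funext => x; rewrite !indicE !mem_setE !in_itv/=.
  by rewrite ltr_pdivrMr// ler_pdivlMr// mulrC.
have {}cn : (c < 0)%R by rewrite lt_neqAle c0.
rewrite (_ : (fun _ => _) = (fun x : R => (\1_(`[v / c, u / c[%classic) x)%:E)).
  rewrite integral_indic_itv lebesgue_measure_itv/= lte_fin ltr_nM2r ?invr_lt0// uv.
  by rewrite -EFinB -EFinM ltr0_norm//; congr (_%:E); field.
apply/funext => x; rewrite !indicE !mem_setE !in_itv/=.
by rewrite ltr_ndivlMr// ler_ndivrMr// mulrC andbC.
Qed.

Lemma ae_neq0 : {ae leb, forall x : mR, x != 0%R}.
Proof.
exists [set 0%R]; split => //; first exact: lebesgue_measure_set1.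
by move=> x /= /negP; rewrite negbK => /eqP.
Qed.


Lemma measurable_invr : measurable_fun setT (fun x : mR => x^-1 : mR)%R.
Proof.
have mE : measurable_fun setT (fun x : mR => x == 0 :> R)%R by apply: measurable_fun_eqr.
rewrite (_ : (fun x : mR => x^-1 : mR)%R =
   (fun x => if x == 0 :> R then 0 else x^-1 : mR)%R); last first.
  by apply/funext => x; case: ifPn => // /eqP ->; rewrite invr0.
apply: measurable_fun_if => //; rewrite setTI.
rewrite (_ : _ @^-1` _ = [set x : R | x != 0]%R); last first.
  by apply/seteqP; split => x /=; [move=> /negbT|move=> /negbTE].
apply: open_continuous_measurable_fun.
  exact: open_neq.
by move=> x; rewrite inE /= => x0; exact: inv_continuous.
Qed.

(** Inversion of the positive half-line only. Intervals then have manageable preimages, whereas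
    inversion of the whole line pulls an interval around [0] back to two unbounded pieces. *)
Let phi1 (x : R) : R := (if 0 < x then x^-1 else x)%R.
Let h1 (x : R) : R := (if 0 < x then x ^- 2 else 1)%R.

Let mpos : measurable_fun setT (fun x : mR => (0 < x :> R)%R).
Proof. by apply: measurable_fun_ltr. Qed.

Let mphi1 : measurable_fun setT (phi1 : mR -> mR).
Proof. by apply: measurable_fun_ifT => //; exact: measurable_invr. Qed.

Let mh1 : measurable_fun setT (h1 : mR -> mR).
Proof.
apply: measurable_fun_ifT => //; apply: (measurableT_comp measurable_invr).
exact: exprn_measurable.
Qed.

Let h1_ge0 x : (0 <= h1 x)%R.
Proof. by rewrite /h1; case: ifP => // x0; rewrite invr_ge0 exprn_ge0// ltW. Qed.

Let nu1 := wpush_measure leb mphi1 mh1 h1_ge0.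

Let nu1_0 (v : R) : (0 < v)%R -> nu1 `]0%R, v]%classic = v%:E.
Proof.
move=> v0; rewrite /nu1 /= /wpush.
rewrite (_ : (fun _ => _) = (fun x : R => (x ^- 2)%R%:E) \_ `[v^-1%R, +oo[).
  rewrite -integral_mkcond.
  rewrite (@ge0_continuous_FTC2y R (fun x => x ^- 2)%R (fun x => - x^-1)%R v^-1%R 0%R).
  - by rewrite invrK -EFinB opprK add0r.
  - by move=> x _; rewrite invr_ge0 sqr_ge0.
  - apply: continuous_in_subspaceT => x; rewrite inE/= in_itv/= andbT => vx.
    have x0 : x != 0%R by rewrite gt_eqF// (lt_le_trans _ vx)// invr_gt0.
    by apply: (@continuous_comp _ _ _ (fun y : R => y ^+ 2)%R (fun y => y^-1)%R);
      [exact: exprn_continuous|apply: inv_continuous; rewrite sqrf_eq0].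
  - rewrite -[X in _ --> X]oppr0; apply: cvgN.
    by apply/gtr0_cvgV0; [near=> x|exact: cvg_id]; near: x; exact: nbhs_pinfty_gt.
  - move=> x vx; have x0 : x != 0%R by rewrite gt_eqF// (lt_trans _ vx)// invr_gt0.
    by apply: derivableN; apply: derivableV.
  - apply: cvg_at_right_filter; apply: cvgN; apply: inv_continuous.
    by rewrite invr_eq0 gt_eqF.
  - move=> x; rewrite in_itv/= andbT => vx.
    have x0 : x != 0%R by rewrite gt_eqF// (lt_trans _ vx)// invr_gt0.
    rewrite derive1E deriveN; last exact: derivableV.
    rewrite (_ : GRing.inv = (fun y : R => (id y)^-1%R))// deriveV//.
    by rewrite derive_id scaleNr opprK; rewrite /GRing.scale/= mulr1.
apply/funext => x; rewrite patchE mem_setE in_itv/= andbT.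
rewrite !indicE !mem_setE in_itv/= /phi1 /h1.
have [x0|x0] := ltP 0%R x.
  rewrite invr_gt0 x0/= -[X in (_ <= X)%R]invrK lef_pV2 ?posrE ?invr_gt0//.
  by case: ifP => _; rewrite ?mule1 ?mule0.
by rewrite ltNge x0/= mule0 leNgt (le_lt_trans x0) ?invr_gt0.
Unshelve. all: by end_near.
Qed.

Let nu1E (u v : R) : (u < v)%R -> nu1 `]u, v]%classic = (v - u)%:E.
Proof.
move=> uv.
have neg (a b : R) : (a < b)%R -> (b <= 0)%R -> nu1 `]a, b]%classic = (b - a)%:E.
  move=> ab b0; rewrite /nu1/= /wpush.
  rewrite (_ : (fun _ => _) = (fun x : R => (\1_(`]a, b]%classic) x)%:E)).
    by rewrite integral_indic_itv lebesgue_measure_itv/= lte_fin ab -EFinB.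
  apply/funext => x; rewrite !indicE !mem_setE !in_itv/= /phi1 /h1.
  have [x0|x0] := ltP 0%R x; last by rewrite mul1e.
  have -> : (x^-1 <= b)%R = false by apply/negbTE; rewrite -ltNge (le_lt_trans b0)// invr_gt0.
  by rewrite (lt_geF (le_lt_trans b0 x0)) !andbF mule0.
have [v0|v0] := leP v 0%R; first exact: neg.
have [u0|u0] := ltP u 0%R.
  rewrite (@itv_bndbnd_setU _ _ _ (BRight 0%R)) ?bnd_simp ?ltW// measureU//.
  - transitivity ((0 - u)%:E + v%:E); last by rewrite sub0r -EFinD addrC.
    by congr (_ + _); [exact: neg|exact: nu1_0].
  - apply/seteqP; split => x //=; rewrite !in_itv/= => -[/andP[_ x1] /andP[x2 _]].
    by move: (le_lt_trans x1 x2); rewrite ltxx.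
move: u0; rewrite le_eqVlt => /predU1P[<-|u0]; first by rewrite subr0 nu1_0.
have : nu1 `]0%R, v]%classic = nu1 `]0%R, u]%classic + nu1 `]u, v]%classic.
  rewrite -measureU//.
    by rewrite -itv_bndbnd_setU// bnd_simp// ltW.
  apply/seteqP; split => x //=; rewrite !in_itv/= => -[/andP[_ x1] /andP[x2 _]].
  by move: (le_lt_trans x1 x2); rewrite ltxx.
rewrite !nu1_0//; case: (nu1 `]u, v]%classic) => //= r [->].
by congr (_%:E); ring.
Qed.

Let leb_inv1 (f : mR -> \bar R) :
  measurable_fun setT f -> (forall y, 0 <= f y) ->
  \int[leb]_x ((h1 x)%:E * f (phi1 x)) = \int[leb]_x f x.
Proof. by move=> mf f0; apply: leb_subst => //; exact: nu1E. Qed.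

Lemma leb_opp (f : mR -> \bar R) :
  measurable_fun setT f -> (forall y, 0 <= f y) ->
  \int[leb]_x f (- x)%R = \int[leb]_x f x.
Proof.
move=> mf f0; rewrite -[RHS](@leb_scale (-1)%R) ?oppr_eq0 ?oner_eq0//.
  by apply: eq_integral => x _; rewrite normrN normr1 mul1e mulN1r.
Qed.

(** Conjugation by [x -> - x] gives the other half-line: the positive half is inverted, the line
    reflected, the positive half inverted again and the line reflected back. The composite is
    inversion everywhere but at [0], a null set. *)
Lemma leb_inv (f : mR -> \bar R) :
  measurable_fun setT f -> (forall y, 0 <= f y) ->
  \int[leb]_x ((x ^- 2)%:E * f (x^-1)%R) = \int[leb]_x f x.
Proof.
move=> mf f0.
have mN : measurable_fun setT (fun x : mR => - x : mR)%R by exact: oppr_measurable.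
have mT (g : mR -> \bar R) : measurable_fun setT g ->
    measurable_fun setT (fun x => (h1 x)%:E * g (phi1 x)).
  move=> mg; apply: emeasurable_funM; first exact/measurable_EFinP.
  exact: measurableT_comp mg mphi1.
have T0 (g : mR -> \bar R) : (forall y, 0 <= g y) ->
    forall x, 0 <= (h1 x)%:E * g (phi1 x).
  by move=> g0 x; rewrite mule_ge0 ?lee_fin ?h1_ge0.
have mRf (g : mR -> \bar R) : measurable_fun setT g ->
    measurable_fun setT (fun x : mR => g (- x : R)%R).
  by move=> mg; exact: measurableT_comp mg mN.
pose f1 (x : mR) := (h1 x)%:E * f (phi1 x).
pose f2 (x : mR) := f1 (- x)%R.
pose f3 (x : mR) := (h1 x)%:E * f2 (phi1 x).
have mf1 : measurable_fun setT f1 by exact: mT.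
have f10 y : 0 <= f1 y by exact: T0.
have mf2 : measurable_fun setT f2 by exact: mRf.
rewrite -[RHS]leb_inv1// -/f1 -(leb_opp mf1 f10) -(leb_inv1 mf2 (fun y => f10 (- y)%R)).
rewrite -/f3 -(leb_opp (mT _ mf2) (T0 f2 (fun y => f10 (- y)%R))).
apply: ae_eq_integral => //.
- apply: emeasurable_funM; last exact: measurableT_comp mf measurable_invr.
  apply/measurable_EFinP; apply: (measurableT_comp measurable_invr).
  exact: exprn_measurable.
- exact: (mRf (fun x => (h1 x)%:E * f2 (phi1 x)) (mT _ mf2)).
apply: filterS ae_neq0 => x x0 _; rewrite /f3 /f2 /f1 /phi1 /h1.
have [xn|xp|x0'] := ltgtP x 0%R; last by rewrite x0' eqxx in x0.
- by rewrite oppr_gt0 xn invrN opprK sqrrN invr_gt0 ltNge (ltW xn)/= mul1e.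
- by rewrite oppr_gt0 ltNge (ltW xp)/= opprK xp mul1e.
Qed.

End Substitution1.

Ltac cring := apply/eqP; rewrite eq_complex/=; apply/andP; split; apply/eqP; ring.

(** * Affine maps and inversion of the plane *)

Section Area.
Variable R : realType.
Local Notation mR := (measurableTypeR R).
Local Notation leb := (@lebesgue_measure R).
Local Notation area := (@area R).
Local Open Scope ereal_scope.
Implicit Types F : mR * mR -> \bar R.

Lemma areaE F : measurable_fun setT F -> (forall p, 0 <= F p) ->
  \int[area]_p F p = \int[leb]_x \int[leb]_y F (x, y).
Proof. by move=> mF F0; rewrite /Defs.area fubini_tonelli1. Qed.

Lemma areaE' F : measurable_fun setT F -> (forall p, 0 <= F p) ->
  \int[area]_p F p = \int[leb]_y \int[leb]_x F (x, y).
Proof. by move=> mF F0; rewrite (areaE mF F0) fubini_tonelli. Qed.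

Lemma measurable_pair_coord d (T : measurableType d) (f g : T -> mR) :
  measurable_fun setT f -> measurable_fun setT g ->
  measurable_fun setT (fun t => (f t, g t)).
Proof. by move=> mf mg; apply/measurable_fun_pairP; split. Qed.

Lemma measurable_fun_slice1 F (y : mR) : measurable_fun setT F ->
  measurable_fun setT (fun x : mR => F (x, y)).
Proof. by move=> mF; apply: (measurableT_comp mF); exact: measurable_pair_coord. Qed.

Lemma measurable_fun_slice2 F (x : mR) : measurable_fun setT F ->
  measurable_fun setT (fun y : mR => F (x, y)).
Proof. by move=> mF; apply: (measurableT_comp mF); exact: measurable_pair_coord. Qed.

Lemma area_shear1 F (a b : R) : measurable_fun setT F -> (forall p, 0 <= F p) ->
  \int[area]_p F (p.1 + (a * p.2 + b), p.2)%R = \int[area]_p F p.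
Proof.
move=> mF F0; rewrite [RHS](areaE' mF F0) areaE'//; last first.
  apply: (measurableT_comp mF); apply: measurable_pair_coord => //.
  apply: measurable_funD => //; apply: measurable_funD => //.
  exact: measurable_funM.
apply: eq_integral => y _ /=.
by rewrite (@leb_shift R (a * y + b)%R (fun x => F (x, y)))//; exact: measurable_fun_slice1.
Qed.

Lemma area_shear2 F (a b : R) : measurable_fun setT F -> (forall p, 0 <= F p) ->
  \int[area]_p F (p.1, p.2 + (a * p.1 + b))%R = \int[area]_p F p.
Proof.
move=> mF F0; rewrite [RHS](areaE mF F0) areaE//; last first.
  apply: (measurableT_comp mF); apply: measurable_pair_coord => //.
  apply: measurable_funD => //; apply: measurable_funD => //.
  exact: measurable_funM.
apply: eq_integral => x _ /=.
by rewrite (@leb_shift R (a * x + b)%R (fun y => F (x, y)))//; exact: measurable_fun_slice2.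
Qed.

Lemma area_scale1 F (c : R) : c != 0%R -> measurable_fun setT F -> (forall p, 0 <= F p) ->
  \int[area]_p (`|c|%:E * F (c * p.1, p.2)%R) = \int[area]_p F p.
Proof.
move=> c0 mF F0; rewrite [RHS](areaE' mF F0) areaE'//; first last.
- by move=> p; rewrite mule_ge0.
- apply: emeasurable_funM => //.
  apply: (measurableT_comp mF); apply: measurable_pair_coord => //.
  exact: measurable_funM.
apply: eq_integral => y _ /=.
by rewrite (@leb_scale R c (fun x => F (x, y)))//; exact: measurable_fun_slice1.
Qed.

Lemma area_scale2 F (c : R) : c != 0%R -> measurable_fun setT F -> (forall p, 0 <= F p) ->
  \int[area]_p (`|c|%:E * F (p.1, c * p.2)%R) = \int[area]_p F p.
Proof.
move=> c0 mF F0; rewrite [RHS](areaE mF F0) areaE//; first last.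
- by move=> p; rewrite mule_ge0.
- apply: emeasurable_funM => //.
  apply: (measurableT_comp mF); apply: measurable_pair_coord => //.
  exact: measurable_funM.
apply: eq_integral => y _ /=.
by rewrite (@leb_scale R c (fun x => F (y, x)))//; exact: measurable_fun_slice2.
Qed.

Let aff (c d : R[i]) (p : mR * mR) : mR * mR :=
  (complex.Re c * p.1 - complex.Im c * p.2 + complex.Re d,
   complex.Im c * p.1 + complex.Re c * p.2 + complex.Im d)%R.

Let maff c d : measurable_fun setT (aff c d).
Proof.
by apply: measurable_pair_coord; apply: measurable_funD => //;
  apply: measurable_funD => //; try apply: measurable_funN; apply: measurable_funM.
Qed.

(** Multiplication by [a + i b] with [a != 0] factors, as in Gaussian elimination, into shears and
    axis scalings by [a] and [(a^2 + b^2) / a]. Each factor changes one coordinate only and is a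
    substitution on the line. *)
Let area_aff_re F (c d : R[i]) : complex.Re c != 0%R ->
  measurable_fun setT F -> (forall p, 0 <= F p) ->
  \int[area]_p ((sqmod c)%:E * F (aff c d p)) = \int[area]_p F p.
Proof.
case: c d => a b [d1 d2] /= a0 mF F0; rewrite /sqmod/=.
have n0 : (a ^+ 2 + b ^+ 2 != 0)%R.
  by rewrite gt_eqF// ltr_wpDr ?sqr_ge0// lt_neqAle eq_sym sqrf_eq0 a0 sqr_ge0.
have k0 : ((a ^+ 2 + b ^+ 2) / a != 0)%R by rewrite mulf_neq0 ?invr_eq0.
have mI d' (T : measurableType d') (u v : T -> mR) : measurable_fun setT u ->
  measurable_fun setT v -> measurable_fun setT (fun t => F (u t, v t)).
  by move=> mu mv; apply: (measurableT_comp mF); exact: measurable_pair_coord.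
rewrite -(@area_shear2 F (b / a)%R (d2 - b / a * d1)%R mF F0).
set F1 := fun p : mR * mR => F _.
have mF1 : measurable_fun setT F1.
  by apply: mI => //; do 2 apply: measurable_funD => //; apply: measurable_funM.
have F10 p : 0 <= F1 p by exact: F0.
rewrite -(@area_scale2 F1 _ k0 mF1 F10).
set F2 := fun p : mR * mR => _ * F1 _.
have mF2 : measurable_fun setT F2.
  apply: emeasurable_funM => //; apply: (measurableT_comp mF1).
  by apply: measurable_pair_coord => //; apply: measurable_funM.
have F20 p : 0 <= F2 p by rewrite mule_ge0.
rewrite -(@area_shear1 F2 0%R d1 mF2 F20).
set F3 := fun p : mR * mR => F2 _.
have mF3 : measurable_fun setT F3.
  apply: (measurableT_comp mF2).
  by apply: measurable_pair_coord => //; do 2 apply: measurable_funD => //; apply: measurable_funM.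
have F30 p : 0 <= F3 p by exact: F20.
rewrite -(@area_scale1 F3 _ a0 mF3 F30).
set F4 := fun p : mR * mR => _ * F3 _.
have mF4 : measurable_fun setT F4.
  apply: emeasurable_funM => //; apply: (measurableT_comp mF3).
  by apply: measurable_pair_coord => //; apply: measurable_funM.
have F40 p : 0 <= F4 p by rewrite mule_ge0.
rewrite -(@area_shear1 F4 (- (b / a))%R 0%R mF4 F40).
apply: eq_integral => -[x y] _; rewrite /F4 /F3 /F2 /F1 /aff/= muleA -EFinM.
congr (_%:E * F (_, _)).
- rewrite normrM normfV mulrCA mulfV ?mulr1 ?normr_eq0//.
  by rewrite ger0_norm// addr_ge0 ?sqr_ge0.
- by field.
- by field.
Qed.

Lemma area_affine F (c d : R[i]) : c != 0%R ->
  measurable_fun setT F -> (forall p, 0 <= F p) ->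
  \int[area]_p ((sqmod c)%:E * F (aff c d p)) = \int[area]_p F p.
Proof.
move=> c0 mF F0; have [a0|] := eqVneq (complex.Re c) 0%R; last by move=> a0; apply: (area_aff_re d a0 mF F0).
have b0 : complex.Im c != 0%R.
  by move: c0; rewrite eq_complex/= a0 eqxx.
pose b := complex.Im c.
(* A purely imaginary [c = i b] is the product of [1 + i] and [(b / 2) (1 + i)], both with nonzero
   real part. *)
rewrite -[RHS](@area_aff_re F (Complex 1%R 1%R : R[i]) d) ?oner_eq0//.
rewrite -[RHS](@area_aff_re _ (Complex (b / 2)%R (b / 2)%R : R[i]) 0%R) ?mulf_neq0 ?invr_eq0 ?pnatr_eq0//=; first last.
- by move=> p; rewrite mule_ge0// lee_fin /sqmod addr_ge0 ?sqr_ge0.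
- by apply: emeasurable_funM => //; apply: (measurableT_comp mF); exact: maff.
apply: eq_integral => -[x y] _; rewrite muleA -EFinM; congr (_%:E * F _).
  by rewrite /sqmod /= a0 /b; field.
by rewrite /aff/= a0 /b; congr (_, _); field.
Qed.

(** Coordinates [(x, k x)] stand in for polar ones: lines through the origin are indexed by their
    slope, with Jacobian [|x|]. They serve for inversion and for radial integrals. *)
Lemma integral_slopes F : measurable_fun setT F -> (forall p, 0 <= F p) ->
  \int[area]_p F p = \int[leb]_k \int[leb]_x (`|x|%:E * F (x, k * x)%R).
Proof.
move=> mF F0.
have mG : measurable_fun setT (fun p : mR * mR => `|p.1|%:E * F (p.1, p.2 * p.1)%R).
  apply: emeasurable_funM.
    by apply/measurable_EFinP; apply: measurableT_comp.
  apply: (measurableT_comp mF); apply: measurable_pair_coord => //.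
  exact: measurable_funM.
have G0 (p : mR * mR) : 0 <= `|p.1|%:E * F (p.1, p.2 * p.1)%R by rewrite mule_ge0.
rewrite -(areaE' mG G0) (areaE mF F0) (areaE mG G0).
apply: ae_eq_integral => //.
- exact: measurable_fun_fubini_tonelli_F.
- exact: (@measurable_fun_fubini_tonelli_F _ _ mR mR R leb _ mG G0).
apply: filterS (@ae_neq0 R) => x x0 _ /=.
rewrite -(@leb_scale R x (fun y => F (x, y)))//; last exact: measurable_fun_slice2.
by apply: eq_integral => y _; rewrite (mulrC x).
Qed.

(** The map [z -> 1 / z] sends the line of slope [k] to that of slope [- k], acting on it as
    [x -> 1 / ((1 + k^2) x)]. Slope by slope it is [leb_inv] combined with a scaling by
    [1 + k^2]. *)
Lemma area_inversion F : measurable_fun setT F -> (forall p, 0 <= F p) ->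
  \int[area]_p (((p.1 ^+ 2 + p.2 ^+ 2) ^- 2)%:E *
     F (p.1 / (p.1 ^+ 2 + p.2 ^+ 2), - p.2 / (p.1 ^+ 2 + p.2 ^+ 2))%R) = \int[area]_p F p.
Proof.
move=> mF F0.
have msq : measurable_fun setT (fun p : mR * mR => p.1 ^+ 2 + p.2 ^+ 2 : mR)%R.
  by apply: measurable_funD; apply: measurable_funX.
have miv : measurable_fun setT (fun p : mR * mR => (p.1 ^+ 2 + p.2 ^+ 2)^-1 : mR)%R.
  exact: measurableT_comp (@measurable_invr R) msq.
rewrite [RHS](integral_slopes mF F0) integral_slopes; first last.
- by move=> p; rewrite mule_ge0// lee_fin invr_ge0 sqr_ge0.
- apply: emeasurable_funM.
    apply/measurable_EFinP; apply: (measurableT_comp (@measurable_invr R)).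
    exact: measurable_funX.
  apply: (measurableT_comp mF); apply: measurable_pair_coord.
    exact: measurable_funM.
  by apply: measurable_funM => //; exact: measurable_funN.
have mH : measurable_fun setT (fun p : mR * mR => `|p.2|%:E * F (p.2, p.1 * p.2)%R).
  apply: emeasurable_funM.
    by apply/measurable_EFinP; apply: measurableT_comp.
  apply: (measurableT_comp mF); apply: measurable_pair_coord => //.
  exact: measurable_funM.
have H0 (p : mR * mR) : 0 <= `|p.2|%:E * F (p.2, p.1 * p.2)%R by rewrite mule_ge0.
rewrite -[RHS]leb_opp; last 2 first.
- exact: (@measurable_fun_fubini_tonelli_F _ _ mR mR R leb _ mH H0).
- by move=> k; apply: integral_ge0 => x _; rewrite mule_ge0.
apply: eq_integral => k _.
have c0 : (0 < 1 + k ^+ 2 :> R)%R by rewrite ltr_wpDr ?sqr_ge0.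
have mHk : measurable_fun setT (fun x : mR => `|x|%:E * F (x, - k * x)%R).
  exact: (measurable_fun_slice2 (- k)%R mH).
rewrite -[RHS](leb_inv mHk); last by move=> x; rewrite mule_ge0.
rewrite -[RHS](@leb_scale R (1 + k ^+ 2)%R) ?gt_eqF//; first last.
- by move=> x; rewrite mule_ge0 ?mule_ge0 ?lee_fin ?invr_ge0 ?sqr_ge0.
- apply: emeasurable_funM; last exact: measurableT_comp mHk (@measurable_invr R).
  apply/measurable_EFinP; apply: (measurableT_comp (@measurable_invr R)).
  exact: exprn_measurable.
apply: eq_integral => x _; rewrite /= !muleA -!EFinM.
have [->|x0] := eqVneq x 0%R.
  by rewrite normr0 mul0r mul0e mulr0 invr0 normr0 mulr0 mul0e.
have e : (x ^+ 2 + (k * x) ^+ 2 = (1 + k ^+ 2) * x ^+ 2)%R by ring.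
rewrite e; congr (_%:E * F (_, _)).
- rewrite (gtr0_norm c0) normfV normrM (gtr0_norm c0).
  rewrite !exprMn (_ : x ^+ 2 = `|x| ^+ 2)%R; last by rewrite real_normK ?num_real.
  have : `|x|%R != 0%R by rewrite normr_eq0.
  by move: `|x|%R => z z0; field; rewrite z0 gt_eqF.
- by field; rewrite x0 gt_eqF.
- by field; rewrite x0 gt_eqF.
Qed.

End Area.

(** * Squared modulus and measurability of complex-valued functions *)

Section ComplexMeasurable.
Variable R : realType.
Local Notation mR := (measurableTypeR R).

Lemma sqmodM (z w : R[i]) : sqmod (z * w) = sqmod z * sqmod w.
Proof. by case: z w => a b [c d]; rewrite /sqmod/=; ring. Qed.

Lemma sqmod_ge0 (z : R[i]) : 0 <= sqmod z.
Proof. by rewrite /sqmod addr_ge0 ?sqr_ge0. Qed.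

Lemma sqmod_eq0 (z : R[i]) : (sqmod z == 0) = (z == 0).
Proof. by case: z => a b; rewrite /sqmod/= paddr_eq0 ?sqr_ge0// !sqrf_eq0 eq_complex. Qed.

Lemma sqmod_gt0 (z : R[i]) : (0 < sqmod z) = (z != 0).
Proof. by rewrite lt_neqAle sqmod_ge0 andbT eq_sym sqmod_eq0. Qed.

Lemma sqmod0 : sqmod (0 : R[i]) = 0.
Proof. by apply/eqP; rewrite sqmod_eq0. Qed.

Lemma sqmod1 : sqmod (1 : R[i]) = 1.
Proof. by rewrite /sqmod/= expr1n expr0n addr0. Qed.

Lemma sqmodV (z : R[i]) : sqmod z^-1 = (sqmod z)^-1.
Proof.
have [->|z0] := eqVneq z 0; first by rewrite invr0 sqmod0 invr0.
have s0 : sqmod z != 0 by rewrite sqmod_eq0.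
by apply: (mulfI s0); rewrite -sqmodM !mulfV// sqmod1.
Qed.

Lemma sqmodJ (z : R[i]) : sqmod z^* = sqmod z.
Proof. by case: z => a b; rewrite /sqmod/= sqrrN. Qed.

Lemma sqmodN (z : R[i]) : sqmod (- z) = sqmod z.
Proof. by case: z => a b; rewrite /sqmod/= !sqrrN. Qed.

Lemma sqmodR (x : R) : sqmod x%:C = x ^+ 2.
Proof. by rewrite /sqmod/= expr0n addr0. Qed.

Lemma sqmodX (z : R[i]) n : sqmod (z ^+ n) = sqmod z ^+ n.
Proof. by elim: n => [|n ih]; rewrite ?expr0 ?sqmod1// !exprS sqmodM ih. Qed.

Lemma mulc_conj (z : R[i]) : z * z^* = (sqmod z)%:C.
Proof. by case: z => a b; rewrite /sqmod/=; apply/eqP; rewrite eq_complex/=; apply/andP; split; apply/eqP; ring. Qed.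

Section Cmeas.
Context d (T : measurableType d).

Definition cmeas (f : T -> R[i]) : Prop :=
  measurable_fun setT (fun t => complex.Re (f t) : mR) /\
  measurable_fun setT (fun t => complex.Im (f t) : mR).

Implicit Types f g : T -> R[i].

Lemma cmeas_cst (c : R[i]) : cmeas (fun=> c).
Proof. by split; exact: measurable_cst. Qed.

Lemma cmeas_real (h : T -> mR) : measurable_fun setT h -> cmeas (fun t => (h t : R)%:C).
Proof. by split => //=; exact: measurable_cst. Qed.

Lemma cmeasD f g : cmeas f -> cmeas g -> cmeas (fun t => f t + g t).
Proof.
move=> [f1 f2] [g1 g2]; split.
- by under eq_fun do rewrite raddfD/=; exact: measurable_funD.
- by under eq_fun do rewrite raddfD/=; exact: measurable_funD.
Qed.

Lemma cmeasN f : cmeas f -> cmeas (fun t => - f t).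
Proof.
move=> [f1 f2]; split.
- by under eq_fun do rewrite raddfN/=; exact: measurable_funN.
- by under eq_fun do rewrite raddfN/=; exact: measurable_funN.
Qed.

Lemma cmeasB f g : cmeas f -> cmeas g -> cmeas (fun t => f t - g t).
Proof. by move=> mf mg; apply: cmeasD => //; exact: cmeasN. Qed.

Lemma cmeasM f g : cmeas f -> cmeas g -> cmeas (fun t => f t * g t).
Proof.
move=> [f1 f2] [g1 g2]; split.
- rewrite (_ : (fun _ => _) = (fun t => (complex.Re (f t) * complex.Re (g t)
     - complex.Im (f t) * complex.Im (g t)))); last first.
    by apply/funext => t; case: (f t) (g t) => a b [].
  by apply: measurable_funB; exact: measurable_funM.
- rewrite (_ : (fun _ => _) = (fun t => (complex.Re (f t) * complex.Im (g t)
     + complex.Im (f t) * complex.Re (g t)))); last first.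
    by apply/funext => t; case: (f t) (g t) => a b [].
  by apply: measurable_funD; exact: measurable_funM.
Qed.

Lemma cmeasJ f : cmeas f -> cmeas (fun t => (f t)^*).
Proof.
move=> [f1 f2]; split.
- rewrite (_ : (fun _ => _) = (fun t => complex.Re (f t)))//.
  by apply/funext => t; case: (f t).
- rewrite (_ : (fun _ => _) = (fun t => - complex.Im (f t))).
    exact: measurable_funN.
  by apply/funext => t; case: (f t).
Qed.

Lemma measurable_sqmod f : cmeas f -> measurable_fun setT (fun t => sqmod (f t) : mR).
Proof. by move=> [f1 f2]; apply: measurable_funD; exact: measurable_funX. Qed.

Lemma cmeasV f : cmeas f -> cmeas (fun t => (f t)^-1).
Proof.
move=> mf.
have mi : measurable_fun setT (fun t => (sqmod (f t))^-1 : mR).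
  exact: measurableT_comp (@measurable_invr R) (measurable_sqmod mf).
case: (mf) => f1 f2; split.
- rewrite (_ : (fun _ => _) = (fun t => (complex.Re (f t) * (sqmod (f t))^-1))).
    exact: measurable_funM.
  by apply/funext => t; case: (f t).
- rewrite (_ : (fun _ => _) = (fun t => - (complex.Im (f t) * (sqmod (f t))^-1))).
    by apply: measurable_funN; exact: measurable_funM.
  by apply/funext => t; case: (f t).
Qed.

Lemma cmeas_of_coord (h : T -> mR * mR) : measurable_fun setT h ->
  cmeas (fun t => of_coord (h t)).
Proof.
move=> mh; split => /=.
- exact: (measurableT_comp measurable_fst mh).
- exact: (measurableT_comp measurable_snd mh).
Qed.

Definition to_coord (z : R[i]) : mR * mR := (complex.Re z : mR, complex.Im z : mR).

Lemma to_coordK (z : R[i]) : of_coord (to_coord z) = z.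
Proof. by case: z. Qed.

Lemma measurable_to_coord f : cmeas f -> measurable_fun setT (fun t => to_coord (f t)).
Proof. by move=> [f1 f2]; apply: measurable_pair_coord. Qed.

Lemma measurable_comp_cmeas d' (U : measurableType d') (G : R[i] -> U) f :
  measurable_fun setT (fun p : mR * mR => G (of_coord p)) -> cmeas f ->
  measurable_fun setT (fun t => G (f t)).
Proof.
move=> mG mf.
rewrite (_ : (fun t => G (f t)) = (fun p => G (of_coord p)) \o (fun t => to_coord (f t))).
  exact: measurableT_comp mG (measurable_to_coord mf).
by apply/funext => t /=; rewrite to_coordK.
Qed.

Lemma cmeas_comp (G : R[i] -> R[i]) f :
  measurable_fun setT (fun p : mR * mR => complex.Re (G (of_coord p)) : mR) /\
  measurable_fun setT (fun p : mR * mR => complex.Im (G (of_coord p)) : mR) ->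
  cmeas f -> cmeas (fun t => G (f t)).
Proof.
move=> [m1 m2] mf; split.
- exact: (measurable_comp_cmeas (G := fun z => complex.Re (G z) : mR)).
- exact: (measurable_comp_cmeas (G := fun z => complex.Im (G z) : mR)).
Qed.

Lemma measurable_in_disc f : cmeas f -> measurable_fun setT (fun t => sqmod (f t) < 1).
Proof. by move=> mf; apply: measurable_fun_ltr => //; exact: measurable_sqmod. Qed.

End Cmeas.
End ComplexMeasurable.

(** * Moebius invariance of the hyperbolic measure *)

Section Moebius.
Variable R : realType.
Local Notation mR := (measurableTypeR R).
Local Notation area := (@area R).
Implicit Types (G : R[i] -> \bar R) (a z w : R[i]).

(** Makes [1 - |phi_a(z)|^2] a product of [1 - |a|^2], [1 - |z|^2] and a Jacobian factor. The
    invariance of the disc and that of [lambda] both come from it. *)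
Lemma sqmod_one_sub a z :
  sqmod (1 - a^* * z) - sqmod (z - a) = (1 - sqmod a) * (1 - sqmod z).
Proof. by case: a z => a1 a2 [z1 z2]; rewrite /sqmod/=; ring. Qed.

Lemma one_sub_neq0 a z : sqmod a < 1 -> sqmod z < 1 -> 1 - a^* * z != 0.
Proof.
move=> a1 z1; rewrite -sqmod_gt0.
have := sqmod_one_sub a z => /eqP; rewrite subr_eq => /eqP ->.
by rewrite ltr_pwDl ?sqmod_ge0// mulr_gt0 ?subr_gt0.
Qed.

Lemma sqmod_moebius a z : 1 - a^* * z != 0 ->
  1 - sqmod (moebius a z) = (1 - sqmod a) * (1 - sqmod z) / sqmod (1 - a^* * z).
Proof.
move=> n0; rewrite -sqmod_one_sub /moebius sqmodM sqmodV mulrBl mulfV//.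
by rewrite sqmod_eq0.
Qed.

Lemma moebius_lt1 a z : sqmod a < 1 -> 1 - a^* * z != 0 ->
  (sqmod (moebius a z) < 1) = (sqmod z < 1).
Proof.
move=> a1 n0; rewrite -subr_gt0 sqmod_moebius// -mulrA pmulr_rgt0 ?subr_gt0//.
by rewrite pmulr_lgt0 ?subr_gt0// invr_gt0 sqmod_gt0.
Qed.

(** Extended by [0] off the disc, so that invariance is stated with integrals over the whole
    plane. *)
Definition lambda_weight z : R := if sqmod z < 1 then lambda_density z else 0.

Lemma lambda_weight_ge0 z : 0 <= lambda_weight z.
Proof.
by rewrite /lambda_weight; case: ifP => // _; rewrite invr_ge0 mulr_ge0 ?pi_ge0 ?sqr_ge0.
Qed.

Lemma measurable_lambda_weight d (T : measurableType d) (f : T -> R[i]) : cmeas f ->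
  measurable_fun setT (fun t => lambda_weight (f t) : mR).
Proof.
move=> mf; apply: measurable_fun_ifT => //; first exact: measurable_in_disc.
apply: (measurableT_comp (@measurable_invr R)); apply: measurable_funM => //.
by apply: measurable_funX; apply: measurable_funB => //; exact: measurable_sqmod.
Qed.

Lemma cmeas_moebius d (T : measurableType d) (f g : T -> R[i]) :
  cmeas f -> cmeas g -> cmeas (fun t => moebius (f t) (g t)).
Proof.
move=> mf mg; apply: cmeasM; first exact: cmeasB.
by apply: cmeasV; apply: cmeasB; [exact: cmeas_cst|apply: cmeasM => //; exact: cmeasJ].
Qed.

Lemma cmeas_id : cmeas (@of_coord R).
Proof. exact: (@cmeas_of_coord _ _ _ id). Qed.

Local Open Scope ereal_scope.

Lemma area_affineC G (c d : R[i]) : c != 0%R ->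
  measurable_fun setT (G \o @of_coord R) -> (forall z, 0 <= G z) ->
  \int[area]_p ((sqmod c)%:E * G (c * of_coord p + d)%R) = \int[area]_p G (of_coord p).
Proof.
move=> c0 mG G0; rewrite -(@area_affine R (G \o @of_coord R) c d)//=.
apply: eq_integral => -[x y] _; congr (_ * G _).
by case: c c0 => c1 c2 _; case: d => d1 d2; rewrite /of_coord; cring.
Qed.

Lemma area_invC G :
  measurable_fun setT (G \o @of_coord R) -> (forall z, 0 <= G z) ->
  \int[area]_p (((sqmod (of_coord p)) ^- 2)%:E * G (of_coord p)^-1%R) =
  \int[area]_p G (of_coord p).
Proof.
move=> mG G0; rewrite -(@area_inversion R (G \o @of_coord R))//=.
by apply: eq_integral => -[x y] _; rewrite /sqmod/= /of_coord mulNr.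
Qed.

(** With [b] the conjugate of [a] and [e = 1 / b - a] one has [phi_a(z) = e / (1 - b z) - 1 / b]: an
    affine map, inversion and another affine map. The three Jacobians multiply to
    [(1 - |a|^2)^2 / |1 - b z|^4]. *)
Lemma area_moebius G a : (sqmod a < 1)%R ->
  measurable_fun setT (G \o @of_coord R) -> (forall z, 0 <= G z) ->
  \int[area]_p (((1 - sqmod a) ^+ 2 / sqmod (1 - a^* * of_coord p) ^+ 2)%:E *
     G (moebius a (of_coord p))) = \int[area]_p G (of_coord p).
Proof.
move=> a1 mG G0; have [a0|a0] := eqVneq a 0%R.
  apply: eq_integral => p _.
  have b0 : (a^* = 0)%R by apply/eqP; rewrite conjC_eq0 a0.
  have e : moebius a (of_coord p) = of_coord p.
    by rewrite /moebius b0 mul0r a0 !subr0 divr1.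
  by rewrite e b0 mul0r a0 sqmod0 !subr0 sqmod1 !expr1n invr1 mulr1 mul1e.
pose b : R[i] := (a^*)%R; have b0 : b != 0%R by rewrite conjC_eq0.
pose e : R[i] := (b^-1 - a)%R.
have ab : (a * b = (sqmod a)%:C)%R by exact: mulc_conj.
have e0 : e != 0%R.
  apply/eqP => /(congr1 (fun z => z * b)%R); rewrite mul0r mulrBl mulVf// ab.
  by case=> /eqP; rewrite subr_eq0 eq_sym => /eqP h; rewrite h ltxx in a1.
have me : cmeas (fun p : mR * mR => e * of_coord p - b^-1)%R.
  by apply: cmeasB; [apply: cmeasM; [exact: cmeas_cst|exact: cmeas_id]|exact: cmeas_cst].
have mi : cmeas (fun p : mR * mR => (of_coord p)^-1)%R by apply: cmeasV; exact: cmeas_id.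
have s0 z : 0 <= (sqmod z)%:E by rewrite lee_fin sqmod_ge0.
rewrite -(@area_affineC G e (- b^-1)%R)//.
have mG1 : measurable_fun setT (fun p : mR * mR => (sqmod e)%:E * G (e * of_coord p - b^-1)%R).
  by apply: emeasurable_funM => //; exact: measurable_comp_cmeas.
rewrite -(@area_invC (fun z => (sqmod e)%:E * G (e * z - b^-1)%R))//; last first.
  by move=> z; rewrite mule_ge0.
rewrite -(@area_affineC (fun z => ((sqmod z) ^- 2)%:E * ((sqmod e)%:E * G (e * z^-1 - b^-1)%R)) (- b)%R 1%R); first last.
- by move=> z; rewrite mule_ge0 ?mule_ge0// lee_fin invr_ge0 sqr_ge0.
- apply: emeasurable_funM.
    apply/measurable_EFinP; apply: (measurableT_comp (@measurable_invr R)).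
    by apply: measurable_funX; apply: measurable_sqmod; exact: cmeas_id.
  exact: (measurable_comp_cmeas (G := fun z => (sqmod e)%:E * G (e * z - b^-1)%R)).
- by rewrite oppr_eq0.
apply: eq_integral => p _; set z := of_coord p; rewrite !muleA -!EFinM.
have -> : (- b * z + 1 = 1 - b * z)%R by rewrite mulNr addrC.
have se : (sqmod (- b) * sqmod e = (1 - sqmod a) ^+ 2)%R.
  rewrite sqmodN -sqmodM mulrBr mulfV// (mulrC b a) ab.
  by rewrite (_ : (1 - (sqmod a)%:C)%R = (1 - sqmod a)%:C)%R ?sqmodR// rmorphB rmorph1.
(* At the pole both sides carry the weight [0], because the inverse of [0] is [0]. *)
have [n0|n0] := eqVneq (1 - b * z)%R 0%R.
  by rewrite n0 sqmod0 expr0n/= invr0 !(mulr0, mul0r) !mul0e.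
congr (_%:E * G _); first by rewrite -se mulrAC.
rewrite /moebius -/b /e; apply: (mulIf n0); rewrite mulfVK//.
by rewrite mulrDl mulfVK// mulNr mulrBr mulr1 mulrA mulVf// mul1r; ring.
Qed.

Lemma lambda_moebius G a : (sqmod a < 1)%R ->
  measurable_fun setT (G \o @of_coord R) -> (forall z, 0 <= G z) ->
  \int[area]_p ((lambda_weight (of_coord p))%:E * G (moebius a (of_coord p))) =
  \int[area]_p ((lambda_weight (of_coord p))%:E * G (of_coord p)).
Proof.
move=> a1 mG G0.
rewrite -[RHS](@area_moebius (fun z => (lambda_weight z)%:E * G z) a)//; last 2 first.
- apply: emeasurable_funM => //; apply/measurable_EFinP.
  by apply: measurable_lambda_weight; exact: cmeas_id.
- by move=> z; rewrite mule_ge0 ?lee_fin ?lambda_weight_ge0.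
apply: eq_integral => p _; set z := of_coord p; rewrite muleA -EFinM.
have [n0|n0] := eqVneq (1 - a^* * z)%R 0%R.
  rewrite n0 sqmod0 expr0n/= invr0 mulr0 mul0r /lambda_weight.
  by case: ifPn => z1; rewrite ?mul0e//; move: (one_sub_neq0 a1 z1); rewrite n0 eqxx.
congr (_%:E * _); rewrite /lambda_weight moebius_lt1//.
case: ifPn => z1; last by rewrite mulr0.
rewrite /lambda_density sqmod_moebius//.
have pi0 : pi != 0%R :> R by rewrite gt_eqF// pi_gt0.
have s0 : sqmod (1 - a^* * z)%R != 0%R by rewrite sqmod_eq0.
have a0 : (1 - sqmod a != 0)%R by rewrite subr_eq0 gt_eqF.
have z0 : (1 - sqmod z != 0)%R by rewrite subr_eq0 gt_eqF.
have F (q t u v : R) : (q != 0 -> t != 0 -> u != 0 -> v != 0 ->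
    (q * v ^+ 2)^-1 = u ^+ 2 / t ^+ 2 * (q * (u * v / t) ^+ 2)^-1)%R.
  by move=> q0 t0 u0 v0; field; rewrite t0 v0 q0 u0.
exact: F.
Qed.

End Moebius.

(** * The mean value property of analytic functions *)

Section Modulus.
Variable R : realType.
Implicit Types z w : R[i].

Lemma ReD z w : complex.Re (z + w) = complex.Re z + complex.Re w.
Proof. by case: z w => ? ? []. Qed.

Lemma ImD z w : complex.Im (z + w) = complex.Im z + complex.Im w.
Proof. by case: z w => ? ? []. Qed.

Lemma ReB z w : complex.Re (z - w) = complex.Re z - complex.Re w.
Proof. by case: z w => ? ? []. Qed.

Lemma ImB z w : complex.Im (z - w) = complex.Im z - complex.Im w.
Proof. by case: z w => ? ? []. Qed.

Definition cabs z : R := Num.sqrt (sqmod z).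

Lemma normc_cabs z : `|z| = (cabs z)%:C.
Proof. by rewrite normc_def. Qed.

Lemma cabs_ge0 z : 0 <= cabs z. Proof. exact: sqrtr_ge0. Qed.

Lemma cabs_sqr z : cabs z ^+ 2 = sqmod z.
Proof. by rewrite sqr_sqrtr ?sqmod_ge0. Qed.

Lemma cabs0 : cabs 0 = 0. Proof. by rewrite /cabs sqmod0 sqrtr0. Qed.

Lemma cabs1 : cabs 1 = 1. Proof. by rewrite /cabs sqmod1 sqrtr1. Qed.

Lemma cabs_eq0 z : (cabs z == 0) = (z == 0).
Proof. by rewrite -sqrf_eq0 cabs_sqr sqmod_eq0. Qed.

Lemma cabs_gt0 z : (0 < cabs z) = (z != 0).
Proof. by rewrite lt_neqAle cabs_ge0 andbT eq_sym cabs_eq0. Qed.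

Lemma cabsM z w : cabs (z * w) = cabs z * cabs w.
Proof. by rewrite /cabs sqmodM sqrtrM ?sqmod_ge0. Qed.

Lemma cabsV z : cabs z^-1 = (cabs z)^-1.
Proof. by rewrite /cabs sqmodV sqrtrV ?sqmod_ge0. Qed.

Lemma cabsN z : cabs (- z) = cabs z. Proof. by rewrite /cabs sqmodN. Qed.

Lemma cabsJ z : cabs z^* = cabs z. Proof. by rewrite /cabs sqmodJ. Qed.

Lemma cabsX z n : cabs (z ^+ n) = cabs z ^+ n.
Proof. by elim: n => [|n ih]; rewrite ?expr0 ?cabs1// !exprS cabsM ih. Qed.

Lemma cabsR (x : R) : cabs x%:C = `|x|.
Proof. by rewrite /cabs sqmodR sqrtr_sqr. Qed.

Lemma cabsD z w : cabs (z + w) <= cabs z + cabs w.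
Proof. by have := ler_normD z w; rewrite !normc_cabs -rmorphD/= lecR. Qed.

Lemma cabsB z w : cabs (z - w) = cabs (w - z).
Proof. by rewrite -cabsN opprB. Qed.

Lemma cabs_triangle u z w : cabs (z - w) <= cabs (z - u) + cabs (u - w).
Proof. by rewrite -[z - w](_ : z - u + (u - w) = _) ?cabsD//; ring. Qed.

Lemma cabs_sum (I : Type) (r : seq I) (F : I -> R[i]) :
  cabs (\sum_(i <- r) F i) <= \sum_(i <- r) cabs (F i).
Proof.
elim/big_rec2: _ => [|i y x _ h]; first by rewrite cabs0.
by apply: (le_trans (cabsD _ _)); rewrite lerD2l.
Qed.

Lemma Re_le_cabs z : `|complex.Re z| <= cabs z.
Proof. by rewrite -sqrtr_sqr ler_wsqrtr// /sqmod lerDl sqr_ge0. Qed.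

Lemma Im_le_cabs z : `|complex.Im z| <= cabs z.
Proof. by rewrite -sqrtr_sqr ler_wsqrtr// /sqmod lerDr sqr_ge0. Qed.

Lemma cabs_le_ReIm z : cabs z <= `|complex.Re z| + `|complex.Im z|.
Proof.
rewrite -(ler_pXn2r (n := 2)) ?nnegrE ?cabs_ge0 ?addr_ge0// cabs_sqr /sqmod sqrrD !real_normK ?num_real//.
by rewrite lerD2r lerDl mulrn_wge0// mulr_ge0.
Qed.

Lemma sqmod_lt1 z : (sqmod z < 1) = (cabs z < 1).
Proof. by rewrite -cabs_sqr expr_lt1 ?cabs_ge0. Qed.

Lemma sqmod_le1 z : (sqmod z <= 1) = (cabs z <= 1).
Proof. by rewrite -cabs_sqr expr_le1 ?cabs_ge0. Qed.

Lemma cvgCP (T : Type) (F : set_system T) (FF : Filter F) (f : T -> R[i]) (l : R[i]) :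
  (f : T -> R[i]^o) @ F --> (l : R[i]^o) <->
  (forall e : R, 0 < e -> \forall t \near F, cabs (f t - l) < e).
Proof.
split=> [/cvgrPdist_lt fl e e0|fl].
  have e0' : (0 : R[i]) < e%:C by rewrite ltcR.
  apply: filterS (fl _ e0') => t; rewrite normc_cabs ltcR.
  by rewrite cabsB.
apply/cvgrPdist_lt => e; case: e => a b; rewrite ltcE/= => /andP[/eqP -> a0].
apply: filterS (fl a a0) => t; rewrite normc_cabs cabsB.
by rewrite ltcE/= eqxx.
Qed.

Lemma cvgC_ReIm (T : Type) (F : set_system T) (FF : Filter F) (f : T -> R[i]) (l : R[i]) :
  (f : T -> R[i]^o) @ F --> (l : R[i]^o) <->
  (complex.Re (f t) @[t --> F] --> complex.Re l /\ complex.Im (f t) @[t --> F] --> complex.Im l).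
Proof.
split=> [/cvgCP fl|[/cvgrPdist_lt r /cvgrPdist_lt i]].
  split; apply/cvgrPdist_lt => e e0; apply: filterS (fl e e0) => t; apply: le_lt_trans;
    rewrite cabsB; [rewrite -raddfB; exact: Re_le_cabs|rewrite -raddfB; exact: Im_le_cabs].
apply/cvgCP => e e0.
have e2 : 0 < e / 2 by rewrite divr_gt0.
near=> t.
apply: le_lt_trans (cabs_le_ReIm _) _; rewrite (splitr e) ltrD//.
- by rewrite raddfB/= distrC; near: t; exact: r.
- by rewrite raddfB/= distrC; near: t; exact: i.
Unshelve. all: by end_near.
Qed.

(** Differentiability with a real tolerance, equivalent to [derivable] by [cderivP]. This is the
    form in which the local affine approximation enters Goursat's argument. *)
Definition cderiv (u : R[i] -> R[i]) z (l : R[i]) : Prop := forall e : R, 0 < e ->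
  exists2 d : R, 0 < d & forall h, cabs h < d -> cabs (u (z + h) - u z - l * h) <= e * cabs h.

Lemma nbhs_cabs z (P : R[i] -> Prop) :
  (\forall w \near (z : R[i]^o), P w) <->
  exists2 d : R, 0 < d & forall w, cabs (w - z) < d -> P w.
Proof.
split=> [/nbhs_ballP[e /= e0 zP]|[d d0 zP]].
  case: e e0 zP => a b; rewrite ltcE/= => /andP[/eqP -> a0] zP.
  exists a => // w wz; apply: zP; rewrite -ball_normE/= normc_cabs cabsB.
  by rewrite ltcE/= eqxx.
apply/nbhs_ballP; exists d%:C => /=; first by rewrite ltcR.
by move=> w; rewrite -ball_normE/= normc_cabs ltcR cabsB => /zP.
Qed.

Lemma cderivP (u : R[i] -> R[i]) z l :
  cderiv u z l <-> is_derive (z : R[i]^o) 1 (u : R[i]^o -> R[i]^o) l.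
Proof.
have key : cderiv u z l <->
    (fun h : R[i]^o => h^-1 *: (((u : R[i]^o -> R[i]^o) \o shift z) (h *: 1) - u z)) @ 0^' --> (l : R[i]^o).
  split.
    move=> ul; apply/cvgCP => e e0.
    have [d d0 H] := ul _ (divr_gt0 e0 (ltr0Sn R 1)).
    apply/(nbhs_cabs 0); exists d => // h; rewrite subr0 => hd h0 /=.
    have -> : h^-1 *: (u (h *: 1 + z) - u z) - l = h^-1 * (u (z + h) - u z - l * h).
      by rewrite /GRing.scale/= mulr1 (addrC h) [RHS]mulrBr mulrCA mulVf// mulr1.
    rewrite cabsM cabsV; have hp : 0 < cabs h by rewrite cabs_gt0.
    rewrite mulrC ltr_pdivrMr//; apply: le_lt_trans (H h hd) _.
    by rewrite ltr_pM2r// ltr_pdivrMr// ltr_pMr// ltr1n.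
  move=> /cvgCP ul e e0.
  have /(nbhs_cabs 0)[d d0 H] := ul _ e0.
  exists d => // h hd; have [->|h0] := eqVneq h 0.
    by rewrite addr0 mulr0 subrr subr0 cabs0 mulr0.
  have := H h; rewrite subr0 => /(_ hd h0) /ltW /=.
  have -> : h^-1 *: (u (h *: 1 + z) - u z) - l = h^-1 * (u (z + h) - u z - l * h).
    by rewrite /GRing.scale/= mulr1 (addrC h) [RHS]mulrBr mulrCA mulVf// mulr1.
  rewrite cabsM cabsV; have hp : 0 < cabs h by rewrite cabs_gt0.
  by rewrite mulrC ler_pdivrMr.
split.
  move=> /key ul; apply: DeriveDef; first by apply/cvg_ex; exists l.
  exact/cvg_lim.
move=> [] /cvg_ex[l' H] dl; apply/key.
by rewrite -dl /derive (cvg_lim _ H).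
Qed.

Lemma derivable_cderiv (u : R[i] -> R[i]) z :
  derivable (u : R[i]^o -> R[i]^o) z 1 <-> exists l, cderiv u z l.
Proof.
split=> [uz|[l /cderivP[]//]].
by exists ('D_1 (u : R[i]^o -> R[i]^o) z); apply/cderivP; apply: derivableP.
Qed.

Definition ccont (u : R[i] -> R[i]) z : Prop := forall e : R, 0 < e ->
  exists2 d : R, 0 < d & forall w, cabs (w - z) < d -> cabs (u w - u z) < e.

Lemma ccontP u z : ccont u z <->
  (u : R[i]^o -> R[i]^o) x @[x --> (z : R[i]^o)] --> (u z : R[i]^o).
Proof.
split=> [uz|/cvgCP uz e e0]; last by have /nbhs_cabs := uz e e0.
have H := (@cvgCP (R[i]^o) (nbhs (z : R[i]^o)) (nbhs_filter (z : R[i]^o)) u (u z)).2; apply: H => e e0.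
by have [d d0 H] := uz e e0; apply/nbhs_cabs; exists d.
Qed.

Lemma cderiv_ccont u z l : cderiv u z l -> ccont u z.
Proof.
move=> uz; apply/ccontP; apply: (@differentiable_continuous _ R[i]^o R[i]^o).
apply/derivable1_diffP; apply/derivable_cderiv; by exists l.
Qed.

End Modulus.

(** * Measurability of continuous functions on the disc *)

Section DiscMeasurable.
Variable R : realType.
Local Notation mR := (measurableTypeR R).

(** An open set is the union of the squares it contains that have rational centre and half-side
    [1 / (n + 1)]; there are countably many of these. *)
Lemma open_coord_measurable (O : set (mR * mR)) :
  (forall p, O p -> exists2 d : R, 0 < d & forall q : mR * mR,
     `|(q.1 : R) - p.1| < d -> `|(q.2 : R) - p.2| < d -> O q) ->
  measurable O.
Proof.
move=> oO.
pose sq (x y e : R) : set (mR * mR) :=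
  (`]x - e, x + e[%classic : set mR) `*` (`]y - e, y + e[%classic : set mR).
have -> : O = \bigcup_(a : rat) \bigcup_(b : rat) \bigcup_(n : nat)
    (if `[< sq (ratr a) (ratr b) n.+1%:R^-1 `<=` O >] then sq (ratr a) (ratr b) n.+1%:R^-1 else set0).
  apply/seteqP; split => [p Op|p]; last first.
    by move=> [a _ [b _ [n _]]]; case: asboolP => // h /h.
  have [d d0 H] := oO p Op.
  have [n nd] : exists n : nat, (n.+1%:R^-1 : R) < d / 2.
    exists (Num.truncn (d / 2)^-1); rewrite invf_plt ?posrE ?divr_gt0//.
    exact: truncnS_gt.
  set e : R := n.+1%:R^-1 in nd *.
  have e0 : 0 < e by rewrite invr_gt0.
  have ex (x : R) : exists a : rat, `|ratr a - x| < e.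
    have [a] := @rat_in_itvoo R (x - e) (x + e) ltac:(by rewrite ltrBlDr -addrA ltrDl addr_gt0).
    by rewrite in_itv/= -ltr_distl => h; exists a.
  have [a ha] := ex p.1; have [b hb] := ex p.2.
  exists a => //; exists b => //; exists n => //; rewrite -/e.
  rewrite asboolT; last first.
    move=> q [] /=; rewrite !in_itv/= -!ltr_distl => q1 q2; apply: H.
    - apply: le_lt_trans (ler_distD (ratr a) _ _) _; rewrite (splitr d).
      by rewrite ltrD// (lt_trans _ nd).
    - apply: le_lt_trans (ler_distD (ratr b) _ _) _; rewrite (splitr d).
      by rewrite ltrD// (lt_trans _ nd).
  by split; rewrite /= in_itv/= -ltr_distl distrC.
apply: bigcupT_measurable_rat => a; apply: bigcupT_measurable_rat => b.
apply: bigcupT_measurable => n; case: ifP => _; last exact: measurable0.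
by apply: measurableX; exact: measurable_itv.
Qed.

Lemma measurable_disc_cont (F : R[i] -> R) :
  (forall z, sqmod z < 1 -> forall e : R, 0 < e -> exists2 d : R, 0 < d &
     forall w, cabs (w - z) < d -> `|F w - F z| < e) ->
  measurable_fun (@disc_coord R) (fun p => F (of_coord p) : mR).
Proof.
move=> cF; apply: (measurability _ (RGenOInfty.measurableE R)) => //.
move=> _ [_ [a ->] <-]; apply: open_coord_measurable => p [/= pD].
rewrite in_itv/= andbT => ap.
have [d1 d10 H1] := cF _ pD (F (of_coord p) - a) ltac:(by rewrite subr_gt0).
have p1 : cabs (of_coord p) < 1 by rewrite -sqmod_lt1.
pose d := Num.min (d1 / 2) ((1 - cabs (of_coord p)) / 2).
have d0 : 0 < d by rewrite lt_min !divr_gt0// subr_gt0.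
exists d => // q q1 q2.
have qp : cabs (of_coord q - of_coord p) < d + d.
  by apply: le_lt_trans (cabs_le_ReIm _) _; rewrite ltrD.
split.
  rewrite /disc_coord/= /unit_disc/= sqmod_lt1.
  rewrite -[of_coord q](subrK (of_coord p)); apply: le_lt_trans (cabsD _ _) _.
  rewrite -ltrBrDr; apply: lt_le_trans qp _; rewrite [leRHS]splitr lerD//.
  - by rewrite /d ge_min lexx orbT.
  - by rewrite /d ge_min lexx orbT.
rewrite /= in_itv/= andbT.
have : cabs (of_coord q - of_coord p) < d1.
  by apply: lt_le_trans qp _; rewrite [leRHS]splitr lerD// /d ge_min lexx.
by move=> /H1; rewrite ltr_norml => /andP[h _]; rewrite ltrBrDl in h; rewrite -[a](subrK (F (of_coord p))) -opprB addrC.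
Qed.

End DiscMeasurable.

(** * Integrals of continuous functions over segments *)

Section ContinuousIntegral.
Variable R : realType.
Local Notation leb := (@lebesgue_measure R).
Implicit Types f g : R -> R.

Definition cint f (a b : R) : R := \int[leb]_(x in `[a, b]) f x.

Lemma cint_integrable f a b : continuous f -> leb.-integrable `[a, b] (EFin \o f).
Proof.
move=> cf; apply: continuous_compact_integrable; first exact: segment_compact.
exact: continuous_subspaceT.
Qed.

Lemma cintB f g a b : continuous f -> continuous g ->
  cint (fun x => f x - g x) a b = cint f a b - cint g a b.
Proof. by move=> cf cg; apply: RintegralB => //; exact: cint_integrable. Qed.

Lemma cint_split f a m b : continuous f -> a <= m -> m <= b ->
  cint f a b = cint f a m + cint f m b.
Proof.
move=> cf am mb; apply/eqP; rewrite addrC -subr_eq; apply/eqP.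
rewrite /cint Rintegral_itvB ?bnd_simp//; last exact: cint_integrable.
rewrite Rintegral_itv_obnd_cbnd//.
apply: integrableS (@cint_integrable f m b cf) => //.
by apply: subset_itvr; rewrite bnd_simp.
Qed.

Lemma cint_cst (k a b : R) : a <= b -> cint (fun=> k) a b = k * (b - a).
Proof.
move=> ab; rewrite /cint Rintegral_cst//= lebesgue_measure_itv/= lte_fin.
by move: ab; rewrite le_eqVlt => /predU1P[->|->] //; rewrite ltxx subrr mulr0.
Qed.

Lemma cint_bound f a b (k : R) : a <= b -> continuous f ->
  (forall x, a <= x <= b -> `|f x| <= k) -> `|cint f a b| <= k * (b - a).
Proof.
move=> ab cf fk; apply: le_trans.
  by apply: le_normr_Rintegral => //; exact: cint_integrable.
rewrite -cint_cst//; apply: le_Rintegral => //.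
- have cn : continuous ((fun x => `|f x|) : R -> R).
    by move=> x; apply: continuous_comp; [exact: cf|exact: norm_continuous].
  exact: (cint_integrable a b cn).
- by apply: (@cint_integrable (fun=> k)) => x; exact: cvg_cst.
Qed.

Lemma cint_FTC f (F : R -> R) (a b : R) : a <= b -> continuous f ->
  (forall x : R, is_derive x 1 F (f x)) -> cint f a b = F b - F a.
Proof.
move=> + cf dF; rewrite le_eqVlt => /predU1P[<-|ab].
  by rewrite subrr /cint set_itv1 Rintegral_set1.
have cF : continuous F.
  by move=> x; apply: differentiable_continuous; apply/derivable1_diffP; case: (dF x).
rewrite /cint /Rintegral (@continuous_FTC2 R f F)//.
- exact: continuous_subspaceT.
- split; [by move=> x _; case: (dF x)|exact: cvg_at_right_filter (cF a)|
    exact: cvg_at_left_filter (cF b)].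
- by move=> x _; rewrite derive1E; case: (dF x).
Qed.

End ContinuousIntegral.

(** * Goursat's subdivision and the mean over a circle *)

Section Goursat.
Variable R : realType.
Implicit Types (v : R[i] -> R[i]) (r t : R).

(** Goursat's bisection for an abstract rectangle function [G], of which only subadditivity under
    quartering is kept. Some quarter always retains a quarter of the value; the nested rectangles
    shrink to a point, where the local bound, quadratic in the size with an arbitrarily small
    constant, contradicts this. *)
Lemma halving_intervals (G : R -> R -> R -> R -> R) (a b c d : R) :
  a < b -> c < d ->
  (forall x y z w, a <= x -> x < y -> y <= b -> c <= z -> z < w -> w <= d ->
    `|G x y z w| <= `|G x ((x + y) / 2) z ((z + w) / 2)| + `|G ((x + y) / 2) y z ((z + w) / 2)| +
      (`|G x ((x + y) / 2) ((z + w) / 2) w| + `|G ((x + y) / 2) y ((z + w) / 2) w|)) ->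
  (forall x0 y0, a <= x0 <= b -> c <= y0 <= d -> forall e : R, 0 < e ->
    exists2 dl : R, 0 < dl & forall x y z w, a <= x -> x < y -> y <= b -> c <= z -> z < w -> w <= d ->
      x <= x0 <= y -> z <= y0 <= w -> y - x + (w - z) < dl ->
      `|G x y z w| <= e * (y - x + (w - z)) ^+ 2) ->
  G a b c d = 0.
Proof.
move=> ab cd split4 loc; apply/eqP/negP => /negP G0.
have {}G0 : 0 < `|G a b c d| by rewrite normr_gt0.
pose mid (p : R * R) := (p.1 + p.2) / 2.
pose step (q : (R * R) * (R * R)) : (R * R) * (R * R) :=
  let: (x, y, (z, w)) := q in let m := (x + y) / 2 in let n := (z + w) / 2 in
  let g := `|G x y z w| / 4 in
  if g <= `|G x m z n| then (x, m, (z, n)) else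
  if g <= `|G m y z n| then (m, y, (z, n)) else
  if g <= `|G x m n w| then (x, m, (n, w)) else (m, y, (n, w)).
pose s n := iter n step (a, b, (c, d)).
pose X n := (s n).1.1; pose Y n := (s n).1.2; pose Z n := (s n).2.1; pose W n := (s n).2.2.
have half (x y : R) : x < y -> [/\ x < (x + y) / 2, (x + y) / 2 < y,
    (x + y) / 2 - x = (y - x) / 2 & y - (x + y) / 2 = (y - x) / 2].
  by move=> xy; split; lra.
have inv n : [/\ a <= X n, X n < Y n, Y n <= b & [/\ c <= Z n, Z n < W n & W n <= d]]
   /\ [/\ Y n - X n = (b - a) / 2 ^+ n, W n - Z n = (d - c) / 2 ^+ n &
      `|G a b c d| / 4 ^+ n <= `|G (X n) (Y n) (Z n) (W n)|] .
  elim: n => [|n [[aX XY Yb [cZ ZW Wd]] [eY eW gG]]].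
    by rewrite /X /Y /Z /W /= !expr0 !divr1 !lexx ab cd.
  have := split4 _ _ _ _ aX XY Yb cZ ZW Wd.
  have [h1 h2 h3 h4] := half _ _ XY; have [k1 k2 k3 k4] := half _ _ ZW.
  move: aX XY Yb cZ ZW Wd eY eW gG h1 h2 h3 h4 k1 k2 k3 k4.
  have e2 (u : R) : u / 2 ^+ n.+1 = u / 2 ^+ n / 2.
    by rewrite exprSr invfM mulrA.
  have e4 (u : R) : u / 4 ^+ n.+1 = u / 4 ^+ n / 4.
    by rewrite exprSr invfM mulrA.
  rewrite /X /Y /Z /W /s iterS -/(s n); case: (s n) => -[x y] [z w] /=.
  rewrite !e2 !e4 => aX XY Yb cZ ZW Wd eY eW gG h1 h2 h3 h4 k1 k2 k3 k4 tot.
  have p4 : 0 < 4^-1 :> R by rewrite invr_gt0.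
  have mb := le_trans (ltW h2) Yb; have am := le_trans aX (ltW h1).
  have nd := le_trans (ltW k2) Wd; have cn := le_trans cZ (ltW k1).
  rewrite eY in h3 h4; rewrite eW in k3 k4.
  have g4 : `|G a b c d| / 4 ^+ n / 4 <= `|G x y z w| / 4 by rewrite ler_pM2r.
  case: ifPn => g1 /=; [|case: ifPn => g2 /=; [|case: ifPn => g3 /=]].
  - by split; split=> //; exact: le_trans g4 g1.
  - by split; split=> //; exact: le_trans g4 g2.
  - by split; split=> //; exact: le_trans g4 g3.
  - split; split=> //; apply: le_trans g4 _.
    move: g1 g2 g3 tot; rewrite -!ltNge; clear.
    move: `|G x y z w| => A; move: (`|G _ _ _ _|) => B; move: (`|G _ _ _ _|) => C.
    move: (`|G _ _ _ _|) => D; move: (`|G _ _ _ _|) => E; lra.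
have stepX n : [/\ X n <= X n.+1, Y n.+1 <= Y n, Z n <= Z n.+1 & W n.+1 <= W n].
  have [[_ XY _ [_ ZW _]] _] := inv n.
  move: XY ZW; rewrite /X /Y /Z /W /s iterS -/(s n); case: (s n) => -[x y] [z w] /= xy zw.
  have [h1 h2 _ _] := half _ _ xy; have [k1 k2 _ _] := half _ _ zw.
  by case: ifP => _ /=; [|case: ifP => _ /=; [|case: ifP => _ /=]]; split; rewrite ?lexx ?ltW.
have nested (A B : nat -> R) : (forall n, A n < B n) -> (forall n, A n <= A n.+1) ->
    (forall n, B n.+1 <= B n) -> exists x, forall n, A n <= x <= B n.
  move=> AB Ai Bd.
  have /nondecreasing_seqP Am := Ai; have /nonincreasing_seqP Bm := Bd.
  have AB' n m : A n <= B m.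
    apply: le_trans (Am n _ (leq_maxl n m)) _; apply: le_trans (ltW (AB _)) _.
    exact: Bm (leq_maxr _ _).
  have hs : has_sup (range A).
    by split; [exists (A 0%N), 0%N|exists (B 0%N) => _ [n _ <-]].
  exists (sup (range A)) => n; apply/andP; split.
    by apply: ub_le_sup; [case: hs|exists n].
  by apply: ge_sup; [case: hs|move=> _ [m _ <-]].
have [x0 hx0] := nested X Y (fun n => let: conj (And4 _ h _ _) _ := inv n in h)
  (fun n => let: And4 h _ _ _ := stepX n in h) (fun n => let: And4 _ h _ _ := stepX n in h).
have [y0 hy0] : exists y0, forall n, Z n <= y0 <= W n.
  apply: nested => n; first by have [[_ _ _ [_ h _]] _] := inv n.
  - by have [_ _ h _] := stepX n.
  - by have [_ _ _ h] := stepX n.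
have x0ab : a <= x0 <= b by have := hx0 0%N.
have y0cd : c <= y0 <= d by have := hy0 0%N.
pose L := b - a + (d - c).
have L0 : 0 < L by rewrite /L addr_gt0// subr_gt0.
(* With this constant the local bound at depth [n] is half of [|G a b c d| / 4 ^ n], below the value
   that [inv] guarantees. *)
have [dl dl0 H] := loc x0 y0 x0ab y0cd (`|G a b c d| / (2 * L ^+ 2)) ltac:(by rewrite divr_gt0// mulr_gt0// exprn_gt0).
have [n hn] : exists n, L / 2 ^+ n < dl.
  exists (Num.truncn (L / dl)).+1; rewrite ltr_pdivrMr ?exprn_gt0//.
  rewrite mulrC -ltr_pdivrMr//; apply: lt_le_trans (truncnS_gt _) _.
  by rewrite -natrX ler_nat ltnW// ltn_expl.
have [[aX XY Yb [cZ ZW Wd]] [eY eW gG]] := inv n.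
have := H _ _ _ _ aX XY Yb cZ ZW Wd (hx0 n) (hy0 n).
rewrite eY eW -mulrDl => /(_ hn) /(le_trans gG).
have e4 : (2 ^+ n) ^+ 2 = 4 ^+ n :> R.
  by rewrite -exprM mulnC exprM; congr (_ ^+ n); ring.
rewrite -/L exprMn exprVn e4 mulrA.
rewrite ler_pM2r ?invr_gt0 ?exprn_gt0//.
have -> : `|G a b c d| / (2 * L ^+ 2) * L ^+ 2 = `|G a b c d| / 2.
  by field; rewrite gt_eqF.
by apply/negP; rewrite -ltNge ltr_pdivrMr// ltr_pMr// ltr1n.
Qed.


Lemma cis_lipschitz (s t : R) : cabs (cis t - cis s) <= 2 * `|t - s|.
Proof.
have key (f df : R -> R) : (forall x : R, is_derive x 1 f (df x)) -> (forall x : R, `|df x| <= 1) ->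
    forall a b : R, a <= b -> `|f b - f a| <= b - a.
  move=> fd df1 a b ab.
  have cf : {within `[a, b], continuous f}.
    apply: continuous_subspaceT => x; apply: differentiable_continuous.
    by apply/derivable1_diffP; case: (fd x).
  have [c _ ->] := @MVT_segment _ f df a b ab (fun x _ => fd x) cf.
  by rewrite normrM (ger0_norm (x := b - a)) ?subr_ge0// ler_piMl ?subr_ge0.
have c1 (x : R) : `|- sin x| <= 1 by rewrite normrN ler_norml sin_geN1 sin_le1.
have s1 (x : R) : `|cos x| <= 1 by rewrite ler_norml cos_geN1 cos_le1.
have kc := key _ _ (@is_derive_cos R) c1; have ks := key _ _ (@is_derive_sin R) s1.
have lip : forall a b : R, `|cos b - cos a| <= `|b - a| /\ `|sin b - sin a| <= `|b - a|.
  move=> a b; have [ab|/ltW ba] := leP a b.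
    by rewrite (ger0_norm (x := b - a)) ?subr_ge0//; split; [exact: kc|exact: ks].
  rewrite (ler0_norm (x := b - a)) ?subr_le0// opprB (distrC (cos b)) (distrC (sin b)).
  by split; [exact: kc|exact: ks].
apply: le_trans (cabs_le_ReIm _) _; have [h1 h2] := lip s t.
by rewrite raddfB raddfB/= mulr_natl mulr2n lerD.
Qed.

Lemma sqmod_cis (t : R) : sqmod (cis t) = 1.
Proof. by rewrite /sqmod/= cos2Dsin2. Qed.

Lemma cabs_cis (t : R) : cabs (cis t) = 1.
Proof. by rewrite /cabs sqmod_cis sqrtr1. Qed.

Definition polar (r t : R) : R[i] := r%:C * cis t.

Lemma Re_polar_mul (x y r t : R) :
  complex.Re ((x +i* y) * polar r t) = r * (x * cos t - y * sin t).
Proof. by rewrite /polar /cis /=; ring. Qed.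

Lemma Im_polar_mul (x y r t : R) :
  complex.Im ((x +i* y) * polar r t) = r * (x * sin t + y * cos t).
Proof. by rewrite /polar /cis /=; ring. Qed.

Lemma polar_dist (r t r0 t0 : R) : 0 <= r ->
  cabs (polar r t - polar r0 t0) <= `|r - r0| + 2 * r * `|t - t0|.
Proof.
move=> r_ge0; rewrite (_ : _ - _ = (r - r0)%:C * cis t0 + r%:C * (cis t - cis t0)); last first.
  by rewrite /polar rmorphB/=; ring.
apply: le_trans (cabsD _ _) _; rewrite !cabsM !cabsR cabs_cis mulr1 lerD2l.
by rewrite (ger0_norm r_ge0) -mulrA (mulrCA 2) ler_wpM2l// cis_lipschitz.
Qed.

(* The local model [(q / r + B t) dr + (p + r A t) dt], with [B' = A], is closed: it
   is the imaginary part of [v(z) dz / z] in polar coordinates for [v] affine. *)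
Lemma goursat_rectangle (P Q : R -> R -> R) (a b c d : R) :
  0 < a -> a < b -> c < d ->
  (forall r, continuous (P r)) -> (forall t, continuous (Q ^~ t)) ->
  (forall r0 t0, a <= r0 <= b -> c <= t0 <= d -> exists p q x y : R,
    forall e : R, 0 < e -> exists2 dl : R, 0 < dl & forall r t,
      a <= r <= b -> c <= t <= d -> `|r - r0| + `|t - t0| < dl ->
      `|P r t - (p + r * (x * cos t - y * sin t))| <= e * (`|r - r0| + `|t - t0|) /\
      `|Q r t - (q / r + (x * sin t + y * cos t))| <= e * (`|r - r0| + `|t - t0|)) ->
  cint (fun t => P b t - P a t) c d = cint (fun r => Q r d - Q r c) a b.
Proof.
move=> a0 ab cd cP cQ loc.
pose G x y z w := cint (fun t => P y t - P x t) z w - cint (fun r => Q r w - Q r z) x y.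
apply/eqP; rewrite -subr_eq0; apply/eqP; rewrite -/(G a b c d).
apply: halving_intervals => //.
  move=> x y z w ax xy yb cz zw wd.
  set m := (x + y) / 2; set n := (z + w) / 2.
  have [xm my] : x <= m /\ m <= y by rewrite /m; split; lra.
  have [zn nw] : z <= n /\ n <= w by rewrite /n; split; lra.
  have -> : G x y z w = G x m z n + G m y z n + (G x m n w + G m y n w).
    rewrite /G !cintB// (@cint_split _ (P y) z n w)// (@cint_split _ (P x) z n w)//.
    by rewrite (@cint_split _ (Q ^~ w) x m y)// (@cint_split _ (Q ^~ z) x m y)//; ring.
  by apply: le_trans (ler_normD _ _) _; rewrite lerD// ler_normD.
move=> r0 t0 hr ht e e0; have [p [q [x' [y' H]]]] := loc r0 t0 hr ht.
(* Half of [e], because each integrand below is a difference of two such errors. *)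
have [dl dl0 {}H] := H (e / 2) ltac:(by rewrite divr_gt0).
exists dl => // x y z w ax xy yb cz zw wd /andP[xr ry] /andP[zt tw] small.
set L := y - x + (w - z).
have L0 : 0 <= L by rewrite /L addr_ge0// subr_ge0 ltW.
pose A t := x' * cos t - y' * sin t; pose B t := x' * sin t + y' * cos t.
have cA : continuous A.
  by move=> t; apply: cvgB; apply: cvgMr; [exact: continuous_cos|exact: continuous_sin].
have near_r r : x <= r <= y -> `|r - r0| <= y - x by move=> /andP[? ?]; rewrite ler_norml; apply/andP; split; lra.
have near_t t : z <= t <= w -> `|t - t0| <= w - z by move=> /andP[? ?]; rewrite ler_norml; apply/andP; split; lra.
have ab_r r : x <= r <= y -> a <= r <= b by move=> /andP[h1 h2]; rewrite (le_trans ax h1) (le_trans h2 yb).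
have cd_t t : z <= t <= w -> c <= t <= d by move=> /andP[h1 h2]; rewrite (le_trans cz h1) (le_trans h2 wd).
have est r t : x <= r <= y -> z <= t <= w ->
   `|P r t - (p + r * A t)| <= e / 2 * L /\ `|Q r t - (q / r + B t)| <= e / 2 * L.
  move=> hr' ht'.
  have le : `|r - r0| + `|t - t0| <= L by rewrite lerD ?near_r ?near_t.
  have [h1 h2] := H r t (ab_r _ hr') (cd_t _ ht') (le_lt_trans le small).
  by split; [apply: le_trans h1 _|apply: le_trans h2 _]; rewrite ler_wpM2l// divr_ge0// ltW.
have xin : x <= x <= y by rewrite lexx ltW.
have yin : x <= y <= y by rewrite lexx ltW.
have zin : z <= z <= w by rewrite lexx ltW.
have win : z <= w <= w by rewrite lexx ltW.
(* The local model contributes nothing: [p] and [q / r] cancel between opposite sides, and the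
   remaining terms cancel because [B' = A]. *)
have affine : cint (fun t => (y - x) * A t) z w = cint (fun=> B w - B z) x y.
  have dB (t : R) : is_derive t 1 (fun t => (y - x) * B t) ((y - x) * A t).
    rewrite /B; apply: is_derive_eq; rewrite /GRing.scale/= /A; ring.
  rewrite cint_cst ?ltW// (@cint_FTC _ _ _ z w _ _ dB) ?ltW//.
  - by rewrite -mulrBr mulrC.
  - by move=> t; apply: cvgMr; exact: cA.
have -> : G x y z w = cint (fun t => P y t - P x t - (y - x) * A t) z w -
    cint (fun r => Q r w - Q r z - (B w - B z)) x y.
  rewrite (@cintB _ (fun t => P y t - P x t)); last 2 first.
  - by move=> t; apply: cvgB; exact: cP.
  - by move=> t; apply: cvgMr; exact: cA.
  rewrite (@cintB _ (fun r => Q r w - Q r z)); last 2 first.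
  - by move=> r; apply: cvgB; exact: cQ.
  - by move=> r; exact: cvg_cst.
  by rewrite affine /G; ring.
apply: le_trans (ler_normB _ _) _.
have -> : e * L ^+ 2 = e * L * (w - z) + e * L * (y - x) by rewrite /L; ring.
have eE : e * L = e / 2 * L + e / 2 * L by lra.
apply: lerD.
- apply: cint_bound; first exact: ltW.
    move=> t; apply: cvgB; first by apply: cvgB; exact: cP.
    by apply: cvgMr; exact: cA.
  move=> t ht'; have [h1 _] := est y t yin ht'; have [h2 _] := est x t xin ht'.
  rewrite (_ : _ - _ = (P y t - (p + y * A t)) - (P x t - (p + x * A t))); last by ring.
  by apply: le_trans (ler_normB _ _) _; rewrite eE lerD.
- apply: cint_bound; first exact: ltW.
    move=> r; apply: cvgB; last exact: cvg_cst.
    by apply: cvgB; exact: cQ.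
  move=> r hr'; have [_ h1] := est r w hr' win; have [_ h2] := est r z hr' zin.
  rewrite (_ : _ - _ = (Q r w - (q / r + B w)) - (Q r z - (q / r + B z))); last by ring.
  by apply: le_trans (ler_normB _ _) _; rewrite eE lerD.
Qed.

Lemma cont_Re_Im_comp v (c : R -> R[i]) (K x0 : R) : ccont v (c x0) ->
  (forall x, cabs (c x - c x0) <= K * `|x - x0|) ->
  {for x0, continuous (fun x => complex.Re (v (c x)))} /\
  {for x0, continuous (fun x => complex.Im (v (c x)))}.
Proof.
move=> cv cK.
have K0 : 0 < `|K| + 1 by rewrite ltr_pwDr.
have key : forall e : R, 0 < e -> \forall x \near x0, cabs (v (c x) - v (c x0)) < e.
  move=> e e0; have [d d0 H] := cv e e0.
  near=> x; apply: H; apply: le_lt_trans (cK x) _.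
  have h : `|x - x0| < d / (`|K| + 1).
    rewrite distrC; near: x; apply: (@cvgr_dist_lt _ R^o) => //; by rewrite divr_gt0.
  apply: le_lt_trans (_ : _ <= (`|K| + 1) * `|x - x0|) _.
    by rewrite ler_wpM2r// (le_trans (ler_norm _))// lerDl.
  by rewrite mulrC -ltr_pdivlMr.
split; apply/cvgrPdist_lt => e e0; apply: filterS (key e e0) => x; apply: le_lt_trans;
  rewrite cabsB -raddfB/=; [exact: Re_le_cabs|exact: Im_le_cabs].
Unshelve. all: by end_near.
Qed.

(** Goursat's theorem for [v(z) dz / z] on the annulus [a <= |z| <= 1] cut along the positive axis.
    The two radial sides agree, so the means over the circles of radius [1] and [a] coincide;
    letting [a] tend to [0] gives the value at the centre by continuity. *)
Lemma mean_value_Re v : (forall z, cabs z <= 1 -> exists l, cderiv v z l) ->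
  cint (fun t => complex.Re (v (cis t))) 0 (2 * pi) = 2 * pi * complex.Re (v 0).
Proof.
move=> dv.
have pi20 : 0 < 2 * pi :> R by rewrite mulr_gt0// pi_gt0.
have cv z : cabs z <= 1 -> ccont v z by move=> /dv[l]; exact: cderiv_ccont.
have cpolar (r t : R) : 0 <= r -> cabs (polar r t) = r.
  by move=> r0; rewrite /polar cabsM cabsR cabs_cis mulr1 ger0_norm.
have conttr (r : R) : 0 <= r <= 1 -> continuous (fun t => complex.Re (v (polar r t))).
  move=> /andP[r0 r1] t; have [] // := @cont_Re_Im_comp v (polar r) (2 * r) t.
    by apply: cv; rewrite cpolar.
  by move=> x; apply: le_trans (polar_dist _ _ _ _) _ => //; rewrite subrr normr0 add0r.
have indep (a : R) : 0 < a -> a < 1 ->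
    cint (fun t => complex.Re (v (cis t))) 0 (2 * pi) =
    cint (fun t => complex.Re (v (polar a t))) 0 (2 * pi).
  move=> a0 a1.
  (* Clamping the radius to [[a, 1]] makes the integrands continuous on all of [R], as
     [goursat_rectangle] asks, and changes nothing on the rectangle. *)
  pose cl (r : R) := Num.max a (Num.min r 1).
  have cla r : a <= cl r by rewrite /cl le_max lexx.
  have cl1 r : cl r <= 1 by rewrite /cl ge_max ge_min lexx (ltW a1) orbT.
  have cl0 r : 0 < cl r by exact: lt_le_trans (cla r).
  have clE r : a <= r <= 1 -> cl r = r.
    by move=> /andP[h1 h2]; rewrite /cl min_l// max_r.
  have cl_mono x y : x <= y -> 0 <= cl y - cl x <= y - x.
    move=> xy; rewrite /cl; case: (leP x 1) => h1; case: (leP y 1) => h2.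
    - by case: (leP a x) => h3; case: (leP a y) => h4; apply/andP; split; lra.
    - by rewrite (max_r (ltW a1)); case: (leP a x) => h3; apply/andP; split; lra.
    - by move: (lt_le_trans h1 (le_trans xy h2)); rewrite ltxx.
    - by rewrite subrr lexx subr_ge0.
  have cl_lip r r0 : `|cl r - cl r0| <= `|r - r0|.
    have [rr|/ltW rr] := leP r0 r; have /andP[h1 h2] := cl_mono _ _ rr.
      by rewrite !ger0_norm ?subr_ge0// -subr_ge0.
    by rewrite distrC [leRHS]distrC !ger0_norm ?subr_ge0// -subr_ge0.
  have polar1 t : polar 1 t = cis t by rewrite /polar mul1r.
  have := @goursat_rectangle (fun r t => complex.Re (v (polar (cl r) t)))
    (fun r t => complex.Im (v (polar (cl r) t)) / cl r) a 1 0 (2 * pi) a0 a1 pi20.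
  rewrite !clE ?lexx ?ltW// cintB; last 2 first.
  - by apply: conttr; rewrite ler01 lexx.
  - by apply: conttr; rewrite !ltW.
  under [X in X - _ = _]eq_Rintegral do rewrite polar1.
  rewrite (_ : cint _ a 1 = 0); last first.
    rewrite /cint; have c2 : cis (2 * pi) = cis 0 :> R[i] by rewrite /cis mulr_natl cos2pi sin2pi cos0 sin0.
    under eq_Rintegral do rewrite /polar c2 subrr.
    by rewrite [LHS](@cint_cst R 0 a 1) ?mul0r// ltW.
  move=> H; apply/eqP; rewrite -subr_eq0; apply/eqP; apply: H.
  - by move=> r; apply: conttr; rewrite (ltW (cl0 r)) cl1.
  - move=> t r; apply: cvgM.
      have [] // := @cont_Re_Im_comp v (fun r => polar (cl r) t) 1 r.
        by apply: cv; rewrite cpolar// ltW.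
      move=> x; apply: le_trans (polar_dist _ _ _ _) _; first exact: ltW.
      by rewrite subrr normr0 mulr0 addr0 mul1r.
    apply: cvgV; first by rewrite gt_eqF.
    apply/cvgrPdist_lt => e e0; near=> x; rewrite distrC; apply: le_lt_trans (cl_lip _ _) _.
    by rewrite distrC; near: x; apply: (@cvgr_dist_lt _ R^o).
  - move=> r0 t0 ha _; have /andP[ar0 r01] := ha.
    have r0p : 0 < r0 by exact: lt_le_trans ar0.
    have [|l lH] := dv (polar r0 t0); first by rewrite cpolar// ltW.
    pose k := v (polar r0 t0) - l * polar r0 t0.
    exists (complex.Re k), (complex.Im k), (complex.Re l), (complex.Im l) => e e0.
    (* The displacement in the plane is at most [3 D], and the division by [r >= a] in the second
       component costs a factor [1 / a]. *)
    have [d d0 H] := lH (e * a / 3) ltac:(by rewrite divr_gt0// mulr_gt0).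
    exists (d / 3) => [|r t har _ hd]; first by rewrite divr_gt0.
    have /andP[ar r1] := har; rewrite (clE r har).
    have rp : 0 < r by exact: lt_le_trans ar.
    set D := `|r - r0| + `|t - t0|; have D0 : 0 <= D by rewrite addr_ge0.
    have pd : cabs (polar r t - polar r0 t0) <= 3 * D.
      apply: le_trans (polar_dist _ _ _ _) _; first exact: ltW.
      rewrite /D mulrDr lerD//; first by rewrite ler_peMl// ler1n.
      by rewrite ler_wpM2r//; lra.
    have := H (polar r t - polar r0 t0) ltac:(by apply: le_lt_trans pd _; rewrite mulrC -ltr_pdivlMr).
    rewrite (_ : polar r0 t0 + (polar r t - polar r0 t0) = polar r t) => [H1|]; last by rewrite addrC subrK.
    have {}H1 : cabs (v (polar r t) - (k + l * polar r t)) <= e * a * D.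
      rewrite (_ : _ - _ = v (polar r t) - v (polar r0 t0) - l * (polar r t - polar r0 t0)); last first.
        by rewrite /k; ring.
      apply: le_trans H1 _; apply: le_trans (_ : _ <= e * a / 3 * (3 * D)) _.
        by rewrite ler_wpM2l// divr_ge0// mulr_ge0// ltW.
      by rewrite mulrA divfK.
    have lE : l = complex.Re l +i* complex.Im l by case: (l).
    have eR : complex.Re (l * polar r t) = r * (complex.Re l * cos t - complex.Im l * sin t).
      by rewrite [in LHS]lE Re_polar_mul.
    have eI : complex.Im (l * polar r t) = r * (complex.Re l * sin t + complex.Im l * cos t).
      by rewrite [in LHS]lE Im_polar_mul.
    have eD : e * a * D <= e * D.
      by rewrite ler_wpM2r// ler_piMr ?ltW.
    split.
      apply: le_trans eD; apply: le_trans H1; apply: le_trans (Re_le_cabs _).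
      by rewrite -eR -ReD -ReB.
    rewrite (_ : _ - _ = (complex.Im (v (polar r t) - (k + l * polar r t))) / r); last first.
      have -> : complex.Im (v (polar r t) - (k + l * polar r t)) = complex.Im (v (polar r t)) -
        (complex.Im k + r * (complex.Re l * sin t + complex.Im l * cos t)) by rewrite -eI -ImD -ImB.
      by field; rewrite gt_eqF.
    rewrite normrM normfV (gtr0_norm rp) ler_pdivrMr//.
    apply: le_trans (Im_le_cabs _) _; apply: le_trans H1 _.
    by rewrite mulrAC ler_wpM2l// mulr_ge0// ltW.
apply/eqP; rewrite -subr_eq0 -normr_le0; apply/ler_addgt0Pl => e e0; rewrite addr0.
have [d d0 H] := cv 0 ltac:(by rewrite cabs0 ler01) (e / (2 * pi)) ltac:(by rewrite divr_gt0).
pose a := Num.min (d / 2) (1 / 2) : R.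
have a0 : 0 < a by rewrite lt_min !divr_gt0.
have a1 : a < 1 by rewrite gt_min; apply/orP; right; lra.
have ad : a < d by rewrite gt_min; apply/orP; left; lra.
rewrite (indep a)// -[X in _ - X](_ : cint (fun=> complex.Re (v 0)) 0 (2 * pi) = _); last first.
  by rewrite cint_cst ?ltW// subr0 mulrC.
rewrite -cintB; last 2 first.
- by apply: conttr; rewrite !ltW.
- by move=> x; exact: cvg_cst.
rewrite -[leRHS](@divfK _ (2 * pi)) ?gt_eqF// -[X in _ / _ * X]subr0.
apply: cint_bound; first exact: ltW.
  by move=> x; apply: cvgB; [apply: conttr; rewrite !ltW|exact: cvg_cst].
move=> t _; rewrite -raddfB; apply: le_trans (Re_le_cabs _) _; apply/ltW/H.
by rewrite subr0 cpolar// ltW.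
Unshelve. all: by end_near.
Qed.

End Goursat.

(** * Rules for complex differentiability *)

Section Analytic.
Variable R : realType.
Implicit Types (u v : R[i] -> R[i]) (z w : R[i]).

Definition dvb u z : Prop := derivable (u : R[i]^o -> R[i]^o) z 1.

Lemma analyticP u : analytic_on_disc u <-> forall z, sqmod z < 1 -> dvb u z.
Proof.
split=> [H z z1|H z]; first by apply: H; rewrite inE.
by rewrite inE => z1; exact: H.
Qed.

Lemma dvb_cst (c : R[i]) z : dvb (fun=> c) z.
Proof. exact: (@derivable_cst _ R[i]^o R[i]^o). Qed.

Lemma dvb_id z : dvb id z.
Proof. exact: (@derivable_id _ R[i]^o). Qed.

Lemma dvbD u v z : dvb u z -> dvb v z -> dvb (fun w => u w + v w) z.
Proof. exact: (@derivableD _ R[i]^o R[i]^o). Qed.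

Lemma dvbB u v z : dvb u z -> dvb v z -> dvb (fun w => u w - v w) z.
Proof. exact: (@derivableB _ R[i]^o R[i]^o). Qed.

Lemma dvbM u v z : dvb u z -> dvb v z -> dvb (fun w => u w * v w) z.
Proof. exact: (@derivableM _ R[i]^o). Qed.

Lemma dvbV u z : u z != 0 -> dvb u z -> dvb (fun w => (u w)^-1) z.
Proof. exact: (@derivableV _ R[i]^o). Qed.

Lemma dvb_comp u v z : dvb v z -> dvb u (v z) -> dvb (fun w => u (v w)) z.
Proof.
move=> /derivable1_diffP dv /derivable1_diffP du.
by have := differentiable_comp dv du => /derivable1_diffP.
Qed.

Lemma dvbX u z n : dvb u z -> dvb (fun w => u w ^+ n) z.
Proof.
move=> du; elim: n => [|n ih]; first exact: dvb_cst.
by rewrite /dvb; under eq_fun do rewrite exprS; exact: dvbM.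
Qed.

Lemma dvb_near u v z : (exists2 d : R, 0 < d & forall w, cabs (w - z) < d -> u w = v w) ->
  dvb v z -> dvb u z.
Proof.
move=> [d d0 uv] /derivable_cderiv [l vl]; apply/derivable_cderiv; exists l => e e0.
have [d' d'0 H] := vl e e0; exists (Num.min d d'); first by rewrite lt_min d0.
move=> h; rewrite lt_min => /andP[h1 h2]; rewrite !uv; first exact: H.
- by rewrite subrr cabs0.
- by rewrite addrC addKr.
Qed.

Lemma disc_nbhs z : sqmod z < 1 -> exists2 d : R, 0 < d & forall w, cabs (w - z) < d -> sqmod w < 1.
Proof.
rewrite sqmod_lt1 => z1; exists (1 - cabs z); first by rewrite subr_gt0.
move=> w; rewrite sqmod_lt1 ltrBrDr; apply: le_lt_trans.
by rewrite -[w in X in X <= _](subrK z) cabsD.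
Qed.

Lemma analytic_ext u v : (forall z, sqmod z < 1 -> u z = v z) ->
  analytic_on_disc v -> analytic_on_disc u.
Proof.
move=> uv /analyticP av; apply/analyticP => z z1.
have [d d0 H] := disc_nbhs z1.
by apply: dvb_near (av z z1); exists d => // w /H/uv.
Qed.

Lemma dvb_cderiv u z : dvb u z <-> exists l, cderiv u z l.
Proof. exact: derivable_cderiv. Qed.

End Analytic.

(** * Principal powers and the operators U *)

Section ComplexPower.
Variable R : realType.
Implicit Types (z w h : R[i]) (s : R).

(** The principal power on the right half-plane, where [1 - z^* w] lies. There the argument is an
    [atan] of a quotient, which is open to differentiation. *)
Definition cpowR w s : R[i] := (expR (s * (ln (sqmod w) / 2)))%:C *
  cis (s * atan (complex.Im w / complex.Re w)).

Lemma RHP_sqmod w : 0 < complex.Re w -> 0 < sqmod w.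
Proof. by move=> w0; rewrite /sqmod ltr_wpDr ?sqr_ge0// exprn_gt0. Qed.

Lemma cos_atan_ratio w : 0 < complex.Re w ->
  cos (atan (complex.Im w / complex.Re w)) = complex.Re w / Num.sqrt (sqmod w).
Proof.
move=> w0; rewrite cos_atan -[RHS]invrK invf_div.
have -> : 1 + (complex.Im w / complex.Re w) ^+ 2 = sqmod w / complex.Re w ^+ 2.
  by rewrite /sqmod; field; rewrite gt_eqF.
rewrite sqrtrM ?sqmod_ge0// sqrtrV ?sqr_ge0// sqrtr_sqr gtr0_norm//.
Qed.

Lemma cpowE w s : 0 < complex.Re w -> cpow w s = cpowR w s.
Proof.
move=> w0; have m0 := RHP_sqmod w0; rewrite /cpow /cpowR; congr (_%:C * cis (s * _)).
  rewrite /powR gt_eqF ?sqrtr_gt0//; congr (expR (s * _)).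
  by rewrite -[in RHS](sqr_sqrtr (ltW m0)) lnXn ?sqrtr_gt0// mulr2n; lra.
rewrite /principal_arg -cos_atan_ratio//.
set q := complex.Im w / complex.Re w.
have q1 : `|atan q| < pi / 2 by rewrite ltr_norml atan_gtNpi2 atan_ltpi2.
have pi0 := pi_gt0 R.
have q2 : atan q <= pi by move: q1; rewrite ltr_norml => /andP[]; lra.
case: ifPn => [i0|]; last rewrite -ltNge => i0.
  have q0 : 0 <= q by rewrite divr_ge0// ltW.
  rewrite cosK// in_itv/= q2 andbT -atan0.
  have [q0'|q0'] := leP q 0; last by apply/ltW; exact: lt_atan.
  by have -> : q = 0 by apply/le_anti; rewrite q0 q0'.
have q0 : q < 0 by rewrite pmulr_llt0// invr_gt0.
have a0 : atan q < 0 by rewrite -atan0; exact: lt_atan.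
rewrite -cosN cosK ?opprK// in_itv/= oppr_ge0 ltW//=.
by move: q1; rewrite ltr_norml => /andP[]; lra.
Qed.

Lemma sqmod_cpowR w s : 0 < complex.Re w -> sqmod (cpowR w s) = sqmod w `^ s.
Proof.
move=> w0; rewrite /cpowR sqmodM sqmodR sqmod_cis mulr1 /powR gt_eqF ?RHP_sqmod//.
by rewrite -expRM_natl mulr_natl -mulrnAr -mulr_natr divfK.
Qed.

Lemma cpowR_neq0 w s : cpowR w s != 0.
Proof.
rewrite mulf_neq0//; first by rewrite (inj_eq (@complexI R)) gt_eqF ?expR_gt0.
by rewrite -sqmod_eq0 sqmod_cis oner_eq0.
Qed.

Lemma cisD (a b : R) : cis (a + b) = cis a * cis b.
Proof. by rewrite /cis cosD sinD; apply/eqP; rewrite eq_complex/=; apply/andP; split; apply/eqP; ring. Qed.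

Lemma cis0 : cis (0 : R) = 1.
Proof. by rewrite /cis cos0 sin0. Qed.

(** On the right half-plane [c / w] has the opposite argument of [w], so no branch ambiguity arises.
    This makes the factors of [U_z] and [U_(-z)] inverse to each other. *)
Lemma cpowR_div (c : R) w s : 0 < c -> 0 < complex.Re w ->
  cpowR (c%:C / w) s = (c `^ s)%:C / cpowR w s.
Proof.
move=> c0 w0; have m0 := RHP_sqmod w0.
apply: (mulIf (cpowR_neq0 w s)); rewrite divfK ?cpowR_neq0// /cpowR.
rewrite mulrACA -rmorphM -cisD -expRD -!mulrDr.
have -> : complex.Im (c%:C / w) / complex.Re (c%:C / w) = - (complex.Im w / complex.Re w).
  case: w w0 m0 => x y /= x0 m0; rewrite /sqmod/= in m0.
  by field; rewrite !gt_eqF.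
rewrite atanN addNr mulr0 cis0 mulr1 sqmodM sqmodV sqmodR.
rewrite lnM ?posrE ?exprn_gt0 ?invr_gt0// lnV ?posrE// lnXn// /powR gt_eqF//.
by congr ((expR (s * _))%:C); rewrite mulr2n; field.
Qed.

(** The exponent [2 + alpha] at [alpha = 0]: there the kernel becomes rational and can be expanded
    by an explicit finite sum. *)
Lemma cpowR2 w : 0 < complex.Re w -> cpowR w 2 = w ^+ 2.
Proof.
move=> w0; have m0 := RHP_sqmod w0.
have e : w = (Num.sqrt (sqmod w))%:C * cis (atan (complex.Im w / complex.Re w)).
  have sin_atan q : sin (atan q) = q / Num.sqrt (1 + q ^+ 2) :> R.
    by rewrite -[X in X / _](atanK q) -cos_atan /tan divfK// gt_eqF// cos_atan invr_gt0 sqrtr_gt0 ltr_wpDr ?sqr_ge0.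
  rewrite /cis cos_atan_ratio// sin_atan.
  have -> : 1 + (complex.Im w / complex.Re w) ^+ 2 = sqmod w / complex.Re w ^+ 2.
    by rewrite /sqmod; field; rewrite gt_eqF.
  rewrite sqrtrM ?sqmod_ge0// sqrtrV ?sqr_ge0// sqrtr_sqr gtr0_norm//.
  have : Num.sqrt (sqmod w) != 0 by rewrite gt_eqF ?sqrtr_gt0.
  move: (Num.sqrt _) => m mn; case: w w0 {m0} => x y /= x0.
  by apply/eqP; rewrite eq_complex/=; apply/andP; split; apply/eqP; field; rewrite ?mn ?gt_eqF.
rewrite [in RHS]e exprMn expr2 -rmorphM -expr2 sqr_sqrtr ?sqmod_ge0// expr2 -cisD.
rewrite /cpowR [2 * (_ / 2)]mulrC divfK// lnK ?posrE//; congr (_ * cis _).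
by rewrite mulr_natl mulr2n.
Qed.

Lemma cvgCM (T : Type) (F : set_system T) (FF : Filter F) (f g : T -> R[i]^o) (a b : R[i]^o) :
  f @ F --> a -> g @ F --> b -> (fun t => f t * g t : R[i]^o) @ F --> (a * b : R[i]^o).
Proof. exact: cvgM. Qed.

Lemma cvgCV (T : Type) (F : set_system T) (FF : Filter F) (f : T -> R[i]^o) (a : R[i]^o) :
  a != 0 -> f @ F --> a -> (fun t => (f t)^-1 : R[i]^o) @ F --> (a^-1 : R[i]^o).
Proof. by move=> a0 fa; exact: cvgV. Qed.

Lemma cvg_cpowR (T : Type) (F : set_system T) (FF : Filter F) (f : T -> R[i]) w s :
  0 < complex.Re w -> (f : T -> R[i]^o) @ F --> (w : R[i]^o) ->
  (fun t => cpowR (f t) s : R[i]^o) @ F --> (cpowR w s : R[i]^o).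
Proof.
move=> w0 /cvgC_ReIm[cR cI]; have m0 := RHP_sqmod w0.
have cm : sqmod (f x) @[x --> F] --> sqmod w.
  by rewrite /sqmod; exact: (cvgD (cvgM cR cR) (cvgM cI cI)).
have cE : expR (s * (ln (sqmod (f x)) / 2)) @[x --> F] --> expR (s * (ln (sqmod w) / 2)).
  apply: (cvg_comp (fun x => s * (ln (sqmod (f x)) / 2)) expR); last exact: continuous_expR.
  apply: cvgM; first exact: cvg_cst.
  apply: cvgM; last exact: cvg_cst.
  by apply: (cvg_comp (@sqmod R \o f) (@ln R)); [exact: cm|exact: continuous_ln].
have cA : s * atan (complex.Im (f x) / complex.Re (f x)) @[x --> F] --> s * atan (complex.Im w / complex.Re w).
  apply: cvgM; first exact: cvg_cst.
  apply: (cvg_comp (fun x => complex.Im (f x) / complex.Re (f x)) (@atan R)); last exact: continuous_atan.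
  by apply: cvgM => //; apply: cvgV => //; rewrite gt_eqF.
have cC := cvg_comp _ _ cA (@continuous_cos R _).
have cS := cvg_comp _ _ cA (@continuous_sin R _).
apply/cvgC_ReIm; rewrite /cpowR /cis /=; split.
- by under eq_fun do rewrite mul0r subr0; rewrite mul0r subr0; exact: cvgM cE cC.
- by under eq_fun do rewrite mul0r addr0; rewrite mul0r addr0; exact: cvgM cE cS.
Qed.

Lemma cpowR_cont w s : 0 < complex.Re w -> ccont (cpowR ^~ s) w.
Proof.
move=> w0; apply/ccontP.
exact: (@cvg_cpowR _ (nbhs (w : R[i]^o)) (nbhs_filter (w : R[i]^o)) id w s w0 (@cvg_id _ _)).
Qed.

Lemma is_derive_ext (f g : R -> R) (t d d' : R) : is_derive t 1 f d ->
  (forall x, f x = g x) -> d = d' -> is_derive t 1 g d'.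
Proof. by move=> fd /funext <- <-. Qed.

Lemma is_derive_mulc (f : R -> R) (t d k : R) : is_derive t 1 f d ->
  is_derive t 1 (fun x => k * f x) (k * d).
Proof. by move=> fd; exact: (@is_deriveZ _ _ R^o f k t 1 d fd). Qed.

(** Real calculus on modulus and argument along the line [w + t h]. The logarithmic derivatives [A]
    of the modulus and [B] of the argument combine to [A + i B = h / (w + t h)]. *)
Lemma cpowR_dir w h s (t : R) : 0 < complex.Re (w + t%:C * h) ->
  is_derive t 1 (fun t => complex.Re (cpowR (w + t%:C * h) s))
    (complex.Re (h * (s%:C * cpowR (w + t%:C * h) s / (w + t%:C * h)))) /\
  is_derive t 1 (fun t => complex.Im (cpowR (w + t%:C * h) s))
    (complex.Im (h * (s%:C * cpowR (w + t%:C * h) s / (w + t%:C * h)))).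
Proof.
move: w h => [a b] [c d].
have E u : (a +i* b) + (u : R)%:C * (c +i* d) = (a + u * c) +i* (b + u * d).
  by apply/eqP; rewrite eq_complex/=; apply/andP; split; apply/eqP; ring.
rewrite E => x0; rewrite /= in x0.
pose m (t : R) := (a + t * c) ^+ 2 + (b + t * d) ^+ 2.
have m0 : 0 < m t by rewrite ltr_wpDr ?sqr_ge0// exprn_gt0.
pose A := ((a + t * c) * c + (b + t * d) * d) / m t.
pose B := ((a + t * c) * d - (b + t * d) * c) / m t.
have dx : is_derive t 1 (fun t => a + t * c) c.
  by apply: is_derive_eq; rewrite /GRing.scale/=; ring.
have dy : is_derive t 1 (fun t => b + t * d) d.
  by apply: is_derive_eq; rewrite /GRing.scale/=; ring.
have dm : is_derive t 1 m (2 * (A * m t)).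
  rewrite /m /A divfK ?gt_eqF//; apply: is_derive_eq; rewrite /GRing.scale/=; ring.
have dg : is_derive t 1 (fun t => s * (ln (m t) / 2)) (s * A).
  have dl := is_derive1_comp (is_derive1_ln m0) dm.
  apply: (is_derive_ext (is_derive_mulc (s / 2) dl)) => [u|].
    by rewrite /=; ring.
  by field; rewrite gt_eqF.
have dk : is_derive t 1 (fun t => s * atan ((b + t * d) / (a + t * c))) (s * B).
  have xn0 : a + t * c != 0 by rewrite gt_eqF.
  have di := is_deriveV (f := fun t : R => a + t * c) xn0 dx.
  have da := is_derive1_comp (g := fun t : R => (b + t * d) / (a + t * c)) (is_derive1_atan ((b + t * d) / (a + t * c))) (is_deriveM dy di).
  apply: (is_derive_ext (is_derive_mulc s da)) => //; congr (s * _).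
  by rewrite /GRing.scale/= /B /m; field; rewrite xn0 /= gt_eqF.
have de := is_derive1_comp (g := fun t : R => s * (ln (m t) / 2)) (is_derive_expR (s * (ln (m t) / 2))) dg.
have dc := is_derive1_comp (g := fun t : R => s * atan ((b + t * d) / (a + t * c))) (is_derive_cos (s * atan ((b + t * d) / (a + t * c)))) dk.
have ds := is_derive1_comp (g := fun t : R => s * atan ((b + t * d) / (a + t * c))) (is_derive_sin (s * atan ((b + t * d) / (a + t * c)))) dk.
have hw : (c +i* d) / ((a + t * c) +i* (b + t * d)) = A +i* B.
  by rewrite /A /B /m; apply/eqP; rewrite eq_complex/=; apply/andP; split; apply/eqP;
    field; rewrite -/(m t) gt_eqF.
have -> : (c +i* d) * (s%:C * cpowR ((a + t * c) +i* (b + t * d)) s / ((a + t * c) +i* (b + t * d))) =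
    s%:C * cpowR ((a + t * c) +i* (b + t * d)) s * (A +i* B).
  by rewrite -hw; ring.
split.
- apply: (is_derive_ext (is_deriveM de dc)) => [u|].
    by rewrite E /cpowR /cis /sqmod /= mul0r subr0.
  by rewrite /GRing.scale/= /cpowR /cis /sqmod /= -/(m t); ring.
- apply: (is_derive_ext (is_deriveM de ds)) => [u|].
    by rewrite E /cpowR /cis /sqmod /= mul0r addr0.
  by rewrite /GRing.scale/= /cpowR /cis /sqmod /= -/(m t); ring.
Qed.

(** The real mean value theorem on the segment from [w] to [w + h], for real and imaginary part
    separately, replaces the increment by the derivative at an intermediate point. Continuity of [G]
    brings that point back to [w], at the price of [e / 2] for each part. *)
Lemma cpowR_cderiv w s : 0 < complex.Re w -> cderiv (cpowR ^~ s) w (s%:C * cpowR w s / w).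
Proof.
move=> w0 e e0.
pose G x := s%:C * cpowR x s / x.
have wn0 : w != 0 by apply/eqP => wE; move: w0; rewrite wE ltxx.
have cG : ccont G w.
  apply/ccontP; have /ccontP cp := cpowR_cont s w0.
  have FF := nbhs_filter (w : R[i]^o).
  apply: (@cvgCM _ _ FF (fun x => s%:C * cpowR x s) (fun x => x^-1)).
    exact: (@cvgCM _ _ FF (fun=> s%:C) (cpowR ^~ s) _ _ (@cvg_cst R[i]^o _ _ _ FF) cp).
  exact: (@cvgCV _ _ FF id w wn0 (@cvg_id _ _)).
have [d d0 H] := cG (e / 2) ltac:(by rewrite divr_gt0).
exists (Num.min d (complex.Re w)); first by rewrite lt_min d0.
move=> h; rewrite lt_min => /andP[h1 h2].
have cabs_t (t : R) : 0 <= t <= 1 -> cabs (t%:C * h) <= cabs h.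
  by move=> /andP[t0 t1]; rewrite cabsM cabsR ger0_norm// ler_piMl ?cabs_ge0.
have pos (t : R) : 0 <= t <= 1 -> 0 < complex.Re (w + t%:C * h).
  move=> t01; rewrite ReD; have := cabs_t t t01; have := Re_le_cabs (t%:C * h).
  by rewrite ler_norml => /andP[]; lra.
have mvt (proj : R[i] -> R) : (forall a b, proj (a - b) = proj a - proj b) ->
    (forall a, `|proj a| <= cabs a) ->
    (forall t : R, 0 <= t <= 1 -> is_derive t 1 (fun t : R => proj (cpowR (w + t%:C * h) s))
       (proj (h * G (w + t%:C * h)))) ->
    `|proj (cpowR (w + h) s - cpowR w s - G w * h)| <= e / 2 * cabs h.
  move=> pB ple dp.
  have [||t] := @MVT_segment R (fun t : R => proj (cpowR (w + t%:C * h) s))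
      (fun t => proj (h * G (w + t%:C * h))) 0 1 ler01.
  - by move=> x; rewrite in_itv/= => /andP[? ?]; apply: dp; rewrite !ltW.
  - apply: derivable_within_continuous => x; rewrite in_itv/= => x01.
    by case: (dp x x01).
  rewrite in_itv/= => t01; rewrite subr0 mulr1 mul1r mul0r addr0 => E.
  rewrite pB pB E -pB (mulrC (G w)) -mulrBr; apply: le_trans (ple _) _.
  rewrite cabsM mulrC ler_wpM2r ?cabs_ge0//; apply/ltW/H.
  by rewrite addrC addKr; apply: le_lt_trans (cabs_t t t01) _.
apply: le_trans (cabs_le_ReIm _) _; rewrite -/(G w) [leRHS](_ : _ = e / 2 * cabs h + e / 2 * cabs h); last first.
  by rewrite -mulrDl -splitr.
apply: lerD; apply: mvt.
- exact: ReB.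
- exact: Re_le_cabs.
- by move=> t /pos t0; case: (cpowR_dir s t0).

- exact: ImB.
- exact: Im_le_cabs.
- by move=> t /pos t0; case: (cpowR_dir s t0).
Qed.

End ComplexPower.

(** * The factor in [U] and its identities *)

Section Weighted.
Variable R : realType.
Implicit Types (z w a : R[i]) (alpha : R) (u v g h : R[i] -> R[i]).

Lemma realC_eq0 (x : R) : (x%:C == 0 :> R[i]) = (x == 0).
Proof. by rewrite eq_complex/= eqxx andbT. Qed.

Lemma powR_inv (x a : R) : 0 < x -> x^-1 `^ a = (x `^ a)^-1.
Proof.
move=> x0; have p0 : x `^ a != 0 by rewrite gt_eqF// powR_gt0.
by apply: (mulfI p0); rewrite mulfV// -powRM ?invr_ge0 ?(ltW x0)// mulfV ?powR1// gt_eqF.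
Qed.

Lemma Re_one_sub a z : sqmod a < 1 -> sqmod z < 1 -> 0 < complex.Re (1 - a^* * z).
Proof.
rewrite !sqmod_lt1 => a1 z1; rewrite ReB /= subr_gt0.
apply: le_lt_trans (ler_norm _) _; apply: le_lt_trans (Re_le_cabs _) _.
rewrite cabsM cabsJ; apply: le_lt_trans (_ : _ <= cabs z) _ => //.
by rewrite ler_piMl ?cabs_ge0// ltW.
Qed.

(** The automorphy factor of [U], with the differentiable [cpowR] for [cpow]. *)
Definition kern alpha z w : R[i] :=
  ((1 - sqmod z) `^ ((2 + alpha) / 2))%:C / cpowR (1 - z^* * w) (2 + alpha).

Lemma UE alpha z u w : sqmod z < 1 -> sqmod w < 1 ->
  U alpha z u w = u (moebius z w) * kern alpha z w.
Proof. by move=> z1 w1; rewrite /U cpowE// Re_one_sub. Qed.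

Lemma sqmod_kern alpha z w : sqmod z < 1 -> sqmod w < 1 ->
  sqmod (kern alpha z w) = ((1 - sqmod z) / sqmod (1 - z^* * w)) `^ (2 + alpha).
Proof.
move=> z1 w1; have r0 := Re_one_sub z1 w1; have m0 := RHP_sqmod r0.
rewrite /kern sqmodM sqmodV sqmodR sqmod_cpowR// powRM ?invr_ge0 ?subr_ge0 ?ltW//.
rewrite powR_inv//; congr (_ / _).
by rewrite expr2 -powRD -?splitr// subr_eq0 [_ == sqmod z]eq_sym (lt_eqF z1) implybT.
Qed.

(** The relation behind unitarity: the factor turns the weight at [w] into the weight at
    [phi_z(w)]. *)
Lemma sqmod_kern_weight alpha z w : sqmod z < 1 -> sqmod w < 1 ->
  sqmod (kern alpha z w) * (1 - sqmod w) `^ (2 + alpha) =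
  (1 - sqmod (moebius z w)) `^ (2 + alpha).
Proof.
move=> z1 w1; rewrite sqmod_kern// -powRM ?divr_ge0 ?sqmod_ge0 ?subr_ge0 ?ltW//.
by rewrite sqmod_moebius ?one_sub_neq0// mulrAC.
Qed.

Lemma moebius_disc z w : sqmod z < 1 -> sqmod w < 1 -> sqmod (moebius z w) < 1.
Proof. by move=> z1 w1; rewrite moebius_lt1// one_sub_neq0. Qed.

Lemma one_sub_moebiusN z w : sqmod z < 1 -> sqmod w < 1 ->
  1 - (- z)^* * moebius z w = (1 - sqmod z)%:C / (1 - z^* * w).
Proof.
move=> z1 w1; have n0 := one_sub_neq0 z1 w1.
apply: (mulIf n0); rewrite divfK// rmorphN mulNr opprK /moebius mulrDl mulrA divfK// mul1r.
by rewrite mulrBr rmorphB/= -mulc_conj [z * _]mulrC rmorph1; ring.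
Qed.

Lemma moebiusK z w : sqmod z < 1 -> sqmod w < 1 -> moebius (- z) (moebius z w) = w.
Proof.
move=> z1 w1; rewrite {1}/moebius one_sub_moebiusN// opprK.
have n0 := one_sub_neq0 z1 w1.
have c0 : (1 - sqmod z)%:C != 0 :> R[i] by rewrite (inj_eq (@complexI R)) subr_eq0 gt_eqF.
rewrite invf_div mulrA; apply: (mulIf c0); rewrite divfK// /moebius mulrDl divfK//.
by rewrite rmorphB/= -mulc_conj rmorph1; ring.
Qed.

(** The cocycle identity that makes [U_(-z)] the exact inverse of [U_z]; principal branches cause no
    unimodular constant, by [cpowR_div]. *)
Lemma kern_moebius alpha z w : sqmod z < 1 -> sqmod w < 1 ->
  kern alpha (- z) (moebius z w) * kern alpha z w = 1.
Proof.
move=> z1 w1; rewrite /kern one_sub_moebiusN// sqmodN.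
have p0 : 0 < 1 - sqmod z by rewrite subr_gt0.
rewrite cpowR_div ?Re_one_sub// invf_div.
set c := cpowR _ _; have c0 : c != 0 by exact: cpowR_neq0.
have -> : ((1 - sqmod z) `^ (2 + alpha))%:C =
  ((1 - sqmod z) `^ ((2 + alpha) / 2))%:C * ((1 - sqmod z) `^ ((2 + alpha) / 2))%:C :> R[i].
  by rewrite -rmorphM -powRD -?splitr// (gt_eqF p0) implybT.
have qn : ((1 - sqmod z) `^ ((2 + alpha) / 2))%:C != 0 :> R[i].
  by rewrite realC_eq0 gt_eqF// powR_gt0.
by move: qn c0; move: (_%:C) c => q c qn c0; field; rewrite c0.
Qed.

Lemma analytic_moebius z u : sqmod z < 1 -> analytic_on_disc u ->
  analytic_on_disc (fun w => u (moebius z w)).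
Proof.
move=> z1 /analyticP au; apply/analyticP => w w1.
apply: dvb_comp; last by apply: au; exact: moebius_disc.
apply: dvbM; first by apply: dvbB; [exact: dvb_id|exact: dvb_cst].
apply: dvbV; first exact: one_sub_neq0.
apply: dvbB; first exact: dvb_cst.
by apply: dvbM; [exact: dvb_cst|exact: dvb_id].
Qed.

Lemma analytic_kern alpha z : sqmod z < 1 -> analytic_on_disc (kern alpha z).
Proof.
move=> z1; apply/analyticP => w w1; apply: dvbM; first exact: dvb_cst.
apply: dvbV; first exact: cpowR_neq0.
have d1 : dvb (fun w0 => 1 - z^* * w0) w.
  apply: dvbB; first exact: dvb_cst.
  by apply: dvbM; [exact: dvb_cst|exact: dvb_id].
have d2 : dvb (@cpowR R ^~ (2 + alpha)) (1 - z^* * w).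
  by apply/dvb_cderiv; eexists; apply: cpowR_cderiv; exact: Re_one_sub.
exact: dvb_comp d1 d2.
Qed.

Lemma analyticM u v : analytic_on_disc u -> analytic_on_disc v ->
  analytic_on_disc (fun w => u w * v w).
Proof. by move=> /analyticP au /analyticP av; apply/analyticP => z z1; apply: dvbM; [exact: au|exact: av]. Qed.

Lemma analyticD u v : analytic_on_disc u -> analytic_on_disc v ->
  analytic_on_disc (fun w => u w + v w).
Proof. by move=> /analyticP au /analyticP av; apply/analyticP => z z1; apply: dvbD; [exact: au|exact: av]. Qed.

Lemma analyticB u v : analytic_on_disc u -> analytic_on_disc v ->
  analytic_on_disc (fun w => u w - v w).
Proof. by move=> /analyticP au /analyticP av; apply/analyticP => z z1; apply: dvbB; [exact: au|exact: av]. Qed.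

Lemma analytic_cst (c : R[i]) : analytic_on_disc (fun=> c).
Proof. by apply/analyticP => z _; exact: dvb_cst. Qed.

Lemma analyticX n : analytic_on_disc (fun w : R[i] => w ^+ n).
Proof. by apply/analyticP => z _; apply: dvbX; exact: dvb_id. Qed.

Lemma analytic_rotate (t : R) u : analytic_on_disc u -> analytic_on_disc (rotate t u).
Proof.
move=> /analyticP au; apply/analyticP => z z1.
apply: (@dvb_comp _ u (fun w => cis t * w)); first by apply: dvbM; [exact: dvb_cst|exact: dvb_id].
by apply: au; rewrite sqmodM sqmod_cis mul1r.
Qed.

Lemma analytic_U alpha z u : sqmod z < 1 -> analytic_on_disc u ->
  analytic_on_disc (U alpha z u).
Proof.
move=> z1 au; apply: (@analytic_ext _ _ (fun w => u (moebius z w) * kern alpha z w)).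
  by move=> w w1; exact: UE.
by apply: analyticM; [exact: analytic_moebius|exact: analytic_kern].
Qed.

End Weighted.

(** * The Gamma function and radial moments *)

Section Gamma.
Variable R : realType.
Local Notation mR := (measurableTypeR R).
Local Notation leb := (@lebesgue_measure R).
Implicit Types (x t a b : R).

(** Cutting the base off at [0] makes the power continuous on the whole line, so that it can be fed
    to the fundamental theorem of calculus. *)
Lemma continuous_powR_max b : 0 <= b -> continuous (fun y : R => (Num.max y 0) `^ b).
Proof.
rewrite le_eqVlt => /predU1P[<-|b0] y.
  by under eq_fun do rewrite powRr0; exact: cvg_cst.
have [y0|y0|y0] := ltgtP y 0.
- apply/cvgrPdist_lt => e e0; near=> z.
  have z0 : z < 0 by near: z; exact: lt_nbhsl.
  by rewrite (max_r (ltW y0)) (max_r (ltW z0)) subrr normr0.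
- have /cvgrPdist_lt H : (fun z => z `^ b) z @[z --> y] --> y `^ b.
    have [dp _] := is_derive1_powR b y0.
    by move/derivable1_diffP: dp => /differentiable_continuous.
  apply/cvgrPdist_lt => e e0; near=> z.
  have z0 : 0 < z by near: z; exact: lt_nbhsr.
  by rewrite (max_l (ltW y0)) (max_l (ltW z0)); near: z; exact: H.
- rewrite /continuous_at y0 maxxx powR0 ?gt_eqF//; apply/cvgrPdist_lt => e e0.
  near=> z; rewrite sub0r normrN ger0_norm ?powR_ge0//.
  have ze : `|z| < e `^ b^-1.
    rewrite -[z]subr0 distrC; near: z; apply: (@cvgr_dist_lt _ R^o) => //; exact: powR_gt0.
  have -> : e = (e `^ b^-1) `^ b by rewrite -powRrM mulVf ?(gt_eqF b0)// powRr1// ltW.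
  apply: gt0_ltr_powR; rewrite ?nnegrE ?powR_ge0 ?le_max ?lexx ?orbT//.
  by rewrite gt_max powR_gt0// andbT (le_lt_trans (ler_norm _)).
Unshelve. all: by end_near.
Qed.

(** From [ln s <= s - 1] at [s = t / (2 a)]; a further factor [expR (- a)] is dropped. *)
Lemma powR_le_expR a t : 0 < a -> 0 < t -> t `^ a <= (2 * a) `^ a * expR (t / 2).
Proof.
move=> a0 t0; have a20 : 0 < 2 * a by rewrite mulr_gt0.
rewrite /powR !gt_eqF// -expRD ler_expR.
have h : ln (t / (2 * a)) <= t / (2 * a) - 1.
  have := @le_ln1Dx R (t / (2 * a) - 1).
  rewrite (_ : 1 + (t / (2 * a) - 1) = t / (2 * a)); last by ring.
  by apply; rewrite ltrBrDl subrr divr_gt0.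
rewrite ln_div ?posrE// in h.
have : a * (ln t - ln (2 * a)) <= a * (t / (2 * a) - 1) by rewrite ler_pM2l.
have -> : a * (t / (2 * a) - 1) = t / 2 - a by field; rewrite gt_eqF.
by rewrite mulrBr; lra.
Qed.

Lemma expR_half_cvg : expR (- (t / 2)) @[t --> +oo] --> (0 : R).
Proof.
apply: (cvg_comp (fun t : R => t / 2) (fun t => expR (- t))); last exact: cvgr_expR.
by apply: gt0_cvgMly => //; exact: cvg_id.
Qed.

Local Open Scope ereal_scope.

Definition egamma x : \bar R := \int[leb]_(t in `[0%R, +oo[) (((Num.max t 0) `^ (x - 1) * expR (- t))%R)%:E.

Lemma measurable_powR_max b : (0 <= b)%R -> measurable_fun setT (fun t : R => (Num.max t 0) `^ b)%R.
Proof. by move=> b0; apply: continuous_measurable_fun; exact: continuous_powR_max. Qed.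

Lemma measurable_expRN : measurable_fun setT (fun t : R => expR (- t))%R.
Proof. by apply: measurableT_comp. Qed.

Lemma integral_expR_half : \int[leb]_(t in `[0%R, +oo[) (expR (- (t / 2)))%:E = 2%:E.
Proof.
rewrite (@ge0_continuous_FTC2y R (fun t => expR (- (t / 2)))%R (fun t => - 2 * expR (- (t / 2)))%R 0%R 0%R).
- by rewrite mul0r oppr0 expR0 mulr1 -EFinB sub0r opprK.
- by move=> x _; exact: expR_ge0.
- apply: continuous_subspaceT => t; apply: (cvg_comp (fun t : R => - (t / 2))%R expR); last exact: continuous_expR.
  by apply: cvgN; apply: cvgM; [exact: cvg_id|exact: cvg_cst].
- by rewrite -[X in _ --> X](mulr0 (- 2)%R); apply: cvgM; [exact: cvg_cst|exact: expR_half_cvg].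
- by move=> x _; apply: ex_derive.
- apply: cvg_at_right_filter; apply: cvgM; first exact: cvg_cst.
  apply: (cvg_comp (fun t : R => - (t / 2))%R expR); last exact: continuous_expR.
  by apply: cvgN; apply: cvgM; [exact: cvg_id|exact: cvg_cst].
- move=> x _; rewrite derive1E; apply: derive_val.
  by apply: is_derive_eq; rewrite /GRing.scale/=; field.
Qed.

Lemma egamma_lty x : (1 < x)%R -> egamma x < +oo.
Proof.
move=> x1; have x0 : (0 < x - 1)%R by rewrite subr_gt0.
apply: (@le_lt_trans _ _ (\int[leb]_(t in `[0%R, +oo[) ((((2 * (x - 1)) `^ (x - 1))%R)%:E * (expR (- (t / 2)))%:E))).
  apply: ge0_le_integral => //.
  - by move=> t _; rewrite lee_fin mulr_ge0 ?powR_ge0 ?expR_ge0.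
  - apply/measurable_EFinP/measurable_funTS; apply: measurable_funM; last exact: measurable_expRN.
    by apply: measurable_powR_max; rewrite ltW.
  - by apply: emeasurable_funM => //; apply/measurable_EFinP/measurable_funTS;
      do 2 apply: measurableT_comp => //; exact: mulrr_measurable.
  move=> t /=; rewrite in_itv/= andbT => t0; rewrite -EFinM lee_fin.
  move: t0; rewrite le_eqVlt => /predU1P[<-|t0].
    by rewrite maxxx powR0 ?gt_eqF// mul0r mulr_ge0 ?powR_ge0 ?expR_ge0.
  rewrite max_l; last exact: ltW.
  apply: (@le_trans _ _ ((2 * (x - 1)) `^ (x - 1) * expR (t / 2) * expR (- t))%R).
    by rewrite ler_wpM2r ?expR_ge0// powR_le_expR.
  by rewrite -mulrA -expRD (_ : t / 2 + - t = - (t / 2))%R//; lra.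
rewrite ge0_integralZl//.
- by rewrite integral_expR_half -EFinM ltry.
- by apply/measurable_EFinP/measurable_funTS; do 2 apply: measurableT_comp => //; exact: mulrr_measurable.
- by rewrite lee_fin powR_ge0.
Qed.

(** Integration by parts written as one derivative. The integrand [x p_(x-1) - p_x] changes sign, so
    the majorant [c expR (- t / 2)] of [p_x] is added to make it nonnegative; its integral [2 c]
    cancels at the end. *)
Lemma egammaS x : (1 < x)%R -> egamma (x + 1) = x%:E * egamma x.
Proof.
move=> x1; have x0 : (0 < x)%R by rewrite (lt_trans ltr01).
pose c := ((2 * x) `^ x)%R; have c0 : (0 <= c)%R by exact: powR_ge0.
pose p b (t : R) := ((Num.max t 0) `^ b * expR (- t))%R.
have cE : continuous (fun t : R => expR (- t))%R.
  by move=> t; apply: (cvg_comp (fun t : R => - t)%R expR); [apply: cvgN; exact: cvg_id|exact: continuous_expR].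
have cE2 : continuous (fun t : R => expR (- (t / 2)))%R.
  move=> t; apply: (cvg_comp (fun t : R => - (t / 2))%R expR); last exact: continuous_expR.
  by apply: cvgN; apply: cvgM; [exact: cvg_id|exact: cvg_cst].
have cp b : (0 <= b)%R -> continuous (p b).
  by move=> b0 t; apply: cvgM; [exact: continuous_powR_max|exact: cE].
have x10 : (0 <= x - 1)%R by rewrite subr_ge0 ltW.
have p0 b t : (0 <= p b t)%R by rewrite mulr_ge0 ?powR_ge0 ?expR_ge0.
have ple t : (0 <= t)%R -> (p x t <= c * expR (- (t / 2)))%R.
  rewrite le_eqVlt /p => /predU1P[<-|t0].
    by rewrite maxxx powR0 ?gt_eqF// mul0r mulr_ge0// expR_ge0.
  rewrite max_l; last exact: ltW.
  apply: (@le_trans _ _ ((2 * x) `^ x * expR (t / 2) * expR (- t))%R).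
    by rewrite ler_wpM2r ?expR_ge0// powR_le_expR.
  by rewrite -mulrA -expRD (_ : t / 2 + - t = - (t / 2))%R//; lra.
pose f (t : R) := (x * p (x - 1) t - p x t + c * expR (- (t / 2)))%R.
have f0 t : (0 <= t)%R -> (0 <= f t)%R.
  move=> t0; rewrite /f -addrA; apply: addr_ge0; first by apply: mulr_ge0; [exact: ltW|exact: p0].
  by rewrite addrC subr_ge0 ple.
have cf : continuous f.
  move=> t; apply: cvgD; last by apply: cvgM; [exact: cvg_cst|exact: cE2].
  apply: cvgB; last by apply: cp; exact: ltW.
  by apply: cvgM; [exact: cvg_cst|exact: cp].
have H : \int[leb]_(t in `[0%R, +oo[) (f t)%:E = (2 * c)%:E.
  rewrite (@ge0_continuous_FTC2y R f (fun t => p x t - 2 * c * expR (- (t / 2)))%R 0%R 0%R).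
  - by rewrite /p maxxx powR0 ?gt_eqF// mul0r sub0r mul0r oppr0 expR0 mulr1 -EFinB sub0r opprK.
  - by move=> t; exact: f0.
  - exact: continuous_subspaceT.
  - rewrite -[X in _ --> X](subrr 0%R); apply: cvgB.
      apply: (@squeeze_cvgr _ _ _ _ (fun=> 0%R) (fun t => c * expR (- (t / 2)))%R).
      + by near=> t; rewrite p0/= ple//; near: t; exact: nbhs_pinfty_ge.
      + exact: cvg_cst.
      + by rewrite -[X in _ --> X](mulr0 c); apply: cvgM; [exact: cvg_cst|exact: expR_half_cvg].
    by rewrite -[X in _ --> X](mulr0 (2 * c)%R); apply: cvgM; [exact: cvg_cst|exact: expR_half_cvg].
  - move=> t t0; apply: (@near_eq_derivable _ _ _ (fun t => t `^ x * expR (- t) - 2 * c * expR (- (t / 2)))%R).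
      by near=> z; rewrite /p max_l//; apply/ltW; near: z; exact: lt_nbhsr.
    have := is_derive1_powR x t0 => dp; exact: ex_derive.
  - apply: cvg_at_right_filter; apply: cvgB; first by apply: cp; exact: ltW.
    by apply: cvgM; [exact: cvg_cst|exact: cE2].
  - move=> t; rewrite in_itv/= andbT => t0; rewrite derive1E.
    have dp := is_derive1_powR x t0.
    rewrite -(@near_eq_derive _ _ _ (fun t => t `^ x * expR (- t) - 2 * c * expR (- (t / 2)))%R); last first.
      by near=> z; rewrite /p max_l//; apply/ltW; near: z; exact: lt_nbhsr.
    apply: derive_val; apply: is_derive_eq; rewrite /f /p max_l; last exact: ltW.
    by rewrite /GRing.scale/=; field.
have mI (g : R -> R) : continuous g -> measurable_fun (`[0%R, +oo[%classic : set mR) (fun t : mR => (g t)%:E).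
  by move=> cg; apply/measurable_EFinP/measurable_funTS; exact: continuous_measurable_fun.
have E : \int[leb]_(t in `[0%R, +oo[) ((f t)%:E + (p x t)%:E) =
    \int[leb]_(t in `[0%R, +oo[) (x%:E * (p (x - 1)%R t)%:E + c%:E * (expR (- (t / 2)))%:E).
  by apply: eq_integral => t _; rewrite -!EFinM -!EFinD /f; congr (_%:E); ring.
rewrite ge0_integralD// in E; [|by move=> t /=; rewrite in_itv/= andbT => /f0; rewrite lee_fin|exact: mI|by move=> t _; rewrite lee_fin|by apply: mI; apply: cp; exact: ltW].
rewrite ge0_integralD// in E; [|by move=> t _; rewrite mule_ge0 ?lee_fin// ltW|by apply: emeasurable_funM => //; apply: mI; exact: cp|by move=> t _; rewrite mule_ge0 ?lee_fin ?expR_ge0|by apply: emeasurable_funM => //; exact: mI].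
rewrite [X in _ = X + _]ge0_integralZl// in E; [|by apply: mI; exact: cp|by move=> t _; rewrite lee_fin|by rewrite lee_fin ltW].
rewrite [X in _ = _ + X]ge0_integralZl// in E; last exact: mI.
rewrite H integral_expR_half -EFinM [(c * 2)%R]mulrC addeC in E.
have -> : egamma (x + 1) = \int[leb]_(t in `[0%R, +oo[) (p x t)%:E.
  by rewrite /egamma addrK.
by move/(congr1 (fun y => y - (2 * c)%:E)): E; rewrite !addeK.
Unshelve. all: by end_near.
Qed.

Lemma GammaE x : (1 < x)%R -> Gamma x = fine (egamma x).
Proof.
move=> x1; rewrite /Gamma /Rintegral; apply: (congr1 (@fine R)).
rewrite integral_itv_obnd_cbnd; last first.
  apply/measurable_EFinP/measurable_funTS; apply: measurable_funM; last exact: measurable_expRN.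
  exact: measurable_powR.
by apply: eq_integral => t; rewrite inE/= in_itv/= andbT => t0; rewrite max_l.
Qed.

Lemma Gamma_gt0 x : (1 < x)%R -> (0 < Gamma x)%R.
Proof.
move=> x1; have x0 : (0 < x - 1)%R by rewrite subr_gt0.
have mf : measurable_fun (`[0%R, +oo[%classic : set mR) (fun t : mR => ((Num.max t 0) `^ (x - 1) * expR (- t))%R%:E).
  apply/measurable_EFinP/measurable_funTS; apply: measurable_funM; last exact: measurable_expRN.
  by apply: measurable_powR_max; rewrite ltW.
rewrite GammaE//; apply: fine_gt0; rewrite egamma_lty// andbT.
apply: lt_le_trans (_ : _ < (expR (- 2))%:E) _; first by rewrite lte_fin expR_gt0.
apply: (@le_trans _ _ (\int[leb]_(t in `[1%R, 2%R]) (cst (expR (- 2))%:E) t)).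
  by rewrite integral_cst//= lebesgue_measure_itv/= lte_fin ltr1n -EFinB (_ : 2 - 1 = 1)%R ?mule1//; ring.
have sub : `[1%R, 2%R] `<=` (`[0%R, +oo[%classic : set R).
  by move=> t /=; rewrite !in_itv/= andbT => /andP[t1 _]; exact: le_trans t1.
apply: (@le_trans _ _ (\int[leb]_(t in `[1%R, 2%R]) (((Num.max t 0) `^ (x - 1) * expR (- t))%R%:E))).
  apply: ge0_le_integral => //.
  - by move=> t _; rewrite lee_fin expR_ge0.
  - by apply: measurable_funS mf.
  move=> t /=; rewrite in_itv/= => /andP[t1 t2]; rewrite lee_fin.
  have t0 : (0 <= t)%R by exact: le_trans t1.
  rewrite max_l// -[leLHS]mul1r ler_pM ?expR_ge0//; last by rewrite ler_expR lerN2.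
  suff : (1 `^ (x - 1) <= t `^ (x - 1))%R by rewrite powR1.
  by apply: ge0_ler_powR; rewrite ?nnegrE// ltW.
apply: ge0_subset_integral => //.
by move=> t _; rewrite lee_fin mulr_ge0 ?powR_ge0 ?expR_ge0.
Qed.

Lemma GammaS x : (1 < x)%R -> Gamma (x + 1) = (x * Gamma x)%R.
Proof.
move=> x1; rewrite !GammaE ?egammaS//; last by rewrite (lt_trans x1)// ltrDl.
rewrite fineM// ge0_fin_numE ?egamma_lty//.
by apply: integral_ge0 => t _; rewrite lee_fin mulr_ge0 ?powR_ge0 ?expR_ge0.
Qed.

End Gamma.

(** * Radial moments of the weights *)

Section Moments.
Variable R : realType.
Local Notation mR := (measurableTypeR R).
Local Notation leb := (@lebesgue_measure R).
Local Notation area := (@area R).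
Implicit Types (alpha : R).

Definition bweight alpha (z : R[i]) : R := if sqmod z < 1 then bergman_density alpha z else 0.

(** The number [n! Gamma (alpha + 2) / Gamma (n + alpha + 2)], the squared norm of [z^n] ([moment]).
    The recursion is what integration by parts yields; the link with [Gamma] is [Gamma_wn]. *)
Fixpoint wn alpha n : R :=
  if n is m.+1 then wn alpha m * (m.+1%:R / (m%:R + alpha + 2)) else 1.

Lemma wn_gt0 alpha n : 0 <= alpha -> 0 < wn alpha n.
Proof.
by move=> a0; elim: n => //= n ih; rewrite mulr_gt0 ?divr_gt0// ltr_wpDl// addr_ge0.
Qed.

Let g alpha (x : R) : R := (Num.max (1 - x ^+ 2) 0) `^ alpha.

Let cg alpha : 0 <= alpha -> continuous (g alpha).
Proof.
move=> a0 x; apply: (cvg_comp (fun x : R => 1 - x ^+ 2) (fun y => (Num.max y 0) `^ alpha)); last exact: continuous_powR_max.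
by apply: cvgB; [exact: cvg_cst|exact: exprn_continuous].
Qed.

Let dg alpha (x : R) : 0 < x < 1 -> is_derive x 1 (g (alpha + 1)) ((alpha + 1) * (1 - x ^+ 2) `^ alpha * (- (2 * x))).
Proof.
move=> /andP[x0 x1].
have y0 : 0 < 1 - x ^+ 2 by rewrite subr_gt0 expr_lt1// ltW.
have dq : is_derive x 1 (fun x : R => 1 - x ^+ 2) (- (2 * x)).
  by apply: is_derive_eq; rewrite /GRing.scale/=; ring.
have dp := is_derive1_powR (alpha + 1) y0.
have H := is_derive1_comp (g := fun x : R => 1 - x ^+ 2) dp dq.
rewrite addrK in H; apply: near_eq_is_derive H; near=> z; rewrite /= /g max_l//.
rewrite subr_ge0 expr_le1//; first by apply/ltW; near: z; exact: lt_nbhsl.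
by apply/ltW; near: z; exact: lt_nbhsr.
Unshelve. all: by end_near.
Qed.

Let B alpha n := cint (fun x => 2 * x ^+ n.*2.+1 * g alpha x) 0 1.

Let cB alpha (n : nat) : 0 <= alpha -> continuous (fun x : R => 2 * x ^+ n.*2.+1 * g alpha x).
Proof.
move=> a0 x; apply: cvgM; last exact: cg.
by apply: cvgM; [exact: cvg_cst|exact: exprn_continuous].
Qed.

Let FTC01 (f F : R -> R) : continuous f -> continuous F ->
  (forall x : R, 0 < x < 1 -> is_derive x 1 F (f x)) -> cint f 0 1 = F 1 - F 0.
Proof.
move=> cf cF dF; rewrite /cint /Rintegral (@continuous_FTC2 R f F)//.
- exact: continuous_subspaceT.
- split; [by move=> x; rewrite in_itv/= => /dF[]|exact: cvg_at_right_filter (cF 0)|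
    exact: cvg_at_left_filter (cF 1)].
- by move=> x; rewrite in_itv/= derive1E => /dF[].
Qed.

Let g1 alpha x : 0 < x < 1 -> g (alpha + 1) x = (1 - x ^+ 2) * g alpha x.
Proof.
move=> /andP[x0 x1]; have y0 : 0 < 1 - x ^+ 2 by rewrite subr_gt0 expr_lt1// ltW.
by rewrite /g max_l ?ltW// powRD ?powRr1 ?ltW ?(gt_eqF y0) ?implybT// mulrC.
Qed.

Let gE alpha x : 0 < x < 1 -> g alpha x = (1 - x ^+ 2) `^ alpha.
Proof.
move=> /andP[x0 x1]; have y0 : 0 < 1 - x ^+ 2 by rewrite subr_gt0 expr_lt1// ltW.
by rewrite /g max_l ?ltW.
Qed.

Let gend alpha : 0 < alpha -> g alpha 1 = 0.
Proof. by move=> a0; rewrite /g expr1n subrr maxxx powR0// gt_eqF. Qed.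

Let B0 alpha : 0 <= alpha -> B alpha 0 = (alpha + 1)^-1.
Proof.
move=> a0; have a1 : 0 < alpha + 1 by rewrite ltr_wpDl.
rewrite /B; apply: etrans; first apply: (@FTC01 _ (fun x => - (alpha + 1)^-1 * g (alpha + 1) x)).
- exact: cB.
- by move=> x; apply: cvgM; [exact: cvg_cst|apply: cg; exact: ltW].
- move=> x x01; apply: (is_derive_ext (is_derive_mulc (- (alpha + 1)^-1) (dg alpha x01))) => //.
  by rewrite gE// expr1; field; rewrite gt_eqF.
by rewrite /= gend// /g expr0n/= subr0 max_l// powR1; ring.
Qed.

(** Integrate the derivative of [x ^ (2 n + 2) (1 - x^2) ^ (alpha + 1)], which vanishes at both ends
    of [[0, 1]]. *)
Let BS alpha n : 0 <= alpha -> B alpha n.+1 = B alpha n * (n.+1%:R / (n%:R + alpha + 2)).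
Proof.
move=> a0; have a1 : 0 < alpha + 1 by rewrite ltr_wpDl.
have c1 (k : R) (m : nat) : continuous (fun x : R => k * (2 * x ^+ m.*2.+1 * g alpha x)).
  by move=> x; apply: cvgM; [exact: cvg_cst|exact: cB].
have H : cint (fun x => n.+1%:R * (2 * x ^+ n.*2.+1 * g alpha x) -
    (n%:R + alpha + 2) * (2 * x ^+ n.+1.*2.+1 * g alpha x)) 0 1 = 0.
  apply: etrans; first apply: (@FTC01 _ (fun x => x ^+ n.+1.*2 * g (alpha + 1) x)).
  - by move=> x; apply: cvgB; exact: c1.
  - by move=> x; apply: cvgM; [exact: exprn_continuous|apply: cg; exact: ltW].
  2: by rewrite /= gend// mulr0 doubleS expr0n/= mul0r subrr.
  move=> x x01.
  have dx : is_derive x 1 (fun x : R => x ^+ n.+1.*2) (n.+1.*2%:R * x ^+ n.*2.+1).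
    apply: (is_derive_ext (is_deriveX n.+1.*2 (is_derive_id x 1))).
      by move=> y; rewrite exprfctE.
    by rewrite /GRing.scale/= mulr1 doubleS.
  apply: (is_derive_ext (is_deriveM dx (dg alpha x01))) => //.
  rewrite -gE// g1// /GRing.scale/= (_ : n.+1.*2%:R = 2 * n.+1%:R :> R); last by rewrite -mul2n natrM.
  rewrite !doubleS !exprS; move: (g alpha x) (x ^+ n.*2) => G X.
  by rewrite -[n.+1%:R]natr1; ring.
have cM (k : R) (m : nat) : cint (fun x : R => k * (2 * x ^+ m.*2.+1 * g alpha x)) 0 1 = k * B alpha m.
  by rewrite /cint RintegralZl//; apply: cint_integrable; exact: cB.
rewrite cintB// !cM in H.
have p0 : n%:R + alpha + 2 != 0 by rewrite gt_eqF// ltr_wpDl// addr_ge0.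
by apply: (mulfI p0); move/eqP: H; rewrite subr_eq0 => /eqP <-; field.
Qed.

Let BE alpha n : 0 <= alpha -> B alpha n = wn alpha n / (alpha + 1).
Proof. by move=> a0; elim: n => [|n ih]; rewrite ?B0 ?mul1r// BS// ih /=; ring. Qed.

Local Open Scope ereal_scope.

Lemma integral_even (h : R -> \bar R) : measurable_fun setT (h : mR -> \bar R) ->
  (forall x, 0 <= h x) -> (forall x, h (- x)%R = h x) ->
  \int[leb]_x h x = 2%:E * \int[leb]_(x in `[0%R, +oo[) h x.
Proof.
move=> mh h0 hN.
have mD1 : measurable (`]0%R, +oo[%classic : set mR) by exact: measurable_itv.
have mD2 : measurable (`]-oo, 0%R]%classic : set mR) by exact: measurable_itv.
have -> : \int[leb]_x h x = \int[leb]_(x in `]-oo, 0%R] `|` `]0%R, +oo[) h x.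
  by congr integral; rewrite -setCitvr setUC setUv.
rewrite ge0_integral_setU//=; last 2 first.
- exact: measurable_funTS.
- rewrite disj_set2E; apply/eqP; rewrite -subset0 => x [] /=; rewrite !in_itv/= andbT => x0.
  by rewrite ltNge x0.
rewrite integral_itv_obnd_cbnd; last exact: measurable_funTS.
rewrite (ge0_integration_by_substitution0 mh h0).
have -> : \int[leb]_(r in `]-oo, 0%R]) h (- r)%R = \int[leb]_(r in `]-oo, 0%R]) h r.
  by apply: eq_integral => x _; rewrite hN.
by rewrite -mule2n// mule_natl.
Qed.

Lemma integral_oneDsqrV : \int[leb]_k ((oneDsqr k)^-1)%:E = pi%:E :> \bar R.
Proof.
rewrite integral_even.
- by rewrite integral0y_oneDsqr -EFinM mulrC divfK.
- by apply/measurable_EFinP; apply: continuous_measurable_fun; exact: continuous_oneDsqrV.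
- by move=> x; rewrite lee_fin invr_ge0 (le_trans ler01)// oneDsqr_ge1.
- by move=> x; rewrite /oneDsqr sqrrN.
Qed.

(** On the line of slope [k] one has [|z|^2 = (1 + k^2) x^2]. Scaling [x] by [sqrt (1 + k^2)] leaves
    a factor [1 / (1 + k^2)], and its integral over all slopes is [pi]. *)
Lemma area_radial (f : R -> \bar R) : measurable_fun setT (f : mR -> \bar R) ->
  (forall x, 0 <= f x) ->
  \int[area]_p f (sqmod (of_coord p)) = pi%:E * \int[leb]_x (`|x|%:E * f (x ^+ 2)%R).
Proof.
move=> mf f0.
have mF : measurable_fun setT (fun p : mR * mR => f (sqmod (of_coord p))).
  by apply: (measurableT_comp mf); apply: measurable_sqmod; exact: cmeas_id.
have mG : measurable_fun setT (fun x : mR => `|x|%:E * f (x ^+ 2)%R).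
  apply: emeasurable_funM; first by apply/measurable_EFinP; exact: normr_measurable.
  by apply: (measurableT_comp mf); exact: exprn_measurable.
rewrite integral_slopes//.
rewrite -integral_oneDsqrV -ge0_integralZr//; first last.
- by apply: integral_ge0 => x _; rewrite mule_ge0.
- by apply/measurable_EFinP; apply: continuous_measurable_fun; exact: continuous_oneDsqrV.
apply: eq_integral => k _.
have o0 : (0 < oneDsqr (k : R))%R by rewrite (lt_le_trans ltr01)// oneDsqr_ge1.
pose c : R := Num.sqrt (oneDsqr k); have c0 : (0 < c)%R by rewrite sqrtr_gt0.
rewrite -[in RHS](@leb_scale R c) ?gt_eqF//; last by move=> x; rewrite mule_ge0.
rewrite -ge0_integralZl//; first last.
- by move=> x _; rewrite !mule_ge0.
- by apply: emeasurable_funM => //; apply: (measurableT_comp mG); exact: mulrl_measurable.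
apply: eq_integral => x _; rewrite !muleA -!EFinM; congr (_%:E * f _).
  rewrite normrM gtr0_norm// -[in RHS](sqr_sqrtr (ltW o0)) -/c; field; by rewrite gt_eqF.
by rewrite exprMn sqr_sqrtr ?(ltW o0)// /sqmod /of_coord /= /oneDsqr; ring.
Qed.

Lemma moment alpha n : (0 <= alpha)%R ->
  \int[area]_p ((sqmod (of_coord p) ^+ n * bweight alpha (of_coord p))%R)%:E = (wn alpha n)%:E.
Proof.
move=> a0; have a1 : (0 < alpha + 1)%R by rewrite ltr_wpDl.
pose f (t : R) := (t ^+ n * (if t < 1 then (alpha + 1) / pi * (1 - t) `^ alpha else 0))%R.
pose f' (t : R) := (if 0 <= t then f t else 0)%R.
have f0 t : (0 <= f' t)%R.
  rewrite /f'; case: ifPn => // t0; rewrite /f mulr_ge0 ?exprn_ge0//; case: ifPn => // _.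
  by rewrite !mulr_ge0 ?powR_ge0 ?invr_ge0 ?pi_ge0 ?ltW.
have mf : measurable_fun setT (f' : mR -> mR).
  apply: measurable_fun_ifT => //; first by apply: measurable_fun_ler.
  apply: measurable_funM; first exact: exprn_measurable.
  apply: measurable_fun_ifT => //; first by apply: measurable_fun_ltr.
  apply: measurable_funM => //; apply: (measurableT_comp (measurable_powR alpha)).
  exact: measurable_funB.
transitivity (\int[area]_p (f' (sqmod (of_coord p)))%:E).
  by apply: eq_integral => p _; rewrite /f' sqmod_ge0.
rewrite (@area_radial (EFin \o f')); [|exact/measurable_EFinP|by move=> x; rewrite lee_fin].
rewrite integral_even; last 3 first.
- apply: emeasurable_funM; first by apply/measurable_EFinP; exact: normr_measurable.
  by apply/measurable_EFinP; apply: (measurableT_comp mf); exact: exprn_measurable.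
- by move=> x; rewrite mule_ge0 ?lee_fin.
- by move=> x; rewrite normrN sqrrN.
have mI : measurable_fun setT (fun x : mR => (`|x| * f' (x ^+ 2))%:E).
  have mabs : measurable_fun setT (fun x : mR => `|x|%R : mR) by exact: normr_measurable.
  have mf2 : measurable_fun setT (fun x : mR => f' (x ^+ 2)%R : mR).
    by apply: (measurableT_comp mf); exact: exprn_measurable.
  by apply/measurable_EFinP; exact: (measurable_funM mabs mf2).
have -> : \int[leb]_(x in `[0%R, +oo[) (`|x|%:E * (f' (x ^+ 2))%:E) =
    \int[leb]_(x in `[0%R, 1%R[) (`|x| * f' (x ^+ 2))%:E.
  rewrite integral_mkcond [RHS]integral_mkcond; apply: eq_integral => x _.
  rewrite !patchE !mem_setE !in_itv/= andbT -EFinM.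
  case: (leP 0%R x) => //= x0; case: ltP => // x1.
  rewrite /f' sqr_ge0 /f ifF ?mulr0//; apply/negbTE; rewrite -leNgt.
  by rewrite -[leLHS](expr1n _ 2) ler_pXn2r ?nnegrE.
rewrite integral_itv_bndo_bndc; last exact: measurable_funTS.
pose k : R := ((alpha + 1) / (2 * pi))%R.
have -> : \int[leb]_(x in `[0%R, 1%R]) (`|x| * f' (x ^+ 2))%:E =
   \int[leb]_(x in `[0%R, 1%R]) (k * (2 * x ^+ n.*2.+1 * g alpha x))%:E.
  rewrite -integral_itv_bndo_bndc; last exact: measurable_funTS.
  rewrite -[RHS]integral_itv_bndo_bndc; last first.
    apply/measurable_EFinP; apply: measurable_funTS.
    by apply: measurable_funM => //; apply: continuous_measurable_fun; exact: cB.
  apply: eq_integral => x; rewrite inE/= in_itv/= => /andP[x0 x1]; congr (_%:E).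
  have x21 : (x ^+ 2 < 1)%R by rewrite expr_lt1.
  rewrite ger0_norm// /f' sqr_ge0 /f x21 /g max_l; last by rewrite subr_ge0 ltW.
  have alg (y P X p : R) : (p != 0 -> y * (X * ((alpha + 1) / p * P)) = (alpha + 1) / (2 * p) * (2 * (y * X) * P))%R.
    by move=> p0; field.
  by rewrite -exprM mul2n [(x ^+ n.*2.+1)%R]exprS /k; apply: alg; rewrite gt_eqF ?pi_gt0.
have := @BE alpha n a0; rewrite /B /cint /Rintegral => HB.
have cI : leb.-integrable `[0%R, 1%R] (fun x : R => (2 * x ^+ n.*2.+1 * g alpha x)%R%:E).
  by apply: (@cint_integrable _ (fun x => 2 * x ^+ n.*2.+1 * g alpha x)%R); exact: cB.
under eq_integral do rewrite EFinM.
rewrite integralZl// -[X in _ * (_ * (_ * X))]fineK; last exact: integrable_fin_num.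
rewrite HB -!EFinM; congr (_%:E); rewrite /k; have := pi_gt0 R; move: (pi : R) => p p0; field.
by rewrite !gt_eqF.
Qed.

End Moments.

(** * Weighted square-integrable functions *)

Section AreaTonelli.
Variable R : realType.
Local Notation mR := (measurableTypeR R).
Local Open Scope ereal_scope.

(* The library leaves [lebesgue_measure \x lebesgue_measure] without a usable
   sigma-finite instance (it is shadowed by that for probabilities). *)
Definition area_sf (A : set (mR * mR)) : \bar R := @area R A.

HB.instance Definition _ := isMeasure.Build _ _ _ area_sf
  (measure0 (@area R)) (measure_ge0 (@area R)) (@measure_semi_sigma_additive _ _ _ (@area R)).

Let area_sigma_finite : sigma_finite setT area_sf.
Proof.
have /sigma_finiteP[F [TF ndF Foo]] := sigma_finiteT (@lebesgue_measure R).
exists (fun n => F n `*` F n).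
  apply/esym/seteqP; split => // -[x y] _.
  have [n _ nx] : (\bigcup_i F i) x by rewrite -TF.
  have [k _ ky] : (\bigcup_i F i) y by rewrite -TF.
  exists (maxn n k) => //; split.
  - by move: x nx; exact/subsetPset/ndF/leq_maxl.
  - by move: y ky; exact/subsetPset/ndF/leq_maxr.
move=> k; have [mk ?] := Foo k; split; first exact: measurableX.
by rewrite /area_sf /Defs.area /= product_measure1E// lte_mul_pinfty// ge0_fin_numE.
Qed.

HB.instance Definition _ := Measure_isSigmaFinite.Build _ _ _ area_sf area_sigma_finite.

Context d (T : measurableType d) (m : {sigma_finite_measure set T -> \bar R}).
Implicit Types h : (T * (mR * mR))%type -> \bar R.

Lemma tonelli_area h : measurable_fun setT h -> (forall q, 0 <= h q) ->
  \int[m]_t \int[@area R]_p h (t, p) = \int[@area R]_p \int[m]_t h (t, p).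
Proof. exact: (@fubini_tonelli _ _ _ _ R m area_sf h). Qed.

Lemma measurable_area_F h : measurable_fun setT h -> (forall q, 0 <= h q) ->
  measurable_fun setT (fun t => \int[@area R]_p h (t, p)).
Proof. exact: (@measurable_fun_fubini_tonelli_F _ _ _ _ R area_sf h). Qed.

End AreaTonelli.

Section L2.
Variable R : realType.
Local Notation mR := (measurableTypeR R).
Local Notation area := (@area R).
Implicit Types (alpha : R) (u v : R[i] -> R[i]) (z w : R[i]).

(* Functions on [R[i]] are arbitrary off the disc; measurability is that of the
   extension by [0]. *)
Definition cut u z : R[i] := if sqmod z < 1 then u z else 0.

Lemma mem_disc p : (p \in @disc_coord R) = (sqmod (of_coord p) < 1).
Proof. by apply/idP/idP; rewrite inE. Qed.

Definition mdisc u : Prop := cmeas (fun p => cut u (of_coord p)).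

Lemma cmeas_if d (T : measurableType d) (b : T -> bool) (f g : T -> R[i]) :
  measurable_fun setT b -> cmeas f -> cmeas g -> cmeas (fun t => if b t then f t else g t).
Proof.
move=> mb [f1 f2] [g1 g2]; split.
- by under eq_fun do rewrite (fun_if (@complex.Re R)); exact: measurable_fun_ifT.
- by under eq_fun do rewrite (fun_if (@complex.Im R)); exact: measurable_fun_ifT.
Qed.

Lemma mdisc_comp d (T : measurableType d) u (f : T -> R[i]) : mdisc u -> cmeas f ->
  cmeas (fun t => cut u (f t)).
Proof. by move=> mu mf; exact: (@cmeas_comp R _ _ (cut u)). Qed.

Lemma mdisc_ext u v : (forall z, sqmod z < 1 -> u z = v z) -> mdisc v -> mdisc u.
Proof.
move=> uv; rewrite /mdisc (_ : (fun p => cut v _) = (fun p => cut u (of_coord p)))//.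
by apply/funext => p; rewrite /cut; case: ifPn => // /uv.
Qed.

Lemma mdiscD u v : mdisc u -> mdisc v -> mdisc (fun z => u z + v z).
Proof.
move=> mu mv; have := cmeasD mu mv; rewrite /mdisc; congr cmeas; apply/funext => p.
by rewrite /cut; case: ifP; rewrite ?addr0.
Qed.

Lemma mdiscM u v : mdisc u -> mdisc v -> mdisc (fun z => u z * v z).
Proof.
move=> mu mv; have := cmeasM mu mv; rewrite /mdisc; congr cmeas; apply/funext => p.
by rewrite /cut; case: ifP; rewrite ?mulr0.
Qed.

Lemma mdisc_cmeas u : cmeas (fun p => u (of_coord p)) -> mdisc u.
Proof.
move=> mu; apply: (@cmeas_if _ _ (fun p => sqmod (of_coord p) < 1) (fun p => u (of_coord p)) (fun=> 0)) => //.
  by apply: measurable_in_disc; exact: cmeas_id.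
Qed.

Lemma mdisc_cst (c : R[i]) : mdisc (fun=> c).
Proof. by apply: mdisc_cmeas; exact: cmeas_cst. Qed.

Lemma mdiscB u v : mdisc u -> mdisc v -> mdisc (fun z => u z - v z).
Proof.
move=> mu mv; apply: mdiscD => //.
apply: (@mdisc_ext _ (fun z => (-1) * v z)); first by move=> z _; rewrite mulN1r.
by apply: mdiscM => //; exact: mdisc_cst.
Qed.

Lemma mdisc_analytic u : analytic_on_disc u -> mdisc u.
Proof.
move=> /analyticP au.
have mdc : measurable (@disc_coord R) by exact: measurable_disc_coord.
have H (F : R[i] -> R) : F 0 = 0 -> (forall z w, `|F z - F w| <= cabs (z - w)) ->
    measurable_fun setT (fun p : mR * mR => F (cut u (of_coord p)) : mR).
  move=> F0 FL.
  have mD : measurable_fun (@disc_coord R) (fun p => F (u (of_coord p)) : mR).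
    apply: (@measurable_disc_cont R (fun z => F (u z))) => z z1 e e0.
    have /dvb_cderiv[l /cderiv_ccont uc] := au _ z1.
    have [d d0 H] := uc e e0; exists d => // w wd.
    by apply: le_lt_trans (FL _ _) _; exact: H.
  rewrite (_ : (fun p => _) = (fun p => F (u (of_coord p))) \_ (@disc_coord R)).
    by apply/(measurable_restrictT _ mdc).
  apply/funext => p; rewrite patchE mem_disc /cut.
  by case: ifP.
split; apply: H => //.
- by move=> z w; rewrite -ReB; exact: Re_le_cabs.
- by move=> z w; rewrite -ImB; exact: Im_le_cabs.
Qed.

Lemma bweight_ge0 alpha z : 0 <= alpha -> 0 <= bweight alpha z.
Proof.
move=> a0; rewrite /bweight; case: ifP => // _; rewrite /bergman_density.
by rewrite mulr_ge0 ?powR_ge0// divr_ge0 ?pi_ge0// addr_ge0.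
Qed.

Lemma measurable_bweight d (T : measurableType d) alpha (f : T -> R[i]) : cmeas f ->
  measurable_fun setT (fun t => bweight alpha (f t) : mR).
Proof.
move=> mf; apply: measurable_fun_ifT => //; first exact: measurable_in_disc.
apply: measurable_funM => //; apply: (measurableT_comp (measurable_powR alpha)).
by apply: measurable_funB => //; exact: measurable_sqmod.
Qed.

(** Expresses [dA_alpha] through the invariant measure, which is how Moebius invariance reaches the
    norms. *)
Lemma bweight_lambda alpha z : sqmod z < 1 ->
  bweight alpha z = (alpha + 1) * (1 - sqmod z) `^ (2 + alpha) * lambda_weight z.
Proof.
move=> z1; have z0 : 0 < 1 - sqmod z by rewrite subr_gt0.
have p0 : 1 - sqmod z != 0 by rewrite gt_eqF.
rewrite /bweight /lambda_weight z1 /bergman_density /lambda_density.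
rewrite powRD ?p0 ?implybT// powR_mulrn ?(ltW z0)//.
move: ((1 - sqmod z) `^ alpha) (1 - sqmod z) p0 (pi_gt0 R) => P q q0; move: (pi : R) => p pp.
by field; rewrite q0 gt_eqF.
Qed.

Lemma cut_bweight alpha u v (F : R[i] -> R[i] -> R) z :
  F (cut u z) (cut v z) * bweight alpha z = F (u z) (v z) * bweight alpha z.
Proof. by rewrite /cut /bweight; case: ifP; rewrite ?mulr0. Qed.

Definition nrm2 alpha u : \bar R :=
  (\int[area]_p (sqmod (u (of_coord p)) * bweight alpha (of_coord p))%:E)%E.

Definition L2 alpha u : Prop := mdisc u /\ (nrm2 alpha u < +oo)%E.

Definition nr alpha u : R := fine (nrm2 alpha u).

Lemma measurable_nrm2_integrand d (T : measurableType d) alpha u (f : T -> R[i]) : mdisc u -> cmeas f ->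
  measurable_fun setT (fun t => sqmod (u (f t)) * bweight alpha (f t) : mR).
Proof.
move=> mu mf; rewrite (_ : (fun t => _) = (fun t => sqmod (cut u (f t)) * bweight alpha (f t))).
  apply: measurable_funM; last exact: measurable_bweight.
  by apply: measurable_sqmod; exact: mdisc_comp.
by apply/funext => t; rewrite (@cut_bweight alpha u u (fun a _ => sqmod a)).
Qed.

Lemma nrm2_integrand_ge0 alpha u z : 0 <= alpha -> 0 <= sqmod (u z) * bweight alpha z.
Proof. by move=> a0; rewrite mulr_ge0 ?sqmod_ge0 ?bweight_ge0. Qed.

Lemma nrm2_ext alpha u v : (forall z, sqmod z < 1 -> u z = v z) -> nrm2 alpha u = nrm2 alpha v.
Proof.
move=> uv; apply: eq_integral => p _; congr (_%:E).
by rewrite /bweight; case: ifP => [/uv ->//|]; rewrite !mulr0.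
Qed.

Lemma disc_integral_bweight alpha (F : R[i] -> R) :
  (\int[area]_(p in @disc_coord R) (F (of_coord p) * bergman_density alpha (of_coord p))%:E =
   \int[area]_p (F (of_coord p) * bweight alpha (of_coord p))%:E)%E.
Proof.
rewrite integral_mkcond; apply: eq_integral => p _; rewrite patchE mem_disc /bweight.
by case: ifP; rewrite ?mulr0.
Qed.

Lemma bergmanP alpha u : bergman alpha u <-> analytic_on_disc u /\ L2 alpha u.
Proof.
rewrite /bergman (disc_integral_bweight alpha (fun z => sqmod (u z))).
by split=> [[au uL]|[au [_ uL]]]; split => //; split => //; exact: mdisc_analytic.
Qed.

Lemma bergman_normE alpha u : bergman_norm alpha u = Num.sqrt (nr alpha u).
Proof.
rewrite /bergman_norm /disc_int /Rintegral; congr (Num.sqrt (fine _)).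
exact: (disc_integral_bweight alpha (fun z => sqmod (u z))).
Qed.

End L2.

(** * The real inner product and polarization *)

Section L2Inner.
Variable R : realType.
Local Notation mR := (measurableTypeR R).
Local Notation area := (@area R).
Variable alpha : R.
Hypothesis a0 : 0 <= alpha.
Implicit Types (u v : R[i] -> R[i]) (z w : R[i]).
Local Notation N := (nrm2 alpha).
Local Notation nr := (nr alpha).
Local Notation L2 := (L2 alpha).

Let mI u : mdisc u -> measurable_fun setT (fun p : mR * mR => (sqmod (u (of_coord p)) * bweight alpha (of_coord p))%:E).
Proof. by move=> mu; apply/measurable_EFinP; apply: measurable_nrm2_integrand => //; exact: cmeas_id. Qed.

Let I0 u (p : mR * mR) : (0 <= (sqmod (u (of_coord p)) * bweight alpha (of_coord p))%:E)%E.
Proof. by rewrite lee_fin nrm2_integrand_ge0. Qed.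

Lemma nrm2_ge0 u : (0 <= N u)%E.
Proof. by apply: integral_ge0 => p _; exact: I0. Qed.

Lemma nr_ge0 u : 0 <= nr u.
Proof. by apply: fine_ge0; exact: nrm2_ge0. Qed.

Lemma nrE u : L2 u -> (nr u)%:E = N u.
Proof. by move=> [_ uL]; rewrite fineK// ge0_fin_numE ?nrm2_ge0. Qed.

(** Holds in the extended reals, where it also shows that sums and differences of square-integrable
    functions are square-integrable. *)
Lemma parallelogram u v : mdisc u -> mdisc v ->
  (N (fun z => (u z + v z)%R) + N (fun z => (u z - v z)%R) = 2%:E * N u + 2%:E * N v)%E.
Proof.
move=> mu mv; rewrite /nrm2 -!ge0_integralZl//; try exact: mI.
rewrite -!ge0_integralD//.
- apply: eq_integral => p _; rewrite -!EFinM -!EFinD; congr (_%:E).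
  by rewrite /sqmod ReD ImD ReB ImB; ring.
- by move=> p _; rewrite mule_ge0.
- by apply: emeasurable_funM => //; exact: mI.
- by move=> p _; rewrite mule_ge0.
- by apply: emeasurable_funM => //; exact: mI.
- by move=> p _; exact: (I0 (fun z => u z + v z)).
- exact: mI (mdiscD mu mv).
- by move=> p _; exact: (I0 (fun z => u z - v z)).
- exact: mI (mdiscB mu mv).
Qed.

Let par_lty u v : L2 u -> L2 v ->
  (N (fun z => (u z + v z)%R) + N (fun z => (u z - v z)%R) < +oo)%E.
Proof.
by move=> [mu uL] [mv vL]; rewrite parallelogram// lte_add_pinfty// lte_mul_pinfty.
Qed.

Lemma L2D u v : L2 u -> L2 v -> L2 (fun z => u z + v z).
Proof.
move=> Lu Lv; split; first by case: Lu Lv => [mu _] [mv _]; exact: mdiscD.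
by apply: le_lt_trans (par_lty Lu Lv); rewrite leeDl// nrm2_ge0.
Qed.

Lemma L2B u v : L2 u -> L2 v -> L2 (fun z => u z - v z).
Proof.
move=> Lu Lv; split; first by case: Lu Lv => [mu _] [mv _]; exact: mdiscB.
by apply: le_lt_trans (par_lty Lu Lv); rewrite leeDr// nrm2_ge0.
Qed.

Lemma nrm2Z (c : R[i]) u : mdisc u -> (N (fun z => (c * u z)%R) = (sqmod c)%:E * N u)%E.
Proof.
move=> mu; rewrite /nrm2 -ge0_integralZl//; try exact: mI; last by rewrite lee_fin sqmod_ge0.
by apply: eq_integral => p _; rewrite -EFinM sqmodM mulrA.
Qed.

Lemma L2Z (c : R[i]) u : L2 u -> L2 (fun z => c * u z).
Proof.
move=> [mu uL]; split; first by apply: mdiscM => //; exact: mdisc_cst.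
by rewrite nrm2Z// lte_mul_pinfty// lee_fin sqmod_ge0.
Qed.

Lemma nrZ (c : R[i]) u : L2 u -> nr (fun z => c * u z) = sqmod c * nr u.
Proof. by move=> [mu uL]; rewrite /nr nrm2Z// fineM// ge0_fin_numE ?nrm2_ge0. Qed.

Lemma L2_ext u v : (forall z, sqmod z < 1 -> u z = v z) -> L2 v -> L2 u.
Proof. by move=> uv [mv vL]; split; [exact: mdisc_ext mv|rewrite (nrm2_ext _ uv)]. Qed.

(** The real part of the inner product. Being real bilinear and symmetric, it is recovered from
    norms alone, and [inner_rin] rebuilds the complex product from it. *)
Definition rin u v : R := \int[area]_p (complex.Re (u (of_coord p) * (v (of_coord p))^*) * bweight alpha (of_coord p)).

Lemma rin_integrable u v : L2 u -> L2 v ->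
  area.-integrable setT (fun p => (complex.Re (u (of_coord p) * (v (of_coord p))^*) * bweight alpha (of_coord p))%:E).
Proof.
move=> Lu Lv; case: (Lu) (Lv) => [mu uL] [mv vL].
have iN (w : R[i] -> R[i]) : L2 w -> area.-integrable setT (fun p => (sqmod (w (of_coord p)) * bweight alpha (of_coord p))%:E).
  move=> [mw wL]; apply/integrableP; split; first exact: mI.
  by under eq_integral do rewrite gee0_abs//.
apply: (@le_integrable _ _ _ area setT measurableT _ (fun p => ((sqmod (u (of_coord p)) * bweight alpha (of_coord p))%:E + (sqmod (v (of_coord p)) * bweight alpha (of_coord p))%:E)%E)) => //.
- apply/measurable_EFinP; rewrite (_ : (fun p => _) = (fun p : mR * mR =>
    complex.Re (cut u (of_coord p) * (cut v (of_coord p))^*) * bweight alpha (of_coord p))).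
    apply: measurable_funM; last by apply: measurable_bweight; exact: cmeas_id.
    by case: (cmeasM mu (cmeasJ mv)).
  by apply/funext => p; rewrite (@cut_bweight _ alpha u v (fun a b => complex.Re (a * b^*))).
- move=> p _; rewrite -EFinD lee_fin [leRHS]ger0_norm; last first.
    by rewrite addr_ge0// nrm2_integrand_ge0.
  rewrite normrM (ger0_norm (bweight_ge0 _ a0)) -mulrDl ler_wpM2r ?bweight_ge0//.
  move: (u _) (v _) => [a b] [c d]; rewrite /sqmod/= ler_norml.
  have := sqr_ge0 (a - c); have := sqr_ge0 (a + c); have := sqr_ge0 (b - d); have := sqr_ge0 (b + d).
  have := sqr_ge0 a; have := sqr_ge0 b; have := sqr_ge0 c; have := sqr_ge0 d.
  by move=> *; apply/andP; split; nra.
- by apply: integrableD => //; exact: iN.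
Qed.

Lemma rinC u v : rin u v = rin v u.
Proof.
by apply: eq_Rintegral => p _; congr (_ * _); case: (u _) (v _) => [a b] [c d] /=; ring.
Qed.

Lemma rinDl u1 u2 v : L2 u1 -> L2 u2 -> L2 v -> rin (fun z => u1 z + u2 z) v = rin u1 v + rin u2 v.
Proof.
move=> L1 L2' Lv; rewrite /rin -RintegralD//; try exact: rin_integrable.
by apply: eq_Rintegral => p _; rewrite -mulrDl; congr (_ * _); rewrite mulrDl ReD.
Qed.

Lemma rinBl u1 u2 v : L2 u1 -> L2 u2 -> L2 v -> rin (fun z => u1 z - u2 z) v = rin u1 v - rin u2 v.
Proof.
move=> L1 L2' Lv; rewrite /rin -RintegralB//; try exact: rin_integrable.
by apply: eq_Rintegral => p _; rewrite -mulrBl; congr (_ * _); rewrite mulrBl ReB.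
Qed.

Lemma rinDr u v1 v2 : L2 u -> L2 v1 -> L2 v2 -> rin u (fun z => v1 z + v2 z) = rin u v1 + rin u v2.
Proof. by move=> *; rewrite rinC rinDl// !(rinC u). Qed.

Lemma rinBr u v1 v2 : L2 u -> L2 v1 -> L2 v2 -> rin u (fun z => v1 z - v2 z) = rin u v1 - rin u v2.
Proof. by move=> *; rewrite rinC rinBl// !(rinC u). Qed.

Lemma rinuu u : L2 u -> rin u u = nr u.
Proof.
by move=> Lu; apply: (congr1 (@fine R)); apply: eq_integral => p _; rewrite mulc_conj.
Qed.

Lemma rin_ext u u' v v' : (forall z, sqmod z < 1 -> u z = u' z) ->
  (forall z, sqmod z < 1 -> v z = v' z) -> rin u v = rin u' v'.
Proof.
move=> uu vv; apply: eq_Rintegral => p _.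
by rewrite /bweight; case: ifP => [h|]; rewrite ?mulr0// uu// vv.
Qed.

Lemma nr_ext u v : (forall z, sqmod z < 1 -> u z = v z) -> nr u = nr v.
Proof. by move=> uv; rewrite /nr (nrm2_ext _ uv). Qed.

Lemma nrD u v : L2 u -> L2 v -> nr (fun z => u z + v z) = nr u + 2 * rin u v + nr v.
Proof.
move=> Lu Lv; have Luv := L2D Lu Lv.
by rewrite -rinuu// rinDl// !rinDr// !rinuu// (rinC v u); ring.
Qed.

Lemma nrB u v : L2 u -> L2 v -> nr (fun z => u z - v z) = nr u - 2 * rin u v + nr v.
Proof.
move=> Lu Lv; have Luv := L2B Lu Lv.
by rewrite -rinuu// rinBl// !rinBr// !rinuu// (rinC v u); ring.
Qed.

(** Cauchy-Schwarz in additive form, from the nonnegativity of the norms of [u + v] and [u - v];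
    rescaling sharpens it where needed. *)
Lemma rin_le u v : L2 u -> L2 v -> `|rin u v| <= (nr u + nr v) / 2.
Proof.
move=> Lu Lv; rewrite ler_norml; apply/andP; split.
- by have := nr_ge0 (fun z => u z + v z); rewrite nrD//; lra.
- by have := nr_ge0 (fun z => u z - v z); rewrite nrB//; lra.
Qed.

Lemma rinZ (k : R) u v : L2 u -> L2 v -> rin (fun z => k%:C * u z) v = k * rin u v.
Proof.
move=> Lu Lv; rewrite /rin -RintegralZl//; last exact: rin_integrable.
apply: eq_Rintegral => p _; rewrite mulrA; congr (_ * _).
by case: (u _) (v _) => [a b] [c d] /=; ring.
Qed.

Lemma rin_mulJ (c : R[i]) u v : rin (fun z => c * u z) v = rin u (fun z => c^* * v z).
Proof.
apply: eq_Rintegral => p _; congr (_ * _).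
by case: c (u _) (v _) => [x y] [a b] [c d] /=; ring.
Qed.

Lemma inner_rin u v : bergman_inner alpha u v = rin u v +i* rin u (fun z => 'i * v z).
Proof.
rewrite /bergman_inner /disc_cint /disc_int /rin /Rintegral.
congr (_ +i* _); congr fine.
- rewrite -(disc_integral_bweight alpha (fun z => complex.Re (u z * (v z)^*))).
  apply: eq_integral => p _; congr (_%:E).
  by case: (u _) (v _) => [a b] [c d] /=; ring.
- rewrite -(disc_integral_bweight alpha (fun z => complex.Re (u z * ('i * v z)^*))).
  apply: eq_integral => p _; congr (_%:E).
  by case: (u _) (v _) => [a b] [c d] /=; ring.
Qed.

End L2Inner.

(** * Unitarity of [U] and of rotations *)

Section Unitary.
Variable R : realType.
Local Notation mR := (measurableTypeR R).
Local Notation area := (@area R).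
Variable alpha : R.
Hypothesis a0 : 0 <= alpha.
Implicit Types (u v : R[i] -> R[i]) (z w : R[i]).
Local Notation N := (nrm2 alpha).
Local Notation nr := (nr alpha).
Local Notation L2 := (L2 alpha).
Local Notation rin := (rin alpha).

Lemma measurable_cos : measurable_fun setT (@cos R : mR -> mR).
Proof. by apply: continuous_measurable_fun; exact: continuous_cos. Qed.

Lemma measurable_sin : measurable_fun setT (@sin R : mR -> mR).
Proof. by apply: continuous_measurable_fun; exact: continuous_sin. Qed.

Lemma cmeas_cis d (T : measurableType d) (f : T -> mR) : measurable_fun setT f ->
  cmeas (fun t => cis (f t)).
Proof.
move=> mf; split => /=.
- exact: (measurableT_comp measurable_cos mf).
- exact: (measurableT_comp measurable_sin mf).
Qed.

Lemma cmeas_cpowR d (T : measurableType d) (f : T -> R[i]) (s : R) : cmeas f ->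
  cmeas (fun t => cpowR (f t) s).
Proof.
move=> mf; have [m1 m2] := mf; apply: cmeasM.
  apply: cmeas_real; apply: measurableT_comp => //; apply: measurable_funM => //.
  apply: measurable_funM => //; apply: measurableT_comp => //; exact: measurable_sqmod.
apply: cmeas_cis; apply: measurable_funM => //.
apply: measurableT_comp.
  by apply: continuous_measurable_fun; exact: continuous_atan.
by apply: measurable_funM => //; apply: (measurableT_comp (@measurable_invr R)).
Qed.

Lemma cmeas_kern d (T : measurableType d) (f g : T -> R[i]) : cmeas f -> cmeas g ->
  cmeas (fun t => kern alpha (f t) (g t)).
Proof.
move=> mf mg; apply: cmeasM.
  apply: cmeas_real; apply: (measurableT_comp (measurable_powR _)).
  by apply: measurable_funB => //; exact: measurable_sqmod.
apply: cmeasV; apply: cmeas_cpowR; apply: cmeasB; first exact: cmeas_cst.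
by apply: cmeasM => //; exact: cmeasJ.
Qed.

Lemma mdisc_U z u : sqmod z < 1 -> mdisc u -> mdisc (U alpha z u).
Proof.
move=> z1 mu; apply: (@mdisc_ext _ _ (fun w => cut u (moebius z w) * kern alpha z w)).
  by move=> w w1; rewrite UE// /cut moebius_disc.
apply: mdisc_cmeas; apply: cmeasM; last by apply: cmeas_kern; [exact: cmeas_cst|exact: cmeas_id].
by apply: mdisc_comp => //; apply: cmeas_moebius; [exact: cmeas_cst|exact: cmeas_id].
Qed.

Lemma nrm2_lambda u : N u = (\int[area]_p ((lambda_weight (of_coord p))%:E *
  (sqmod (cut u (of_coord p)) * ((alpha + 1) * (1 - sqmod (of_coord p)) `^ (2 + alpha)))%:E))%E.
Proof.
apply: eq_integral => p _; rewrite -EFinM; congr (_%:E).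
case: (ltP (sqmod (of_coord p)) 1) => h; last by rewrite /bweight /lambda_weight ltNge h mulr0 mul0r.
by rewrite bweight_lambda// /cut h; ring.
Qed.

(** Against [lambda] the change of variables by [phi_z] is free, and [sqmod_kern_weight] absorbs the
    weight. *)
Lemma nrm2_U z u : sqmod z < 1 -> mdisc u -> N (U alpha z u) = N u.
Proof.
move=> z1 mu; rewrite [RHS]nrm2_lambda.
rewrite -(@lambda_moebius R (fun w => (sqmod (cut u w) * ((alpha + 1) * (1 - sqmod w) `^ (2 + alpha)))%:E) z z1).
- rewrite nrm2_lambda; apply: eq_integral => p _; rewrite -!EFinM; congr (_%:E).
  rewrite /lambda_weight; case: ltP => h; last by rewrite !mul0r.
  congr (_ * _); rewrite /cut h moebius_disc// UE// sqmodM.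
  rewrite [in RHS]mulrCA -(sqmod_kern_weight alpha z1 h); ring.
- apply/measurable_EFinP; apply: measurable_funM; first exact: measurable_sqmod.
  apply: measurable_funM => //; apply: (measurableT_comp (measurable_powR _)).
  by apply: measurable_funB => //; apply: measurable_sqmod; exact: cmeas_id.
- by move=> w; rewrite lee_fin !mulr_ge0 ?sqmod_ge0 ?powR_ge0// addr_ge0.
Qed.

Lemma L2_U z u : sqmod z < 1 -> L2 u -> L2 (U alpha z u).
Proof. by move=> z1 [mu uL]; split; [exact: mdisc_U|rewrite nrm2_U]. Qed.

Lemma nr_U z u : sqmod z < 1 -> L2 u -> nr (U alpha z u) = nr u.
Proof. by move=> z1 [mu uL]; rewrite /nr nrm2_U. Qed.

Lemma U_add z u v w : U alpha z (fun x => u x + v x) w = U alpha z u w + U alpha z v w.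
Proof. by rewrite /U mulrDl. Qed.

Lemma U_scale z (c : R[i]) v w : U alpha z (fun x => c * v x) w = c * U alpha z v w.
Proof. by rewrite /U; exact: esym (mulrA _ _ _). Qed.

Lemma sqmodN_lt1 z : sqmod z < 1 -> sqmod (- z) < 1.
Proof. by rewrite sqmodN. Qed.

Lemma U_inv z u w : sqmod z < 1 -> sqmod w < 1 -> U alpha (- z) (U alpha z u) w = u w.
Proof.
move=> z1 w1; have z1' := sqmodN_lt1 z1; have m1 := moebius_disc z1' w1.
have mK := moebiusK z1' w1; have kK := kern_moebius alpha z1' w1; rewrite opprK in mK kK.
by rewrite UE// UE// -mulrA mK kK mulr1.
Qed.

Lemma U_inv' z u w : sqmod z < 1 -> sqmod w < 1 -> U alpha z (U alpha (- z) u) w = u w.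
Proof. by move=> z1 w1; have := U_inv u (sqmodN_lt1 z1) w1; rewrite opprK. Qed.

Lemma rin_isometry (T : (R[i] -> R[i]) -> R[i] -> R[i]) u v :
  (forall x y z, T (fun w => x w + y w) z = T x z + T y z) ->
  (forall x, L2 x -> L2 (T x)) -> (forall x, L2 x -> nr (T x) = nr x) ->
  L2 u -> L2 v -> rin (T u) (T v) = rin u v.
Proof.
move=> TD TL TN Lu Lv; have := nrD a0 Lu Lv; rewrite -TN; last exact: L2D.
rewrite (nr_ext alpha (v := fun z => T u z + T v z)); last by move=> z _; exact: TD.
rewrite nrD//; [rewrite !TN//|exact: TL|exact: TL]; lra.
Qed.

Lemma rin_UU z u v : sqmod z < 1 -> L2 u -> L2 v -> rin (U alpha z u) (U alpha z v) = rin u v.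
Proof.
move=> z1; apply: (@rin_isometry (U alpha z)) => [x y w|x|x]; first exact: U_add.
  exact: L2_U.
exact: nr_U.
Qed.

(** An isometry with inverse [U_(-z)] has that inverse as its adjoint. *)
Lemma rin_adjoint z u v : sqmod z < 1 -> L2 u -> L2 v ->
  rin (U alpha (- z) u) v = rin u (U alpha z v).
Proof.
move=> z1 Lu Lv; rewrite -(rin_UU z1) //; last by apply: L2_U => //; exact: sqmodN_lt1.
by apply: rin_ext => // w w1; exact: U_inv'.
Qed.

Lemma cis_neq0 (t : R) : cis t != 0 :> R[i].
Proof. by rewrite -sqmod_eq0 sqmod_cis oner_eq0. Qed.

Lemma bweight_cis t z : bweight alpha (cis t * z) = bweight alpha z.
Proof. by rewrite /bweight /bergman_density sqmodM sqmod_cis mul1r. Qed.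

Lemma area_rotate (G : R[i] -> \bar R) (t : R) : measurable_fun setT (G \o @of_coord R) ->
  (forall z, (0 <= G z)%E) ->
  (\int[area]_p G (cis t * of_coord p)%R = \int[area]_p G (of_coord p))%E.
Proof.
move=> mG G0; rewrite -(@area_affineC R G (cis t) 0 (cis_neq0 t))//.
by apply: eq_integral => p _; rewrite sqmod_cis mul1e addr0.
Qed.

Lemma nrm2_rotate t u : mdisc u -> N (rotate t u) = N u.
Proof.
move=> mu; rewrite /nrm2 -[RHS](@area_rotate (fun z => (sqmod (u z) * bweight alpha z)%:E) t).
- by apply: eq_integral => p _; rewrite bweight_cis.
- by apply/measurable_EFinP; apply: measurable_nrm2_integrand => //; exact: cmeas_id.
- by move=> z; rewrite lee_fin nrm2_integrand_ge0.
Qed.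

Lemma nr_rotate t u : mdisc u -> nr (rotate t u) = nr u.
Proof. by move=> mu; congr fine; exact: nrm2_rotate. Qed.

Lemma mdisc_rotate t u : mdisc u -> mdisc (rotate t u).
Proof.
move=> mu; apply: (@mdisc_ext _ _ (fun w => cut u (cis t * w))).
  by move=> w w1; rewrite /cut sqmodM sqmod_cis mul1r w1.
by apply: mdisc_cmeas; apply: mdisc_comp => //; apply: cmeasM; [exact: cmeas_cst|exact: cmeas_id].
Qed.

Lemma L2_rotate t u : L2 u -> L2 (rotate t u).
Proof. by move=> [mu uL]; split; [exact: mdisc_rotate|rewrite nrm2_rotate]. Qed.

(** Each rotation preserves area, so the integral equals its average over rotations, and Tonelli
    moves the average inside. *)
Lemma area_circle_mean (G : R[i] -> \bar R) : measurable_fun setT (G \o @of_coord R) ->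
  (forall z, (0 <= G z)%E) ->
  (\int[area]_p G (of_coord p) = \int[area]_p ((2 * pi)^-1%:E *
     \int[@lebesgue_measure R]_(t in `[0%R, (2 * pi)%R]) G (cis t * of_coord p)%R))%E.
Proof.
move=> mG G0.
have mF : measurable_fun setT (fun q : mR * (mR * mR) => G (cis q.1 * of_coord q.2)%R).
  apply: (@measurable_comp_cmeas R _ _ _ _ G) => //; apply: cmeasM.
    by apply: cmeas_cis; exact: measurable_fst.
  by apply: cmeas_of_coord; exact: measurable_snd.
have pp : (0 < 2 * pi :> R)%R by rewrite mulr_gt0// pi_gt0.
pose h (q : mR * (mR * mR)) : \bar R := (G (cis q.1 * of_coord q.2)%R * (\1_(`[0%R, (2 * pi)%R]%classic) q.1)%:E)%E.
have mh : measurable_fun setT h.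
  apply: emeasurable_funM => //; apply/measurable_EFinP.
  by apply: (measurableT_comp (measurable_indic _)).
have h0 q : (0 <= h q)%E by rewrite mule_ge0// lee_fin.
have hx p : (\int[@lebesgue_measure R]_t h (t, p) =
    \int[@lebesgue_measure R]_(t in `[0%R, (2 * pi)%R]) G (cis t * of_coord p)%R)%E.
  rewrite [RHS]integral_mkcond; apply: eq_integral => t _.
  by rewrite /h patchE indicE; case: ifP => _; rewrite ?mule1 ?mule0.
transitivity (\int[area]_p ((2 * pi)^-1%:E * \int[@lebesgue_measure R]_t h (t, p)))%E; last first.
  by apply: eq_integral => p _; rewrite hx.
rewrite ge0_integralZl//; first last.
- by rewrite lee_fin invr_ge0 ltW.
- by move=> p _; apply: integral_ge0.
- exact: (@measurable_fun_fubini_tonelli_G _ _ _ _ _ (@lebesgue_measure R) _ mh h0).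
rewrite -(tonelli_area _ mh h0).
have -> : (\int[@lebesgue_measure R]_t \int[area]_p h (t, p) =
   \int[@lebesgue_measure R]_(t in `[0%R, (2 * pi)%R]) cst (\int[area]_p G (of_coord p)) t)%E.
  rewrite [RHS]integral_mkcond; apply: eq_integral => t _.
  rewrite patchE; case: ifPn => ht.
    rewrite -(area_rotate t mG G0); apply: eq_integral => p _.
    by rewrite /h indicE ht mule1.
  by apply: integral0_eq => p _; rewrite /h indicE (negbTE ht) mule0.
rewrite integral_cst//= lebesgue_measure_itv/= lte_fin pp sube0 muleCA -EFinM.
by rewrite mulVf ?mule1// gt_eqF.
Qed.

End Unitary.

(** * Power series *)

Section ComplexSeries.
Variable R : realType.
Implicit Types (b c : nat -> R[i]) (l m : R[i]) (q x : R).

(* Convergence of a complex series in epsilon form: unification in the topology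
   of [R[i]^o] is prohibitively slow. *)
Definition csums b l : Prop := forall e : R, 0 < e ->
  exists N : nat, forall n, (N <= n)%N -> cabs (\sum_(k < n) b k - l) < e.

Lemma csumsP b l : csums b l <-> (series b : nat -> R[i]^o) @ \oo --> (l : R[i]^o).
Proof.
split=> [H|/cvgCP H e e0]; last first.
  have [N _ HN] := H e e0; exists N => n Nn.
  by have := HN n Nn; rewrite /series/= big_mkord.
apply/cvgCP => e e0; have [N HN] := H e e0; exists N => // n /= Nn.
by rewrite /series/= big_mkord; exact: HN.
Qed.

Lemma csumsD b c l m : csums b l -> csums c m -> csums (fun n => b n + c n) (l + m).
Proof.
move=> bl cm e e0; have e2 : 0 < e / 2 by rewrite divr_gt0.
have [N HN] := bl _ e2; have [M HM] := cm _ e2; exists (maxn N M) => n.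
rewrite geq_max => /andP[Nn Mn]; rewrite big_split/= opprD addrACA.
by apply: le_lt_trans (cabsD _ _) _; rewrite (splitr e) ltrD// ?HN ?HM.
Qed.

Lemma csumsZ b l k : csums b l -> csums (fun n => k * b n) (k * l).
Proof.
move=> bl e e0; have k1 : 0 < cabs k + 1 by rewrite ltr_wpDl// cabs_ge0.
have [N HN] := bl _ (divr_gt0 e0 k1); exists N => n Nn.
rewrite -mulr_sumr -mulrBr cabsM.
apply: le_lt_trans (_ : _ <= (cabs k + 1) * cabs (\sum_(k < n) b k - l)) _.
  by rewrite ler_wpM2r ?cabs_ge0// lerDl.
by rewrite mulrC -ltr_pdivlMr// HN.
Qed.

Lemma csums_ext b c l : (forall n, b n = c n) -> csums c l -> csums b l.
Proof. by move=> /funext ->. Qed.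

Lemma csumsB b c l m : csums b l -> csums c m -> csums (fun n => b n - c n) (l - m).
Proof.
move=> bl cm; rewrite -[- m]mulN1r.
apply: (@csums_ext _ (fun n => b n + -1 * c n)); first by move=> n; rewrite mulN1r.
by apply: csumsD => //; exact: csumsZ.
Qed.

Lemma csums_unique b l m : csums b l -> csums b m -> l = m.
Proof.
move=> bl bm; apply/eqP; rewrite -subr_eq0 -cabs_eq0; apply/eqP/le_anti; rewrite cabs_ge0 andbT.
apply/ler_addgt0Pr => e e0; have e2 : 0 < e / 2 by rewrite divr_gt0.
have [N HN] := bl _ e2; have [M HM] := bm _ e2.
pose n := maxn N M; have := HN n (leq_maxl _ _); have := HM n (leq_maxr _ _).
move: (\sum_(k < n) b k) => s h1 h2; rewrite add0r.
apply: le_trans (cabs_triangle s _ _) _; rewrite (cabsB l) (splitr e).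
by apply: lerD; exact: ltW.
Qed.

Lemma csums_ReIm b l : csums b l <->
  (series (fun n => complex.Re (b n)) @ \oo --> complex.Re l) /\
  (series (fun n => complex.Im (b n)) @ \oo --> complex.Im l).
Proof.
have eR : series (fun n => complex.Re (b n)) = (fun n => complex.Re (series b n)).
  by apply/funext => n; rewrite /series/= (raddf_sum (@complex.Re R)).
have eI : series (fun n => complex.Im (b n)) = (fun n => complex.Im (series b n)).
  by apply/funext => n; rewrite /series/= (raddf_sum (@complex.Im R)).
rewrite eR eI; split=> [/csumsP|h]; first by move/cvgC_ReIm.
by apply/csumsP/cvgC_ReIm.
Qed.

Lemma series_bounded_cvg (u : nat -> R) (C : R) : (forall n, 0 <= u n) ->
  (forall N, \sum_(n < N) u n <= C) -> cvgn (series u).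
Proof.
move=> u0 uC; apply: nondecreasing_is_cvgn.
  by apply/nondecreasing_seqP => n; rewrite /series/= big_nat_recr//= lerDl.
by exists C => _ [n _ <-]; rewrite /series/= big_mkord.
Qed.

Lemma csums_exists b (C : R) : (forall N, \sum_(n < N) cabs (b n) <= C) -> exists l, csums b l.
Proof.
move=> bC.
have H (F : R[i] -> R) : (forall z, `|F z| <= cabs z) -> cvgn (series (fun n => F (b n))).
  move=> FL; apply: (@normed_cvg R R^o); apply: (@series_bounded_cvg _ C); first by move=> n; exact: normr_ge0.
  by move=> N; apply: (le_trans _ (bC N)); apply: ler_sum => n _; exact: FL.
have /cvg_ex[x hx] := H _ (@Re_le_cabs R); have /cvg_ex[y hy] := H _ (@Im_le_cabs R).
by exists (x +i* y); apply/csums_ReIm.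
Qed.

Lemma csums_le b l (C : R) : csums b l -> (forall N, \sum_(n < N) cabs (b n) <= C) -> cabs l <= C.
Proof.
move=> bl bC; apply/ler_addgt0Pr => e e0; have [N HN] := bl e e0.
rewrite -[l](subKr (\sum_(k < N) b k)); apply: le_trans (cabsD _ _) _.
rewrite cabsN; apply: lerD; last exact: ltW (HN N _).
exact: le_trans (cabs_sum _ _) (bC N).
Qed.

Lemma csums_bounded b l : csums b l -> exists2 C, 0 <= C & forall n, cabs (b n) <= C.
Proof.
move=> bl; have [N HN] := bl 1 ltr01.
exists (\sum_(k < N) cabs (b k) + 2).
  by rewrite addr_ge0// sumr_ge0// => k _; exact: cabs_ge0.
move=> n; have [nN|Nn] := ltnP n N.
  rewrite (bigD1 (Ordinal nN))//= -addrA lerDl addr_ge0// sumr_ge0// => k _; exact: cabs_ge0.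
have := HN n Nn; have := HN n.+1 (leqW Nn); rewrite big_ord_recr/=.
move: (\sum_(k < n) b k) => s h1 h2.
rewrite -[X in X <= _]add0r lerD ?sumr_ge0// => [k _|]; first exact: cabs_ge0.
have -> : b n = (s + b n - l) - (s - l) by ring.
apply: le_trans (cabsD _ _) _; rewrite cabsN (_ : 2 = 1 + 1); last by ring.
by apply: lerD; exact: ltW.
Qed.

Lemma sum_geom_le q N : 0 <= q < 1 -> \sum_(n < N) q ^+ n <= (1 - q)^-1.
Proof.
move=> /andP[q0 q1]; have q10 : 0 < 1 - q by rewrite subr_gt0.
rewrite -[(1 - q)^-1]mul1r ler_pdivlMr// mulrC.
have := subrX1 q N; have := exprn_ge0 N q0; move: (q ^+ N) (\sum_(i < N) _) => Q S; nra.
Qed.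

Lemma natmul_expr_le q n : 0 <= q < 1 -> n%:R * q ^+ n <= (1 - q)^-1.
Proof.
move=> q01; apply: le_trans (sum_geom_le n q01); have /andP[q0 q1] := q01.
have -> : n%:R * q ^+ n = \sum_(i < n) q ^+ n by rewrite sumr_const card_ord mulr_natl.
by apply: ler_sum => i _; rewrite ler_wiXn2l ?(ltW q1)// ltnW.
Qed.

(** Radius of convergence at least [1], phrased as a growth bound on the coefficients. *)
Definition rad1 b : Prop := forall q, 0 < q < 1 -> exists2 C, 0 <= C & forall n, cabs (b n) * q ^+ n <= C.

Lemma rad1_sum b q : rad1 b -> 0 <= q < 1 -> exists C,
  forall N, \sum_(n < N) ((n%:R ^+ 2 + 1) * cabs (b n) * q ^+ n) <= C.
Proof.
(* Bernoulli's inequality gives [q <= y ^ 4]. Of the four factors [y ^ n], one pays for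
   [cabs (b n)], two for [n ^ 2], and the last sums as a geometric series. *)
move=> rb /andP[q0 q1]; pose d := (1 - q) / 4; pose y := 1 - d.
have d0 : 0 < d by rewrite divr_gt0// subr_gt0.
have d1 : d <= 1 / 4 by rewrite /d; lra.
have y01 : 0 < y < 1 by rewrite /y; lra.
have /andP[y0 y1] := y01.
have qy : q <= y ^+ 4.
  have e : q = 1 - 4 * d by rewrite /d; field.
  by rewrite e /y; nra.
have [C C0 HC] := rb y y01; have yp : 0 < 1 - y by rewrite subr_gt0.
have y01' : 0 <= y < 1 by rewrite ltW.
pose K := (1 - y)^-1 ^+ 2 + 1.
exists (C * K * (1 - y)^-1) => N.
apply: (@le_trans _ _ (\sum_(n < N) (C * K * y ^+ n))); last first.
  by rewrite -mulr_sumr ler_wpM2l ?sum_geom_le// mulr_ge0// addr_ge0// sqr_ge0.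
apply: ler_sum => n _.
have yn0 : 0 <= y ^+ n by rewrite exprn_ge0// ltW.
have yn1 : y ^+ n <= 1 by rewrite exprn_ile1// ltW.
have qn : q ^+ n <= (y ^+ n) ^+ 4 by rewrite -exprM mulnC exprM lerXn2r// ?nnegrE ?exprn_ge0// ltW.
have ny := natmul_expr_le n y01'.
apply: (@le_trans _ _ ((n%:R ^+ 2 + 1) * cabs (b n) * (y ^+ n) ^+ 4)).
  by rewrite ler_wpM2l// mulr_ge0 ?cabs_ge0// addr_ge0// sqr_ge0.
have -> : (n%:R ^+ 2 + 1) * cabs (b n) * (y ^+ n) ^+ 4 =
   (cabs (b n) * y ^+ n) * ((n%:R * y ^+ n) ^+ 2 + (y ^+ n) ^+ 2) * y ^+ n by ring.
rewrite ler_wpM2r// ler_pM ?mulr_ge0 ?cabs_ge0 ?addr_ge0 ?sqr_ge0//.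
rewrite /K lerD//; last by rewrite expr_le1.
by rewrite lerXn2r ?nnegrE ?mulr_ge0 ?invr_ge0 ?(ltW yp).
Qed.

Lemma rad1_abs b z : rad1 b -> sqmod z < 1 -> exists C,
  forall N, \sum_(n < N) cabs (b n * z ^+ n) <= C.
Proof.
move=> rb; rewrite sqmod_lt1 => z1.
have [C HC] := @rad1_sum b (cabs z) rb ltac:(by rewrite cabs_ge0).
exists C => N; apply: le_trans (HC N); apply: ler_sum => n _; rewrite cabsM cabsX.
by rewrite ler_wpM2r ?exprn_ge0 ?cabs_ge0// ler_peMl ?cabs_ge0// lerDr sqr_ge0.
Qed.

Lemma rad1_csums b z : rad1 b -> sqmod z < 1 -> exists l, csums (fun n => b n * z ^+ n) l.
Proof. by move=> rb z1; have [C HC] := rad1_abs rb z1; exact: csums_exists HC. Qed.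

Lemma sums_rad1 b (u : R[i] -> R[i]) : (forall z, sqmod z < 1 -> csums (fun n => b n * z ^+ n) (u z)) -> rad1 b.
Proof.
move=> bu q /andP[q0 q1]; have q1' : sqmod (q%:C) < 1 by rewrite sqmodR expr_lt1// ltW.
have [C C0 HC] := csums_bounded (bu _ q1'); exists C => // n.
by have := HC n; rewrite cabsM cabsX cabsR ger0_norm// ltW.
Qed.

(** Induction: multiplying the remainder by [z + h] and adding [n z^(n-1) h^2] gives the next one.
    The bound is homogeneous in [r], so it sums against coefficients satisfying [rad1]. *)
Lemma expr_taylor_bound z h (r : R) n : 0 < r -> cabs z <= r -> cabs (z + h) <= r ->
  cabs ((z + h) ^+ n - z ^+ n - n%:R * z ^+ n.-1 * h) <= n%:R ^+ 2 * r ^+ n * (cabs h / r) ^+ 2.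
Proof.
move=> r0 zr whr; elim: n => [|n ih].
  by rewrite !expr0 subrr !mul0r subr0 cabs0 expr0n/= !mul0r.
have -> : (z + h) ^+ n.+1 - z ^+ n.+1 - n.+1%:R * z ^+ n.+1.-1 * h =
  (z + h) * ((z + h) ^+ n - z ^+ n - n%:R * z ^+ n.-1 * h) + n%:R * z ^+ n.-1 * h ^+ 2.
  case: n {ih} => [|n] /=; first by rewrite !expr0 !expr1; ring.
  by rewrite !exprS -[n.+2%:R]natr1; ring.
apply: le_trans (cabsD _ _) _.
rewrite [cabs ((z + h) * _)]cabsM.
have k0 : 0 <= (cabs h / r) ^+ 2 by exact: sqr_ge0.
have s2 : cabs (n%:R * z ^+ n.-1 * h ^+ 2) <= n%:R * r ^+ n.+1 * (cabs h / r) ^+ 2.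
  rewrite !cabsM !cabsX.
  have -> : cabs (n%:R : R[i]) = n%:R by rewrite -(rmorph_nat (@real_complex R)) cabsR ger0_norm.
  case: n {ih} => [|n] /=; first by rewrite !mul0r.
  have -> : n.+1%:R * r ^+ n.+2 * (cabs h / r) ^+ 2 = n.+1%:R * r ^+ n * cabs h ^+ 2.
    by rewrite !exprS; field; rewrite gt_eqF.
  by rewrite ler_wpM2r ?sqr_ge0// ler_wpM2l// lerXn2r// ?nnegrE ?cabs_ge0// ltW.
have s1 : cabs (z + h) * cabs ((z + h) ^+ n - z ^+ n - n%:R * z ^+ n.-1 * h) <=
   r * (n%:R ^+ 2 * r ^+ n * (cabs h / r) ^+ 2).
  by apply: ler_pM => //; exact: cabs_ge0.
apply: le_trans (lerD s1 s2) _.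
have rn0 : 0 <= r ^+ n.+1 * (cabs h / r) ^+ 2 by rewrite mulr_ge0// exprn_ge0// ltW.
have -> : r * (n%:R ^+ 2 * r ^+ n * (cabs h / r) ^+ 2) + n%:R * r ^+ n.+1 * (cabs h / r) ^+ 2 =
   (n%:R ^+ 2 + n%:R) * (r ^+ n.+1 * (cabs h / r) ^+ 2) by rewrite [r ^+ n.+1]exprS; ring.
rewrite -mulrA ler_wpM2r// -natr1; have : 0 <= n%:R :> R by []; nra.
Qed.

(** Termwise differentiation: on the disc whose radius is halfway between [|z|] and [1], the
    remainders of [expr_taylor_bound] add up to at most a constant times [|h|^2]. *)
Lemma pseries_analytic b (u : R[i] -> R[i]) : rad1 b ->
  (forall z, sqmod z < 1 -> csums (fun n => b n * z ^+ n) (u z)) -> analytic_on_disc u.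
Proof.
move=> rb bu; apply/analyticP => z z1.
have cz1 : cabs z < 1 by rewrite -sqmod_lt1.
have cz0 := cabs_ge0 z.
pose r := (1 + cabs z) / 2.
have r0 : 0 < r by rewrite /r; lra.
have r1 : 0 <= r < 1 by rewrite /r; lra.
have zr : cabs z <= r by rewrite /r; lra.
have [C HC] := rad1_sum rb r1.
have C0 : 0 <= C by have := HC 0%N; rewrite big_ord0.
have [l hl] : exists l, csums (fun n => b n * (n%:R * z ^+ n.-1)) l.
  apply: (@csums_exists _ (C / r)) => N; rewrite ler_pdivlMr// mulr_suml.
  apply: le_trans (HC N); apply: ler_sum => n _.
  rewrite !cabsM cabsX.
  have -> : cabs ((n%:R : R[i])) = n%:R by rewrite -(rmorph_nat (@real_complex R)) cabsR ger0_norm.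
  case: (n : nat) => [|m]; first by rewrite !mul0r mulr0 mul0r mulr_ge0// ?mulr_ge0 ?addr_ge0 ?cabs_ge0 ?sqr_ge0.
  rewrite /= [r ^+ m.+1]exprSr [leRHS]mulrA ler_wpM2r ?(ltW r0)// mulrA [cabs _ * _]mulrC.
  apply: ler_pM; rewrite ?mulr_ge0 ?cabs_ge0 ?exprn_ge0 ?cabs_ge0//.
    rewrite ler_wpM2r ?cabs_ge0//; have : 0 <= m.+1%:R :> R by []; nra.
  by rewrite lerXn2r// ?nnegrE ?cabs_ge0// ltW.
apply/dvb_cderiv; exists l => e e0.
pose d := Num.min (r - cabs z) (e * r ^+ 2 / (C + 1)).
have C1 : 0 < C + 1 by rewrite ltr_wpDl.
exists d.
  rewrite lt_min; apply/andP; split; first by rewrite /r; lra.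
  apply: divr_gt0 => //; apply: mulr_gt0 => //; exact: exprn_gt0.
move=> h; rewrite lt_min => /andP[h1 h2].
have whr : cabs (z + h) <= r by apply: le_trans (cabsD _ _) _; lra.
have w1 : sqmod (z + h) < 1 by rewrite sqmod_lt1; lra.
have S := csumsB (csumsB (bu _ w1) (bu _ z1)) (csumsZ h hl).
rewrite [h * l]mulrC in S.
have : cabs (u (z + h) - u z - l * h) <= C * (cabs h / r) ^+ 2.
  apply: (csums_le S) => N; apply: (@le_trans _ _ (\sum_(n < N) ((n%:R ^+ 2 + 1) * cabs (b n) * r ^+ n) * (cabs h / r) ^+ 2)).
    apply: ler_sum => n _.
    have -> : b n * (z + h) ^+ n - b n * z ^+ n - h * (b n * (n%:R * z ^+ n.-1)) =
      b n * ((z + h) ^+ n - z ^+ n - n%:R * z ^+ n.-1 * h) by ring.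
    rewrite cabsM; apply: (@le_trans _ _ (cabs (b n) * (n%:R ^+ 2 * r ^+ n * (cabs h / r) ^+ 2))).
      by rewrite ler_wpM2l ?cabs_ge0// expr_taylor_bound.
    have -> : cabs (b n) * (n%:R ^+ 2 * r ^+ n * (cabs h / r) ^+ 2) =
      (n%:R ^+ 2 * cabs (b n) * r ^+ n) * (cabs h / r) ^+ 2 by ring.
    rewrite ler_wpM2r ?sqr_ge0// ler_wpM2r ?exprn_ge0 ?(ltW r0)// ler_wpM2r ?cabs_ge0//.
    by rewrite lerDl.
  by rewrite -mulr_suml ler_wpM2r// sqr_ge0.
move=> H; apply: le_trans H _.
have -> : C * (cabs h / r) ^+ 2 = (C * cabs h / r ^+ 2) * cabs h by field; rewrite gt_eqF.
rewrite ler_wpM2r ?cabs_ge0// ler_pdivrMr ?exprn_gt0//.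
move: h2; rewrite ltr_pdivlMr// => h2; have := cabs_ge0 h; nra.
Qed.

(** Strong induction on [n]. Once the earlier coefficients vanish, dividing by [x ^ n] bounds [d n]
    by a constant times [x], the tail being geometric in [x / x0]; then [x] tends to [0]. *)
Lemma pseries_real_eq0 (d : nat -> R) (r : R) : 0 < r ->
  (forall x, 0 < x < r -> series (fun n => d n * x ^+ n) @ \oo --> 0) -> forall n, d n = 0.
Proof.
move=> r0 H; elim/ltn_ind => n ih.
pose x0 := r / 2; have x00 : 0 < x0 by rewrite divr_gt0.
have x0r : 0 < x0 < r by rewrite x00 /x0; lra.
have [M [_ HM]] : bounded_fun (fun n => d n * x0 ^+ n).
  by apply: cvg_series_bounded; apply/cvg_ex; exists 0; exact: H.
pose C := `|M| + 1; have C0 : 0 < C by rewrite ltr_wpDl.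
have HC k : `|d k| * x0 ^+ k <= C.
  have := HM C _ k I; rewrite /= normrM (ger0_norm (exprn_ge0 _ (ltW x00))); apply.
  by rewrite /C; have := ler_norm M; lra.
have key x : 0 < x -> x <= x0 / 2 -> `|d n| <= (2 * C / x0 ^+ n.+1) * x.
  move=> xp xx; have xr : 0 < x < r by rewrite xp /=; rewrite /x0 in xx; lra.
  have xn0 : 0 < x ^+ n by rewrite exprn_gt0.
  rewrite -(ler_pM2r xn0); apply/ler_addgt0Pr => e e0.
  have /cvgrPdist_lt/(_ e e0)[N _ HN] := H x xr.
  have := HN (maxn N n.+1) (leq_maxl _ _); rewrite sub0r normrN /series/= big_mkord.
  set m := maxn N n.+1; have nm : (n < m)%N by exact: leq_maxr.
  rewrite (bigD1 (Ordinal nm))//= => hs.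
  have rest : `|\sum_(i < m | i != Ordinal nm) d i * x ^+ i| <= 2 * C / x0 ^+ n.+1 * x * x ^+ n.
    apply: le_trans (ler_norm_sum _ _ _) _.
    pose q := x / x0; have q0 : 0 <= q by rewrite divr_ge0// ltW.
    have q2 : q <= 1 / 2 by rewrite ler_pdivrMr//; lra.
    apply: (@le_trans _ _ (\sum_(i < m) (C * q ^+ n.+1) * q ^+ i)); last first.
      rewrite -mulr_sumr; apply: (@le_trans _ _ (C * q ^+ n.+1 * 2)).
        rewrite ler_wpM2l ?mulr_ge0 ?exprn_ge0 ?(ltW C0)//.
        apply: le_trans (sum_geom_le m _) _; first by rewrite q0; lra.
        by rewrite -[leRHS]invrK lef_pV2 ?posrE ?invr_gt0//; lra.
      by rewrite /q expr_div_n [x ^+ n.+1]exprS le_eqVlt; apply/orP; left; apply/eqP; ring.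
    have shift : \sum_(i < m | i != Ordinal nm) `|d i * x ^+ i| <= \sum_(i < m | (n < i)%N) C * q ^+ i.
      rewrite big_mkcond [leRHS]big_mkcond; apply: ler_sum => i _.
      have [ni|] := ltnP n i.
        rewrite -val_eqE /= (gtn_eqF ni) normrM (ger0_norm (exprn_ge0 _ (ltW xp))).
        by rewrite /q expr_div_n mulrA ler_pdivlMr ?exprn_gt0// mulrAC ler_wpM2r ?exprn_ge0 ?(ltW xp) ?HC.
      rewrite leq_eqVlt => /predU1P[e'|lin]; last by rewrite ih// mul0r normr0; case: ifP.
      by rewrite ifF//; apply/negbTE; rewrite negbK; apply/eqP/val_inj.
    apply: le_trans shift _.
    rewrite -(big_mkord (fun i => (n < i)%N) (fun i => C * q ^+ i)).
    rewrite (big_cat_nat (n := n.+1))//= big_nat_cond big_pred0 ?add0r; last first.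
      by move=> i; rewrite ltnS; case: (leqP i n) => //; rewrite ?andbF ?andbT//=.
    rewrite -(add0n n.+1) big_addn big_nat_cond.
    rewrite (eq_bigr (fun i => C * q ^+ n.+1 * q ^+ i)); last first.
      by move=> i _; rewrite exprD; ring.
    rewrite -(big_mkord xpredT (fun i => C * q ^+ n.+1 * q ^+ i)).
    rewrite (big_cat_nat (n := m - n.+1) (leq0n _) (leq_subr _ _))/= big_mkcond/=.
    have t0 i : 0 <= C * q ^+ n.+1 * q ^+ i by rewrite !mulr_ge0 ?exprn_ge0// ltW.
    rewrite -[X in X <= _]addr0 lerD ?sumr_ge0//.
    by apply: ler_sum => i _; case: ifP.
  have : `|d n * x ^+ n| <= `|d n * x ^+ n + \sum_(i < m | i != Ordinal nm) d i * x ^+ i| +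
      `|\sum_(i < m | i != Ordinal nm) d i * x ^+ i|.
    by rewrite -[X in `|X| <= _](addrK (\sum_(i < m | i != Ordinal nm) d i * x ^+ i)) ler_normB.
  by rewrite normrM (gtr0_norm xn0); lra.
apply/eqP; rewrite -normr_eq0; apply/eqP/le_anti; rewrite normr_ge0 andbT.
apply/ler_addgt0Pr => e e0; rewrite add0r.
pose K := 2 * C / x0 ^+ n.+1; have K0 : 0 < K by rewrite divr_gt0 ?exprn_gt0// mulr_gt0.
pose x := Num.min (x0 / 2) (e / K).
apply: le_trans (key x _ _) _.
- by rewrite /x lt_min; apply/andP; split; exact: divr_gt0.
- by rewrite /x ge_min lexx.
- by rewrite -/K mulrC -ler_pdivlMr// ge_min lexx orbT.
Qed.

Lemma pseries_eq b c (r : R) : 0 < r ->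
  (forall x : R, 0 < x < r -> exists l, csums (fun n => b n * x%:C ^+ n) l /\ csums (fun n => c n * x%:C ^+ n) l) ->
  b = c.
Proof.
move=> r0 H.
have D (x : R) : 0 < x < r -> csums (fun n => (b n - c n) * x%:C ^+ n) 0.
  move=> /H[l [h1 h2]]; rewrite -(subrr l); apply: csums_ext (csumsB h1 h2) => n.
  by rewrite mulrBl.
have xR (x : R) n : x%:C ^+ n = (x ^+ n)%:C by rewrite rmorphXn.
apply/funext => n; apply/eqP; rewrite -subr_eq0 eq_complex /=.
rewrite (@pseries_real_eq0 (fun n => complex.Re (b n - c n)) r r0) ?(@pseries_real_eq0 (fun n => complex.Im (b n - c n)) r r0) ?eqxx// => x xr; have /csums_ReIm[h1 h2] := D x xr.
- apply: cvg_trans h2; apply: near_eq_cvg; near=> k; apply: eq_bigr => j _.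
  by rewrite xR; case: (b j - c j) => p q /=; ring.
- apply: cvg_trans h1; apply: near_eq_cvg; near=> k; apply: eq_bigr => j _.
  by rewrite xR; case: (b j - c j) => p q /=; ring.
Unshelve. all: by end_near.
Qed.

End ComplexSeries.

(** * Means over circles about the origin *)

Section CircleMean.
Variable R : realType.
Local Notation mR := (measurableTypeR R).
Local Notation leb := (@lebesgue_measure R).
Implicit Types (u v : R[i] -> R[i]) (z w c : R[i]).

Lemma two_pi_gt0 : 0 < 2 * pi :> R.
Proof. by rewrite mulr_gt0// pi_gt0. Qed.

Lemma measurable_circle_mean (G : R[i] -> \bar R) : measurable_fun setT (G \o @of_coord R) ->
  (forall z, (0 <= G z)%E) -> measurable_fun setT (fun p : mR * mR =>
    (2 * pi)^-1%:E * \int[leb]_(t in `[0%R, (2 * pi)%R]) G (cis t * of_coord p)%R)%E.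
Proof.
move=> mG G0; apply: emeasurable_funM => //.
pose h (q : mR * (mR * mR)) : \bar R := (G (cis q.1 * of_coord q.2)%R * (\1_(`[0%R, (2 * pi)%R]%classic) q.1)%:E)%E.
have mh : measurable_fun setT h.
  apply: emeasurable_funM.
    apply: (@measurable_comp_cmeas R _ _ _ _ G) => //; apply: cmeasM.
      by apply: cmeas_cis; exact: measurable_fst.
    by apply: cmeas_of_coord; exact: measurable_snd.
  by apply/measurable_EFinP; apply: (measurableT_comp (measurable_indic _)).
have h0 q : (0 <= h q)%E by rewrite mule_ge0// lee_fin.
rewrite (_ : (fun p => _) = (fun p => \int[leb]_t h (t, p))%E).
  exact: (@measurable_fun_fubini_tonelli_G _ _ _ _ _ leb _ mh h0).
apply/funext => p; rewrite integral_mkcond; apply: eq_integral => t _.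
by rewrite /h patchE indicE; case: ifP => _; rewrite ?mule1 ?mule0.
Qed.

Lemma integral_cint (F : R -> R) : continuous F -> (forall t, 0 <= F t) ->
  (\int[leb]_(t in `[0%R, (2 * pi)%R]) (F t)%:E = (cint F 0 (2 * pi))%:E)%E.
Proof.
by move=> cF F0; rewrite /cint /Rintegral fineK// integrable_fin_num//; exact: cint_integrable.
Qed.

Lemma cintD (f g : R -> R) a b : continuous f -> continuous g ->
  cint (fun x => f x + g x) a b = cint f a b + cint g a b.
Proof. by move=> cf cg; rewrite /cint RintegralD//; exact: cint_integrable. Qed.

Lemma cintZ (k : R) (f : R -> R) a b : continuous f -> cint (fun x => k * f x) a b = k * cint f a b.
Proof. by move=> cf; rewrite /cint RintegralZl//; exact: cint_integrable. Qed.

Lemma ccont_circle u z t : ccont u (cis t * z) ->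
  {for t, continuous (fun t => complex.Re (u (cis t * z)))} /\
  {for t, continuous (fun t => complex.Im (u (cis t * z)))}.
Proof.
move=> uc; apply: (@cont_Re_Im_comp R u (fun t => cis t * z) (2 * cabs z + 1) t uc) => s.
rewrite -mulrBl cabsM; apply: le_trans (_ : _ <= (2 * `|s - t|) * cabs z) _.
  by rewrite ler_wpM2r ?cabs_ge0// cis_lipschitz.
by rewrite [leRHS]mulrDl mul1r [leLHS]mulrAC lerDl.
Qed.

Lemma analytic_ccont u z : analytic_on_disc u -> sqmod z < 1 -> ccont u z.
Proof. by move=> /analyticP au z1; have /dvb_cderiv[l /cderiv_ccont] := au z z1. Qed.

Lemma sqmod_cisM t z : sqmod (cis t * z) = sqmod z.
Proof. by rewrite sqmodM sqmod_cis mul1r. Qed.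

Lemma analytic_circle_cont u z : analytic_on_disc u -> sqmod z < 1 ->
  continuous (fun t => complex.Re (u (cis t * z))) /\
  continuous (fun t => complex.Im (u (cis t * z))).
Proof.
move=> au z1; have H t := ccont_circle (analytic_ccont au (z := cis t * z) ltac:(by rewrite sqmod_cisM)).
by split => t; case: (H t).
Qed.

Lemma sqmod_circle_cont u z : analytic_on_disc u -> sqmod z < 1 ->
  continuous (fun t => sqmod (u (cis t * z))).
Proof.
move=> au z1 t; have [cR cI] := analytic_circle_cont au z1.
by apply: cvgD; [apply: cvgM; exact: cR|apply: cvgM; exact: cI].
Qed.

Lemma mean_value_disc u z c : analytic_on_disc u -> sqmod z < 1 ->
  cint (fun t => complex.Re (u (cis t * z) * c)) 0 (2 * pi) = 2 * pi * complex.Re (u 0 * c).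
Proof.
move=> au z1; rewrite (@mean_value_Re R (fun w => u (w * z) * c)) ?mul0r// => w w1.
have wz : sqmod (w * z) < 1.
  rewrite sqmodM; apply: le_lt_trans z1; rewrite ler_piMl ?sqmod_ge0//.
  by rewrite sqmod_le1.
apply/dvb_cderiv; apply: dvbM; last exact: dvb_cst.
apply: (@dvb_comp R u (fun w => w * z)); first by apply: dvbM; [exact: dvb_id|exact: dvb_cst].
by move/analyticP: au; apply.
Qed.

Lemma sqmodD (z w : R[i]) : sqmod (z + w) = sqmod z + 2 * complex.Re (z * w^*) + sqmod w.
Proof. by case: z w => a b [c d]; rewrite /sqmod/=; ring. Qed.

(** The cross term is the real part of an analytic function, so its mean is its value at [0]. Only
    sums of squares occur, so that the identity can be integrated over the disc with nonnegative
    integrands. *)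
Lemma mean_sqmod_shift u z c : analytic_on_disc u -> sqmod z < 1 ->
  cint (fun t => sqmod (u (cis t * z) + c)) 0 (2 * pi) + cint (fun=> sqmod (u 0)) 0 (2 * pi) =
  cint (fun t => sqmod (u (cis t * z))) 0 (2 * pi) + cint (fun=> sqmod (u 0 + c)) 0 (2 * pi).
Proof.
move=> au z1; have cS := sqmod_circle_cont au z1.
have cc (k : R) : continuous (fun _ : R => k) by move=> x; exact: cvg_cst.
have cRe : continuous (fun t => 2 * complex.Re (u (cis t * z) * c^*)).
  move=> t; apply: cvgM; first exact: cvg_cst.
  have auc := @analyticM _ u (fun=> c^*) au (@analytic_cst _ c^*).
  by have [h _] := analytic_circle_cont auc z1; exact: h.
have -> : (fun t => sqmod (u (cis t * z) + c)) =
    (fun t => (sqmod (u (cis t * z)) + 2 * complex.Re (u (cis t * z) * c^*)) + sqmod c).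
  by apply/funext => t; rewrite sqmodD.
rewrite cintD//; last by move=> t; apply: cvgD; [exact: cS|exact: cRe].
rewrite cintD// cintZ; last first.
  have auc := @analyticM _ u (fun=> c^*) au (@analytic_cst _ c^*).
  by have [h _] := analytic_circle_cont auc z1; exact: h.
have pp := ltW two_pi_gt0.
by rewrite mean_value_disc// !cint_cst// subr0 sqmodD; ring.
Qed.

End CircleMean.

(** * The reproducing property *)

Section MeanValue.
Variable R : realType.
Local Notation mR := (measurableTypeR R).
Local Notation leb := (@lebesgue_measure R).
Local Notation area := (@area R).
Variable alpha : R.
Hypothesis a0 : 0 <= alpha.
Implicit Types (u v : R[i] -> R[i]) (z w c : R[i]).
Local Notation N := (nrm2 alpha).
Local Notation nr := (nr alpha).
Local Notation L2 := (L2 alpha).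
Local Notation rin := (rin alpha).

Definition circ u (p : mR * mR) : \bar R := ((2 * pi)^-1%:E *
  \int[leb]_(t in `[0%R, (2 * pi)%R]) (sqmod (u (cis t * of_coord p)) * bweight alpha (cis t * of_coord p))%:E)%E.

Let G u z : \bar R := (sqmod (u z) * bweight alpha z)%:E.

Let mG u : mdisc u -> measurable_fun setT (G u \o @of_coord R).
Proof. by move=> mu; apply/measurable_EFinP; apply: measurable_nrm2_integrand => //; exact: cmeas_id. Qed.

Let G0 u z : (0 <= G u z)%E. Proof. by rewrite lee_fin nrm2_integrand_ge0. Qed.

Lemma nrm2_circ u : mdisc u -> N u = (\int[area]_p circ u p)%E.
Proof. by move=> mu; rewrite /nrm2 (area_circle_mean (mG mu) (G0 u)). Qed.

Lemma measurable_circ u : mdisc u -> measurable_fun setT (circ u).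
Proof. by move=> mu; exact: (measurable_circle_mean (mG mu) (G0 u)). Qed.

Lemma circ_ge0 u p : (0 <= circ u p)%E.
Proof.
rewrite mule_ge0 ?lee_fin ?invr_ge0 ?(ltW (two_pi_gt0 R))//.
by apply: integral_ge0 => t _; exact: G0.
Qed.

Lemma nrm2_circD u v : mdisc u -> mdisc v -> (N u + N v = \int[area]_p (circ u p + circ v p))%E.
Proof.
move=> mu mv; rewrite (nrm2_circ mu) (nrm2_circ mv); apply: esym; apply: ge0_integralD.
- exact: measurableT.
- by move=> p _; exact: circ_ge0.
- exact: measurable_circ.
- by move=> p _; exact: circ_ge0.
- exact: measurable_circ.
Qed.

Lemma circE u p : analytic_on_disc u ->
  circ u p = (bweight alpha (of_coord p) * ((2 * pi)^-1 *
    cint (fun t => sqmod (u (cis t * of_coord p))) 0 (2 * pi)))%:E.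
Proof.
move=> au; rewrite /circ.
under eq_integral do rewrite bweight_cis.
have [z1|z1] := ltP (sqmod (of_coord p)) 1; last first.
  rewrite /bweight ltNge z1/= mul0r integral0_eq ?mule0// => t _.
  by rewrite mulr0.
have cF := sqmod_circle_cont au z1.
rewrite (@integral_cint R (fun t => sqmod (u (cis t * of_coord p)) * bweight alpha (of_coord p))).
- rewrite -EFinM; congr (_%:E).
  under [X in cint X]eq_fun do rewrite mulrC.
  by rewrite cintZ//; ring.
- by move=> t; apply: cvgM; [exact: cF|exact: cvg_cst].
- by move=> t; rewrite mulr_ge0 ?sqmod_ge0 ?bweight_ge0.
Qed.

Lemma nrm2_cst c : N (fun=> c) = (sqmod c)%:E.
Proof.
have := @moment R alpha 0 a0; rewrite /=.
under eq_integral do rewrite expr0 mul1r.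
move=> m0; rewrite /nrm2; under eq_integral do rewrite EFinM.
rewrite ge0_integralZl//; first by rewrite m0 mule1.
- by apply/measurable_EFinP; apply: measurable_bweight; exact: cmeas_id.
- by move=> p _; rewrite lee_fin bweight_ge0.
- by rewrite lee_fin sqmod_ge0.
Qed.

Lemma L2_cst c : L2 (fun=> c).
Proof. by split; [exact: mdisc_cst|rewrite nrm2_cst ltry]. Qed.

Lemma nr_cst c : nr (fun=> c) = sqmod c.
Proof. by rewrite /nr nrm2_cst. Qed.

Lemma nrm2_le u (m : R) : mdisc u -> (forall z, sqmod z < 1 -> sqmod (u z) <= m) -> (N u <= m%:E)%E.
Proof.
move=> mu um; have m0 : 0 <= m by apply: le_trans (um 0 _); rewrite ?sqmod_ge0 ?sqmod0.
have := nrm2_cst (Num.sqrt m)%:C; rewrite sqmodR sqr_sqrtr// => <-.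
apply: ge0_le_integral => //.
- by move=> p _; exact: (G0 u).
- exact: (mG mu).
- exact: (mG (mdisc_cst _)).
move=> p _; rewrite lee_fin sqmodR sqr_sqrtr// /bweight; case: ifP => [h|]; rewrite ?mulr0//.
by rewrite ler_wpM2r ?um//; have := bweight_ge0 (of_coord p) a0; rewrite /bweight h.
Qed.

(** [mean_sqmod_shift], integrated over the disc, compares the norms of [u + c] and [u]; expanding
    the former by [nrD] isolates the inner product. *)
Lemma rin_cst u c : analytic_on_disc u -> L2 u -> rin u (fun=> c) = complex.Re (u 0 * c^*).
Proof.
move=> au Lu; have [mu _] := Lu; have Lc := L2_cst c; have Luc := L2D a0 Lu Lc.
have [muc _] := Luc.
have auc := @analyticD _ u (fun=> c) au (@analytic_cst _ c).
have : (N (fun z => u z + c)%R + N (fun=> u 0%R) = N u + N (fun=> (u 0 + c)%R))%E.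
  have mc k := mdisc_cst (k : R[i]).
  rewrite (nrm2_circD muc (mc _)) (nrm2_circD mu (mc _)).
  apply: eq_integral => p _; rewrite (circE p au) (circE p auc) (circE p (@analytic_cst _ (u 0))) (circE p (@analytic_cst _ (u 0 + c))).
  rewrite -!EFinD -!mulrDr; congr (_%:E).
  have [z1|z1] := ltP (sqmod (of_coord p)) 1; last by rewrite /bweight ltNge z1/= !mul0r.
  by rewrite mean_sqmod_shift.
rewrite !nrm2_cst -(nrE a0 Luc) -(nrE a0 Lu) -!EFinD => -[]; rewrite nrD// nr_cst sqmodD; lra.
Qed.

Lemma cpowR1 (s : R) : cpowR 1 s = 1.
Proof. by rewrite /cpowR sqmod1 ln1 mul0r mulr0 expR0 /= mul0r atan0 mulr0 cis0 mulr1. Qed.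

(** Moving [U_z] to the other side reduces to pairing with a constant, that is, to the value of
    [U_(-z) u] at [0]. *)
Lemma reproducing u z c : analytic_on_disc u -> L2 u -> sqmod z < 1 ->
  rin u (U alpha z (fun=> c)) = (1 - sqmod z) `^ ((2 + alpha) / 2) * complex.Re (u z * c^*).
Proof.
move=> au Lu z1; have z1' := sqmodN_lt1 z1.
rewrite -rin_adjoint//; last exact: L2_cst.
rewrite rin_cst; [|exact: analytic_U|exact: L2_U].
have o1 : sqmod (0 : R[i]) < 1 by rewrite sqmod0.
rewrite UE// /moebius opprK mulr0 subr0 divr1 add0r /kern mulr0 subr0 cpowR1 divr1 sqmodN.
move: (_ `^ _) (u z) c => k [a b] [x y] /=; ring.
Qed.

Lemma rin_mulr u v c : L2 u -> L2 v ->
  rin u (fun z => c * v z) = complex.Re (c^* * bergman_inner alpha u v).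
Proof.
move=> Lu Lv; rewrite inner_rin; have Liv := L2Z a0 'i Lv.
rewrite (@rin_ext _ alpha u u (fun z => c * v z)
  (fun z => (complex.Re c)%:C * v z + (complex.Im c)%:C * ('i * v z)))//.
  rewrite rinDr//; try exact: L2Z.
  rewrite !(rinC alpha u) !rinZ// !(rinC alpha _ u).
  by case: c => x y /=; ring.
move=> z _; rewrite mulrA -mulrDl; congr (_ * _); case: c => x y.
by apply/eqP; rewrite eq_complex/=; apply/andP; split; apply/eqP; ring.
Qed.

(** Before [rin_le], [u] is multiplied by [sqrt m] and [v] divided by it. For a unit vector [u] the
    bound is [m], as Cauchy-Schwarz would give. *)
Lemma rin_small u v (m : R) : 0 < m -> L2 u -> L2 v -> nr v <= m ^+ 2 ->
  `|rin u v| <= m * (nr u + 1) / 2.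
Proof.
move=> m0 Lu Lv vm; pose k : R := Num.sqrt m; have k0 : 0 < k by rewrite sqrtr_gt0.
have k2 : k ^+ 2 = m by rewrite sqr_sqrtr// ltW.
have Lku := L2Z a0 (k%:C) Lu; have Lkv := L2Z a0 (k^-1%:C) Lv.
have -> : rin u v = rin (fun z => k%:C * u z) (fun z => k^-1%:C * v z).
  have e1 := rinZ a0 k Lu Lkv; have e2 := rinZ a0 k^-1 Lv Lu.
  apply: esym; apply: etrans e1 _; rewrite rinC e2 (rinC alpha v) mulrA mulfV ?mul1r//.
  by rewrite gt_eqF.
apply: le_trans (rin_le a0 Lku Lkv) _; rewrite (nrZ a0 _ Lu) (nrZ a0 _ Lv) !sqmodR exprVn k2.
rewrite ler_wpM2r// mulrDr mulr1 lerD2l ler_pdivrMl//.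
Qed.

End MeanValue.

(** * Power series of square-integrable analytic functions *)

Section Expansion.
Variable R : realType.
Local Notation mR := (measurableTypeR R).
Local Notation area := (@area R).
Implicit Types (u v : R[i] -> R[i]) (z w c : R[i]).

Lemma analytic_scale (k : R) u : 0 <= k <= 1 -> analytic_on_disc u -> analytic_on_disc (fun z => u (k%:C * z)).
Proof.
move=> /andP[k0 k1] /analyticP au; apply/analyticP => z z1.
apply: (@dvb_comp R u (fun w => k%:C * w)); first by apply: dvbM; [exact: dvb_cst|exact: dvb_id].
apply: au; rewrite sqmodM sqmodR; apply: le_lt_trans z1.
by rewrite ler_piMl ?sqmod_ge0// expr_le1.
Qed.

Lemma conjc_conj z : ((z^*)^* = z)%R.
Proof. by case: z => a b; apply/eqP; rewrite eq_complex/= opprK !eqxx. Qed.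

Lemma conjcM z w : ((z * w)^* = z^* * w^*)%R.
Proof. exact: rmorphM. Qed.

Lemma conjc_nat n : ((n%:R : R[i])^* = n%:R)%R.
Proof. exact: rmorph_nat. Qed.

Lemma conjcR (x : R) : ((x%:C)^* = x%:C)%R.
Proof. by apply/eqP; rewrite eq_complex/= oppr0 !eqxx. Qed.

Lemma conjcX z n : ((z ^+ n)^* = (z^*) ^+ n)%R.
Proof. exact: rmorphXn. Qed.

Lemma sum_natS_expr x N :
  (1 - x) ^+ 2 * \sum_(n < N) (n.+1%:R * x ^+ n) = 1 - N.+1%:R * x ^+ N + N%:R * x ^+ N.+1 :> R[i].
Proof.
elim: N => [|N ih]; first by rewrite big_ord0 mulr0 expr0 !mul0r mul1r subrr addr0.
rewrite big_ord_recr/= mulrDr ih !exprS -[N.+2%:R]natr1 -[N.+1%:R]natr1; ring.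
Qed.

(** Makes the expansion of [(1 - x)^-2] uniform on the disc of radius [r]. *)
Lemma bergman_kernel_tail x (r : R) N : cabs x <= r -> r < 1 ->
  cabs (\sum_(n < N) (n.+1%:R * x ^+ n) - ((1 - x) ^+ 2)^-1) <= (2 * N%:R + 1) * r ^+ N / (1 - r) ^+ 2.
Proof.
move=> xr r1; have r0 : 0 <= r by apply: le_trans xr; exact: cabs_ge0.
have d0 : 0 < 1 - r by rewrite subr_gt0.
have xd : 1 - r <= cabs (1 - x).
  have := cabsD (1 - x) x; rewrite subrK cabs1; lra.
have x1 : 1 - x != 0 by rewrite -cabs_gt0; lra.
have -> : \sum_(n < N) (n.+1%:R * x ^+ n) - ((1 - x) ^+ 2)^-1 =
    (N%:R * x ^+ N.+1 - N.+1%:R * x ^+ N) / (1 - x) ^+ 2.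
  apply: (mulfI (x := (1 - x) ^+ 2)); first by rewrite expf_neq0.
  rewrite mulrBr sum_natS_expr mulfV ?expf_neq0//.
  by rewrite [RHS]mulrC divfK ?expf_neq0//; ring.
rewrite cabsM cabsV cabsX; apply: ler_pM; rewrite ?cabs_ge0 ?invr_ge0 ?sqr_ge0//.
  apply: le_trans (cabsD _ _) _; rewrite cabsN !cabsM !cabsX.
  have cn k : cabs (k%:R : R[i]) = k%:R by rewrite -(rmorph_nat (@real_complex R)) cabsR ger0_norm.
  rewrite !cn.
  have xN : cabs x ^+ N <= r ^+ N by rewrite lerXn2r ?nnegrE ?cabs_ge0.
  have xN1 : cabs x ^+ N.+1 <= r ^+ N.
    rewrite exprS; apply: le_trans xN; rewrite ler_piMl ?exprn_ge0 ?cabs_ge0//.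
    by rewrite (le_trans xr)// ltW.
  have n0 : 0 <= N%:R :> R by [].
  by rewrite -natr1; nra.
by rewrite lef_pV2 ?posrE ?exprn_gt0 ?cabs_gt0// lerXn2r// ?nnegrE ?cabs_ge0// ltW.
Qed.

(** Pairing [u] with a partial sum of the kernel gives a partial sum of the series, and pairing it
    with the kernel itself gives [u z]. The two kernels are uniformly close in [w], so [rin_small]
    bounds the difference. *)
Lemma expansion0 u z : analytic_on_disc u -> L2 0 u -> sqmod z < 1 ->
  csums (fun n => n.+1%:R * bergman_inner 0 u (fun w => w ^+ n) * z ^+ n) (u z).
Proof.
move=> au Lu z1; have z0 := sqmod_ge0 z; have a0 : 0 <= (0 : R) by [].
have oz : 0 < 1 - sqmod z by rewrite subr_gt0.
pose r := cabs z; have r0 : 0 <= r by exact: cabs_ge0.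
have r1 : r < 1 by rewrite /r -sqmod_lt1.
(* Chosen with [r <= q ^ 2]: in the tail bound one factor [q ^ N] absorbs the growth of [2 N + 1]
   and the other remains as the rate. *)
pose q := (1 + r) / 2; have q01 : 0 <= q < 1 by rewrite /q; lra.
have q0 : 0 < q by rewrite /q; lra.
have rq : r <= q ^+ 2 by rewrite /q; have := sqr_ge0 (1 - r); rewrite !expr2; nra.
pose A := (2 / (1 - q) + 1) / (1 - r) ^+ 2.
have q10 : 0 < 1 - q by rewrite subr_gt0; case/andP: q01.
have r10 : 0 < 1 - r by rewrite subr_gt0.
have A0 : 0 < A by rewrite divr_gt0 ?exprn_gt0// addr_gt0// divr_gt0.
pose m N := A * q ^+ N; have m0 N : 0 < m N by rewrite mulr_gt0 ?exprn_gt0.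
have tail x N : cabs x <= r -> cabs (\sum_(n < N) (n.+1%:R * x ^+ n) - ((1 - x) ^+ 2)^-1) <= m N.
  move=> xr; apply: le_trans (bergman_kernel_tail N xr r1) _.
  rewrite /m /A [leRHS]mulrAC ler_wpM2r ?invr_ge0 ?sqr_ge0//.
  have rN : r ^+ N <= q ^+ N * q ^+ N by rewrite -exprD addnn -mul2n exprM lerXn2r// ?nnegrE ?exprn_ge0// ltW.
  have qN0 : 0 <= q ^+ N by rewrite exprn_ge0// ltW.
  have qN1 : q ^+ N <= 1 by rewrite exprn_ile1 ?(ltW q0)//; case/andP: q01 => _ /ltW.
  have nq := natmul_expr_le N q01.
  apply: (@le_trans _ _ ((2 * N%:R + 1) * (q ^+ N * q ^+ N))).
    by rewrite ler_wpM2l// addr_ge0// mulr_ge0.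
  by rewrite mulrA ler_wpM2r//; nra.
(* A unimodular [c] selects a real part of the difference; [c = 1] and [c = 'i] together recover
   it. *)
have key c N : cabs c = 1 ->
    `|complex.Re ((\sum_(n < N) n.+1%:R * bergman_inner 0 u (fun w => w ^+ n) * z ^+ n - u z) * c^*)| <=
    m N * (nr 0 u + 1) / 2.
  move=> c1.
  pose S (w : R[i]) := \sum_(n < N) (c * (n.+1%:R * (z^*) ^+ n)) * w ^+ n.
  have LX n : L2 0 (fun w : R[i] => w ^+ n).
    split; first by apply: mdisc_analytic; exact: analyticX.
    apply: le_lt_trans (nrm2_le (m := 1) a0 _ _) _; rewrite ?ltry//.
      by apply: mdisc_analytic; exact: analyticX.
    by move=> w w1; rewrite sqmodX exprn_ile1 ?sqmod_ge0// ltW.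
  have [LS ES] : L2 0 S /\ rin 0 u S = complex.Re (\sum_(n < N) n.+1%:R * bergman_inner 0 u (fun w => w ^+ n) * z ^+ n * c^*).
    rewrite /S; elim: N {S} => [|N [ihL ihE]].
      split; first by apply: (L2_ext (v := fun=> 0)); [move=> w _; rewrite big_ord0|exact: L2_cst].
      rewrite (rin_ext _ (u' := u) (v' := fun=> 0))//; last by move=> w _; rewrite big_ord0.
      by rewrite (rin_cst a0 0 au Lu) rmorph0 mulr0 big_ord0.
    have LN : L2 0 (fun w => (c * (N.+1%:R * z^* ^+ N)) * w ^+ N) by apply: L2Z.
    split.
      apply: (L2_ext (v := fun w => \sum_(n < N) (c * (n.+1%:R * z^* ^+ n)) * w ^+ n + (c * (N.+1%:R * z^* ^+ N)) * w ^+ N)).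
        by move=> w _; rewrite big_ord_recr.
      exact: L2D.
    rewrite (rin_ext _ (u' := u) (v' := fun w => \sum_(n < N) (c * (n.+1%:R * z^* ^+ n)) * w ^+ n + (c * (N.+1%:R * z^* ^+ N)) * w ^+ N))//; last first.
      by move=> w _; rewrite big_ord_recr.
    rewrite rinDr// ihE rin_mulr// big_ord_recr/= ReD; congr (_ + complex.Re _).
    have zN : ((z^* ^+ N)^* = z ^+ N)%R by rewrite conjcX conjc_conj.
    by rewrite !conjcM zN conjc_nat; ring.
  pose K := U 0 z (fun=> c / (1 - sqmod z)%:C).
  have LK : L2 0 K by apply: L2_U => //; exact: L2_cst.
  have EK : rin 0 u K = complex.Re (u z * c^*).
    rewrite /K reproducing// addr0 divff// powRr1 ?(ltW oz)//.
    have : (1 - sqmod z)%:C != 0 :> R[i] by rewrite realC_eq0 gt_eqF.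
    have -> : ((c / (1 - sqmod z)%:C)^* = c^* * ((1 - sqmod z)^-1)%:C)%R.
      have -> : (1 - sqmod z)%:C^-1 = ((1 - sqmod z)^-1)%:C :> R[i] by rewrite fmorphV.
      by rewrite conjcM conjcR.
    rewrite mulrA => _; move: (u z * c^*)%R => [x y] /=; rewrite mulr0 subr0 mulrCA mulfV ?mulr1// gt_eqF//.
  have -> : complex.Re ((\sum_(n < N) n.+1%:R * bergman_inner 0 u (fun w => w ^+ n) * z ^+ n - u z) * c^*) =
     rin 0 u (fun w => S w - K w).
    by rewrite rinBr// EK ES mulrBl ReB mulr_suml.
  apply: (rin_small a0 (m0 N) Lu); first exact: L2B.
  have LSK := L2B a0 LS LK.
  rewrite -lee_fin nrE//; case: (LSK) => mSK _; apply: nrm2_le => // w w1.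
  rewrite -cabs_sqr lerXn2r ?nnegrE ?cabs_ge0 ?(ltW (m0 N))//.
  have zw : cabs (z^* * w) <= r.
    rewrite cabsM cabsJ ler_piMr ?cabs_ge0//; by apply: ltW; rewrite -sqmod_lt1.
  have -> : S w - K w = c * (\sum_(n < N) (n.+1%:R * (z^* * w) ^+ n) - ((1 - z^* * w) ^+ 2)^-1).
    rewrite mulrBr; congr (_ - _).
      by rewrite /S mulr_sumr; apply: eq_bigr => n _; rewrite exprMn; ring.
    rewrite /K UE// /kern addr0 divff// powRr1 ?(ltW oz)// cpowR2; last exact: Re_one_sub.
    by rewrite mulrA divfK// realC_eq0 gt_eqF.
  by rewrite cabsM c1 mul1r; exact: tail.
move=> e e0.
have nr1 : 0 < nr 0 u + 1 by rewrite ltr_wpDl// nr_ge0.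
have /cvgrPdist_lt/(_ e e0)[N0 _ HN0] : geometric (A * (nr 0 u + 1)) q @ \oo --> 0.
  by apply: cvg_geometric; rewrite ger0_norm ?(ltW q0)//; case/andP: q01.
exists N0 => N NN; have := HN0 N NN; rewrite sub0r normrN ger0_norm; last first.
  by apply: mulr_ge0; [apply: mulr_ge0; exact: ltW|rewrite exprn_ge0// ltW].
apply: le_lt_trans; apply: le_trans (cabs_le_ReIm _) _.
have := key 1 N (@cabs1 R); rewrite rmorph1 mulr1 => h1.
have ci : cabs ('i : R[i]) = 1 by rewrite /cabs /sqmod/= expr0n expr1n add0r sqrtr1.
have := key 'i N ci.
have iE (w' : R[i]) : complex.Re (w' * 'i^*) = complex.Im w' by case: w' => x y /=; ring.
rewrite iE.
move: h1; rewrite /geometric/= /m => h1 h2; apply: le_trans (lerD h1 h2) _.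
by rewrite le_eqVlt; apply/orP; left; apply/eqP; field.
Qed.

(** On the disc of radius [k < 1] the factor [(1 - |z|^2) ^ alpha] is at least [1 / C], so dilation
    removes the weight. *)
Lemma L2_dilate alpha u (k : R) : 0 <= alpha -> 0 < k < 1 -> analytic_on_disc u -> L2 alpha u ->
  L2 0 (fun z => u (k%:C * z)).
Proof.
move=> a0 /andP[k0 k1] au [mu uL].
have auk : analytic_on_disc (fun z => u (k%:C * z)) by apply: analytic_scale => //; rewrite !ltW.
split; first exact: mdisc_analytic.
have k2 : 0 < 1 - k ^+ 2 by rewrite subr_gt0 expr_lt1// ltW.
pose C := ((1 - k ^+ 2) `^ alpha)^-1.
have C0 : 0 < C by rewrite invr_gt0 powR_gt0.
pose G z : \bar R := (sqmod (u z) * bweight alpha z)%:E.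
have mG : measurable_fun setT (G \o @of_coord R).
  by apply/measurable_EFinP; apply: measurable_nrm2_integrand => //; exact: cmeas_id.
have G0 z : (0 <= G z)%E by rewrite lee_fin nrm2_integrand_ge0.
have kc0 : k%:C != 0 :> R[i] by rewrite realC_eq0 gt_eqF.
have mGk : measurable_fun setT (fun p : mR * mR => G (k%:C * of_coord p)).
  apply: (@measurable_comp_cmeas R _ _ _ _ G) => //; apply: cmeasM; [exact: cmeas_cst|exact: cmeas_id].
have I : (\int[area]_p G (k%:C * of_coord p)%R < +oo)%E.
  have := @area_affineC R G k%:C 0 kc0 mG G0.
  under eq_integral do rewrite addr0.
  have -> : (\int[area]_p ((sqmod k%:C)%:E * G (k%:C * of_coord p)%R) =
      (sqmod k%:C)%:E * \int[area]_p G (k%:C * of_coord p)%R)%E.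
    apply: ge0_integralZl; [exact: measurableT|exact: mGk|by move=> p _; exact: G0|].
    by rewrite lee_fin sqmod_ge0.
  rewrite -[X in _ = X -> _]/(nrm2 alpha u) sqmodR => E.
  have kk : (0 < k ^+ 2)%R by rewrite exprn_gt0.
  have : ((k ^+ 2)%:E * \int[area]_p G (k%:C * of_coord p)%R < +oo)%E by rewrite E.
  have : (0 <= \int[area]_p G (k%:C * of_coord p)%R)%E by apply: integral_ge0 => p _; exact: G0.
  case: (\int[area]_p _)%E => [x _ _|_|//]; first by rewrite ltry.
  by rewrite gt0_muley// lte_fin.
apply: le_lt_trans (_ : (_ <= C%:E * \int[area]_p G (k%:C * of_coord p)%R)%E) _; last by rewrite lte_mul_pinfty// lee_fin ltW.
have -> : (C%:E * \int[area]_p G (k%:C * of_coord p)%R = \int[area]_p (C%:E * G (k%:C * of_coord p)%R))%E.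
  apply: esym; apply: ge0_integralZl; [exact: measurableT|exact: mGk|by move=> p _; exact: G0|].
  by rewrite lee_fin ltW.
apply: ge0_le_integral => //.
- by move=> p _; rewrite lee_fin mulr_ge0 ?sqmod_ge0 ?bweight_ge0.
- apply/measurable_EFinP; apply: (@measurable_nrm2_integrand _ _ _ 0 (fun z => u (k%:C * z))).
    exact: mdisc_analytic.
  exact: cmeas_id.
- by apply: emeasurable_funM; [exact: measurable_cst|exact: mGk].
move=> p _; rewrite -EFinM lee_fin /G mulrCA ler_wpM2l ?sqmod_ge0//.
rewrite /bweight; have [z1|z1] := ltP (sqmod (of_coord p)) 1; last first.
  by rewrite mulr_ge0 ?(ltW C0)//; exact: (bweight_ge0 (alpha := alpha)).
have kz : sqmod (k%:C * of_coord p) <= k ^+ 2.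
  by rewrite sqmodM sqmodR ler_piMr ?sqr_ge0// ltW.
have kz1 : sqmod (k%:C * of_coord p) < 1 by apply: le_lt_trans kz _; rewrite -subr_gt0.
rewrite kz1 /bergman_density powRr0 mulr1 add0r mulrCA mulrAC.
have := pi_gt0 R => pp.
rewrite ler_wpM2r ?invr_ge0 ?(ltW pp)//.
have h : 1 <= C * (1 - sqmod (k%:C * of_coord p)) `^ alpha.
  rewrite /C mulrC ler_pdivlMr ?powR_gt0// mul1r ge0_ler_powR ?nnegrE ?(ltW k2)//; first by rewrite subr_ge0 ltW.
  by rewrite lerD2l lerN2.
by apply: le_trans h _; rewrite ler_peMl ?mulr_ge0 ?powR_ge0 ?(ltW C0)// lerDr.
Qed.

(** Expanding the dilate by [k] and rescaling represents [u] for [|z| < k]. Near [0] all these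
    series agree, so by uniqueness their coefficients are the same for every [k >= 1 / 2], and one
    sequence serves the whole disc. *)
Lemma analytic_expansion alpha u : 0 <= alpha -> analytic_on_disc u -> L2 alpha u ->
  exists a, forall z, sqmod z < 1 -> csums (fun n => a n * z ^+ n) (u z).
Proof.
move=> a0 au Lu.
pose b (k : R) n := n.+1%:R * bergman_inner 0 (fun z => u (k%:C * z)) (fun w => w ^+ n) * (k^-1)%:C ^+ n.
have bu (k : R) z : 0 < k < 1 -> cabs z < k -> csums (fun n => b k n * z ^+ n) (u z).
  move=> k01 zk; have /andP[k0 k1] := k01.
  have kc0 : k%:C != 0 :> R[i] by rewrite realC_eq0 gt_eqF.
  have z1 : sqmod ((k^-1)%:C * z) < 1.
    rewrite sqmod_lt1 cabsM cabsR ger0_norm ?invr_ge0 ?(ltW k0)//.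
    by rewrite mulrC ltr_pdivrMr// mul1r.
  have auk : analytic_on_disc (fun z => u (k%:C * z)) by apply: analytic_scale => //; rewrite !ltW.
  have := expansion0 auk (L2_dilate a0 k01 au Lu) z1.
  rewrite mulrA -rmorphM mulfV ?gt_eqF// mul1r.
  by apply: csums_ext => n; rewrite exprMn /b mulrA.
have bE (k : R) : 1 / 2 <= k < 1 -> b (1 / 2) = b k.
  move=> /andP[k2 k1]; apply: (@pseries_eq R _ _ (1 / 2)) => // x /andP[x0 x2].
  exists (u x%:C); split; apply: bu; rewrite ?cabsR ?ger0_norm ?(ltW x0)//; lra.
exists (b (1 / 2)) => z; rewrite sqmod_lt1 => z1.
have k12 : 1 / 2 <= (1 + cabs z) / 2 < 1 by have := cabs_ge0 z; lra.
by rewrite (bE _ k12); apply: bu; have := cabs_ge0 z; lra.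
Qed.

Lemma power_coefP alpha u : 0 <= alpha -> analytic_on_disc u -> L2 alpha u ->
  forall z, sqmod z < 1 -> csums (fun n => power_coef u n * z ^+ n) (u z).
Proof.
move=> a0 au Lu z z1; have [a ha] := analytic_expansion a0 au Lu.
have : sums_on_disc (power_coef u) u.
  by apply: (@xgetPex _ (fun=> 0) [set a | sums_on_disc a u]); exists a => w; rewrite inE => w1; apply/csumsP/ha.
by move=> /(_ z); rewrite inE => /(_ z1) /csumsP.
Qed.

End Expansion.

(** * Taylor coefficients and Parseval's identity *)

Section Parseval.
Variable R : realType.
Local Notation mR := (measurableTypeR R).
Local Notation leb := (@lebesgue_measure R).
Implicit Types (u v : R[i] -> R[i]) (z w c : R[i]) (a b : nat -> R[i]).

Definition psum b n z : R[i] := \sum_(k < n) b k * z ^+ k.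

Lemma dvb_psum b n z : dvb (psum b n) z.
Proof.
rewrite /psum; elim: n => [|n ih].
  by apply: (@dvb_near R _ (fun=> 0)); [exists 1 => // w _; rewrite big_ord0|exact: dvb_cst].
apply: (@dvb_near R _ (fun w => \sum_(k < n) b k * w ^+ k + b n * w ^+ n)).
  by exists 1 => // w _; rewrite big_ord_recr.
have pm := @dvbM R (fun=> b n) (fun w => w ^+ n) z (@dvb_cst R (b n) z) (@dvbX R id z n (@dvb_id R z)).
exact (@dvbD R _ _ z ih pm).
Qed.

Lemma entire_circle_cont u z : (forall w, dvb u w) ->
  continuous (fun t => complex.Re (u (cis t * z))) /\
  continuous (fun t => complex.Im (u (cis t * z))).
Proof.
move=> du; have uc w : ccont u w by have /dvb_cderiv[l /cderiv_ccont] := du w.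
by split => t; case: (ccont_circle (uc (cis t * z))).
Qed.

Lemma sqmod_cont (f : R -> R[i]) : continuous (fun t => complex.Re (f t)) ->
  continuous (fun t => complex.Im (f t)) -> continuous (fun t => sqmod (f t)).
Proof. by move=> cR cI t; apply: cvgD; [apply: cvgM; exact: cR|apply: cvgM; exact: cI]. Qed.

(** Induction on the form [z q(z) + b 0]: the cross term vanishes at the origin and hence in mean,
    and the first square is [|z|^2 |q|^2]. *)
Lemma psum_circle b n z :
  cint (fun t => sqmod (psum b n (cis t * z))) 0 (2 * pi) = 2 * pi * \sum_(k < n) sqmod (b k) * sqmod z ^+ k.
Proof.
have pp := ltW (two_pi_gt0 R).
elim: n b => [|n ih] b.
  have -> : (fun t => sqmod (psum b 0 (cis t * z))) = fun=> 0.
    by apply/funext => t; rewrite /psum big_ord0 sqmod0.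
  by rewrite cint_cst// big_ord0 mul0r mulr0.
pose b' k := b k.+1; pose q := psum b' n; pose v w := (w * z) * q (w * z) * (b 0%N)^*.
have dq w : dvb (fun w => (w * q w) * (b 0%N)^*) w.
  exact (@dvbM R _ (fun=> (b 0%N)^*) w (@dvbM R id q w (@dvb_id R w) (@dvb_psum b' n w)) (@dvb_cst R _ w)).
have [cq cqi] := entire_circle_cont z (@dvb_psum b' n).
have cS := sqmod_cont cq cqi.
have [cRe _] := entire_circle_cont z dq.
have cc (k : R) : continuous (fun _ : R => k) by move=> x; exact: cvg_cst.
have -> : (fun t => sqmod (psum b n.+1 (cis t * z))) = (fun t => (sqmod (b 0%N) +
    2 * complex.Re ((cis t * z) * q (cis t * z) * (b 0%N)^*)) + sqmod z * sqmod (q (cis t * z))).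
  apply/funext => t; have -> : psum b n.+1 (cis t * z) = (cis t * z) * q (cis t * z) + b 0%N.
    rewrite /psum big_ord_recl expr0 mulr1 addrC /q /psum mulr_sumr; congr (_ + _).
    by apply: eq_bigr => k _; rewrite /b' /= exprS; ring.
  by rewrite sqmodD !sqmodM sqmod_cis mul1r; ring.
have c2 : continuous (fun t => 2 * complex.Re ((cis t * z) * q (cis t * z) * (b 0%N)^*)).
  by move=> t; apply: cvgM; [exact: cvg_cst|exact: cRe].
have cz : continuous (fun t => sqmod z * sqmod (q (cis t * z))).
  by move=> t; apply: cvgM; [exact: cvg_cst|exact: cS].
rewrite cintD//; last by move=> t; apply: cvgD; [exact: cvg_cst|exact: c2].
rewrite cintD// cint_cst// (cintZ 2)//.
rewrite (@cintZ R (sqmod z) (fun t => sqmod (q (cis t * z))))//.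
rewrite (@mean_value_Re R v); last first.
  move=> w _; apply/dvb_cderiv.
  apply: (@dvb_comp R (fun w => (w * q w) * (b 0%N)^*) (fun w => w * z)); last exact: dq.
  by apply: dvbM; [exact: dvb_id|exact: dvb_cst].
rewrite /v !mul0r /= ih big_ord_recl /= expr0 mulr1 subr0 mulr0 mulr0 addr0.
have -> : \sum_(i < n) sqmod (b (bump 0 i)) * sqmod z ^+ bump 0 i =
    sqmod z * \sum_(k < n) sqmod (b' k) * sqmod z ^+ k.
  by rewrite mulr_sumr; apply: eq_bigr => k _; rewrite /b' exprS; ring.
by ring.
Qed.

Lemma sqmod_csums_cvg b c : csums b c -> sqmod (\sum_(k < n) b k) @[n --> \oo] --> sqmod c.
Proof.
move=> /csums_ReIm[hR hI].
have -> : (fun n : nat => sqmod (\sum_(k < n) b k)) = (fun n =>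
    series (fun k => complex.Re (b k)) n ^+ 2 + series (fun k => complex.Im (b k)) n ^+ 2).
  apply/funext => n; rewrite /series/= !big_mkord /sqmod.
  by rewrite (raddf_sum (@complex.Re R)) (raddf_sum (@complex.Im R)).
by apply: cvgD; apply: cvgM.
Qed.

Lemma nneseries_real (x : nat -> R) (y : R) : (forall n, 0 <= x n) ->
  (\sum_(0 <= n <oo) (x n)%:E = y%:E)%E -> series x @ \oo --> y.
Proof.
move=> x0 E.
have : (fun n => \sum_(0 <= k < n) (x k)%:E)%E @ \oo --> y%:E.
  by rewrite -E; apply: is_cvg_nneseries => n _ _; rewrite lee_fin.
move=> /fine_cvg; rewrite (_ : fine \o _ = series x)//.
by apply/funext => n; rewrite /= sumEFin.
Qed.

Lemma nneseries_le (x : nat -> \bar R) (y : \bar R) : (forall n, 0 <= x n)%E ->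
  (forall N, \sum_(n < N) x n <= y)%E -> (\sum_(0 <= n <oo) x n <= y)%E.
Proof.
move=> x0 xy; apply: lime_le; first by apply: is_cvg_nneseries => n _ _.
by apply: nearW => N; rewrite big_mkord.
Qed.

Lemma nneseries_ge (x : nat -> \bar R) N : (forall n, 0 <= x n)%E ->
  (\sum_(n < N) x n <= \sum_(0 <= n <oo) x n)%E.
Proof. by move=> x0; rewrite -(big_mkord xpredT x); apply: nneseries_lim_ge => n _ _. Qed.

(** The finite identity and dominated convergence, with the constant bound [C ^ 2]. As [S] is a
    function on the circle only, the lemma also covers the dependence of [p(t, z)] on [t]. *)
Lemma parseval b (C : R) (S : R -> R[i]) z : (forall N, \sum_(n < N) cabs (b n) <= C) ->
  sqmod z <= 1 ->
  (forall t, csums (fun n => b n * (cis t * z) ^+ n) (S t)) ->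
  (\int[leb]_(t in `[0%R, (2 * pi)%R]) (sqmod (S t))%:E =
   (2 * pi)%:E * \sum_(0 <= n <oo) (sqmod (b n) * sqmod z ^+ n)%:E)%E.
Proof.
move=> bC z1 bS.
have C0 : 0 <= C by have := bC 0%N; rewrite big_ord0.
pose f N t : \bar R := (sqmod (psum b N (cis t * z)))%:E.
have mf N : measurable_fun setT (f N : mR -> \bar R).
  have [cR cI] := entire_circle_cont z (@dvb_psum b N).
  apply/measurable_EFinP; apply: continuous_measurable_fun; exact: sqmod_cont.
have fS t : f ^~ t @ \oo --> (sqmod (S t))%:E.
  by apply: cvg_EFin; [exact: nearW|exact: (sqmod_csums_cvg (bS t))].
have mS : measurable_fun (`[0, 2 * pi]%classic : set mR) (fun t : mR => (sqmod (S t))%:E).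
  exact: (@emeasurable_fun_cvg _ _ _ `[0, 2 * pi]%classic f _ (fun N => measurable_funTS (mf N)) (fun t _ => fS t)).
have ig : leb.-integrable `[0, 2 * pi] (cst (C ^+ 2)%:E : mR -> \bar R).
  by apply: (@cint_integrable R (fun=> C ^+ 2)) => x; exact: cvg_cst.
have fC : \forall t \ae leb, forall N, (`[0, 2 * pi]%classic : set mR) t -> (`|f N t| <= cst (C ^+ 2)%:E t)%E.
  apply: aeW => t N _; rewrite /f gee0_abs ?lee_fin ?sqmod_ge0//.
  rewrite -cabs_sqr lerXn2r ?nnegrE ?cabs_ge0//.
  apply: le_trans (cabs_sum _ _) _; apply: le_trans (bC N); apply: ler_sum => k _.
  rewrite cabsM ler_piMr ?cabs_ge0// cabsX exprn_ile1 ?cabs_ge0//.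
  by rewrite cabsM cabs_cis mul1r -sqmod_le1.
have fS' : \forall t \ae leb, (`[0, 2 * pi]%classic : set mR) t -> f ^~ t @ \oo --> (sqmod (S t))%:E.
  by apply: aeW => t _; exact: fS.
have mD : measurable (`[0, 2 * pi]%classic : set mR) by exact: measurable_itv.
have [_ _] := @dominated_convergence _ _ R leb _ mD f (fun t => (sqmod (S t))%:E) _
  (fun N => measurable_funTS (mf N)) mS fS' ig fC.
move=> H; apply: (cvg_unique _ H) => //.
have eN : (fun N => \int[leb]_(t in `[0%R, (2 * pi)%R]) f N t)%E =
    (fun N => (2 * pi)%:E * \sum_(0 <= n < N) (sqmod (b n) * sqmod z ^+ n)%:E)%E.
  apply/funext => N; rewrite integral_cint; last by move=> t; exact: sqmod_ge0.
    by rewrite psum_circle EFinM sumEFin big_mkord.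
  by have [cR cI] := entire_circle_cont z (@dvb_psum b N); exact: sqmod_cont.
rewrite /= eN; apply: cvgeZl => //; apply: is_cvg_nneseries => n _ _.
by rewrite lee_fin mulr_ge0 ?sqmod_ge0 ?exprn_ge0 ?sqmod_ge0.
Qed.

Definition has_coef a u : Prop := forall z, sqmod z < 1 -> csums (fun n => a n * z ^+ n) (u z).

Lemma has_coef_rad1 a u : has_coef a u -> rad1 a.
Proof. exact: sums_rad1. Qed.

Lemma has_coef_analytic a u : has_coef a u -> analytic_on_disc u.
Proof. by move=> au; have ra := has_coef_rad1 au; exact: pseries_analytic ra au. Qed.

Lemma has_coefD a b u v : has_coef a u -> has_coef b v ->
  has_coef (fun n => a n + b n) (fun z => u z + v z).
Proof.
by move=> au bv z z1; apply: csums_ext (csumsD (au z z1) (bv z z1)) => n; rewrite mulrDl.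
Qed.

Lemma has_coefB a b u v : has_coef a u -> has_coef b v ->
  has_coef (fun n => a n - b n) (fun z => u z - v z).
Proof.
by move=> au bv z z1; apply: csums_ext (csumsB (au z z1) (bv z z1)) => n; rewrite mulrBl.
Qed.

Lemma has_coefZ a u c : has_coef a u -> has_coef (fun n => c * a n) (fun z => c * u z).
Proof. by move=> au z z1; apply: csums_ext (csumsZ c (au z z1)) => n; rewrite mulrA. Qed.

Lemma csums_finite (b : nat -> R[i]) N : (forall n, (N <= n)%N -> b n = 0) -> csums b (\sum_(n < N) b n).
Proof.
move=> b0 e e0; exists N => n Nn; rewrite -(big_mkord xpredT b) (big_cat_nat (n := N))//=.
have -> : \sum_(N <= k < n) b k = 0.
  by rewrite big_nat_cond big1// => k /andP[/andP[Nk _] _]; exact: b0.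
by rewrite big_mkord addr0 subrr cabs0.
Qed.

Lemma has_coef_psum a N : has_coef (fun n => if (n < N)%N then a n else 0) (psum a N).
Proof.
move=> z z1; have := @csums_finite (fun n => (if (n < N)%N then a n else 0) * z ^+ n) N.
rewrite (_ : \sum_(n < N) _ = psum a N z); last by apply: eq_bigr => k _; rewrite ltn_ord.
by apply => n Nn; rewrite ltnNge Nn mul0r.
Qed.

Lemma has_coefX n : has_coef (fun k => (k == n)%:R) (fun z => z ^+ n).
Proof.
move=> z z1; have := @csums_finite (fun k => (k == n)%:R * z ^+ k) n.+1.
rewrite big_ord_recr/= eqxx mul1r big1 ?add0r; last by move=> k _; rewrite ltn_eqF ?mul0r.
by apply => k nk; rewrite gtn_eqF ?mul0r.
Qed.

End Parseval.

(** * Norms and inner products through Taylor coefficients *)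

Section Coefficients.
Variable R : realType.
Local Notation mR := (measurableTypeR R).
Local Notation leb := (@lebesgue_measure R).
Variable alpha : R.
Hypothesis a0 : 0 <= alpha.
Implicit Types (u v : R[i] -> R[i]) (z w c : R[i]) (a b : nat -> R[i]).
Local Notation N := (nrm2 alpha).
Local Notation nr := (nr alpha).
Local Notation L2 := (L2 alpha).
Local Notation rin := (rin alpha).
Local Notation wn := (wn alpha).

Lemma wn_ge0 n : 0 <= wn n. Proof. by apply: ltW; exact: wn_gt0. Qed.

Lemma circle_coef a u z : has_coef a u -> sqmod z < 1 ->
  (\int[leb]_(t in `[0%R, (2 * pi)%R]) (sqmod (u (cis t * z)))%:E =
   (2 * pi)%:E * \sum_(0 <= n <oo) (sqmod (a n) * sqmod z ^+ n)%:E)%E.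
Proof.
move=> au z1; have [C HC] := rad1_abs (has_coef_rad1 au) z1.
have := @parseval R (fun n => a n * z ^+ n) C (fun t => u (cis t * z)) 1 HC.
rewrite sqmod1 => -> //; last first.
  move=> t; apply: csums_ext (au (cis t * z) _); last by rewrite sqmod_cisM.
  by move=> n; rewrite mulr1 exprMn; ring.
by congr (_ * _)%E; apply: eq_eseriesr => n _; rewrite expr1n mulr1 sqmodM sqmodX.
Qed.

Lemma circ_coef a u p : has_coef a u ->
  circ alpha u p = (\sum_(0 <= n <oo) (sqmod (a n) * (sqmod (of_coord p) ^+ n * bweight alpha (of_coord p)))%:E)%E.
Proof.
move=> au.
have e n : ((sqmod (a n) * (sqmod (of_coord p) ^+ n * bweight alpha (of_coord p)))%:E =
   (bweight alpha (of_coord p))%:E * (sqmod (a n) * sqmod (of_coord p) ^+ n)%:E)%E.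
  by rewrite -EFinM; congr (_%:E); ring.
under eq_eseriesr do rewrite e.
rewrite nneseriesZl; last by move=> n _; rewrite lee_fin mulr_ge0 ?exprn_ge0 ?sqmod_ge0.
have [z1|z1] := ltP (sqmod (of_coord p)) 1; last first.
  rewrite (circE a0 _ (has_coef_analytic au)) /bweight ltNge z1/= mul0r mul0e//.
have pp := two_pi_gt0 R.
have cF := sqmod_circle_cont (has_coef_analytic au) z1.
have := circle_coef au z1; rewrite integral_cint//; last by move=> t; exact: sqmod_ge0.
move=> E; rewrite (circE a0 _ (has_coef_analytic au)) EFinM; congr (_ * _)%E.
by rewrite EFinM E muleA -EFinM mulVf ?mul1e// gt_eqF.
Qed.

(** Parseval on each circle, then [moment] over the radii. *)
Lemma nrm2_coef a u : has_coef a u -> N u = (\sum_(0 <= n <oo) (sqmod (a n) * wn n)%:E)%E.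
Proof.
move=> au; rewrite nrm2_circ//; last by apply: mdisc_analytic; exact: has_coef_analytic au.
under eq_integral do rewrite (circ_coef _ au).
have mM n : measurable_fun setT (fun p : mR * mR => (sqmod (of_coord p) ^+ n * bweight alpha (of_coord p))%:E).
  apply/measurable_EFinP; apply: measurable_funM; last by apply: measurable_bweight; exact: cmeas_id.
  by apply: measurable_funX; apply: measurable_sqmod; exact: cmeas_id.
have M0 n (p : mR * mR) : (0 <= (sqmod (of_coord p) ^+ n * bweight alpha (of_coord p))%:E)%E.
  by rewrite lee_fin mulr_ge0 ?exprn_ge0 ?sqmod_ge0 ?bweight_ge0.
under eq_integral do under eq_eseriesr do rewrite EFinM.
rewrite integral_nneseries//.
- apply: eq_eseriesr => n _; rewrite ge0_integralZl//; first by rewrite moment.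
  by rewrite lee_fin sqmod_ge0.
- by move=> n; apply: emeasurable_funM.
- by move=> n p _; rewrite mule_ge0// lee_fin sqmod_ge0.
Qed.

Lemma nr_coef a u : has_coef a u -> L2 u -> series (fun n => sqmod (a n) * wn n) @ \oo --> nr u.
Proof.
move=> au Lu; apply: nneseries_real; first by move=> n; rewrite mulr_ge0 ?sqmod_ge0 ?wn_ge0.
by rewrite -(nrm2_coef au) nrE.
Qed.

Lemma nr_coef_ge a u n : has_coef a u -> L2 u -> \sum_(k < n) sqmod (a k) * wn k <= nr u.
Proof.
move=> au Lu; rewrite -lee_fin nrE// (nrm2_coef au) -sumEFin.
apply: (@nneseries_ge _ (fun k => (sqmod (a k) * wn k)%:E)) => k.
by rewrite lee_fin mulr_ge0 ?sqmod_ge0 ?wn_ge0.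
Qed.

(** The ratios [(n + 1) / (n + alpha + 2)] of [wn] tend to [1], so [q ^ n / wn n] is eventually
    nonincreasing. Hence weighted square-summability forces convergence on the whole disc. *)
Lemma wn_poly (q : R) : 0 < q < 1 -> exists2 C, 0 <= C & forall n, q ^+ n <= C * wn n.
Proof.
move=> /andP[q0 q1].
pose x n := q ^+ n / wn n.
have x0 n : 0 <= x n by rewrite divr_ge0 ?exprn_ge0 ?wn_ge0// ltW.
have [n0 hn0] : exists n0 : nat, forall n, (n0 <= n)%N -> q * (n%:R + alpha + 2) <= n.+1%:R.
  have q10 : 0 < 1 - q by rewrite subr_gt0.
  exists (Num.truncn ((q * (alpha + 2)) / (1 - q))).+1 => n hn.
  have : (q * (alpha + 2)) / (1 - q) <= n%:R.
    apply: le_trans (ltW (truncnS_gt _)) _; by rewrite ler_nat.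
  by rewrite ler_pdivrMr// -natr1; nra.
have xS n : (n0 <= n)%N -> x n.+1 <= x n.
  move=> /hn0 h; rewrite /x /= exprS invfM invf_div.
  have p0 : 0 < n%:R + alpha + 2 by rewrite ltr_wpDl// addr_ge0.
  have -> : q * q ^+ n * ((wn n)^-1 * ((n%:R + alpha + 2) / n.+1%:R)) =
    (q ^+ n / wn n) * (q * (n%:R + alpha + 2) / n.+1%:R) by ring.
  by rewrite ler_piMr ?x0// ler_pdivrMr// mul1r.
exists (\sum_(k < n0.+1) x k); first by apply: sumr_ge0 => k _.
move=> n; rewrite -ler_pdivrMr ?wn_gt0// -/(x n).
have sx k : (k <= n0)%N -> x k <= \sum_(k < n0.+1) x k.
  move=> kn; rewrite (bigD1 (Ordinal (kn : (k < n0.+1)%N)))//= lerDl.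
  by apply: sumr_ge0 => j _.
have [nn|/ltnW nn] := leqP n n0; first exact: sx.
apply: le_trans (_ : _ <= x n0) _; last exact: sx.
by elim: n nn => [|n ih]; rewrite leq_eqVlt => /predU1P[->//|]; rewrite ?ltnS// => h; apply: le_trans (xS _ h) (ih h).
Qed.

Lemma sqsum_rad1 a (C : R) : (forall n, \sum_(k < n) sqmod (a k) * wn k <= C) -> rad1 a.
Proof.
move=> aC q /andP[q0 q1].
have [K K0 HK] := @wn_poly (q ^+ 2) ltac:(by rewrite exprn_gt0//= expr_lt1// ltW).
have C0 : 0 <= C by have := aC 0%N; rewrite big_ord0.
exists (K * C + 1); first by rewrite addr_ge0// mulr_ge0.
move=> n; have h : sqmod (a n) * wn n <= C.
  apply: le_trans (aC n.+1); rewrite big_ord_recr/= lerDr.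
  by apply: sumr_ge0 => k _; rewrite mulr_ge0 ?sqmod_ge0 ?wn_ge0.
have h2 : (cabs (a n) * q ^+ n) ^+ 2 <= K * C.
  rewrite exprMn cabs_sqr -exprM mulnC exprM; apply: le_trans (_ : _ <= sqmod (a n) * (K * wn n)) _.
    by rewrite ler_wpM2l ?sqmod_ge0.
  by rewrite mulrCA ler_wpM2l.
have : 0 <= cabs (a n) * q ^+ n by rewrite mulr_ge0 ?cabs_ge0 ?exprn_ge0// ltW.
move: (cabs _ * _) h2 => y; nra.
Qed.

(** Plays the part of completeness: elements of the space are produced from their coefficients, here
    for [riesz] and for [V]. *)
Lemma has_coef_exists a (C : R) : (forall n, \sum_(k < n) sqmod (a k) * wn k <= C) ->
  exists u, [/\ has_coef a u, L2 u & nr u <= C].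
Proof.
move=> aC; have ra := sqsum_rad1 aC.
have [u hu] : {u | has_coef a u}.
  have H z : exists l, sqmod z < 1 -> csums (fun n => a n * z ^+ n) l.
    have [z1|] := ltP (sqmod z) 1; last by exists 0.
    by have [l hl] := rad1_csums ra z1; exists l.
  by exists (fun z => sval (cid (H z))) => z; exact: (svalP (cid (H z))).
have NC : (N u <= C%:E)%E.
  rewrite (nrm2_coef hu); apply: nneseries_le => n.
    by rewrite lee_fin mulr_ge0 ?sqmod_ge0 ?wn_ge0.
  by rewrite sumEFin lee_fin.
have Lu : L2 u by split; [apply: mdisc_analytic; exact: has_coef_analytic hu|exact: le_lt_trans NC (ltry _)].
by exists u; split => //; rewrite -lee_fin nrE.
Qed.

Lemma rin_coef a b u v : has_coef a u -> has_coef b v -> L2 u -> L2 v ->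
  series (fun n => complex.Re (a n * (b n)^*) * wn n) @ \oo --> rin u v.
Proof.
move=> au bv Lu Lv.
have h1 := nr_coef (has_coefD au bv) (L2D a0 Lu Lv).
have h2 := nr_coef (has_coefB au bv) (L2B a0 Lu Lv).
have -> : rin u v = (nr (fun z => u z + v z) - nr (fun z => u z - v z)) / 4.
  by rewrite nrD// nrB//; field.
have -> : series (fun n => complex.Re (a n * (b n)^*) * wn n) = (fun n =>
    (series (fun n => sqmod (a n + b n) * wn n) n - series (fun n => sqmod (a n - b n) * wn n) n) / 4).
  apply/funext => n; rewrite /series/= -sumrB mulr_suml; apply: eq_bigr => k _.
  by case: (a k) (b k) => x y [x' y']; rewrite /sqmod/=; field.
by apply: cvgM; [exact: cvgB|exact: cvg_cst].
Qed.

Lemma inner_coef a b u v : has_coef a u -> has_coef b v -> L2 u -> L2 v ->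
  csums (fun n => a n * (b n)^* * (wn n)%:C) (bergman_inner alpha u v).
Proof.
move=> au bv Lu Lv; apply/csums_ReIm; rewrite inner_rin /=; split.
  have -> : (fun n => complex.Re (a n * (b n)^* * (wn n)%:C)) = (fun n => complex.Re (a n * (b n)^*) * wn n).
    by apply/funext => n; case: (a n) (b n) => x y [x' y'] /=; ring.
  exact: rin_coef.
have -> : (fun n => complex.Im (a n * (b n)^* * (wn n)%:C)) = (fun n => complex.Re (a n * ('i * b n)^*) * wn n).
  by apply/funext => n; case: (a n) (b n) => x y [x' y'] /=; ring.
exact: rin_coef au (has_coefZ 'i bv) Lu (L2Z a0 'i Lv).
Qed.

Lemma L2X n : L2 (fun z : R[i] => z ^+ n).
Proof.
split; first by apply: mdisc_analytic; exact: analyticX.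
apply: le_lt_trans (nrm2_le (m := 1) a0 _ _) _; rewrite ?ltry//.
  by apply: mdisc_analytic; exact: analyticX.
by move=> w w1; rewrite sqmodX exprn_ile1 ?sqmod_ge0// ltW.
Qed.

Lemma inner_X a u n : has_coef a u -> L2 u ->
  bergman_inner alpha u (fun z => z ^+ n) = a n * (wn n)%:C.
Proof.
move=> au Lu; apply: csums_unique (inner_coef au (@has_coefX R n) Lu (L2X n)) _.
have := @csums_finite R (fun k => a k * ((k == n)%:R)^* * (wn k)%:C) n.+1.
rewrite big_ord_recr/= eqxx conjc_nat mulr1 big1 ?add0r; last first.
  by move=> k _; rewrite ltn_eqF// conjc_nat mulr0 mul0r.
by apply => k nk; rewrite gtn_eqF// conjc_nat mulr0 mul0r.
Qed.

Lemma L2_coef u : analytic_on_disc u -> L2 u -> has_coef (power_coef u) u.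
Proof. by move=> au Lu z z1; exact: power_coefP au Lu z z1. Qed.

End Coefficients.

(** * The orthogonality relation *)

Section Schur.
Variable R : realType.
Local Notation mR := (measurableTypeR R).
Local Notation leb := (@lebesgue_measure R).
Local Notation area := (@area R).
Variable alpha : R.
Hypothesis a0 : 0 <= alpha.
Implicit Types (u v g psi : R[i] -> R[i]) (z w c : R[i]) (a b : nat -> R[i]).
Local Notation N := (nrm2 alpha).
Local Notation nr := (nr alpha).
Local Notation L2 := (L2 alpha).
Local Notation rin := (rin alpha).
Local Notation wn := (wn alpha).
Local Notation inner := (bergman_inner alpha).
Local Notation circle := (`[0, 2 * pi]%classic : set mR).

Lemma tonelli_circle (h : mR * (mR * mR) -> \bar R) : measurable_fun setT h -> (forall q, 0 <= h q)%E ->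
  measurable_fun setT (fun p => \int[leb]_(t in circle) h (t, p))%E /\
  (\int[leb]_(t in circle) \int[area]_p h (t, p) = \int[area]_p \int[leb]_(t in circle) h (t, p))%E.
Proof.
move=> mh h0; pose h' (q : mR * (mR * mR)) : \bar R := (h q * (\1_circle q.1)%:E)%E.
have mh' : measurable_fun setT h'.
  apply: emeasurable_funM => //; apply/measurable_EFinP.
  by apply: (measurableT_comp (measurable_indic _)).
have h'0 q : (0 <= h' q)%E by rewrite mule_ge0// lee_fin.
have e p : (\int[leb]_(t in circle) h (t, p) = \int[leb]_t h' (t, p))%E.
  rewrite integral_mkcond; apply: eq_integral => t _.
  by rewrite /h' patchE indicE; case: ifP => _; rewrite ?mule1 ?mule0.
split.
  rewrite (_ : (fun p => _) = (fun p => \int[leb]_t h' (t, p))%E); last by apply/funext.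
  exact: (@measurable_fun_fubini_tonelli_G _ _ _ _ _ leb _ mh' h'0).
rewrite integral_mkcond.
transitivity (\int[leb]_t \int[area]_p h' (t, p))%E.
  apply: eq_integral => t _; rewrite patchE; case: ifPn => ht.
    by apply: eq_integral => p _; rewrite /h' indicE ht mule1.
  by rewrite integral0_eq// => p _; rewrite /h' indicE (negbTE ht) mule0.
by rewrite (tonelli_area _ mh' h'0); apply: eq_integral => p _; rewrite e.
Qed.

(** Polarization again: squared norms of [g + e k_s] are integrals of nonnegative functions, and
    these depend measurably on the parameter by Tonelli. *)
Lemma cmeas_inner d (T : measurableType d) (k : T -> R[i] -> R[i]) g : L2 g -> (forall s, L2 (k s)) ->
  cmeas (fun q : T * (mR * mR) => cut (k q.1) (of_coord q.2)) -> cmeas (fun s => inner g (k s)).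
Proof.
move=> Lg Lk mk.
have mN (e : R[i]) : measurable_fun setT (fun s => nr (fun z => g z + e * k s z) : mR).
  pose F (q : T * (mR * mR)) : \bar R := (sqmod (cut g (of_coord q.2) + e * cut (k q.1) (of_coord q.2)) * bweight alpha (of_coord q.2))%:E.
  have mF : measurable_fun setT F.
    have m2 : cmeas (fun q : T * (mR * mR) => of_coord q.2) by apply: cmeas_of_coord; exact: measurable_snd.
    apply/measurable_EFinP; apply: measurable_funM; last by apply: measurable_bweight.
    apply: measurable_sqmod; apply: cmeasD; first by apply: mdisc_comp => //; case: Lg.
    by apply: cmeasM => //; exact: cmeas_cst.
  have F0 q : (0 <= F q)%E by rewrite lee_fin mulr_ge0 ?sqmod_ge0 ?bweight_ge0.
  rewrite (_ : (fun s => _) = (fun s => fine (\int[area]_p F (s, p))%E)).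
    by apply: measurableT_comp (measurable_area_F mF F0); exact: fine_measurable.
  apply/funext => s; congr fine; apply: eq_integral => p _; congr (_%:E).
  by rewrite (@cut_bweight R alpha g (k s) (fun x y : R[i] => sqmod (x + e * y))).
have mr (e : R[i]) : measurable_fun setT (fun s => rin g (fun z => e * k s z) : mR).
  rewrite (_ : (fun s => _) = (fun s => (nr (fun z => g z + e * k s z) - nr (fun z => g z + (- e) * k s z)) / 4)).
    by apply: measurable_funM => //; apply: measurable_funB; exact: mN.
  apply/funext => s; have Le := L2Z a0 e (Lk s).
  have -> : nr (fun z => g z + - e * k s z) = nr (fun z => g z - e * k s z).
    by apply: nr_ext => z _; rewrite mulNr.
  by rewrite nrD// nrB//; field.
split; under eq_fun do rewrite inner_rin/=; last exact: mr.
rewrite (_ : (fun s => _) = (fun s => rin g (fun z => 1 * k s z))); first exact: mr.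
by apply/funext => s; apply: rin_ext => // z _; rewrite mul1r.
Qed.

(** The value [0] off the disc keeps every window square-integrable and the dependence on [z]
    measurable on the whole plane. *)
Definition Uc z u : R[i] -> R[i] := if sqmod z < 1 then U alpha z u else fun=> 0.

Lemma L2_Uc z u : L2 u -> L2 (Uc z u).
Proof. by move=> Lu; rewrite /Uc; case: ifP => z1; [exact: L2_U|exact: L2_cst]. Qed.

Lemma cmeas_Uc d (T : measurableType d) (t : T -> mR) (z : T -> R[i]) (w : T -> R[i]) u :
  mdisc u -> measurable_fun setT t -> cmeas z -> cmeas w ->
  cmeas (fun s => cut (Uc (z s) (rotate (t s) u)) (w s)).
Proof.
move=> mu mt mz mw.
rewrite (_ : (fun s => _) = (fun s => if (sqmod (z s) < 1) && (sqmod (w s) < 1) then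
    cut u (cis (t s) * moebius (z s) (w s)) * kern alpha (z s) (w s) else 0)).
  apply: cmeas_if; last exact: cmeas_cst.
    by apply: measurable_and; exact: measurable_in_disc.
  apply: cmeasM; last exact: cmeas_kern.
  by apply: mdisc_comp => //; apply: cmeasM; [exact: cmeas_cis|exact: cmeas_moebius].
apply/funext => s; rewrite /cut /Uc.
case: (ltP (sqmod (w s)) 1) => w1; rewrite ?andbF ?andbT//.
case: (ltP (sqmod (z s)) 1) => z1 //.
by rewrite UE// /rotate sqmod_cisM moebius_disc.
Qed.

Definition pf g psi (t : R) z : R[i] := inner g (Uc z (rotate t psi)).

Lemma cmeas_pf d (T : measurableType d) (t : T -> mR) (z : T -> R[i]) g psi : L2 g -> L2 psi ->
  measurable_fun setT t -> cmeas z -> cmeas (fun s => pf g psi (t s) (z s)).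
Proof.
move=> Lg Lpsi mt mz.
apply: (@cmeas_inner _ _ (fun s => Uc (z s) (rotate (t s) psi))) => //.
  by move=> s; apply: L2_Uc; exact: L2_rotate.
apply: (@cmeas_Uc _ _ (fun q => t q.1) (fun q => z q.1) (fun q => of_coord q.2)).
- by case: Lpsi.
- exact: (measurableT_comp mt measurable_fst).
- by case: mz => m1 m2; split; [exact: (measurableT_comp m1 measurable_fst)|exact: (measurableT_comp m2 measurable_fst)].
- by apply: cmeas_of_coord; exact: measurable_snd.
Qed.

Lemma inner_adjoint z u v : sqmod z < 1 -> L2 u -> L2 v -> inner (U alpha (- z) u) v = inner u (U alpha z v).
Proof.
move=> z1 Lu Lv; rewrite !inner_rin rin_adjoint// rin_adjoint//; last exact: L2Z.
by congr (_ +i* _); apply: rin_ext => // w _; exact: U_scale.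
Qed.

(** The Taylor coefficients of [U_(-z) g], by [AcoefP]; written as inner products they are
    measurable in [z]. *)
Definition Acoef g z n : R[i] := pf g (fun w => w ^+ n) 0 z / (wn n)%:C.

Lemma wnC_neq0 n : (wn n)%:C != 0 :> R[i].
Proof. by rewrite realC_eq0 gt_eqF// wn_gt0. Qed.

Lemma rotate0 u : rotate 0 u = u.
Proof. by apply/funext => w; rewrite /rotate cis0 mul1r. Qed.

Lemma AcoefP g z : analytic_on_disc g -> L2 g -> sqmod z < 1 -> has_coef (Acoef g z) (U alpha (- z) g).
Proof.
move=> ag Lg z1; have z1' := sqmodN_lt1 z1.
have aU := analytic_U (alpha := alpha) z1' ag; have LU := L2_U a0 z1' Lg.
have hc := L2_coef a0 aU LU.
rewrite (_ : Acoef g z = power_coef (U alpha (- z) g))//.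
apply/funext => n; rewrite /Acoef /pf rotate0 /Uc z1 -inner_adjoint//; last exact: L2X.
by rewrite (inner_X a0 n hc LU) mulfK// wnC_neq0.
Qed.

Lemma cmeas_Acoef g n : L2 g -> cmeas (fun p : mR * mR => Acoef g (of_coord p) n).
Proof.
move=> Lg; apply: cmeasM; last exact: cmeas_cst.
by apply: (@cmeas_pf _ _ (fun=> 0) (@of_coord R)) => //; [exact: L2X|exact: cmeas_id].
Qed.

(** The orthogonality integral for the window [w ^ n], divided by [wn n ^ 2]. *)
Definition Mn g n : \bar R := (\int[area]_p (lambda_weight (of_coord p) * sqmod (Acoef g (of_coord p) n))%:E)%E.

Lemma Mn_ge0 g n : (0 <= Mn g n)%E.
Proof. by apply: integral_ge0 => p _; rewrite lee_fin mulr_ge0 ?lambda_weight_ge0 ?sqmod_ge0. Qed.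

(** The integral of [|U_(-z) g|^2] at the point [x] of the circle of radius [x] turned by [t] is
    computed twice: by coefficients in [Qh_coef] and by invariance in [Qh_norm]. *)
Definition Qh g (x : R) (q : mR * (mR * mR)) : R :=
  lambda_weight (of_coord q.2) * sqmod (cut (Uc (- of_coord q.2) g) (cis q.1 * x%:C)).

Lemma measurable_Qh g x : mdisc g -> measurable_fun setT (Qh g x : mR * (mR * mR) -> mR).
Proof.
move=> mg; have m2 : cmeas (fun q : mR * (mR * mR) => of_coord q.2) by apply: cmeas_of_coord; exact: measurable_snd.
apply: measurable_funM; first exact: measurable_lambda_weight.
apply: measurable_sqmod.
rewrite -[g]rotate0.
apply: (@cmeas_Uc _ _ (fun=> 0) (fun q : mR * (mR * mR) => - of_coord q.2) (fun q => cis q.1 * x%:C)) => //.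
  exact: cmeasN.
by apply: cmeasM; [apply: cmeas_cis; exact: measurable_fst|exact: cmeas_cst].
Qed.

Lemma Qh_ge0 g x q : 0 <= Qh g x q.
Proof. by rewrite mulr_ge0 ?lambda_weight_ge0 ?sqmod_ge0. Qed.

Lemma sqmodC_lt1 (x : R) : 0 < x < 1 -> sqmod (x%:C) < 1.
Proof. by move=> /andP[x0 x1]; rewrite sqmodR expr_lt1// ltW. Qed.

Lemma Qh_coef g x : analytic_on_disc g -> L2 g -> 0 < x < 1 ->
  (\int[area]_p \int[leb]_(t in circle) (Qh g x (t, p))%:E =
   (2 * pi)%:E * \sum_(0 <= n <oo) (((x ^+ 2) ^+ n)%:E * Mn g n))%E.
Proof.
move=> ag Lg x01; have [mg _] := Lg; have x1 := sqmodC_lt1 x01.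
have mT n : measurable_fun setT (fun p : mR * mR => (lambda_weight (of_coord p) * sqmod (Acoef g (of_coord p) n))%:E).
  apply/measurable_EFinP; apply: measurable_funM; first by apply: measurable_lambda_weight; exact: cmeas_id.
  by apply: measurable_sqmod; exact: cmeas_Acoef.
have T0 n (p : mR * mR) : (0 <= (lambda_weight (of_coord p) * sqmod (Acoef g (of_coord p) n))%:E)%E.
  by rewrite lee_fin mulr_ge0 ?lambda_weight_ge0 ?sqmod_ge0.
have xn0 n : (0 <= ((x ^+ 2) ^+ n)%:E)%E by rewrite lee_fin exprn_ge0// sqr_ge0.
transitivity (\int[area]_p ((2 * pi)%:E * \sum_(0 <= n <oo) (((x ^+ 2) ^+ n)%:E *
    (lambda_weight (of_coord p) * sqmod (Acoef g (of_coord p) n))%:E)))%E.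
  apply: eq_integral => p _.
  have [z1|z1] := ltP (sqmod (of_coord p)) 1; last first.
    rewrite /Qh /lambda_weight ltNge z1/= integral0_eq; last by move=> t _; rewrite mul0r.
    rewrite eseries0 ?mule0// => n _ _; by rewrite mul0r mule0.
  have z1' := sqmodN_lt1 z1.
  transitivity (\int[leb]_(t in circle) ((lambda_weight (of_coord p))%:E * (sqmod (U alpha (- of_coord p) g (cis t * x%:C)))%:E))%E.
    apply: eq_integral => t _; rewrite -EFinM; congr (_%:E); rewrite /Qh /=; congr (_ * sqmod _).
    by rewrite /cut sqmod_cisM x1 /Uc z1'.
  have aU := analytic_U (alpha := alpha) z1' ag.
  rewrite ge0_integralZl//; last 3 first.
  - apply/measurable_EFinP; apply: measurable_funTS; apply: continuous_measurable_fun.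
    exact: sqmod_circle_cont.
  - by move=> t _; rewrite lee_fin sqmod_ge0.
  - by rewrite lee_fin lambda_weight_ge0.
  rewrite (circle_coef (AcoefP ag Lg z1) x1) muleCA; congr (_ * _)%E.
  rewrite -nneseriesZl; last by move=> n _; rewrite lee_fin mulr_ge0 ?exprn_ge0 ?sqmod_ge0.
  by apply: eq_eseriesr => n _; rewrite -!EFinM sqmodR; congr (_%:E); ring.
have mS : measurable_fun setT (fun p : mR * mR => \sum_(0 <= n <oo) (((x ^+ 2) ^+ n)%:E *
    (lambda_weight (of_coord p) * sqmod (Acoef g (of_coord p) n))%:E))%E.
  apply: ge0_emeasurable_sum => n; first by move=> p _ _; rewrite mule_ge0.
  by move=> _; apply: emeasurable_funM.
rewrite ge0_integralZl//; last 2 first.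
- by move=> p _; apply: nneseries_ge0 => n _ _; rewrite mule_ge0.
- by rewrite lee_fin; exact: ltW (two_pi_gt0 R).
congr (_ * _)%E; rewrite integral_nneseries//.
- by apply: eq_eseriesr => n _; rewrite ge0_integralZl.
- by move=> n; apply: emeasurable_funM.
- by move=> n p _; rewrite mule_ge0.
Qed.

(** Turning [z] together with the evaluation point takes the rotation out of the Moebius map and
    leaves the kernel unchanged, since both depend on [z^* w] up to a common factor. *)
Lemma Qh_rotate g x (t : R) p : 0 < x < 1 -> sqmod (of_coord p) < 1 ->
  lambda_weight (cis t * of_coord p) * sqmod (cut (Uc (- (cis t * of_coord p)) g) (cis t * x%:C)) =
  lambda_weight (of_coord p) * (sqmod (g (cis t * moebius (- of_coord p) x%:C)) *
    ((1 - sqmod (moebius (- of_coord p) x%:C)) `^ (2 + alpha) / (1 - x ^+ 2) `^ (2 + alpha))).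
Proof.
move=> x01 z1; have x1 := sqmodC_lt1 x01; have z1' := sqmodN_lt1 z1.
have e1 : lambda_weight (cis t * of_coord p) = lambda_weight (of_coord p).
  by rewrite /lambda_weight /lambda_density sqmod_cisM.
have c1 : (cis t)^* * cis t = 1 :> R[i] by rewrite mulrC mulc_conj sqmod_cis.
rewrite e1; congr (_ * _); rewrite /cut sqmod_cisM x1 /Uc -mulrN sqmod_cisM z1'.
rewrite UE ?sqmod_cisM// sqmodM.
have e2 : (cis t * - of_coord p)^* * (cis t * x%:C) = (- of_coord p)^* * x%:C :> R[i].
  rewrite conjcM; transitivity (((cis t)^* * cis t) * ((- of_coord p)^* * x%:C) : R[i]); first by ring.
  by rewrite c1 mul1r.
have -> : moebius (cis t * - of_coord p) (cis t * x%:C) = cis t * moebius (- of_coord p) x%:C.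
  by rewrite /moebius e2 -mulrBr mulrA.
congr (_ * _).
have -> : kern alpha (cis t * - of_coord p) (cis t * x%:C) = kern alpha (- of_coord p) x%:C.
  by rewrite /kern e2 sqmod_cisM.
rewrite -(sqmod_kern_weight alpha z1' x1) sqmodR mulfK//.
by rewrite gt_eqF// powR_gt0// subr_gt0 -sqmodR.
Qed.

Lemma conjcN z : ((- z)^* = - z^*)%R.
Proof. exact: rmorphN. Qed.

Lemma conjcB z w : ((z - w)^* = z^* - w^*)%R.
Proof. exact: rmorphB. Qed.

Lemma conjc_sum n (F : 'I_n -> R[i]) : ((\sum_(j < n) F j)^* = \sum_(j < n) (F j)^*)%R.
Proof. exact: rmorph_sum. Qed.

(** Exchanges point and parameter: the variable of integration becomes the argument of the fixed map
    [phi_(-x)], to which invariance applies. *)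
Lemma sqmod_moebius_swap z x : sqmod z < 1 -> 0 < x < 1 ->
  sqmod (moebius (- z) x%:C) = sqmod (moebius (- x%:C) z).
Proof.
move=> z1 x01; have x1 := sqmodC_lt1 x01.
rewrite /moebius !sqmodM !sqmodV !opprK addrC; congr (_ / _).
have -> : ((- x%:C)^* * z = ((- z)^* * x%:C)^*)%R.
  by rewrite conjcM conjc_conj !conjcN conjcR; ring.
by case: (_ * _)%R => p q; rewrite /sqmod/=; ring.
Qed.

(** After [Qh_rotate], Parseval makes the mean over [t] a function of [|phi_(-z)(x)|] alone. The
    swap and Moebius invariance then remove [x], except for the factor [(1 - x^2) ^ (2 + alpha)] in
    the denominator. *)
Lemma Qh_norm g x : analytic_on_disc g -> L2 g -> 0 < x < 1 ->
  (\int[area]_p \int[leb]_(t in circle) (Qh g x (t, p))%:E =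
   (2 * pi)%:E * (((1 - x ^+ 2) `^ (2 + alpha))^-1 / (alpha + 1))%:E * N g)%E.
Proof.
move=> ag Lg x01; have [mg _] := Lg; have x1 := sqmodC_lt1 x01.
have x1' : sqmod (- x%:C) < 1 by rewrite sqmodN.
have hg := L2_coef a0 ag Lg; set b := power_coef g in hg.
have a1 : 0 < alpha + 1 by rewrite ltr_wpDl.
pose k : R := ((1 - x ^+ 2) `^ (2 + alpha))^-1; have k0 : 0 <= k by rewrite invr_ge0 powR_ge0.
pose h (q : mR * (mR * mR)) : R := lambda_weight (of_coord q.2) * (sqmod (cut g (cis q.1 * moebius (- of_coord q.2) x%:C)) *
    ((1 - sqmod (moebius (- of_coord q.2) x%:C)) `^ (2 + alpha) * k)).
have m2 : cmeas (fun q : mR * (mR * mR) => of_coord q.2) by apply: cmeas_of_coord; exact: measurable_snd.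
have mm : cmeas (fun q : mR * (mR * mR) => moebius (- of_coord q.2) x%:C).
  by apply: cmeas_moebius; [exact: cmeasN|exact: cmeas_cst].
have mh : measurable_fun setT (h : mR * (mR * mR) -> mR).
  apply: measurable_funM; first exact: measurable_lambda_weight.
  apply: measurable_funM.
    apply: measurable_sqmod; apply: mdisc_comp => //; apply: cmeasM => //.
    by apply: cmeas_cis; exact: measurable_fst.
  apply: measurable_funM => //; apply: (measurableT_comp (measurable_powR _)).
  by apply: measurable_funB => //; exact: measurable_sqmod.
have h0 q : 0 <= h q by rewrite !mulr_ge0 ?lambda_weight_ge0 ?sqmod_ge0 ?powR_ge0.
have mQ := measurable_Qh x mg.
have mQE : measurable_fun setT (fun q : mR * (mR * mR) => (Qh g x q)%:E) by exact/measurable_EFinP.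
have mhE : measurable_fun setT (fun q : mR * (mR * mR) => (h q)%:E) by exact/measurable_EFinP.
have [_ <-] := @tonelli_circle (fun q => (Qh g x q)%:E) mQE (fun q => Qh_ge0 g x q).
transitivity (\int[leb]_(t in circle) \int[area]_p (h (t, p))%:E)%E.
  apply: eq_integral => t _.
  have := @area_rotate R (fun z => (lambda_weight z * sqmod (cut (Uc (- z) g) (cis t * x%:C)))%:E) t.
  move=> <-; last 2 first.
  - apply/measurable_EFinP.
    have mt : measurable_fun setT (fun p : mR * mR => ((t : mR), p)) by exact: measurable_pair1.
    exact: (measurableT_comp mQ mt).
  - by move=> z; rewrite lee_fin mulr_ge0 ?lambda_weight_ge0 ?sqmod_ge0.
  apply: eq_integral => p _; congr (_%:E).
  have [z1|z1] := ltP (sqmod (of_coord p)) 1; last first.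
    by rewrite /h /lambda_weight sqmod_cisM ltNge z1 !mul0r.
  rewrite (Qh_rotate g t x01 z1) /h /= /cut sqmod_cisM moebius_disc//; last by rewrite sqmodN.
have [_ ->] := @tonelli_circle (fun q => (h q)%:E) mhE h0.
pose Hs w : \bar R := (\sum_(0 <= n <oo) (sqmod (b n) * sqmod w ^+ n)%:E)%E.
pose G1 w : \bar R := (((1 - sqmod w) `^ (2 + alpha))%:E * Hs w)%E.
have t0 n w : (0 <= (sqmod (b n) * sqmod w ^+ n)%:E)%E by rewrite lee_fin mulr_ge0 ?exprn_ge0 ?sqmod_ge0.
have Hs0 w : (0 <= Hs w)%E by apply: nneseries_ge0 => n _ _.
have G10 w : (0 <= G1 w)%E by rewrite mule_ge0// lee_fin powR_ge0.
have msq : measurable_fun setT (fun p : mR * mR => sqmod (of_coord p) : mR) by apply: measurable_sqmod; exact: cmeas_id.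
have mG1 : measurable_fun setT (G1 \o @of_coord R).
  apply: emeasurable_funM.
    by apply/measurable_EFinP; apply: (measurableT_comp (measurable_powR _)); exact: measurable_funB.
  apply: ge0_emeasurable_sum => n; first by move=> p _ _.
  by move=> _; apply/measurable_EFinP; apply: measurable_funM => //; exact: measurable_funX.
have pp := two_pi_gt0 R.
transitivity (\int[area]_p (((2 * pi) * k)%:E * ((lambda_weight (of_coord p))%:E * G1 (moebius (- x%:C)%R (of_coord p)))))%E.
  apply: eq_integral => p _.
  have [z1|z1] := ltP (sqmod (of_coord p)) 1; last first.
    rewrite /h /lambda_weight ltNge z1/= mul0e mule0 integral0_eq// => t _; by rewrite mul0r.
  have z1' := sqmodN_lt1 z1; have y1 := moebius_disc z1' x1.
  set y := moebius (- of_coord p) x%:C in y1 *.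
  transitivity (\int[leb]_(t in circle) ((lambda_weight (of_coord p) * ((1 - sqmod y) `^ (2 + alpha) * k))%:E * (sqmod (g (cis t * y)))%:E))%E.
    by apply: eq_integral => t _; rewrite -EFinM /h /= -/y /cut sqmod_cisM y1; congr (_%:E); ring.
  rewrite ge0_integralZl//; last 3 first.
  - apply/measurable_EFinP; apply: measurable_funTS; apply: continuous_measurable_fun.
    exact: sqmod_circle_cont.
  - by move=> t _; rewrite lee_fin sqmod_ge0.
  - by rewrite lee_fin !mulr_ge0 ?lambda_weight_ge0 ?powR_ge0.
  rewrite (circle_coef hg y1) /G1 /Hs -(sqmod_moebius_swap z1 x01) -/y.
  rewrite !muleA -!EFinM; congr (_%:E * _)%E; ring.
have mGm : measurable_fun setT (fun p : mR * mR => (lambda_weight (of_coord p))%:E * G1 (moebius (- x%:C)%R (of_coord p)))%E.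
  apply: emeasurable_funM; first by apply/measurable_EFinP; apply: measurable_lambda_weight; exact: cmeas_id.
  by apply: (@measurable_comp_cmeas R _ _ _ _ G1) => //; apply: cmeas_moebius; [exact: cmeas_cst|exact: cmeas_id].
rewrite ge0_integralZl//; last 2 first.
- by move=> p _; rewrite mule_ge0// lee_fin lambda_weight_ge0.
- by rewrite lee_fin mulr_ge0// ltW.
rewrite lambda_moebius// nrm2_circ//.
have mc := measurable_circ a0 mg.
have -> : (\int[area]_p circ alpha g p = (alpha + 1)%:E * \int[area]_p ((lambda_weight (of_coord p))%:E * G1 (of_coord p)))%E.
  rewrite -ge0_integralZl//; last 3 first.
  - apply: emeasurable_funM => //.
    by apply/measurable_EFinP; apply: measurable_lambda_weight; exact: cmeas_id.
  - by move=> p _; rewrite mule_ge0// lee_fin lambda_weight_ge0.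
  - by rewrite lee_fin ltW.
  apply: eq_integral => p _; rewrite (circ_coef a0 _ hg).
  have [z1|z1] := ltP (sqmod (of_coord p)) 1; last first.
    rewrite /lambda_weight ltNge z1/= mul0e mule0 eseries0// => n _ _.
    by rewrite /bweight ltNge z1/= !mulr0.
  rewrite /G1 /Hs !muleA -!EFinM -nneseriesZl//.
  by apply: eq_eseriesr => n _; rewrite -EFinM bweight_lambda//; congr (_%:E); ring.
rewrite !muleA -!EFinM; congr (_%:E * _)%E; rewrite /k; field.
by rewrite gt_eqF//= gt_eqF// powR_gt0// subr_gt0 -sqmodR.
Qed.

Lemma schur_series g x : analytic_on_disc g -> L2 g -> 0 < x < 1 ->
  (\sum_(0 <= n <oo) (((x ^+ 2) ^+ n)%:E * Mn g n) = (((1 - x ^+ 2) `^ (2 + alpha))^-1 / (alpha + 1) * nr g)%:E)%E.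
Proof.
move=> ag Lg x01; have := Qh_coef ag Lg x01; rewrite (Qh_norm ag Lg x01) -nrE// -!EFinM => E.
have pp := two_pi_gt0 R.
have := congr1 (fun y => ((2 * pi)^-1)%:E * y)%E E.
rewrite muleA -!EFinM mulVf ?gt_eqF// mul1e => <-; congr (_%:E).
by rewrite -[2 * pi * _ * nr g]mulrA mulKf// gt_eqF.
Qed.

Lemma Mn_fin g n : analytic_on_disc g -> L2 g -> (Mn g n \is a fin_num)%E.
Proof.
(* Any [x] in []0, 1[] would do: each term of a finite sum of nonnegative terms is finite. *)
move=> ag Lg; have x01 : 0 < (1 / 2 : R) < 1 by lra.
have S := schur_series ag Lg x01.
have t0 k : (0 <= (((1 / 2) ^+ 2) ^+ k)%:E * Mn g k)%E by rewrite mule_ge0 ?Mn_ge0// lee_fin exprn_ge0// sqr_ge0.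
have := nneseries_ge n.+1 t0; rewrite S big_ord_recr/= => H.
have : ((((1 / 2) ^+ 2) ^+ n)%:E * Mn g n < +oo)%E.
  apply: le_lt_trans (ltry _); apply: le_trans H; rewrite leeDr// sume_ge0// => i _; exact: t0.
have q0 : (0 < ((1 / 2 : R) ^+ 2) ^+ n) by rewrite !exprn_gt0.
rewrite ge0_fin_numE ?Mn_ge0//; case: (Mn g n) (Mn_ge0 g n) => [r _ _|_|//]; first by rewrite ltry.
by rewrite gt0_muley// lte_fin.
Qed.

(* By [schur_series] the generating function of [Mn g] is proportional to [nr g]. *)
Lemma Mn_prop g n : analytic_on_disc g -> L2 g ->
  fine (Mn g n) = nr g * fine (Mn (fun=> 1) n).
Proof.
move=> ag Lg; have a1 := @analytic_cst R 1; have L1 := L2_cst a0 1.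
apply/eqP; rewrite -subr_eq0; apply/eqP; move: n.
apply: (@pseries_real_eq0 R (fun n => fine (Mn g n) - nr g * fine (Mn (fun=> 1) n)) 1) => // y /andP[y0 y1].
pose x := Num.sqrt y; have x2 : x ^+ 2 = y by rewrite sqr_sqrtr// ltW.
have x01 : 0 < x < 1.
  by rewrite sqrtr_gt0 y0 /= -(@expr_lt1 _ 2) ?sqrtr_ge0// x2.
have H u : analytic_on_disc u -> L2 u -> series (fun n => y ^+ n * fine (Mn u n)) @ \oo -->
    ((1 - x ^+ 2) `^ (2 + alpha))^-1 / (alpha + 1) * nr u.
  move=> au Lu; apply: nneseries_real.
    by move=> n; rewrite mulr_ge0 ?exprn_ge0 ?fine_ge0 ?Mn_ge0// ltW.
  rewrite -(schur_series au Lu x01); apply: eq_eseriesr => n _.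
  by rewrite EFinM fineK ?Mn_fin// x2.
have -> : series (fun n => (fine (Mn g n) - nr g * fine (Mn (fun=> 1) n)) * y ^+ n) = (fun n =>
    series (fun n => y ^+ n * fine (Mn g n)) n - nr g * series (fun n => y ^+ n * fine (Mn (fun=> 1) n)) n).
  by apply/funext => n; rewrite /series/= mulr_sumr -sumrB; apply: eq_bigr => k _; rewrite mulrBl [_ * y ^+ k]mulrC -mulrA [_ * y ^+ k]mulrC.
have -> : (0 : R) = ((1 - x ^+ 2) `^ (2 + alpha))^-1 / (alpha + 1) * nr g -
    nr g * (((1 - x ^+ 2) `^ (2 + alpha))^-1 / (alpha + 1) * nr (fun=> 1)).
  by rewrite nr_cst// sqmod1; ring.
by apply: cvgB; [exact: H|apply: cvgM; [exact: cvg_cst|exact: H]].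
Qed.

(** Pairing with the constant [1] evaluates [U_z w^n] at [0], up to conjugation. *)
Lemma sqmod_inner1 z n : sqmod z < 1 ->
  sqmod (inner (fun=> 1) (U alpha z (fun w => w ^+ n))) = sqmod z ^+ n * (1 - sqmod z) `^ (2 + alpha).
Proof.
move=> z1; set v := U alpha z _.
have av : analytic_on_disc v by apply: analytic_U => //; exact: analyticX.
have Lv : L2 v by apply: L2_U => //; exact: L2X.
have aiv : analytic_on_disc (fun w => 'i * v w) by exact: (analyticM (@analytic_cst R 'i) av).
rewrite inner_rin rinC rin_cst// rinC (rin_cst a0 _ aiv (L2Z a0 'i Lv)).
have o1 : sqmod (0 : R[i]) < 1 by rewrite sqmod0.
transitivity (sqmod (v 0)).
  by rewrite rmorph1 !mulr1; case: (v 0) => x y; rewrite /sqmod/=; ring.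
rewrite /v UE// sqmodM sqmod_kern// sqmodX /moebius sub0r mulr0 subr0 divr1 sqmodN.
by rewrite sqmod1 divr1.
Qed.

(** For [g = 1] the integrand is a multiple of [|z|^(2 n)] against the weight, so [moment] computes
    it. *)
Lemma Mn1 n : Mn (fun=> 1) n = ((alpha + 1)^-1 / wn n)%:E.
Proof.
have a1 : 0 < alpha + 1 by rewrite ltr_wpDl.
have w0 : 0 < wn n by exact: wn_gt0.
transitivity (\int[area]_p (((alpha + 1)^-1 / wn n ^+ 2)%:E * (sqmod (of_coord p) ^+ n * bweight alpha (of_coord p))%:E))%E.
  apply: eq_integral => p _; rewrite -EFinM; congr (_%:E).
  have [z1|z1] := ltP (sqmod (of_coord p)) 1; last first.
    by rewrite /lambda_weight /bweight ltNge z1/= mul0r !mulr0.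
  rewrite /Acoef /pf rotate0 /Uc z1 sqmodM sqmod_inner1// sqmodV sqmodR bweight_lambda//.
  by move: (_ `^ _) (_ ^+ n) (lambda_weight _) => P Q l; field; rewrite !gt_eqF.
rewrite ge0_integralZl//; last 3 first.
- apply/measurable_EFinP; apply: measurable_funM; last by apply: measurable_bweight; exact: cmeas_id.
  by apply: measurable_funX; apply: measurable_sqmod; exact: cmeas_id.
- by move=> p _; rewrite lee_fin mulr_ge0 ?exprn_ge0 ?sqmod_ge0 ?bweight_ge0.
- by rewrite lee_fin divr_ge0 ?sqr_ge0// invr_ge0 ltW.
by rewrite moment// -EFinM; congr (_%:E); field; rewrite !gt_eqF.
Qed.

Lemma MnE g n : analytic_on_disc g -> L2 g -> Mn g n = (nr g / (alpha + 1) / wn n)%:E.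
Proof.
by move=> ag Lg; rewrite -[LHS]fineK ?Mn_fin// Mn_prop// Mn1 /= mulrA.
Qed.

(** As a function of [t], [pf] is a Fourier series in [e^(- i n t)] whose coefficients combine those
    of [U_(-z) g] and [psi]. Conjugation turns it into the power series form that [parseval]
    expects. *)
Lemma pf_circle g psi z : analytic_on_disc g -> L2 g -> analytic_on_disc psi -> L2 psi -> sqmod z < 1 ->
  (\int[leb]_(t in circle) (sqmod (pf g psi t z))%:E =
   (2 * pi)%:E * \sum_(0 <= n <oo) (sqmod (Acoef g z n) * (sqmod (power_coef psi n) * wn n ^+ 2))%:E)%E.
Proof.
move=> ag Lg ap Lp z1; have hc := L2_coef a0 ap Lp; set c := power_coef psi in hc *.
have z1' := sqmodN_lt1 z1; have hA := AcoefP ag Lg z1; have LU := L2_U a0 z1' Lg.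
pose d n := (Acoef g z n)^* * c n * (wn n)%:C.
have dC k : \sum_(n < k) cabs (d n) <= (nr (U alpha (- z) g) + nr psi) / 2.
  apply: (@le_trans _ _ ((\sum_(n < k) sqmod (Acoef g z n) * wn n + \sum_(n < k) sqmod (c n) * wn n) / 2)); last first.
    by rewrite ler_wpM2r// lerD// nr_coef_ge.
  rewrite -big_split/= mulr_suml; apply: ler_sum => n _.
  rewrite /d !cabsM cabsJ cabsR ger0_norm ?wn_ge0// -mulrDl [leRHS]mulrAC.
  rewrite ler_wpM2r ?wn_ge0// -!cabs_sqr; have := sqr_ge0 (cabs (Acoef g z n) - cabs (c n)).
  by rewrite !expr2; lra.
have dS t : csums (fun n => d n * (cis t * 1) ^+ n) ((pf g psi t z)^*)%R.
  have hr : has_coef (fun n => c n * cis t ^+ n) (rotate t psi).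
    move=> w w1; apply: csums_ext (hc (cis t * w) _); last by rewrite sqmod_cisM.
    by move=> n; rewrite exprMn mulrA.
  have := inner_coef a0 hA hr LU (L2_rotate a0 t Lp).
  rewrite inner_adjoint//; last exact: L2_rotate.
  rewrite (_ : inner g _ = pf g psi t z); last by rewrite /pf /Uc z1.
  move=> H e e0; have [k Hk] := H e e0; exists k => n kn.
  have -> : (\sum_(j < n) d j * (cis t * 1) ^+ j - (pf g psi t z)^* =
     (\sum_(j < n) Acoef g z j * (c j * cis t ^+ j)^* * (wn j)%:C - pf g psi t z)^*)%R.
    rewrite conjcB conjc_sum; congr (_ - _); apply: eq_bigr => j _.
    by rewrite /d mulr1 !conjcM !conjc_conj conjcR; ring.
  by rewrite cabsJ; exact: Hk.
have := parseval dC _ dS; rewrite sqmod1 => /(_ (lexx _)).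
under eq_integral do rewrite sqmodJ.
move=> ->; congr (_ * _)%E; apply: eq_eseriesr => n _.
by rewrite expr1n mulr1 /d (sqmodM _ (wn n)%:C) (sqmodM _ (c n)) sqmodJ sqmodR mulrA.
Qed.

(** Parseval in [t] splits the integral over the Taylor index, with a factor [wn n ^ 2]; against
    [1 / wn n] from [MnE] this leaves [wn n], and the sum is the squared norm of [psi]. *)
Theorem orthogonality g psi : analytic_on_disc g -> L2 g -> analytic_on_disc psi -> L2 psi ->
  (\int[area]_p \int[leb]_(t in circle) (lambda_weight (of_coord p) * sqmod (pf g psi t (of_coord p)))%:E =
   (2 * pi / (alpha + 1) * nr g * nr psi)%:E)%E.
Proof.
move=> ag Lg ap Lp; have hc := L2_coef a0 ap Lp; set c := power_coef psi in hc *.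
have a1 : 0 < alpha + 1 by rewrite ltr_wpDl.
have pp := two_pi_gt0 R.
have mT n : measurable_fun setT (fun p : mR * mR => (lambda_weight (of_coord p) * sqmod (Acoef g (of_coord p) n))%:E).
  apply/measurable_EFinP; apply: measurable_funM; first by apply: measurable_lambda_weight; exact: cmeas_id.
  by apply: measurable_sqmod; exact: cmeas_Acoef.
have T0 n (p : mR * mR) : (0 <= (lambda_weight (of_coord p) * sqmod (Acoef g (of_coord p) n))%:E)%E.
  by rewrite lee_fin mulr_ge0 ?lambda_weight_ge0 ?sqmod_ge0.
have k0 n : (0 <= (sqmod (c n) * wn n ^+ 2)%:E)%E by rewrite lee_fin mulr_ge0 ?sqmod_ge0 ?sqr_ge0.
pose F n (p : mR * mR) : \bar R := ((sqmod (c n) * wn n ^+ 2)%:E * (lambda_weight (of_coord p) * sqmod (Acoef g (of_coord p) n))%:E)%E.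
have mF n : measurable_fun setT (F n) by exact: emeasurable_funM.
have F0 n p : (0 <= F n p)%E by rewrite mule_ge0.
transitivity (\int[area]_p ((2 * pi)%:E * \sum_(0 <= n <oo) F n p))%E.
  apply: eq_integral => p _.
  have [z1|z1] := ltP (sqmod (of_coord p)) 1; last first.
    rewrite /F /lambda_weight ltNge z1/= integral0_eq; last by move=> t _; rewrite mul0r.
    by rewrite eseries0 ?mule0// => n _ _; rewrite mul0r mule0.
  under eq_integral do rewrite EFinM.
  rewrite ge0_integralZl//; last 3 first.
  - apply/measurable_EFinP; apply: measurable_funTS; apply: measurable_sqmod.
    by apply: (@cmeas_pf _ _ id (fun=> of_coord p)) => //; exact: cmeas_cst.
  - by move=> t _; rewrite lee_fin sqmod_ge0.
  - by rewrite lee_fin lambda_weight_ge0.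
  rewrite pf_circle// muleCA; congr (_ * _)%E.
  rewrite -nneseriesZl; last by move=> n _; rewrite lee_fin mulr_ge0 ?sqmod_ge0// mulr_ge0 ?sqmod_ge0 ?sqr_ge0.
  by apply: eq_eseriesr => n _; rewrite /F -!EFinM; congr (_%:E); ring.
rewrite ge0_integralZl//; last 3 first.
- by apply: ge0_emeasurable_sum => n.
- by move=> p _; apply: nneseries_ge0.
- by rewrite lee_fin ltW.
rewrite integral_nneseries//.
transitivity ((2 * pi)%:E * \sum_(0 <= n <oo) ((nr g / (alpha + 1))%:E * (sqmod (c n) * wn n)%:E))%E.
  congr (_ * _)%E; apply: eq_eseriesr => n _; rewrite /F ge0_integralZl// -[X in (_ * X)%E]/(Mn g n) MnE// -!EFinM.
  by congr (_%:E); have := wn_gt0 n a0; move=> w0; field; rewrite !gt_eqF.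
rewrite nneseriesZl; last by move=> n _; rewrite lee_fin mulr_ge0 ?sqmod_ge0 ?wn_ge0.
by rewrite -(nrm2_coef a0 hc) -nrE// -!EFinM; congr (_%:E); ring.
Qed.

End Schur.

(** * Bounded forms and the localization operator *)

Section Riesz.
Variable R : realType.
Variable alpha : R.
Hypothesis a0 : 0 <= alpha.
Implicit Types (u v g h : R[i] -> R[i]) (z w c : R[i]) (a b : nat -> R[i]) (t : R).
Local Notation nr := (nr alpha).
Local Notation L2 := (L2 alpha).
Local Notation rin := (rin alpha).
Local Notation wn := (wn alpha).
Local Notation inner := (bergman_inner alpha).

Lemma innerDl u1 u2 v : L2 u1 -> L2 u2 -> L2 v -> inner (fun z => u1 z + u2 z) v = inner u1 v + inner u2 v.
Proof.
move=> L1 L2' Lv; by rewrite !inner_rin !rinDl//; exact: L2Z.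
Qed.

Lemma innerZl c u v : L2 u -> L2 v -> inner (fun z => c * u z) v = c * inner u v.
Proof.
move=> Lu Lv; have Liv := L2Z a0 'i Lv.
rewrite inner_rin !rin_mulJ !rin_mulr// conjc_conj.
rewrite !inner_rin; have -> : rin u (fun z => 'i * ('i * v z)) = - rin u v.
  rewrite (@rin_ext _ _ u u _ (fun z => (-1)%:C * v z))//; last first.
    by move=> z _; case: (v z) => x y; apply/eqP; rewrite eq_complex/=; apply/andP; split; apply/eqP; ring.
  by rewrite rinC rinZ// rinC mulN1r.
by case: c => x y; apply/eqP; rewrite eq_complex/=; apply/andP; split; apply/eqP; ring.
Qed.

Lemma inner_sym u v : L2 u -> L2 v -> inner v u = ((inner u v)^*)%R.
Proof.
move=> Lu Lv; rewrite !inner_rin.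
have -> : rin v (fun z => 'i * u z) = - rin u (fun z => 'i * v z).
  rewrite rinC rin_mulJ (@rin_ext _ _ u u _ (fun z => (-1)%:C * ('i * v z)))//; last first.
    by move=> z _; case: (v z) => x y; apply/eqP; rewrite eq_complex/=; apply/andP; split; apply/eqP; ring.
  by rewrite rinC rinZ//; [rewrite rinC mulN1r|exact: L2Z].
by rewrite (rinC alpha v u).
Qed.

Lemma innerDr u v1 v2 : L2 u -> L2 v1 -> L2 v2 -> inner u (fun z => v1 z + v2 z) = inner u v1 + inner u v2.
Proof.
move=> Lu L1 L2'; have L12 := L2D a0 L1 L2'.
by rewrite (inner_sym L12 Lu) innerDl// rmorphD/= -!inner_sym.
Qed.

Lemma innerZr c u v : L2 u -> L2 v -> inner u (fun z => c * v z) = (c^* * inner u v)%R.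
Proof.
move=> Lu Lv; have Lc := L2Z a0 c Lv.
by rewrite (inner_sym Lc Lu) innerZl// conjcM -inner_sym.
Qed.

Definition antilinear (F : (R[i] -> R[i]) -> R[i]) : Prop :=
  (forall h1 h2, L2 h1 -> L2 h2 -> F (fun z => h1 z + h2 z) = F h1 + F h2) /\
  (forall c h, L2 h -> F (fun z => c * h z) = (c^* * F h)%R).

Lemma inner_antilinear u : L2 u -> antilinear (inner u).
Proof. by move=> Lu; split => *; [exact: innerDr|exact: innerZr]. Qed.

Lemma psumS b n : psum b n.+1 = fun z => psum b n z + b n * z ^+ n.
Proof. by apply/funext => z; rewrite /psum big_ord_recr. Qed.

Lemma L2_psum b n : L2 (psum b n).
Proof.
elim: n => [|n ih].
  by apply: (L2_ext _ (L2_cst a0 0)) => z _; rewrite /psum big_ord0.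
by rewrite psumS; apply: L2D => //; apply: L2Z => //; exact: L2X.
Qed.

Lemma antilinear_psum F b n : antilinear F -> F (psum b n) = (\sum_(k < n) (b k)^* * F (fun z => z ^+ k))%R.
Proof.
move=> [FD FZ]; elim: n => [|n ih].
  rewrite big_ord0 (_ : psum b 0 = fun z => 0 * 0); last by apply/funext => z; rewrite /psum big_ord0 mul0r.
  by rewrite (FZ 0 (fun=> 0) (L2_cst a0 0)) (_ : (0 : R[i])^* = 0)%R ?mul0r// conjcR.
have LX := L2X a0 n.
by rewrite psumS FD ?ih ?FZ ?big_ord_recr//; [exact: L2_psum|exact: L2Z].
Qed.

Lemma inner_psum a u b n : has_coef a u -> L2 u ->
  inner u (psum b n) = (\sum_(k < n) a k * (b k)^* * (wn k)%:C)%R.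
Proof.
move=> ha Lu; rewrite (antilinear_psum _ _ (inner_antilinear Lu)).
by apply: eq_bigr => k _; rewrite (inner_X a0 k ha Lu) mulrA [(_^* * _)%R]mulrC.
Qed.

Lemma Re_sum n (F : 'I_n -> R[i]) : complex.Re (\sum_k F k) = \sum_k complex.Re (F k).
Proof. by apply: (big_morph (@complex.Re R)) => // -[? ?] []. Qed.

Lemma rinE u v : rin u v = complex.Re (inner u v).
Proof. by rewrite inner_rin. Qed.

Lemma Re_sqmod c (x : R) : complex.Re (c * c^* * x%:C)%R = sqmod c * x.
Proof. by rewrite mulc_conj -rmorphM. Qed.

Lemma Re_sum_sqmod b n : complex.Re (\sum_(k < n) b k * (b k)^* * (wn k)%:C)%R = \sum_(k < n) sqmod (b k) * wn k.
Proof. by rewrite Re_sum; apply: eq_bigr => k _; rewrite Re_sqmod. Qed.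

Lemma nr_psum b n : nr (psum b n) = \sum_(k < n) sqmod (b k) * wn k.
Proof.
have Lp := L2_psum b n; rewrite -rinuu// rinE (inner_psum _ _ (has_coef_psum b n) Lp).
by rewrite Re_sum; apply: eq_bigr => k _; rewrite ltn_ord Re_sqmod.
Qed.

Lemma nr_sub_psum b h n : has_coef b h -> L2 h ->
  nr (fun z => h z - psum b n z) = nr h - \sum_(k < n) sqmod (b k) * wn k.
Proof.
move=> hb Lh; have Lp := L2_psum b n; rewrite nrB// nr_psum rinE (inner_psum _ _ hb Lh).
by rewrite Re_sum_sqmod; ring.
Qed.

Lemma analytic_psum b n : analytic_on_disc (psum b n).
Proof. exact: has_coef_analytic (has_coef_psum b n). Qed.

(* Boundedness of [F] is stated as [Re (F h) <= (K + nr h) / 2], which by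
   homogeneity amounts to [|F h|^2 <= K * nr h]. *)
Lemma riesz F (K : R) : antilinear F ->
  (forall h, analytic_on_disc h -> L2 h -> complex.Re (F h) <= (K + nr h) / 2) ->
  exists u, [/\ analytic_on_disc u, L2 u, nr u <= K &
    forall h, analytic_on_disc h -> L2 h -> inner u h = F h].
Proof.
move=> FA FK; have [FD FZ] := FA.
pose a m : R[i] := F (fun z => z ^+ m) / (wn m)%:C.
have Fa m : F (fun z => z ^+ m) = a m * (wn m)%:C by rewrite /a divfK// wnC_neq0.
have Fp b n : F (psum b n) = (\sum_(k < n) a k * (b k)^* * (wn k)%:C)%R.
  rewrite antilinear_psum//; apply: eq_bigr => k _.
  by rewrite Fa mulrA [(_^* * _)%R]mulrC.
(* Tested on the polynomial with coefficients [a], the hypothesis reads [S <= (K + S) / 2]. *)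
have aK n : \sum_(k < n) sqmod (a k) * wn k <= K.
  have := FK _ (@analytic_psum a n) (L2_psum a n).
  rewrite Fp nr_psum Re_sum_sqmod.
  by move: (\sum_(_ < _) _) => S ?; lra.
have [u [ha Lu uK]] := has_coef_exists a0 aK.
have K0 : 0 <= K by apply: le_trans uK; exact: nr_ge0.
have aZ c h : analytic_on_disc h -> analytic_on_disc (fun z => c * h z).
  by move=> ah; exact: (@analyticM R _ h (@analytic_cst R c) ah).
have FKk h (k : R) : 0 < k -> analytic_on_disc h -> L2 h -> complex.Re (F h) <= (K / k + k * nr h) / 2.
  move=> k0 ah Lh; have := FK _ (aZ k%:C _ ah) (L2Z a0 k%:C Lh).
  rewrite FZ// nrZ// sqmodR conjcR.
  have -> : complex.Re (k%:C * F h) = k * complex.Re (F h) by case: (F h) => ? ? /=; ring.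
  move: (complex.Re _) (nr h) => x y H.
  have -> : (K / k + k * y) / 2 = (K + k ^+ 2 * y) / 2 / k by field; rewrite gt_eqF.
  by rewrite ler_pdivlMr// mulrC.
have Fabs h (k : R) : 0 < k -> analytic_on_disc h -> L2 h -> `|complex.Re (F h)| <= (K / k + k * nr h) / 2.
  move=> k0 ah Lh; rewrite ler_norml FKk// andbT.
  have := FKk _ _ k0 (aZ (-1)%:C _ ah) (L2Z a0 (-1)%:C Lh).
  rewrite FZ// nrZ// sqmodR conjcR sqrrN expr1n mul1r.
  have -> : complex.Re ((-1)%:C * F h) = - complex.Re (F h) by case: (F h) => ? ? /=; ring.
  by rewrite lerNl.
have main h : analytic_on_disc h -> L2 h -> complex.Re (inner u h) = complex.Re (F h).
  move=> ah Lh; have hb := L2_coef a0 ah Lh; set b := power_coef h in hb.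
  have /csums_ReIm[c1 _] := inner_coef a0 ha hb Lu Lh.
  have c2 : series (fun n => complex.Re (a n * (b n)^* * (wn n)%:C)%R) @ \oo --> complex.Re (F h).
    apply/cvgrPdist_le => e e0.
    (* Balances the two terms of [Fabs]: [K / k] is at most [e], and the squared norm of the
       remainder is eventually at most [e / k]. *)
    pose k : R := (K + 1) / e; have k0 : 0 < k by rewrite divr_gt0// ltr_wpDl.
    have c3 := nr_coef a0 hb Lh; have ek : 0 < e / k by rewrite divr_gt0.
    move/cvgrPdist_le/(_ _ ek): c3; apply: filterS => n.
    rewrite /series/= !big_mkord => H.
    have -> : \sum_(k < n) complex.Re (a k * (b k)^* * (wn k)%:C)%R = complex.Re (F (psum b n)).
      by rewrite Fp Re_sum.
    have Lp := L2_psum b n; have Lm := L2Z a0 (-1)%:C Lp; have Ld := L2B a0 Lh Lp.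
    have ad : analytic_on_disc (fun z => h z - psum b n z) by exact: (@analyticB R _ _ ah (@analytic_psum b n)).
    have E : F (fun z => h z - psum b n z) = F h - F (psum b n).
      rewrite (_ : (fun z => _) = (fun z => h z + (-1)%:C * psum b n z)); last first.
        by apply/funext => z; rewrite rmorphN mulN1r.
      by rewrite FD// FZ// conjcR rmorphN mulN1r.
    have -> : complex.Re (F h) - complex.Re (F (psum b n)) = complex.Re (F (fun z => h z - psum b n z)).
      by rewrite E; case: (F h) (F (psum b n)) => ? ? [].
    apply: le_trans (Fabs _ _ k0 ad Ld) _.
    have H2 : k * nr (fun z => h z - psum b n z) <= e.
      by rewrite mulrC -ler_pdivlMr// nr_sub_psum//; apply: le_trans H; exact: ler_norm.
    have H1 : K / k <= e.
      by rewrite /k invf_div mulrCA ler_piMr ?(ltW e0)// ler_pdivrMr ?mul1r ?lerDl// ltr_wpDl.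
    by move: H1 H2; move: (K / k) (k * _) => x y; lra.
  exact: (cvg_unique _ c1 c2).
exists u; split => //; first exact: has_coef_analytic ha.
move=> h ah Lh; have m1 := main h ah Lh.
(* Imaginary parts are the real parts at ['i h]. *)
have m2 := main _ (aZ 'i h ah) (L2Z a0 'i Lh).
move: m1 m2; rewrite innerZr// FZ//; case: (inner u h) (F h) => x y [x' y'] /= -> m2.
by congr (_ +i* _); move: m2; lra.
Qed.

End Riesz.

(** * The form of the localization operator for bounded nonnegative [f] *)

Section Form.
Variable R : realType.
Local Notation mR := (measurableTypeR R).
Local Notation leb := (@lebesgue_measure R).
Local Notation area := (@area R).
Variable alpha : R.
Hypothesis a0 : 0 <= alpha.
Implicit Types (u v g h : R[i] -> R[i]) (z w c : R[i]) (a b : nat -> R[i]) (t : R).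
Local Notation nr := (nr alpha).
Local Notation L2 := (L2 alpha).
Local Notation rin := (rin alpha).
Local Notation inner := (bergman_inner alpha).
Local Notation circle := (`[0, 2 * pi]%classic : set mR).
Variable psi : R[i] -> R[i].
Hypothesis ap : analytic_on_disc psi.
Hypothesis Lp : L2 psi.
Hypothesis np : nr psi = 1.
Variables (f : R[i] -> R) (M : R).
Hypothesis mf : measurable_fun setT (fun p : mR * mR => f (of_coord p) : mR).
Hypothesis f0 : forall z, 0 <= f z.
Hypothesis fM : forall z, f z <= M.
Hypothesis M0 : 0 < M.
Let W z := f z * lambda_weight z.
Hypothesis iW : (\int[area]_p (f (of_coord p) * lambda_weight (of_coord p))%:E < +oo)%E.
Local Notation p_ g t z := (pf alpha g psi t z).

Let LU t z : L2 (Uc alpha z (rotate t psi)).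
Proof. by apply: L2_Uc => //; exact: L2_rotate. Qed.

Let pD g h t z : L2 g -> L2 h -> p_ (fun w => g w + h w) t z = p_ g t z + p_ h t z.
Proof. by move=> Lg Lh; exact: innerDl. Qed.

Let pZ c g t z : L2 g -> p_ (fun w => c * g w) t z = c * p_ g t z.
Proof. by move=> Lg; exact: innerZl. Qed.

Let nrU t z : nr (Uc alpha z (rotate t psi)) <= 1.
Proof.
rewrite /Uc; case: ifP => z1; last by rewrite nr_cst// sqmod0.
by rewrite nr_U//; [rewrite nr_rotate//; [rewrite -np|case: Lp]|exact: L2_rotate].
Qed.

(** Crude but uniform in [t] and [z]: it secures integrability, after which signed integrals may be
    split. *)
Let sqmod_p_le g t z : L2 g -> sqmod (p_ g t z) <= 2 * ((nr g + 1) / 2) ^+ 2.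
Proof.
move=> Lg; rewrite /pf inner_rin; have Liu := L2Z a0 'i (LU t z).
have h1 := rin_le a0 Lg (LU t z); have h2 := rin_le a0 Lg Liu.
have u1 := nrU t z; have g0 := nr_ge0 a0 g.
have i1 : nr (fun w => 'i * Uc alpha z (rotate t psi) w) <= 1.
  by rewrite nrZ// (_ : sqmod 'i = 1) ?mul1r// /sqmod/= expr0n expr1n add0r.
have k0 : 0 <= (nr g + 1) / 2 by lra.
have e (x : R) y : `|x| <= (nr g + y) / 2 -> y <= 1 -> x ^+ 2 <= ((nr g + 1) / 2) ^+ 2.
  by move=> xy y1; rewrite -real_normK ?num_real// lerXn2r ?nnegrE//; lra.
by rewrite /sqmod/= [2 * _]mulr_natl mulr2n lerD// (e _ _ h1 u1, e _ _ h2 i1).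
Qed.

Let W0 z : 0 <= W z. Proof. by rewrite mulr_ge0 ?lambda_weight_ge0. Qed.

Let mW : measurable_fun setT (fun p : mR * mR => W (of_coord p) : mR).
Proof. by apply: measurable_funM => //; apply: measurable_lambda_weight; exact: cmeas_id. Qed.

Let intW : area.-integrable setT (fun p => (W (of_coord p))%:E).
Proof.
apply/integrableP; split; first exact/measurable_EFinP.
by under eq_integral do rewrite gee0_abs ?lee_fin//.
Qed.

Definition kP g h t z : R := complex.Re (p_ g t z * (p_ h t z)^*).

Let kP_le g h t z : L2 g -> L2 h ->
  `|kP g h t z| <= 2 * ((nr g + 1) / 2) ^+ 2 + 2 * ((nr h + 1) / 2) ^+ 2.
Proof.
move=> Lg Lh; have := sqmod_p_le t z Lg; have := sqmod_p_le t z Lh; rewrite /kP.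
move: (_ * _ ^+ 2) (_ * _ ^+ 2) (p_ g t z) (p_ h t z) => A B [x y] [x' y']; rewrite /sqmod/= ler_norml => h1 h2.
have := sqr_ge0 (x - x'); have := sqr_ge0 (x + x'); have := sqr_ge0 (y - y'); have := sqr_ge0 (y + y').
have := sqr_ge0 x; have := sqr_ge0 y; have := sqr_ge0 x'; have := sqr_ge0 y'.
by move=> *; apply/andP; split; nra.
Qed.

Let mkP g h : L2 g -> L2 h -> measurable_fun setT (fun q : mR * (mR * mR) => kP g h q.1 (of_coord q.2) * W (of_coord q.2) : mR).
Proof.
move=> Lg Lh; have m2 : cmeas (fun q : mR * (mR * mR) => of_coord q.2) by apply: cmeas_of_coord; exact: measurable_snd.
have mp k : L2 k -> cmeas (fun q : mR * (mR * mR) => p_ k q.1 (of_coord q.2)).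
  by move=> Lk; apply: cmeas_pf => //; exact: measurable_fst.
apply: measurable_funM; first by case: (cmeasM (mp g Lg) (cmeasJ (mp h Lh))).
exact: (measurableT_comp mW measurable_snd).
Qed.

Let ikP g h t : L2 g -> L2 h -> area.-integrable setT (fun p => (kP g h t (of_coord p) * W (of_coord p))%:E).
Proof.
move=> Lg Lh; pose C := 2 * ((nr g + 1) / 2) ^+ 2 + 2 * ((nr h + 1) / 2) ^+ 2.
apply: (@le_integrable _ _ _ area setT measurableT _ (fun p => (C%:E * (W (of_coord p))%:E)%E)) => //.
- apply/measurable_EFinP.
  have mt : measurable_fun setT (fun p : mR * mR => ((t : mR), p)) by exact: measurable_pair1.
  exact: (measurableT_comp (mkP Lg Lh) mt).
- move=> p _; have h1 := kP_le t (of_coord p) Lg Lh; have h2 := W0 (of_coord p).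
  rewrite -EFinM /= lee_fin (normrM (kP _ _ _ _)) (normrM C) (ger0_norm h2) ler_wpM2r//.
  by apply: le_trans h1 _; exact: ler_norm.
- exact: integrableZl.
Qed.

Definition Ifun g h t : R := \int[area]_p (kP g h t (of_coord p) * W (of_coord p)).

Let IfunDr g h1 h2 t : L2 g -> L2 h1 -> L2 h2 -> Ifun g (fun z => h1 z + h2 z) t = Ifun g h1 t + Ifun g h2 t.
Proof.
move=> Lg L1 L2'; rewrite /Ifun -RintegralD//; try exact: ikP.
apply: eq_Rintegral => p _; rewrite -mulrDl; congr (_ * _); rewrite /kP pD//.
by case: (p_ g _ _) (p_ h1 _ _) (p_ h2 _ _) => ? ? [? ?] [? ?] /=; ring.
Qed.

Let IfunZr g h (k : R) t : L2 g -> L2 h -> Ifun g (fun z => k%:C * h z) t = k * Ifun g h t.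
Proof.
move=> Lg Lh; rewrite /Ifun -RintegralZl//; last exact: ikP.
apply: eq_Rintegral => p _; rewrite mulrA; congr (_ * _); rewrite /kP pZ//.
by case: (p_ g _ _) (p_ h _ _) => ? ? [? ?] /=; ring.
Qed.

Let IfunC g h t : Ifun g h t = Ifun h g t.
Proof.
apply: eq_Rintegral => p _; congr (_ * _); rewrite /kP.
by case: (p_ g _ _) (p_ h _ _) => ? ? [? ?] /=; ring.
Qed.

Let Ifun_diag g t : L2 g -> (Ifun g g t)%:E = (\int[area]_p (kP g g t (of_coord p) * W (of_coord p))%:E)%E.
Proof. by move=> Lg; rewrite /Ifun /Rintegral fineK// integrable_fin_num//; exact: ikP. Qed.

Let kPgg g t z : kP g g t z = sqmod (p_ g t z).
Proof. by rewrite /kP mulc_conj. Qed.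

Let mIfun_diag g : L2 g -> measurable_fun setT (fun t : mR => Ifun g g t : mR).
Proof.
move=> Lg; have mE : measurable_fun setT (fun q : mR * (mR * mR) => (kP g g q.1 (of_coord q.2) * W (of_coord q.2))%:E).
  by apply/measurable_EFinP; exact: mkP.
have h0 (q : mR * (mR * mR)) : (0 <= (kP g g q.1 (of_coord q.2) * W (of_coord q.2))%:E)%E.
  by rewrite lee_fin kPgg mulr_ge0 ?sqmod_ge0.
have := measurable_area_F mE h0 => /= H; apply/measurable_EFinP.
by rewrite (_ : EFin \o _ = (fun t => \int[area]_p (kP g g t (of_coord p) * W (of_coord p))%:E)%E)//; apply/funext => t /=; rewrite Ifun_diag.
Qed.

(** Reduces measurability in [t] to the diagonal, where the integrand is nonnegative. *)
Let Ifun_polar g h t : L2 g -> L2 h ->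
  Ifun g h t = (Ifun (fun z => g z + h z) (fun z => g z + h z) t - Ifun g g t - Ifun h h t) / 2.
Proof.
move=> Lg Lh; have Lgh := L2D a0 Lg Lh; rewrite IfunDr//.
rewrite (IfunC (fun z => g z + h z) g) (IfunC (fun z => g z + h z) h) IfunDr// IfunDr// (IfunC h g).
by move: (Ifun g h t) (Ifun g g t) (Ifun h h t) => x y z; field.
Qed.

Let Ifun_int g h : L2 g -> L2 h -> leb.-integrable circle (EFin \o Ifun g h).
Proof.
move=> Lg Lh; pose C := 2 * ((nr g + 1) / 2) ^+ 2 + 2 * ((nr h + 1) / 2) ^+ 2.
pose K := C * \int[area]_p W (of_coord p).
have mI : measurable_fun setT (Ifun g h : mR -> mR).
  have Lgh := L2D a0 Lg Lh.
  rewrite (_ : Ifun g h = (fun t => (Ifun (fun z => g z + h z) (fun z => g z + h z) t - Ifun g g t - Ifun h h t) / 2)).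
    apply: measurable_funM => //; apply: measurable_funB; last exact: mIfun_diag.
    by apply: measurable_funB; exact: mIfun_diag.
  by apply/funext => t; exact: Ifun_polar.
apply: (@le_integrable _ _ _ leb circle _ _ (cst K%:E)) => //.
- by apply/measurable_EFinP; exact: measurable_funTS.
- move=> t _; rewrite /= lee_fin; apply: le_trans (_ : _ <= K) _; last exact: ler_norm.
  apply: le_trans (le_normr_Rintegral measurableT (ikP t Lg Lh)) _.
  rewrite /K -RintegralZl//; apply: le_Rintegral => //.
  + by apply: integrable_norm; exact: ikP.
  + rewrite (_ : EFin \o _ = (fun p => C%:E * (W (of_coord p))%:E)%E); first exact: integrableZl.
    by apply/funext.
  by move=> p _; rewrite normrM (ger0_norm (W0 _)) ler_wpM2r//; exact: kP_le.
- by apply: (@cint_integrable R (fun=> K)) => x; exact: cvg_cst.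
Qed.

(** The real part of [localization_form]; the imaginary part is its value at ['i h], by
    [localization_formE]. *)
Definition formR g h : R := (alpha + 1) / (2 * pi) * \int[leb]_(t in circle) Ifun g h t.

Lemma formRC g h : formR g h = formR h g.
Proof.
by rewrite /formR; have -> : Ifun g h = Ifun h g by apply/funext => t; exact: IfunC.
Qed.

Lemma formRD g h1 h2 : L2 g -> L2 h1 -> L2 h2 -> formR g (fun z => h1 z + h2 z) = formR g h1 + formR g h2.
Proof.
move=> Lg L1 L2'; rewrite /formR -mulrDr -RintegralD//; try exact: Ifun_int.
have -> // : Ifun g (fun z => h1 z + h2 z) = (fun t => Ifun g h1 t + Ifun g h2 t).
by apply/funext => t; exact: IfunDr.
Qed.

Lemma formRZ g h (k : R) : L2 g -> L2 h -> formR g (fun z => k%:C * h z) = k * formR g h.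
Proof.
move=> Lg Lh; rewrite /formR.
have -> : Ifun g (fun z => k%:C * h z) = (fun t => k * Ifun g h t) by apply/funext => t; exact: IfunZr.
have -> : \int[leb]_(t in circle) (k * Ifun g h t) = k * \int[leb]_(t in circle) Ifun g h t.
  by apply: RintegralZl => //; exact: Ifun_int.
by move: (_ / _) (\int[leb]_(t in circle) Ifun g h t) => x y; rewrite mulrCA.
Qed.

Lemma formR_ext g h h' : (forall z, sqmod z < 1 -> h z = h' z) -> formR g h = formR g h'.
Proof.
move=> hh; have pE t z : p_ h t z = p_ h' t z.
  by rewrite /pf !inner_rin; congr (_ +i* _); apply: rin_ext.
rewrite /formR; have -> // : Ifun g h = Ifun g h'.
by apply/funext => t; rewrite /Ifun; apply: eq_Rintegral => p _; rewrite /kP pE.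
Qed.

Lemma formR_ge0 g : L2 g -> 0 <= formR g g.
Proof.
move=> Lg; rewrite mulr_ge0//.
  by rewrite divr_ge0 ?addr_ge0// ltW// two_pi_gt0.
apply: Rintegral_ge0 => // t _; apply: Rintegral_ge0 => // p _.
by rewrite kPgg mulr_ge0 ?sqmod_ge0.
Qed.

Lemma formR_diagE g : L2 g -> (formR g g)%:E = (((alpha + 1) / (2 * pi))%:E *
  \int[area]_p \int[leb]_(t in circle) (sqmod (p_ g t (of_coord p)) * W (of_coord p))%:E)%E.
Proof.
move=> Lg; rewrite /formR EFinM; congr (_ * _)%E.
rewrite /Rintegral fineK; last by apply: integrable_fin_num => //; exact: Ifun_int.
have mE : measurable_fun setT (fun q : mR * (mR * mR) => (kP g g q.1 (of_coord q.2) * W (of_coord q.2))%:E).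
  by apply/measurable_EFinP; exact: mkP.
have h0 (q : mR * (mR * mR)) : (0 <= (kP g g q.1 (of_coord q.2) * W (of_coord q.2))%:E)%E.
  by rewrite lee_fin kPgg mulr_ge0 ?sqmod_ge0.
transitivity (\int[leb]_(t in circle) \int[area]_p (kP g g t (of_coord p) * W (of_coord p))%:E)%E.
  by apply: eq_integral => t _; rewrite Ifun_diag.
have [_ /= ->] := tonelli_circle mE h0.
by apply: eq_integral => p _; apply: eq_integral => t _; rewrite kPgg.
Qed.

(** Once [f] is replaced by [M], the integral is that of [orthogonality], whose constant cancels the
    normalization of the form. *)
Lemma formR_le g : analytic_on_disc g -> L2 g -> formR g g <= M * nr g.
Proof.
move=> ag Lg; rewrite -lee_fin formR_diagE//.
have a1 : 0 < alpha + 1 by rewrite ltr_wpDl.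
have pp := two_pi_gt0 R.
have k0 : 0 < (alpha + 1) / (2 * pi) by rewrite divr_gt0.
have -> : (M * nr g)%:E = (((alpha + 1) / (2 * pi))%:E * (M%:E *
   \int[area]_p \int[leb]_(t in circle) (lambda_weight (of_coord p) * sqmod (p_ g t (of_coord p)))%:E))%E.
  rewrite orthogonality// np mulr1 -!EFinM; congr (_%:E); move: (2 * pi) pp => q q0.
  by field; rewrite !gt_eqF.
rewrite lee_pmul2l//.
have mS : measurable_fun setT (fun q : mR * (mR * mR) => sqmod (p_ g q.1 (of_coord q.2)) : mR).
  have m2 : cmeas (fun q : mR * (mR * mR) => of_coord q.2) by apply: cmeas_of_coord; exact: measurable_snd.
  have mp : cmeas (fun q : mR * (mR * mR) => p_ g q.1 (of_coord q.2)).
    by apply: cmeas_pf => //; exact: measurable_fst.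
  exact: measurable_sqmod mp.
have mL : measurable_fun setT (fun q : mR * (mR * mR) => lambda_weight (of_coord q.2) : mR).
  by apply: measurable_lambda_weight; apply: cmeas_of_coord; exact: measurable_snd.
have m1 : measurable_fun setT (fun q : mR * (mR * mR) => (sqmod (p_ g q.1 (of_coord q.2)) * W (of_coord q.2))%:E).
  by apply/measurable_EFinP; apply: measurable_funM => //; exact: (measurableT_comp mW measurable_snd).
have m2 : measurable_fun setT (fun q : mR * (mR * mR) => (lambda_weight (of_coord q.2) * sqmod (p_ g q.1 (of_coord q.2)))%:E).
  by apply/measurable_EFinP; exact: measurable_funM.
have h1 (q : mR * (mR * mR)) : (0 <= (sqmod (p_ g q.1 (of_coord q.2)) * W (of_coord q.2))%:E)%E by rewrite lee_fin mulr_ge0 ?sqmod_ge0.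
have h2 (q : mR * (mR * mR)) : (0 <= (lambda_weight (of_coord q.2) * sqmod (p_ g q.1 (of_coord q.2)))%:E)%E.
  by rewrite lee_fin mulr_ge0 ?sqmod_ge0 ?lambda_weight_ge0.
have [M1 _] := tonelli_circle m1 h1; have [M2 _] := tonelli_circle m2 h2.
rewrite -ge0_integralZl//; last 2 first.
- by move=> p _; apply: integral_ge0 => t _; exact: (h2 (t, p)).
- by rewrite lee_fin ltW.
apply: ge0_le_integral => //.
- by move=> p _; apply: integral_ge0 => t _; exact: (h1 (t, p)).
- by apply: emeasurable_funM.
move=> p _; rewrite -ge0_integralZl//; last 3 first.
- by apply: measurable_funTS; exact: (measurableT_comp m2 (measurable_pair2 p)).
- by move=> t _; exact: (h2 (t, p)).
- by rewrite lee_fin ltW.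
apply: ge0_le_integral => //.
- by move=> t _; exact: (h1 (t, p)).
- by apply: measurable_funTS; exact: (measurableT_comp m1 (measurable_pair2 p)).
- by apply: emeasurable_funM => //; apply: measurable_funTS; exact: (measurableT_comp m2 (measurable_pair2 p)).
move=> t _; rewrite -EFinM lee_fin /W mulrCA (mulrC (lambda_weight _)).
by rewrite ler_wpM2r// mulr_ge0 ?sqmod_ge0 ?lambda_weight_ge0.
Qed.

(** Positivity of the form at [g + h] and [g - h], together with the bound on the diagonal. *)
Lemma formR_amgm g h : analytic_on_disc g -> L2 g -> analytic_on_disc h -> L2 h ->
  `|formR g h| <= M * (nr g + nr h) / 2.
Proof.
move=> ag Lg ah Lh.
have Lm := L2Z a0 (-1)%:C Lh.
have e (k : R) : 0 <= formR g g + 2 * k * formR g h + k ^+ 2 * formR h h.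
  have Lk := L2Z a0 k%:C Lh; have Lgk := L2D a0 Lg Lk.
  have := formR_ge0 Lgk; rewrite (formRD Lgk Lg Lk) (formRZ k Lgk Lh).
  rewrite (formRC (fun z => g z + k%:C * h z) g) (formRC (fun z => g z + k%:C * h z) h).
  rewrite (formRD Lg Lg Lk) (formRZ k Lg Lh) (formRD Lh Lg Lk) (formRZ k Lh Lh) (formRC h g).
  by move: (formR g h) (formR g g) (formR h h) => x y z H; apply: le_trans H _; rewrite le_eqVlt; apply/orP; left; apply/eqP; ring.
have := e 1; have := e (-1); have := formR_le ag Lg; have := formR_le ah Lh.
move: (formR g g) (formR h h) (formR g h) (nr g) (nr h) => x y z p q h1 h2 h3 h4.
by rewrite ler_norml mulrDr; move: (M * p) (M * q) h1 h2 => P Q h1 h2; apply/andP; split; lra.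
Qed.

Lemma formR_scale g h (k : R) : 0 < k -> L2 g -> L2 h ->
  formR g h = formR (fun z => k%:C * g z) (fun z => (k^-1)%:C * h z).
Proof.
move=> k0 Lg Lh; have Lk := L2Z a0 k%:C Lg.
by rewrite (formRZ k^-1 Lk Lh) (formRC (fun z => k%:C * g z)) (formRZ k Lh Lg) mulrA mulVf ?gt_eqF// mul1r formRC.
Qed.

Lemma formR_amgm_scale g h (k : R) : 0 < k -> analytic_on_disc g -> L2 g -> analytic_on_disc h -> L2 h ->
  `|formR g h| <= M * (k * nr g + k^-1 * nr h) / 2.
Proof.
move=> k0 ag Lg ah Lh; pose s : R := Num.sqrt k; have s0 : 0 < s by rewrite sqrtr_gt0.
have s2 : s ^+ 2 = k by rewrite sqr_sqrtr// ltW.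
have aZ c u : analytic_on_disc u -> analytic_on_disc (fun z => c * u z).
  by move=> au; exact: (@analyticM R _ u (@analytic_cst R c) au).
rewrite (formR_scale s0 Lg Lh).
have B := formR_amgm (aZ s%:C g ag) (L2Z a0 s%:C Lg) (aZ (s^-1)%:C h ah) (L2Z a0 (s^-1)%:C Lh).
by apply: le_trans B _; rewrite !nrZ// !sqmodR exprVn s2.
Qed.

(** Scaling by [k = M] gives the shape that [riesz] takes, with [K = M ^ 2 * nr g]. *)
Lemma formR_sq g h : analytic_on_disc g -> L2 g -> analytic_on_disc h -> L2 h ->
  formR g h <= (M ^+ 2 * nr g + nr h) / 2.
Proof.
move=> ag Lg ah Lh; apply: le_trans (ler_norm _) _.
apply: le_trans (formR_amgm_scale M0 ag Lg ah Lh) _.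
by rewrite mulrDr mulrA -expr2 mulrA mulfV ?mul1r ?gt_eqF.
Qed.

Let Lpsi_t t z : sqmod z < 1 -> Uc alpha z (rotate t psi) = U alpha z (rotate t psi).
Proof. by rewrite /Uc => ->. Qed.

Let kPi g h t z : L2 h -> kP g (fun w => 'i * h w) t z = complex.Im (p_ g t z * (p_ h t z)^*).
Proof.
move=> Lh; rewrite /kP pZ//; case: (p_ g t z) (p_ h t z) => x y [x' y'] /=; ring.
Qed.

Let disc_int_kP g h t F : (forall z, sqmod z < 1 -> F z = kP g h t z * W z) -> disc_int F = Ifun g h t.
Proof.
move=> FE; rewrite /disc_int /Ifun Rintegral_mkcond; apply: eq_Rintegral => p _.
rewrite patchE mem_disc; case: ifP => z1; first exact: FE.
by rewrite /W /lambda_weight z1 !mulr0.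
Qed.

Lemma localization_formE g h : L2 g -> L2 h ->
  localization_form alpha psi f g h = formR g h +i* formR g (fun z => 'i * h z).
Proof.
move=> Lg Lh; have Lih := L2Z a0 'i Lh; have pp := two_pi_gt0 R.
pose G t := Ifun g h t +i* Ifun g (fun z => 'i * h z) t.
rewrite /localization_form (_ : (fun t => _) = G); last first.
  apply/funext => t; rewrite /disc_cint /G; congr (_ +i* _); apply: disc_int_kP => z z1;
    rewrite -?Lpsi_t//.
    rewrite (inner_sym a0 Lh (LU t z)) /kP /W /lambda_weight z1.
    by rewrite /pf; case: (inner g _) (inner h _) => x y [x' y'] /=; ring.
  rewrite (inner_sym a0 Lh (LU t z)) kPi// /W /lambda_weight z1.
  by rewrite /pf; case: (inner g _) (inner h _) => x y [x' y'] /=; ring.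
have E k : L2 k -> \int[leb]_(t in circle) (Ifun g k t / (2 * pi)) = (\int[leb]_(t in circle) Ifun g k t) / (2 * pi).
  by move=> Lk; apply: RintegralZr => //; exact: Ifun_int.
have -> : angle_mean G = ((\int[leb]_(t in circle) Ifun g h t) / (2 * pi)) +i*
    ((\int[leb]_(t in circle) Ifun g (fun z => 'i * h z) t) / (2 * pi)).
  by congr (_ +i* _); [exact: (E _ Lh)|exact: (E _ Lih)].
have A (k x y q : R) : k%:C * ((x / q) +i* (y / q)) = (k / q * x) +i* (k / q * y).
  by apply/eqP; rewrite eq_complex/=; apply/andP; split; apply/eqP; ring.
exact: A.
Qed.

Let form_antilinear g : L2 g -> antilinear alpha (fun h => formR g h +i* formR g (fun z => 'i * h z)).
Proof.
move=> Lg; split=> [h1 h2 L1 L2'|c h Lh].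
  have Li1 := L2Z a0 'i L1; have Li2 := L2Z a0 'i L2'.
  rewrite formRD// (_ : (fun z => 'i * (h1 z + h2 z)) = fun z => 'i * h1 z + 'i * h2 z).
    by rewrite formRD.
  by apply/funext => z; rewrite mulrDr.
have Li := L2Z a0 'i Lh.
have E (x y : R) : formR g (fun z => (x +i* y) * h z) = x * formR g h + y * formR g (fun z => 'i * h z).
  rewrite -(formRZ x Lg Lh) -(formRZ y Lg Li) -(formRD Lg (L2Z a0 x%:C Lh) (L2Z a0 y%:C Li)).
  apply: formR_ext => z _; case: (h z) => p q; apply/eqP; rewrite eq_complex/=; apply/andP; split; apply/eqP; ring.
case: c => x y; rewrite (E x y) (_ : (fun z => 'i * ((x +i* y) * h z)) = fun z => ((- y) +i* x) * h z).
  rewrite (E (- y) x); move: (formR g h) (formR g _) => p q.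
  by apply/eqP; rewrite eq_complex/=; apply/andP; split; apply/eqP; ring.
by apply/funext => z; case: (h z) => p q; apply/eqP; rewrite eq_complex/=; apply/andP; split; apply/eqP; ring.
Qed.

(** [riesz] shows that the set from which [xget] chooses is nonempty, so the chosen function does
    represent the form. *)
Lemma localization_opP g : analytic_on_disc g -> L2 g ->
  let u := localization_op alpha psi f g in
  [/\ analytic_on_disc u, L2 u & forall h, analytic_on_disc h -> L2 h -> rin u h = formR g h].
Proof.
move=> ag Lg u.
have := riesz a0 (form_antilinear Lg) (fun h ah Lh => formR_sq ag Lg ah Lh).
move=> [v [av Lv _ vE]].
have : exists v, bergman alpha v /\ (forall h, bergman alpha h -> inner v h = localization_form alpha psi f g h).
  exists v; split; first exact/bergmanP.
  by move=> h /bergmanP[ah Lh]; rewrite vE// localization_formE.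
move=> /(xgetPex (fun=> 0))[/bergmanP[au Lu] uE]; split => // h ah Lh.
by rewrite rinE uE ?localization_formE//; exact/bergmanP.
Qed.

(** Take [h = u], the image of [g], in [formR_sq]: [|u|^2 <= (M^2 |g|^2 + |u|^2) / 2]. *)
Lemma localization_op_le g : analytic_on_disc g -> L2 g -> nr (localization_op alpha psi f g) <= M ^+ 2 * nr g.
Proof.
move=> ag Lg; have [au Lu uE] := localization_opP ag Lg.
have := formR_sq ag Lg au Lu; rewrite -uE// rinuu//.
by move: (nr _) (_ * nr g) => x y; lra.
Qed.

Lemma localization_op_ge g (L : R) : 0 < L -> analytic_on_disc g -> L2 g -> nr g = 1 ->
  nr (localization_op alpha psi f g) <= L ^+ 2 -> formR g g <= L.
Proof.
move=> L0 ag Lg g1 uL; have [au Lu uE] := localization_opP ag Lg.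
rewrite -uE// rinC; apply: le_trans (ler_norm _) _; apply: le_trans (rin_small a0 L0 Lg Lu uL) _.
by rewrite g1 -natr1 mulfK.
Qed.

End Form.

(** * Concentration of the windows *)

Section Vfacts.
Variable R : realType.
Local Notation mR := (measurableTypeR R).
Local Notation area := (@area R).
Implicit Types (u v psi : R[i] -> R[i]) (z w c : R[i]) (a b : nat -> R[i]) (alpha : R).

Lemma Gamma_wn alpha n : 0 <= alpha ->
  Gamma (n%:R + alpha + 2) / (n`!%:R * Gamma (alpha + 2)) = (wn alpha n)^-1.
Proof.
move=> a0; have g1 k : 1 < k%:R + alpha + 2 by have := ler0n R k; lra.
elim: n => [|n ih] /=.
  by rewrite fact0 mul1r add0r divff ?invr1// gt_eqF// Gamma_gt0//; lra.
have -> : n.+1%:R + alpha + 2 = (n%:R + alpha + 2) + 1 by rewrite -natr1; ring.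
rewrite GammaS// factS natrM (invfM (wn alpha n)) -ih invf_div.
have G0 : Gamma (alpha + 2) != 0 by rewrite gt_eqF// Gamma_gt0//; lra.
have f0 : (n`!)%:R != 0 :> R by rewrite pnatr_eq0 -lt0n fact_gt0.
by field; rewrite f0 G0 /= -[1 + _]/(1 + n%:R) nat1r pnatr_eq0.
Qed.

Lemma V_factor_sqr alpha n : 0 <= alpha -> V_factor alpha n ^+ 2 = (n.+1%:R * wn alpha n)^-1.
Proof.
move=> a0; rewrite /V_factor Gamma_wn// exprMn exprVn !sqr_sqrtr ?ler0n ?invr_ge0 ?wn_ge0//.
by rewrite invfM.
Qed.

Lemma wn0E n : wn 0 n = (n.+1%:R)^-1 :> R.
Proof.
elim: n => [|n ih] /=; first by rewrite invr1.
by rewrite ih mulKf ?pnatr_eq0// addr0 -natrD addn2.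
Qed.

Definition Vcoef alpha psi n : R[i] := power_coef psi n * (V_factor alpha n)%:C.

Lemma sqmod_Vcoef alpha psi n : 0 <= alpha ->
  sqmod (Vcoef alpha psi n) = sqmod (power_coef psi n) * wn 0 n / wn alpha n.
Proof. by move=> a0; rewrite /Vcoef sqmodM sqmodR V_factor_sqr// wn0E invfM mulrA. Qed.

Lemma sqmod_Vcoef_wn alpha psi n : 0 <= alpha ->
  sqmod (Vcoef alpha psi n) * wn alpha n = sqmod (power_coef psi n) * wn 0 n.
Proof. by move=> a0; rewrite sqmod_Vcoef// divfK// gt_eqF// wn_gt0. Qed.

Section UnitVector.
Variable psi : R[i] -> R[i].
Hypothesis ap : analytic_on_disc psi.
Hypothesis Lp : L2 0 psi.

Let hc : has_coef (power_coef psi) psi := L2_coef (lexx 0) ap Lp.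

(** By [sqmod_Vcoef_wn] the weighted squares of the coefficients at [alpha] and at [0] agree one by
    one. Hence some function has these coefficients, and on the disc the limit in [V] is its
    value. *)
Lemma V_isometry alpha : 0 <= alpha ->
  [/\ has_coef (Vcoef alpha psi) (V alpha psi), analytic_on_disc (V alpha psi),
   L2 alpha (V alpha psi) & nr alpha (V alpha psi) = nr 0 psi].
Proof.
move=> a0.
have bd n : \sum_(k < n) sqmod (Vcoef alpha psi k) * wn alpha k <= nr 0 psi.
  rewrite (eq_bigr (fun k : 'I_n => sqmod (power_coef psi k) * wn 0 k)).
    exact: (@nr_coef_ge R 0 (lexx 0) _ psi n hc Lp).
  by move=> k _; exact: sqmod_Vcoef_wn.
have [u [hu Lu _]] := has_coef_exists a0 bd.
have Vu z : sqmod z < 1 -> V alpha psi z = u z.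
  by move=> z1; have /csumsP H := hu z z1; exact: (cvg_lim (@norm_hausdorff _ R[i]^o) H).
have hV : has_coef (Vcoef alpha psi) (V alpha psi) by move=> z z1; rewrite Vu//; exact: hu.
have LV : L2 alpha (V alpha psi) := L2_ext Vu Lu.
split; [exact: hV|exact: has_coef_analytic hV|exact: LV|].
apply: (cvg_unique _ (nr_coef a0 hV LV)) => //.
rewrite (_ : (fun n => _) = (fun n => sqmod (power_coef psi n) * wn 0 n)).
  exact: (@nr_coef R 0 (lexx 0) _ psi hc Lp).
by apply/funext => n; exact: sqmod_Vcoef_wn.
Qed.

Definition near0 (r : R) u z : R[i] := if sqmod z < r then u z else 0.

Lemma measurable_near r : measurable_fun setT (fun p : mR * mR => sqmod (of_coord p) < r).
Proof.
by apply: measurable_fun_ltr; [apply: measurable_sqmod; exact: cmeas_id|exact: measurable_cst].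
Qed.

Lemma mdisc_near r u : mdisc u -> mdisc (near0 r u).
Proof.
move=> mu; rewrite /mdisc (_ : (fun p => _) = (fun p => if sqmod (of_coord p) < r then cut u (of_coord p) else 0)).
  by apply: cmeas_if; [exact: measurable_near|exact: mu|exact: cmeas_cst].
by apply/funext => p; rewrite /near0 /cut; do 2 case: ifP.
Qed.

(** Where [|z|^2 >= r] one has [|u|^2 <= 2 |u - v|^2 + 2 |v|^2] and [|v|^2 <= |z v|^2 / r]. So
    multiplication by [z] detects mass away from the origin; [v] will be a partial sum of [u]. *)
Lemma near_tail alpha r u v : 0 <= alpha -> 0 < r -> L2 alpha u -> L2 alpha v -> L2 alpha (fun z => z * v z) ->
  nr alpha u - 2 / r * nr alpha (fun z => z * v z) - 2 * nr alpha (fun z => u z - v z) <= nr alpha (near0 r u).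
Proof.
move=> a0 r0 Lu Lv Lzv; have Lnear : L2 alpha (near0 r u).
  split; first by apply: mdisc_near; case: Lu.
  case: Lu => mu; apply: le_lt_trans; apply: ge0_le_integral => //.
  - by move=> p _; rewrite lee_fin nrm2_integrand_ge0.
  - apply/measurable_EFinP; apply: measurable_nrm2_integrand; [exact: mdisc_near|exact: cmeas_id].
  - by apply/measurable_EFinP; apply: measurable_nrm2_integrand => //; exact: cmeas_id.
  move=> p _; rewrite lee_fin ler_wpM2r ?bweight_ge0// /near0; case: ifP => // _.
  by rewrite sqmod0 sqmod_ge0.
have Ld := L2B a0 Lu Lv.
have mI (h : R[i] -> R[i]) : L2 alpha h -> measurable_fun setT (fun p : mR * mR => (sqmod (h (of_coord p)) * bweight alpha (of_coord p))%:E).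
  by move=> [mh _]; apply/measurable_EFinP; apply: measurable_nrm2_integrand => //; exact: cmeas_id.
have I0 (h : R[i] -> R[i]) p : (0 <= (sqmod (h (of_coord p)) * bweight alpha (of_coord p))%:E)%E.
  by rewrite lee_fin nrm2_integrand_ge0.
have k0 : 0 <= 2 / r by rewrite divr_ge0// ltW.
have mZ (k : R) (h : R[i] -> R[i]) : L2 alpha h -> measurable_fun setT (fun p : mR * mR => (k%:E * (sqmod (h (of_coord p)) * bweight alpha (of_coord p))%:E)%E).
  by move=> Lh; apply: emeasurable_funM => //; exact: mI.
have Z0 (k : R) (h : R[i] -> R[i]) p : 0 <= k -> (0 <= k%:E * (sqmod (h (of_coord p)) * bweight alpha (of_coord p))%:E)%E.
  by move=> k0'; rewrite mule_ge0.
have EZ (k : R) h : 0 <= k -> L2 alpha h -> (k%:E * nrm2 alpha h = \int[area]_p (k%:E * (sqmod (h (of_coord p)) * bweight alpha (of_coord p))%:E))%E.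
  by move=> k0' Lh; rewrite ge0_integralZl//; exact: mI.
have mD := emeasurable_funD (mZ 2 _ Ld) (mZ (2 / r) _ Lzv).
have D0 (p : mR * mR) : setT p -> (0 <= 2%:E * (sqmod (u (of_coord p) - v (of_coord p)) * bweight alpha (of_coord p))%:E +
  (2 / r)%:E * (sqmod (of_coord p * v (of_coord p)) * bweight alpha (of_coord p))%:E)%E.
  by move=> _; apply: adde_ge0; [exact: (Z0 2 (fun z => u z - v z))|exact: (Z0 _ (fun z => z * v z))].
have := @ge0_integralD _ _ _ area _ measurableT _ _ (fun p _ => I0 (near0 r u) p) (mI _ Lnear) D0 mD.
rewrite (ge0_integralD area measurableT (fun p _ => Z0 2 (fun z => u z - v z) p (ler0n R 2)) (mZ 2 _ Ld)
  (fun p _ => Z0 (2 / r) (fun z => z * v z) p k0) (mZ (2 / r) _ Lzv)).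
rewrite -(EZ 2 _ (ler0n R 2) Ld) -(EZ _ _ k0 Lzv) => HE.
rewrite lerBlDr lerBlDr -lee_fin !EFinD (EFinM (2 / r)) (EFinM 2 (nr alpha _)) (nrE a0 Lu) (nrE a0 Lnear) (nrE a0 Ld) (nrE a0 Lzv) -addeA.
rewrite -HE.
apply: ge0_le_integral => //; first exact: mI.
- exact: (emeasurable_funD (mI _ Lnear) mD).
move=> p _; rewrite -!EFinM -!EFinD lee_fin !mulrA -!mulrDl ler_wpM2r ?bweight_ge0// /near0.
move: (of_coord p) => z; case: ltP => zr.
  by rewrite lerDl addr_ge0// mulr_ge0// sqmod_ge0.
rewrite sqmod0 add0r sqmodM -mulrA.
have h1 : sqmod (v z) <= r^-1 * (sqmod z * sqmod (v z)).
  by rewrite mulrA ler_peMl ?sqmod_ge0// ler_pdivlMl// mulr1.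
have h2 : sqmod (u z) <= 2 * sqmod (u z - v z) + 2 * sqmod (v z).
  case: (u z) (v z) => x y [x' y']; rewrite /sqmod/=.
  have := sqr_ge0 (x - 2 * x'); have := sqr_ge0 (y - 2 * y'); nra.
by apply: le_trans h2 _; rewrite lerD2l ler_wpM2l.
Qed.

(** The number [N] of coefficients to keep is independent of [alpha], because [V] preserves each
    weighted square. For the polynomial [p] that is kept, the squared norm of [z p] is at most
    [N / (alpha + 2)]. *)
Lemma near_mass (e r : R) : nr 0 psi = 1 -> 0 < e -> 0 < r ->
  exists2 A : R, 0 <= A & forall alpha, A <= alpha -> 1 - e <= nr alpha (near0 r (V alpha psi)).
Proof.
move=> np e0 r0.
have c0 : e / 4 > 0 by rewrite divr_gt0.
have /cvgrPdist_le/(_ _ c0)[N _ /(_ N (leqnn N))] := nr_coef (lexx 0) hc Lp.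
rewrite np /series/= big_mkord => HN.
(* Makes [(2 / r) N / (alpha + 2)] at most [e / 2]; the discarded tail, at most [e / 4], enters
   [near_tail] twice. *)
pose A := 4 * N%:R / (r * e).
have A0 : 0 <= A by rewrite divr_ge0 ?mulr_ge0// ltW.
exists A => // alpha Aa; have a0 : 0 <= alpha := le_trans A0 Aa.
have [hV aV LV nV] := V_isometry a0.
pose b := Vcoef alpha psi; pose p := psum b N.
pose b' k := if k is k'.+1 then b k' else 0.
have zp z : z * p z = psum b' N.+1 z.
  rewrite /psum big_ord_recl mul0r add0r mulr_sumr; apply: eq_bigr => k _.
  by rewrite /= exprS mulrCA.
have Lp' : L2 alpha p := L2_psum a0 b N.
have Lzp : L2 alpha (fun z => z * p z).
  by apply: (L2_ext _ (L2_psum a0 b' N.+1)) => z _; exact: zp.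
apply: le_trans (near_tail a0 r0 LV Lp' Lzp).
have -> : nr alpha (fun z => z * p z) = \sum_(k < N.+1) sqmod (b' k) * wn alpha k.
  by rewrite -(nr_psum a0); apply: nr_ext => z _; exact: zp.
rewrite (nr_sub_psum a0 N hV LV) nV np big_ord_recl/= sqmod0 mul0r add0r.
rewrite [X in _ - 2 * (1 - X)](eq_bigr (fun k : 'I_N => sqmod (power_coef psi k) * wn 0 k)); last first.
  by move=> k _; exact: sqmod_Vcoef_wn.
have S1 : \sum_(k < N) sqmod (power_coef psi k) * wn 0 k <= 1 by rewrite -np; exact: (@nr_coef_ge R 0 (lexx 0) _ psi N hc Lp).
have h2 : 1 - \sum_(k < N) sqmod (power_coef psi k) * wn 0 k <= e / 4.
  by apply: le_trans HN; exact: ler_norm.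
clear HN Lzp Lp' zp LV aV hV nV.
have h1 : \sum_(k < N) sqmod (b k) * (wn alpha k * (k.+1%:R / (k%:R + alpha + 2))) <= N%:R / (alpha + 2).
  apply: le_trans (_ : _ <= N%:R / (alpha + 2) * \sum_(k < N) sqmod (power_coef psi k) * wn 0 k) _; last first.
    by rewrite ler_piMr// divr_ge0// addr_ge0.
  rewrite mulr_sumr; apply: ler_sum => k _; rewrite mulrA sqmod_Vcoef_wn// mulrC.
  rewrite ler_wpM2r ?mulr_ge0 ?sqmod_ge0 ?wn_ge0//.
  have k0 := ler0n R k; have kN : k.+1%:R <= N%:R :> R by rewrite ler_nat.
  rewrite ler_pM ?invr_ge0 ?ler0n//; first by rewrite !addr_ge0.
  by rewrite lef_pV2 ?posrE ?ltr_wpDl ?addr_ge0// lerD2r lerDr.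
have h3 : 2 / r * (N%:R / (alpha + 2)) <= e / 2.
  have a2 : 0 < alpha + 2 by rewrite ltr_wpDl.
  rewrite mulrA ler_pdivrMr// mulrAC ler_pdivrMr//.
  have : 4 * N%:R <= alpha * (r * e) by rewrite -ler_pdivrMr// mulr_gt0.
  have : 0 <= r * e by rewrite mulr_ge0// ltW.
  by clear; move: (N%:R : R) => n; nra.
have h4 : 2 / r * \sum_(k < N) sqmod (b k) * (wn alpha k * (k.+1%:R / (k%:R + alpha + 2))) <= e / 2.
  by apply: le_trans h3; rewrite ler_wpM2l// divr_ge0// ltW.
by move: h2 h4; clear; move: (2 / r * _) (\sum_(k < N) sqmod (power_coef psi k) * _) => x y; lra.
Qed.

End UnitVector.
End Vfacts.

(** * Inner and outer approximation at positive distance *)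

Section Regularity.
Variable R : realType.
Local Notation mR := (measurableTypeR R).
Variable mu : {measure set (mR * mR) -> \bar R}.
Hypothesis mu_fin : (mu setT < +oo)%E.
Implicit Types (A E F : set (mR * mR)) (p q : mR * mR) (eta r : R).

Lemma mu_lty A : measurable A -> (mu A < +oo)%E.
Proof. by move=> mA; apply: le_lt_trans mu_fin; apply: le_measure; rewrite ?inE. Qed.

Lemma mu_decreasing_small (G : (set (mR * mR))^nat) eta : 0 < eta -> (forall n, measurable (G n)) ->
  (forall n, G n.+1 `<=` G n) -> (forall p, ~ (forall n, G n p)) -> exists n, (mu (G n) < eta%:E)%E.
Proof.
move=> eta0 mG Gd G0.
have I0 : \bigcap_n G n = set0 by rewrite -subset0 => p Gp; apply: (G0 p) => n; exact: Gp.
have := @nonincreasing_cvg_mu _ _ _ mu G (mu_lty (mG 0%N)) mG.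
rewrite I0 measure0 => /(_ measurable0) H.
have {}H : mu \o G @ \oo --> 0%E.
  by apply: H; apply/nonincreasing_seqP => n; apply/subsetPset; exact: Gd.
have /fine_cvgP[_ /cvgrPdist_lt/(_ _ eta0)[n _ /(_ n (leqnn n))]] := H.
rewrite /= sub0r normrN => Hn; exists n.
rewrite -[mu (G n)]fineK ?lte_fin; first by apply: le_lt_trans Hn; exact: ler_norm.
by rewrite ge0_fin_numE// mu_lty.
Qed.

(** Regularity with a gap between [F] and the complement of [E]. The gap lets points of [F] be
    displaced a little, by Moebius maps later on, without leaving [E]. *)
Definition separated_approx A eta : Prop := exists F E r, [/\ 0 < r, measurable F /\ measurable E,
  F `<=` A /\ A `<=` E, (mu (E `\` F) < eta%:E)%E &
  forall p q, F p -> sqmod (of_coord p - of_coord q) < r -> E q].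

Definition regular A : Prop := forall eta, 0 < eta -> separated_approx A eta.

(** Complementation exchanges inner and outer sets, and the gap is symmetric. *)
Lemma regularC A : regular A -> regular (~` A).
Proof.
move=> rA eta eta0; have [F [E [r [r0 [mF mE] [FA AE] EF sep]]]] := rA _ eta0.
exists (~` E), (~` F), r; split => //.
- by split; exact: measurableC.
- by split; apply: subsetC.
- by rewrite setDE setCK setIC -setDE.
move=> p q Ep pq Fq; apply: Ep; apply: (sep q) => //.
by rewrite -sqmodN opprB.
Qed.

(** Infinitely many gaps might shrink to [0], so only finitely many inner sets are united, the rest
    being small by continuity from above. All outer sets are kept, with errors
    [eta / 2 / 2 ^ (k + 1)]. *)
Lemma regular_bigcup (A : (set (mR * mR))^nat) : (forall n, regular (A n)) -> regular (\bigcup_n A n).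
Proof.
move=> rA eta eta0; have eta2 : 0 < eta / 2 by rewrite divr_gt0.
have /choice[T HT] : forall k, exists t : set (mR * mR) * set (mR * mR) * R, [/\ 0 < t.2, measurable t.1.1 /\ measurable t.1.2,
    t.1.1 `<=` A k /\ A k `<=` t.1.2, (mu (t.1.2 `\` t.1.1) < (eta / 2 / (2 ^ k.+1)%:R)%:E)%E &
    forall p q, t.1.1 p -> sqmod (of_coord p - of_coord q) < t.2 -> t.1.2 q].
  move=> k; have k0 : 0 < eta / 2 / (2 ^ k.+1)%:R by rewrite divr_gt0// ltr0n expn_gt0.
  by have [F [E [r H]]] := rA k _ k0; exists (F, E, r).
pose F k := (T k).1.1; pose E k := (T k).1.2; pose r k := (T k).2.
have mF k : measurable (F k) by case: (HT k) => _ [].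
have mE k : measurable (E k) by case: (HT k) => _ [].
pose FN n := \bigcup_(k in [set k | (k < n)%N]) F k.
have mFN n : measurable (FN n) by apply: bigcup_measurable => k _; exact: mF.
have mFU : measurable (\bigcup_k F k) by exact: bigcup_measurable.
have mD k : measurable (E k `\` F k) by exact: measurableD.
have mDU : measurable (\bigcup_k (E k `\` F k)) by exact: bigcup_measurable.
have [n Hn] : exists n, (mu ((\bigcup_k F k) `\` FN n) < (eta / 2)%:E)%E.
  apply: mu_decreasing_small => // [n|n|p H]; first exact: measurableD.
  - apply: setDS => p [k /= kn Fp]; exists k => //=; exact: ltnW.
  have [[k _ Fp] _] := H 0%N; have [_ []] := H k.+1; by exists k => /=.
have [r0 rr0 rle] : exists2 r0, 0 < r0 & forall k, (k < n)%N -> r0 <= r k.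
  elim: n {Hn} => [|n [r0 r00 ih]]; first by exists 1.
  exists (Num.min r0 (r n)); first by rewrite lt_min r00; case: (HT n).
  move=> k; rewrite ltnS leq_eqVlt => /orP[/eqP->|/ih kr]; first by rewrite ge_min lexx orbT.
  by rewrite ge_min kr.
exists (FN n), (\bigcup_k E k), r0; split => //.
- by split => //; exact: bigcup_measurable.
- split.
    by move=> p [k _ Fp]; exists k => //; have [_ _ [FA _] _ _] := HT k; exact: FA.
  by move=> p [k _ Ap]; exists k => //; have [_ _ [_ AE] _ _] := HT k; exact: AE.
- apply: (@le_lt_trans _ _ (mu ((\bigcup_k (E k `\` F k)) `|` ((\bigcup_k F k) `\` FN n)))).
    apply: le_measure; rewrite ?inE.
    + by apply: measurableD => //; exact: bigcup_measurable.
    + by apply: measurableU => //; exact: measurableD.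
    move=> p [[k _ Ep] nF]; have [Fp|nFp] := pselect (F k p); last by left; exists k.
    by right; split => //; exists k.
  apply: le_lt_trans (measureU2 _ _ _) _ => //; first exact: measurableD.
  rewrite [eta]splitr EFinD; apply: lee_ltD => //.
    by rewrite ge0_fin_numE// mu_lty.
  apply: le_trans (generalized_Boole_inequality mu mD mDU) _.
  apply: le_trans (epsilon_trick0 xpredT (ltW eta2)).
  by apply: lee_nneseries => [k _ _|k _]; [exact: measure_ge0|have [_ _ _ /ltW] := HT k].
move=> p q [k /= kn Fp] pq; exists k => //; have [_ _ _ _ sep] := HT k.
by apply: (sep p) => //; apply: lt_le_trans pq (rle k kn).
Qed.

(** A thin strip beyond the level [a] has small measure; leaving it out of the inner set creates a
    gap equal to its width [d], which enters squared. *)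
Lemma regular_halfspace (h : mR * mR -> mR) (a : R) : measurable_fun setT h ->
  (forall p q, ((h p : R) - h q) ^+ 2 <= sqmod (of_coord p - of_coord q)) ->
  regular (h @^-1` `]a, +oo[).
Proof.
move=> mh hL eta eta0.
have mpre (B : set mR) : measurable B -> measurable (h @^-1` B).
  by move=> mB; rewrite -[_ @^-1` _]setTI; exact: mh.
pose G n := h @^-1` [set x | (a < x < a + n.+1%:R^-1)].
have mG n : measurable (G n).
  apply: mpre; rewrite (_ : [set _ | _] = `]a, (a + n.+1%:R^-1)[%classic); first exact: measurable_itv.
  by apply/seteqP; split => x /=; rewrite in_itv.
have [n Hn] : exists n, (mu (G n) < eta%:E)%E.
  apply: mu_decreasing_small => // [n p|p H].
    rewrite /G/= => /andP[-> H]; apply: lt_le_trans H _.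
    by rewrite lerD2l lef_pV2 ?posrE ?ltr0n// ler_nat.
  have /andP[ah _] := H 0%N.
  have [k Hk] := ltr_add_invr ah; have /andP[_] := H k.
  by move=> /(lt_trans Hk); rewrite ltxx.
pose d : R := n.+1%:R^-1; have d0 : 0 < d by rewrite invr_gt0.
exists (h @^-1` `[a + d, +oo[), (h @^-1` `]a, +oo[), (d ^+ 2); split.
- by rewrite exprn_gt0.
- by split; apply: mpre; exact: measurable_itv.
- split=> // p /=; rewrite !in_itv/= !andbT => H; apply: lt_le_trans H; by rewrite ltrDl.
- apply: le_lt_trans Hn; apply: le_measure; rewrite ?inE.
  + by apply: measurableD; apply: mpre; exact: measurable_itv.
  + exact: mG.
  by move=> p [/=]; rewrite !in_itv/= !andbT => ap /negP; rewrite -ltNge => pd; apply/andP.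
move=> p q /=; rewrite !in_itv/= !andbT => ap pq.
have : ((h p : R) - h q) ^+ 2 < d ^+ 2 by apply: le_lt_trans pq.
rewrite -[X in X < _]real_normK ?num_real// ltr_pXn2r ?nnegrE ?normr_ge0 ?(ltW d0)//.
rewrite ltr_norml => /andP[_]; move: (h p : R) (h q : R) ap => x y; lra.
Qed.

(** Regular sets form a sigma-algebra, and it contains the half-planes generating the product
    sigma-algebra. *)
Lemma measurable_regular A : measurable A -> regular A.
Proof.
have sr : sigma_algebra setT regular.
  split; last exact: regular_bigcup.
    move=> eta eta0; exists set0, set0, 1; split => //.
    - by split.
    by rewrite set0D measure0 lte_fin.
  by move=> B rB; rewrite setTD; exact: regularC.
have gen (h : mR * mR -> mR) : measurable_fun setT h ->
  (forall p q, ((h p : R) - h q) ^+ 2 <= sqmod (of_coord p - of_coord q)) ->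
  forall B : set mR, measurable B -> regular (h @^-1` B).
  move=> mh hL; suff : (@measurable _ mR) `<=` [set B | regular (h @^-1` B)] by move=> H B /H.
  rewrite [X in X `<=` _](@RGenOInfty.measurableE R).
  apply: smallest_sub.
    have [s0 sC sU] := sr; split => /=; first by rewrite preimage_set0.
      by move=> B rB; rewrite setTD preimage_setC; exact: regularC.
    by move=> B rB; rewrite preimage_bigcup; exact: regular_bigcup.
  by move=> _ [x ->]; exact: regular_halfspace.
suff : (@measurable _ (mR * mR)%type) `<=` regular by move=> H /H.
apply: smallest_sub => //; rewrite subUset; split => _ [B mB <-]; rewrite setTI.
  apply: (gen (fun p => p.1)) => //; first exact: measurable_fst.
  by move=> p q; rewrite /sqmod/= lerDl sqr_ge0.
apply: (gen (fun p => p.2)) => //; first exact: measurable_snd.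
by move=> p q; rewrite /sqmod/= lerDr sqr_ge0.
Qed.

End Regularity.

(** * The lower bound *)

Section Lower.
Variable R : realType.
Local Notation mR := (measurableTypeR R).
Local Notation leb := (@lebesgue_measure R).
Local Notation area := (@area R).
Variable alpha : R.
Hypothesis a0 : 0 <= alpha.
Implicit Types (u v g : R[i] -> R[i]) (z w c : R[i]).
Local Notation nr := (nr alpha).
Local Notation L2 := (L2 alpha).
Local Notation inner := (bergman_inner alpha).
Local Notation circle := (`[0, 2 * pi]%classic : set mR).
Variable psi : R[i] -> R[i].
Hypothesis ap : analytic_on_disc psi.
Hypothesis Lp : L2 psi.
Hypothesis np : nr psi = 1.
Variables (f : R[i] -> R).
Hypothesis mf : measurable_fun setT (fun p : mR * mR => f (of_coord p) : mR).
Hypothesis f0 : forall z, 0 <= f z.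
Hypothesis iW : (\int[area]_p (f (of_coord p) * lambda_weight (of_coord p))%:E < +oo)%E.

Lemma tonelli_area_area (h : (mR * mR) * (mR * mR) -> \bar R) : measurable_fun setT h -> (forall q, 0 <= h q)%E ->
  (\int[area]_q \int[area]_p h (q, p) = \int[area]_p \int[area]_q h (q, p))%E.
Proof. exact: (@fubini_tonelli _ _ _ _ R (@area_sf R) (@area_sf R) h). Qed.

Lemma measurable_area_G (h : (mR * mR) * (mR * mR) -> \bar R) : measurable_fun setT h -> (forall q, 0 <= h q)%E ->
  measurable_fun setT (fun p => \int[area]_q h (q, p))%E.
Proof. exact: (@measurable_fun_fubini_tonelli_G _ _ _ _ R (@area_sf R) h). Qed.

Lemma sqmod_inner_kernel v w : analytic_on_disc v -> L2 v -> sqmod w < 1 ->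
  sqmod (inner (U alpha w (fun=> 1)) v) = (1 - sqmod w) `^ (2 + alpha) * sqmod (v w).
Proof.
move=> av Lv w1; have L1 := L2_cst a0 1; have Lk := L2_U a0 w1 L1.
rewrite (inner_sym a0 Lv Lk) sqmodJ inner_rin.
have -> : rin alpha v (fun z => 'i * U alpha w (fun=> 1) z) = rin alpha v (U alpha w (fun=> 'i)).
  by apply: rin_ext => // z _; rewrite -U_scale mulr1.
rewrite !reproducing// rmorph1 mulr1.
have -> : (1 - sqmod w) `^ (2 + alpha) = ((1 - sqmod w) `^ ((2 + alpha) / 2)) ^+ 2.
  rewrite expr2 -powRD; first by congr (_ `^ _); field.
  by have -> : 1 - sqmod w != 0 by [rewrite gt_eqF// subr_gt0]; rewrite implybT.
by case: (v w) => x y; rewrite /sqmod/=; ring.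
Qed.

Local Notation b := (power_coef psi).

Definition ringsum y : \bar R := (\sum_(0 <= n <oo) (sqmod (b n) * sqmod y ^+ n)%:E)%E.
(** Times [alpha + 1], the density with respect to [lambda] of the probability kernel in the
    overview: by Parseval [ringsum] is the mean of [|psi|^2] over the circle of radius [|y|]. *)
Definition berezin y : \bar R := (((1 - sqmod y) `^ (2 + alpha))%:E * ringsum y)%E.

Let t0 n y : (0 <= (sqmod (b n) * sqmod y ^+ n)%:E)%E.
Proof. by rewrite lee_fin mulr_ge0 ?exprn_ge0 ?sqmod_ge0. Qed.

Lemma berezin_ge0 y : (0 <= berezin y)%E.
Proof. by rewrite mule_ge0 ?lee_fin ?powR_ge0//; apply: nneseries_ge0 => n _ _; exact: t0. Qed.

Lemma measurable_berezin d (T : measurableType d) (y : T -> R[i]) : cmeas y -> measurable_fun setT (fun t => berezin (y t)).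
Proof.
move=> my; have msq := measurable_sqmod my.
apply: emeasurable_funM.
  by apply/measurable_EFinP; apply: (measurableT_comp (measurable_powR _)); exact: measurable_funB.
apply: ge0_emeasurable_sum => n; first by move=> p _ _; exact: t0.
by move=> _; apply/measurable_EFinP; apply: measurable_funM => //; exact: measurable_funX.
Qed.

Let hb : has_coef b psi := L2_coef a0 ap Lp.

(** The reproducing property evaluates [U_z psi_t] at [w]. The two weights merge by
    [sqmod_kern_weight], and the mean over [t] leaves a function of [phi_z(w)] alone. *)
Lemma kernel_form w : sqmod w < 1 ->
  (formR alpha psi f (U alpha w (fun=> 1)) (U alpha w (fun=> 1)))%:E =
  ((alpha + 1)%:E * \int[area]_p ((f (of_coord p) * lambda_weight (of_coord p))%:E * berezin (moebius (of_coord p) w)))%E.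
Proof.
move=> w1; have Lk := L2_U a0 w1 (L2_cst a0 1); have pp := two_pi_gt0 R.
have W0 z : 0 <= f z * lambda_weight z by rewrite mulr_ge0 ?lambda_weight_ge0.
rewrite (formR_diagE a0 Lp np mf f0 iW Lk).
transitivity (((alpha + 1) / (2 * pi))%:E * \int[area]_p ((2 * pi)%:E * ((f (of_coord p) * lambda_weight (of_coord p))%:E * berezin (moebius (of_coord p) w))))%E.
  congr (_ * _)%E; apply: eq_integral => p _.
  have [z1|z1] := ltP (sqmod (of_coord p)) 1; last first.
    rewrite /lambda_weight ltNge z1/= mulr0 mul0e mule0.
    by rewrite integral0_eq// => t _; rewrite mulr0.
  have y1 := moebius_disc z1 w1; set y := moebius (of_coord p) w in y1 *.
  transitivity (\int[leb]_(t in circle) ((f (of_coord p) * lambda_weight (of_coord p) * (1 - sqmod y) `^ (2 + alpha))%:E * (sqmod (psi (cis t * y)))%:E))%E.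
    apply: eq_integral => t _; rewrite -EFinM; congr (_%:E).
    have aU := analytic_U (alpha := alpha) z1 (@analytic_rotate R t psi ap).
    have LU := L2_U a0 z1 (L2_rotate a0 t Lp).
    rewrite /pf /Uc z1 (sqmod_inner_kernel aU LU w1).
    by rewrite UE// sqmodM -(sqmod_kern_weight alpha z1 w1) /rotate -/y; ring.
  rewrite ge0_integralZl//; last 3 first.
  - apply/measurable_EFinP; apply: measurable_funTS; apply: continuous_measurable_fun.
    exact: sqmod_circle_cont.
  - by move=> t _; rewrite lee_fin sqmod_ge0.
  - by rewrite lee_fin mulr_ge0 ?powR_ge0.
  rewrite (circle_coef hb y1) /berezin /ringsum muleCA; congr (_ * _)%E.
  by rewrite EFinM muleA.
rewrite ge0_integralZl//; last 3 first.
- apply: emeasurable_funM.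
    by apply/measurable_EFinP; apply: measurable_funM => //; apply: measurable_lambda_weight; exact: cmeas_id.
  by apply: measurable_berezin; apply: cmeas_moebius; [exact: cmeas_id|exact: cmeas_cst].
- by move=> p _; apply: mule_ge0; [rewrite lee_fin|exact: berezin_ge0].
- by rewrite lee_fin ltW.
by rewrite muleA -EFinM divfK// gt_eqF.
Qed.

Definition near_berezin (r : R) z : \bar R := if sqmod z < r then berezin z else 0%E.

Lemma near_berezin_ge0 r z : (0 <= near_berezin r z)%E.
Proof. by rewrite /near_berezin; case: ifP => // _; exact: berezin_ge0. Qed.

Lemma measurable_near_berezin r : measurable_fun setT (fun p : mR * mR => near_berezin r (of_coord p)).
Proof.
apply: measurable_fun_ifT => //; first exact: measurable_near.
by apply: measurable_berezin; exact: cmeas_id.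
Qed.

Lemma near0_berezin (r : R) :
  (nr (near0 r psi))%:E = ((alpha + 1)%:E * \int[area]_p ((lambda_weight (of_coord p))%:E *
     near_berezin r (of_coord p)))%E.
Proof.
have [mp _] := Lp; have mn := mdisc_near r mp; have a1 : 0 < alpha + 1 by rewrite ltr_wpDl.
have Ln : L2 (near0 r psi).
  split => //; case: Lp => _; apply: le_lt_trans; apply: ge0_le_integral => //.
  - by move=> p _; rewrite lee_fin nrm2_integrand_ge0.
  - by apply/measurable_EFinP; apply: measurable_nrm2_integrand => //; exact: cmeas_id.
  - by apply/measurable_EFinP; apply: measurable_nrm2_integrand => //; exact: cmeas_id.
  move=> p _; rewrite lee_fin ler_wpM2r ?bweight_ge0// /near0; case: ifP => // _.
  by rewrite sqmod0 sqmod_ge0.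
rewrite nrE// nrm2_circ// -ge0_integralZl//; last 3 first.
- apply: emeasurable_funM; last exact: measurable_near_berezin.
  by apply/measurable_EFinP; apply: measurable_lambda_weight; exact: cmeas_id.
- by move=> p _; apply: mule_ge0; [rewrite lee_fin lambda_weight_ge0|exact: near_berezin_ge0].
- by rewrite lee_fin ltW.
apply: eq_integral => p _; rewrite /near_berezin.
have [zr|zr] := ltP (sqmod (of_coord p)) r; last first.
  rewrite !mule0 /circ integral0_eq ?mule0// => t _.
  by rewrite /near0 sqmod_cisM ltNge zr/= sqmod0 mul0r.
have -> : circ alpha (near0 r psi) p = circ alpha psi p.
  by rewrite /circ; congr (_ * _)%E; apply: eq_integral => t _; rewrite /near0 sqmod_cisM zr.
rewrite (circ_coef a0 _ hb).
have [z1|z1] := ltP (sqmod (of_coord p)) 1; last first.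
  rewrite /lambda_weight ltNge z1/= mul0e mule0 eseries0// => n _ _.
  by rewrite /bweight ltNge z1/= !mulr0.
rewrite /berezin /ringsum !muleA -!EFinM -nneseriesZl//.
by apply: eq_eseriesr => n _; rewrite -EFinM bweight_lambda//; congr (_%:E); ring.
Qed.

Variables (L : R) (E F : set (mR * mR)) (r : R).
Hypothesis L0 : 0 <= L.
Hypothesis HL : forall g, analytic_on_disc g -> L2 g -> nr g = 1 -> formR alpha psi f g g <= L.
Hypotheses (mE : measurable E) (mF : measurable F).
Hypothesis ED : forall p, E p -> sqmod (of_coord p) < 1.
Hypothesis FE : forall p z, F p -> sqmod (of_coord p) < 1 -> sqmod z < 1 -> sqmod z < r -> E (to_coord (moebius (- of_coord p) z)).

Let iE z : R := \1_E (to_coord z).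

Let miE d (T : measurableType d) (y : T -> R[i]) : cmeas y -> measurable_fun setT (fun t => iE (y t) : mR).
Proof.
move=> my; apply: (measurableT_comp (measurable_indic mE)); exact: measurable_to_coord.
Qed.

Let iE_ge0 z : (0 <= (iE z)%:E)%E. Proof. by rewrite lee_fin. Qed.

(** Substituting [q = phi_(-p)(z)] turns the kernel into [berezin z]; for [p] in [F] and [|z|^2 < r]
    the point [q] lies in [E], so nothing near [0] is lost. *)
Let inner_lower p : F p -> sqmod (of_coord p) < 1 ->
  ((nr (near0 r psi))%:E <= (alpha + 1)%:E * \int[area]_q ((lambda_weight (of_coord q))%:E *
     ((iE (of_coord q))%:E * berezin (moebius (of_coord p) (of_coord q)))))%E.
Proof.
move=> Fp p1; have p1' := sqmodN_lt1 p1; have a1 : 0 < alpha + 1 by rewrite ltr_wpDl.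
pose G z : \bar R := ((iE (moebius (- of_coord p) z))%:E * berezin z)%E.
have mG : measurable_fun setT (G \o @of_coord R).
  apply: emeasurable_funM; last by apply: measurable_berezin; exact: cmeas_id.
  by apply/measurable_EFinP; apply: miE; apply: cmeas_moebius; [exact: cmeas_cst|exact: cmeas_id].
have G0 z : (0 <= G z)%E by apply: mule_ge0; [exact: iE_ge0|exact: berezin_ge0].
have -> : (\int[area]_q ((lambda_weight (of_coord q))%:E * ((iE (of_coord q))%:E * berezin (moebius (of_coord p) (of_coord q)))) =
   \int[area]_q ((lambda_weight (of_coord q))%:E * G (moebius (of_coord p) (of_coord q))))%E.
  apply: eq_integral => q _; have [q1|q1] := ltP (sqmod (of_coord q)) 1.
    by rewrite /G moebiusK.
  by rewrite /lambda_weight ltNge q1 !mul0e.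
rewrite lambda_moebius// near0_berezin lee_pmul2l//.
have mlw : measurable_fun setT (fun p : mR * mR => (lambda_weight (of_coord p))%:E).
  by apply/measurable_EFinP; apply: measurable_lambda_weight; exact: cmeas_id.
apply: ge0_le_integral => //.
- by move=> q _; apply: mule_ge0; [rewrite lee_fin lambda_weight_ge0|exact: near_berezin_ge0].
- by apply: emeasurable_funM => //; exact: measurable_near_berezin.
- exact: emeasurable_funM.
move=> q _; have [q1|q1] := ltP (sqmod (of_coord q)) 1; last first.
  by rewrite /lambda_weight ltNge q1 !mul0e.
apply: lee_wpmul2l; first by rewrite lee_fin lambda_weight_ge0.
rewrite /near_berezin; case: ltP => qr; last exact: G0.
by rewrite /G /iE indicE mem_set ?mul1e//; exact: FE.
Qed.

(** The form at the unit vectors [k_w] is integrated over [w] in [E]. Each value is at most [L];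
    after Tonelli, the integral over [E] is bounded below by [inner_lower] for the points of [F]. *)
Lemma opnorm_lower :
  ((nr (near0 r psi))%:E * \int[area]_p (f (of_coord p) * lambda_weight (of_coord p) * \1_F p)%:E <=
   L%:E * \int[area]_q (lambda_weight (of_coord q) * \1_E q)%:E)%E.
Proof.
have a1 : 0 < alpha + 1 by rewrite ltr_wpDl.
have W0 z : 0 <= f z * lambda_weight z by rewrite mulr_ge0 ?lambda_weight_ge0.
have mlw : measurable_fun setT (fun p : mR * mR => lambda_weight (of_coord p) : mR).
  by apply: measurable_lambda_weight; exact: cmeas_id.
have mW : measurable_fun setT (fun p : mR * mR => f (of_coord p) * lambda_weight (of_coord p) : mR) by exact: measurable_funM.
pose h (qp : (mR * mR) * (mR * mR)) : \bar R := ((f (of_coord qp.2) * lambda_weight (of_coord qp.2))%:E *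
  ((lambda_weight (of_coord qp.1))%:E * ((iE (of_coord qp.1))%:E * berezin (moebius (of_coord qp.2) (of_coord qp.1)))))%E.
have c1 : cmeas (fun q : (mR * mR) * (mR * mR) => of_coord q.1) by apply: cmeas_of_coord; exact: measurable_fst.
have c2 : cmeas (fun q : (mR * mR) * (mR * mR) => of_coord q.2) by apply: cmeas_of_coord; exact: measurable_snd.
have mh : measurable_fun setT h.
  apply: emeasurable_funM; first by apply/measurable_EFinP; exact: (measurableT_comp mW measurable_snd).
  apply: emeasurable_funM; first by apply/measurable_EFinP; exact: measurable_lambda_weight.
  apply: emeasurable_funM; first by apply/measurable_EFinP; exact: miE.
  by apply: measurable_berezin; exact: cmeas_moebius.
have h0 q : (0 <= h q)%E.
  apply: mule_ge0; first by rewrite lee_fin.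
  apply: mule_ge0; first by rewrite lee_fin lambda_weight_ge0.
  by apply: mule_ge0; [exact: iE_ge0|exact: berezin_ge0].
have iEq (q : mR * mR) : iE (of_coord q) = \1_E q by rewrite /iE /to_coord /of_coord/=; case: q.
have mq p : measurable_fun setT (fun q : mR * mR => ((lambda_weight (of_coord q))%:E * ((iE (of_coord q))%:E * berezin (moebius (of_coord p) (of_coord q))))%E).
  apply: emeasurable_funM; first exact/measurable_EFinP.
  apply: emeasurable_funM; first by apply/measurable_EFinP; apply: miE; exact: cmeas_id.
  by apply: measurable_berezin; apply: cmeas_moebius; [exact: cmeas_cst|exact: cmeas_id].
have q0 p (q : mR * mR) : (0 <= (lambda_weight (of_coord q))%:E * ((iE (of_coord q))%:E * berezin (moebius (of_coord p) (of_coord q))))%E.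
  apply: mule_ge0; first by rewrite lee_fin lambda_weight_ge0.
  by apply: mule_ge0; [exact: iE_ge0|exact: berezin_ge0].
have mG := measurable_area_G mh h0; have mF' := measurable_area_F mh h0.
have G0 p : (0 <= \int[area]_q h (q, p))%E by exact: integral_ge0.
have F0' q : (0 <= \int[area]_p h (q, p))%E by exact: integral_ge0.
apply: (@le_trans _ _ ((alpha + 1)%:E * \int[area]_p \int[area]_q h (q, p))%E).
  have mWF : measurable_fun setT (fun p : mR * mR => (f (of_coord p) * lambda_weight (of_coord p) * \1_F p)%:E).
    by apply/measurable_EFinP; apply: measurable_funM => //; exact: measurable_indic.
  have WF0 (p : mR * mR) : setT p -> (0 <= (f (of_coord p) * lambda_weight (of_coord p) * \1_F p)%:E)%E.
    by move=> _; rewrite lee_fin mulr_ge0.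
  rewrite -(ge0_integralZl area measurableT mWF WF0) ?lee_fin ?nr_ge0//.
  rewrite -(ge0_integralZl area measurableT mG (fun p _ => G0 p)) ?lee_fin ?(ltW a1)//.
  apply: ge0_le_integral => //.
  - by move=> p Tp; apply: mule_ge0; [rewrite lee_fin nr_ge0|exact: WF0].
  - exact: (emeasurable_funM (measurable_cst _) mWF).
  - exact: (emeasurable_funM (measurable_cst _) mG).
  move=> p _.
  rewrite (_ : \int[area]_q h (q, p) = (f (of_coord p) * lambda_weight (of_coord p))%:E * \int[area]_q ((lambda_weight (of_coord q))%:E *
     ((iE (of_coord q))%:E * berezin (moebius (of_coord p) (of_coord q)))))%E; last first.
    by rewrite -(ge0_integralZl area measurableT (mq p) (fun q _ => q0 p q)) ?lee_fin.
  have [p1|p1] := ltP (sqmod (of_coord p)) 1; last first.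
    by rewrite /lambda_weight ltNge p1/= mulr0 mul0r mul0e !mule0.
  rewrite (EFinM (f _ * _)) muleCA [leRHS]muleCA; apply: lee_wpmul2l; first by rewrite lee_fin.
  rewrite indicE; have [Fp|nFp] := pselect (F p); last first.
    by rewrite memNset// mule0 mule_ge0 ?lee_fin ?(ltW a1)//; exact: integral_ge0.
  by rewrite mem_set// mule1; exact: inner_lower.
have mlE : measurable_fun setT (fun q : mR * mR => (lambda_weight (of_coord q) * \1_E q)%:E).
  by apply/measurable_EFinP; apply: measurable_funM => //; exact: measurable_indic.
have lE0 (q : mR * mR) : setT q -> (0 <= (lambda_weight (of_coord q) * \1_E q)%:E)%E.
  by move=> _; rewrite lee_fin mulr_ge0 ?lambda_weight_ge0.
rewrite -tonelli_area_area// -(ge0_integralZl area measurableT mlE lE0) ?lee_fin//.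
rewrite -(ge0_integralZl area measurableT mF' (fun p _ => F0' p)) ?lee_fin ?(ltW a1)//.
apply: ge0_le_integral => //.
- by move=> q _; apply: mule_ge0; [rewrite lee_fin ltW|exact: F0'].
- exact: (emeasurable_funM (measurable_cst _) mF').
- exact: (emeasurable_funM (measurable_cst _) mlE).
move=> q _.
have [Eq|nEq] := pselect (E q); last first.
  rewrite indicE memNset// mulr0 mule0 integral0_eq ?mule0// => p _.
  by rewrite /h/= iEq indicE memNset// mul0e !mule0.
have q1 := ED Eq.
have -> : (\int[area]_p h (q, p) = (lambda_weight (of_coord q))%:E * \int[area]_p ((f (of_coord p) * lambda_weight (of_coord p))%:E * berezin (moebius (of_coord p) (of_coord q))))%E.
  rewrite -ge0_integralZl//; last 3 first.
  - apply: emeasurable_funM; first exact/measurable_EFinP.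
    by apply: measurable_berezin; apply: cmeas_moebius; [exact: cmeas_id|exact: cmeas_cst].
  - by move=> p _; apply: mule_ge0; [rewrite lee_fin|exact: berezin_ge0].
  - by rewrite lee_fin lambda_weight_ge0.
  by apply: eq_integral => p _; rewrite /h/= iEq indicE mem_set// mul1e muleCA.
rewrite indicE mem_set// mulr1 muleCA [(L%:E * _)%E]muleC; apply: lee_wpmul2l; first by rewrite lee_fin lambda_weight_ge0.
rewrite -kernel_form// lee_fin; apply: HL.
- exact: (@analytic_U R alpha _ _ q1 (@analytic_cst R 1)).
- exact: (L2_U a0 q1 (L2_cst a0 1)).
- by rewrite (nr_U a0 q1 (L2_cst a0 1)) nr_cst// sqmod1.
Qed.

End Lower.

(** * Sets [F] and [E] adapted to Moebius displacements *)

Section GoodSets.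
Variable R : realType.
Local Notation mR := (measurableTypeR R).
Local Notation area := (@area R).
Implicit Types (z w : R[i]) (A B E F : set (mR * mR)) (p q : mR * mR).

(** One has [phi_(-z)(w) - z = w (1 - |z|^2) / (1 + z^* w)], and the denominator is at least
    [1 - |z|] in modulus; this leaves the factor [1 + |z| <= 2], uniformly in [z]. *)
Lemma moebius_dist z w : sqmod z < 1 -> sqmod w < 1 -> cabs (moebius (- z) w - z) <= 2 * cabs w.
Proof.
move=> z1 w1; have d0 := one_sub_neq0 (sqmodN_lt1 z1) w1.
have -> : moebius (- z) w - z = w * (1 - sqmod z)%:C / (1 - (- z)^* * w).
  have -> : (1 - sqmod z)%:C = 1 - z * z^* by rewrite mulc_conj rmorphB rmorph1.
  by apply: (mulIf d0); rewrite /moebius opprK mulrBl !divfK// conjcN; ring.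
have cz : cabs z < 1 by rewrite -sqmod_lt1.
have cw : cabs w < 1 by rewrite -sqmod_lt1.
have h : 1 - cabs z <= cabs (1 - (- z)^* * w).
  have := cabsD (1 - (- z)^* * w) ((- z)^* * w); rewrite subrK cabs1 cabsM cabsJ cabsN => h.
  have : cabs z * cabs w <= cabs z by rewrite ler_piMr ?cabs_ge0// ltW.
  by move: h; lra.
rewrite !cabsM cabsV cabsR -cabs_sqr ger0_norm; last by rewrite subr_ge0 expr_le1 ?cabs_ge0// ltW.
have p0 : 0 < cabs (1 - (- z)^* * w) by apply: lt_le_trans h; rewrite subr_gt0.
rewrite ler_pdivrMr// [2 * _]mulrC -mulrA ler_wpM2l ?cabs_ge0//.
apply: le_trans (_ : _ <= 2 * (1 - cabs z)) _; last by rewrite ler_pM2l.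
by have := cabs_ge0 z; nra.
Qed.

Definition lambda_mass A : \bar R := (\int[area]_p (lambda_weight (of_coord p) * \1_A p)%:E)%E.

Let mlw : measurable_fun setT (fun p : mR * mR => lambda_weight (of_coord p) : mR).
Proof. by apply: measurable_lambda_weight; exact: cmeas_id. Qed.

Let mlA A : measurable A -> measurable_fun setT (fun p : mR * mR => (lambda_weight (of_coord p) * \1_A p)%:E).
Proof. by move=> mA; apply/measurable_EFinP; apply: measurable_funM => //; exact: measurable_indic. Qed.

Let lA0 A p : (0 <= (lambda_weight (of_coord p) * \1_A p)%:E)%E.
Proof. by rewrite lee_fin mulr_ge0 ?lambda_weight_ge0. Qed.

Let area_indic A (k : R) : 0 <= k -> measurable A -> (k%:E * area A = \int[area]_p (k * \1_A p)%:E)%E.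
Proof.
move=> k0 mA; rewrite -[in LHS](setIT A) -integral_indic// -ge0_integralZl//.
by apply/measurable_EFinP; exact: measurable_indic.
Qed.

Lemma lambda_mass_ge A : measurable A -> A `<=` @disc_coord R -> ((pi^-1)%:E * area A <= lambda_mass A)%E.
Proof.
move=> mA AD; rewrite area_indic ?invr_ge0 ?pi_ge0//; apply: ge0_le_integral => //.
- by move=> p _; rewrite lee_fin mulr_ge0 ?invr_ge0 ?pi_ge0.
- by apply/measurable_EFinP; apply: measurable_funM => //; exact: measurable_indic.
- exact: mlA.
move=> p _; rewrite lee_fin indicE; have [Ap|nAp] := pselect (A p); last by rewrite memNset// !mulr0.
have z1 : sqmod (of_coord p) < 1 := AD _ Ap; have z0 := sqmod_ge0 (of_coord p).
rewrite mem_set// !mulr1 /lambda_weight z1 /lambda_density lef_pV2 ?posrE ?pi_gt0//; last first.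
  by rewrite mulr_gt0 ?pi_gt0// exprn_gt0// subr_gt0.
by rewrite ler_piMr ?pi_ge0// expr_le1//; lra.
Qed.

(** Within radius [s < 1] the density of [lambda] is bounded, so sets of small area have small
    mass. *)
Lemma lambda_mass_le A (s : R) : measurable A -> 0 < s < 1 -> (forall p, A p -> cabs (of_coord p) < s) ->
  (lambda_mass A <= ((pi * (1 - s ^+ 2) ^+ 2)^-1)%:E * area A)%E.
Proof.
move=> mA /andP[s0 s1] As; have q0 : 0 < 1 - s ^+ 2 by rewrite subr_gt0 expr_lt1// ltW.
have d0 : 0 < pi * (1 - s ^+ 2) ^+ 2 by rewrite mulr_gt0 ?pi_gt0// exprn_gt0.
rewrite area_indic ?invr_ge0 ?(ltW d0)//; apply: ge0_le_integral => //.
- exact: mlA.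
- by apply/measurable_EFinP; apply: measurable_funM => //; exact: measurable_indic.
move=> p _; rewrite lee_fin indicE; have [Ap|nAp] := pselect (A p); last by rewrite memNset// !mulr0.
have zs := As _ Ap; have z0 := cabs_ge0 (of_coord p).
have z2 : sqmod (of_coord p) <= s ^+ 2 by rewrite -cabs_sqr lerXn2r ?nnegrE// ltW.
have z1 : sqmod (of_coord p) < 1 by move: q0; lra.
rewrite mem_set// !mulr1 /lambda_weight z1 /lambda_density lef_pV2 ?posrE//; last first.
  by rewrite mulr_gt0 ?pi_gt0// exprn_gt0// subr_gt0.
by rewrite ler_pM2l ?pi_gt0// lerXn2r ?nnegrE; lra.
Qed.

Lemma lambda_mass_mono A B : measurable A -> measurable B -> A `<=` B -> (lambda_mass A <= lambda_mass B)%E.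
Proof.
move=> mA mB AB; apply: ge0_le_integral => //; try exact: mlA.
move=> p _; rewrite lee_fin ler_wpM2l ?lambda_weight_ge0// !indicE.
by have [Ap|nAp] := pselect (A p); [rewrite !mem_set//; exact: AB|rewrite memNset].
Qed.

Lemma lambda_massD F E : measurable F -> measurable E -> F `<=` E -> lambda_mass E = (lambda_mass F + lambda_mass (E `\` F))%E.
Proof.
move=> mF mE FE; rewrite /lambda_mass -ge0_integralD//; try exact: mlA; last exact: mlA (measurableD mE mF).
apply: eq_integral => p _; rewrite -EFinD -mulrDr; congr (_ * _)%:E; rewrite !indicE in_setD.
have [Fp|nFp] := pselect (F p); first by rewrite !mem_set ?addr0//; exact: FE.
by rewrite (memNset nFp) andbT add0r.
Qed.

(** The zeroth moment at [alpha = 0], where the density is [1 / pi]. *)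
Lemma disc_area_setT : @disc_area R setT = pi%:E.
Proof.
rewrite (_ : @disc_area R setT = area (setT `&` @disc_coord R))// setTI.
have mD := @measurable_disc_coord R.
have -> : area (@disc_coord R) = (\int[area]_p (\1_(@disc_coord R) p)%:E)%E by rewrite integral_indic// setIT.
rewrite (_ : (\int[area]_p _)%E = (pi%:E * \int[area]_p ((sqmod (of_coord p) ^+ 0 * bweight 0 (of_coord p))%:E))%E).
  by rewrite moment// mule1.
rewrite -ge0_integralZl//; last 3 first.
- apply/measurable_EFinP; apply: measurable_funM; first by rewrite (_ : (fun _ => _) = cst 1)//; apply/funext => ?; rewrite expr0.
  by apply: measurable_bweight; exact: cmeas_id.
- by move=> p _; rewrite lee_fin mulr_ge0 ?bweight_ge0.
- by rewrite lee_fin pi_ge0.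
apply: eq_integral => p _; rewrite -EFinM indicE mem_disc expr0 mul1r /bweight; case: ifP => z1; last by rewrite mulr0.
by rewrite /bergman_density powRr0 mulr1 add0r mul1r mulfV// gt_eqF ?pi_gt0.
Qed.

Lemma disc_area_lty : (@disc_area R setT < +oo)%E.
Proof. by rewrite disc_area_setT ltry. Qed.

(** As [lambda] is infinite near the boundary, [A] is first cut down to radius [s < 1], keeping
    positive area. Regularity of area then yields [F] and, within a larger radius [s'], [E];
    [moebius_dist] turns small [|z|] into a small displacement. *)
Lemma good_sets A (d : R) : measurable A -> A `<=` @disc_coord R -> (0 < area A)%E -> 0 < d ->
  exists F E r, [/\ 0 < r, measurable F /\ measurable E, F `<=` A /\ (forall p, E p -> sqmod (of_coord p) < 1),
    [/\ (0 < lambda_mass E)%E, (lambda_mass E < +oo)%E & ((1 - d)%:E * lambda_mass E <= lambda_mass F)%E] &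
    forall p z, F p -> sqmod (of_coord p) < 1 -> sqmod z < 1 -> sqmod z < r -> E (to_coord (moebius (- of_coord p) z))].
Proof.
move=> mA AD A0 d0; have fin := disc_area_lty.
have dA B : B `<=` @disc_coord R -> @disc_area R B = area B.
  by move=> BD; rewrite (_ : @disc_area R B = area (B `&` @disc_coord R))// setIidl.
have mc (s : R) : measurable [set p : mR * mR | cabs (of_coord p) < s].
  have m : measurable_fun setT (fun p : mR * mR => Num.sqrt (sqmod (of_coord p)) : mR).
    apply: (measurableT_comp (f := fun x : mR => Num.sqrt x : mR)).
      by apply: continuous_measurable_fun; exact: sqrt_continuous.
    by apply: measurable_sqmod; exact: cmeas_id.
  have := m measurableT _ (measurable_itv `]-oo, s[).
  by rewrite setTI; congr measurable; apply/seteqP; split => p /=; rewrite in_itv.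
have Afin : (area A < +oo)%E by rewrite -(dA _ AD); exact: (mu_lty fin mA).
pose G n := A `\` [set p | cabs (of_coord p) < 1 - n.+2%:R^-1].
have mG n : measurable (G n) by exact: measurableD.
have [n Hn] : exists n, (@disc_area R (G n) < (fine (area A))%:E)%E.
  apply: mu_decreasing_small => //.
  - by rewrite fine_gt0// A0.
  - move=> n; apply: setDS => p /= H; apply: lt_le_trans H _.
    by rewrite lerD2l lerN2 lef_pV2 ?posrE ?ltr0n// ler_nat.
  move=> p H; have [Ap _] := H 0%N; have := AD _ Ap; rewrite /disc_coord/unit_disc/= sqmod_lt1 => c1.
  have [k Hk] := ltr_add_invr c1; have [_] := H k; apply.
  rewrite /= ltrBrDr; apply: le_lt_trans Hk; rewrite lerD2l lef_pV2 ?posrE ?ltr0n// ler_nat//.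
pose s : R := 1 - n.+2%:R^-1.
have s0 : 0 < s by rewrite subr_gt0 invf_lt1 ?ltr0n// ltr1n.
have s1 : s < 1 by rewrite ltrBlDr ltrDl invr_gt0 ltr0n.
pose B := A `&` [set p | cabs (of_coord p) < s].
have mB : measurable B by exact: measurableI.
have BD : B `<=` @disc_coord R by move=> p [/AD].
have B0 : (0 < area B)%E.
  rewrite lt0e measure_ge0 andbT; apply/eqP => B0.
  have : (area A <= area (G n) + area B)%E.
    apply: le_trans (measureU2 _ (mG n) mB); apply: le_measure; rewrite ?inE//.
      exact: measurableU.
    by move=> p Ap; have [ps|ps] := pselect (cabs (of_coord p) < s); [right|left].
  rewrite B0 adde0 -(dA (G n)); last by move=> p [/AD].
  move/le_lt_trans => /(_ _ Hn); rewrite fineK ?ltxx// ge0_fin_numE//.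
have lB0 : (0 < lambda_mass B)%E.
  by apply: lt_le_trans (lambda_mass_ge mB BD); rewrite mule_gt0// lte_fin invr_gt0 pi_gt0.
pose s' : R := (1 + s) / 2; have s'01 : 0 < s' < 1 by rewrite /s'; lra.
pose K : R := (pi * (1 - s' ^+ 2) ^+ 2)^-1.
have K0 : 0 < K.
  by rewrite invr_gt0 mulr_gt0 ?pi_gt0// exprn_gt0// subr_gt0 expr_lt1//; lra.
have Kfin (x : \bar R) : (x < +oo -> K%:E * x < +oo)%E.
  by move=> xoo; apply: lte_mul_pinfty => //; rewrite lee_fin ltW.
have lB1 : (lambda_mass B < +oo)%E.
  apply: le_lt_trans (lambda_mass_le mB s'01 _) _.
    by move=> p [_ /= ps]; apply: lt_trans ps _; rewrite /s'; lra.
  by apply: Kfin; rewrite -(dA _ BD); exact: (mu_lty fin mB).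
pose b := fine (lambda_mass B).
have bE : b%:E = lambda_mass B by rewrite fineK// ge0_fin_numE// ltW.
have b0 : 0 < b by rewrite -lte_fin bE.
(* Then what [E] has beyond [F] has mass at most [K (d b / K) = d b], and [b] is at most the mass of
   [E]. *)
have eta0 : 0 < d * b / K by rewrite divr_gt0// mulr_gt0.
have [F [E0 [rho [rho0 [mF mE0] [FB BE] EF sep]]]] := measurable_regular fin mB eta0.
pose E := E0 `&` [set p | cabs (of_coord p) < s'].
have mE : measurable E by exact: measurableI.
have ED : E `<=` @disc_coord R.
  move=> p [_ /= ps]; rewrite /disc_coord/unit_disc/= sqmod_lt1; apply: lt_trans ps _; lra.
have BE' : B `<=` E.
  move=> p Bp; split; first exact: BE.
  by case: Bp => _ /= ps; apply: lt_trans ps _; rewrite /s'; lra.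
have lE1 : (lambda_mass E < +oo)%E.
  apply: le_lt_trans (lambda_mass_le mE s'01 _) _; first by move=> p [].
  by apply: Kfin; rewrite -(dA _ ED); exact: (mu_lty fin mE).
have lE0 : (lambda_mass B <= lambda_mass E)%E by exact: lambda_mass_mono.
have FE : F `<=` E by apply: subset_trans BE'.
(* The displacement is at most [2 |z|]. It stays within the gap [rho] if [|z|^2 < rho / 4], and
   within radius [s'] if [|z| < (s' - s) / 2]. *)
exists F, E, (Num.min (rho / 4) (((s' - s) / 2) ^+ 2)); split => //.
- by rewrite lt_min divr_gt0//= exprn_gt0// divr_gt0// subr_gt0 /s'; lra.
- by split=> p; [move=> /FB[]|move=> /ED].
- split => //; first exact: lt_le_trans lB0 lE0.
  have lD : (lambda_mass (E `\` F) <= (d * b)%:E)%E.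
    apply: le_trans (lambda_mass_le (measurableD mE mF) s'01 _) _; first by move=> p [[]].
    apply: (@le_trans _ _ (K%:E * (d * b / K)%:E)%E); last by rewrite -EFinM mulrC divfK ?gt_eqF.
    apply: lee_wpmul2l; first by rewrite lee_fin ltW.
    rewrite -dA; last by move=> p [/ED].
    apply: le_trans (ltW EF); apply: le_measure; rewrite ?inE; try exact: measurableD.
    by apply: setSD => p [].
  have eE : (fine (lambda_mass E))%:E = lambda_mass E by rewrite fineK// ge0_fin_numE// (le_trans _ lE0)// ltW.
  have lF1 : (lambda_mass F < +oo)%E by apply: le_lt_trans lE1; exact: lambda_mass_mono.
  have eF : (fine (lambda_mass F))%:E = lambda_mass F by rewrite fineK// ge0_fin_numE//; exact: integral_ge0.
  have : (lambda_mass E <= lambda_mass F + (d * b)%:E)%E by rewrite (lambda_massD mF mE FE) leeD2l.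
  move: lE0; rewrite -bE -eE -eF -EFinM -EFinD !lee_fin.
  move: (fine _) (fine _) => x y bx xy.
  have : d * b <= d * y by rewrite ler_wpM2l// ltW.
  lra.
move=> p z Fp p1 z1; rewrite lt_min => /andP[zr zr'].
have dist := moebius_dist p1 z1; set y := moebius _ z in dist *.
have cz : cabs z < (s' - s) / 2.
  by rewrite -(@ltr_pXn2r _ 2)// ?nnegrE ?cabs_ge0 ?cabs_sqr// divr_ge0// subr_ge0 /s'; lra.
split; last first.
  rewrite /= to_coordK; have [_ /= ps] := FB _ Fp.
  have := cabsD (y - of_coord p) (of_coord p); rewrite subrK; lra.
apply: (sep p) => //; rewrite to_coordK -cabs_sqr cabsB.
apply: (@le_lt_trans _ _ ((2 * cabs z) ^+ 2)).
  by rewrite lerXn2r ?nnegrE ?mulr_ge0 ?cabs_ge0.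
by rewrite exprMn cabs_sqr -natrX mulrC -ltr_pdivlMr.
Qed.

End GoodSets.

(** * Replacing [f] by an everywhere bounded nonnegative function *)

Section Truncation.
Variable R : realType.
Local Notation mR := (measurableTypeR R).
Local Notation area := (@area R).
Variables (f : R[i] -> R) (M : R).
Hypothesis mf : measurable_fun (@disc_coord R) (f \o @of_coord R : mR * mR -> mR).
Hypothesis fM : {ae @disc_area R, forall p, 0 <= f (of_coord p) <= M}.

(** The bounds on [f] hold almost everywhere and its measurability on the disc; [trunc] has both on
    the whole plane and the same integrals over the disc. *)
Definition trunc z : R := if (sqmod z < 1) && (0 <= f z <= M) then f z else 0.

Lemma trunc_ge0 z : 0 <= trunc z.
Proof. by rewrite /trunc; case: ifP => // /andP[_ /andP[]]. Qed.

Lemma trunc_le z : 0 <= M -> trunc z <= M.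
Proof. by rewrite /trunc; case: ifP => // /andP[_ /andP[]]. Qed.

Lemma measurable_trunc : measurable_fun setT (fun p : mR * mR => trunc (of_coord p) : mR).
Proof.
pose g := (f \o @of_coord R : mR * mR -> mR) \_ (@disc_coord R).
have mg : measurable_fun setT g by apply/(measurable_restrictT _ (@measurable_disc_coord R)).
have gE p : sqmod (of_coord p) < 1 -> g p = f (of_coord p) by move=> p1; rewrite /g patchE mem_disc p1.
rewrite (_ : (fun p => _) = fun p : mR * mR => (if (sqmod (of_coord p) < 1) && ((0 <= (g p : R)) && ((g p : R) <= M)) then g p else 0 : mR)).
  apply: measurable_fun_ifT => //; apply: measurable_and; first exact: measurable_near.
  by apply: measurable_and; apply: measurable_fun_ler.
by apply/funext => p; rewrite /trunc; case: ltP => //= p1; rewrite gE.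
Qed.

Lemma trunc_ae : exists N, [/\ measurable N, area N = 0%E & forall p, sqmod (of_coord p) < 1 -> ~ N p ->
  f (of_coord p) = trunc (of_coord p)].
Proof.
have [N [mN N0 fN]] := fM; exists (N `&` @disc_coord R); split => //.
  by apply: measurableI => //; exact: measurable_disc_coord.
move=> p p1 nN; rewrite /trunc p1 /=; case: ifP => // h; exfalso; apply: nN; split => //.
by apply: fN => /=; rewrite h.
Qed.

Lemma integral_trunc (k : mR * mR -> mR) : measurable_fun setT k ->
  (\int[area]_(p in @disc_coord R) (f (of_coord p) * k p)%:E =
   \int[area]_(p in @disc_coord R) (trunc (of_coord p) * k p)%:E)%E.
Proof.
move=> mk; have [N [mN N0 fN]] := trunc_ae; have mk' := measurable_funTS (D := @disc_coord R) mk.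
apply: ae_eq_integral; first exact: measurable_disc_coord.
- by apply/measurable_EFinP; exact: (measurable_funM mf mk').
- by apply/measurable_EFinP; exact: (measurable_funM (measurable_funTS measurable_trunc) mk').
exists N; split => // p /= H; apply: contrapT => nN; apply: H => p1.
by rewrite (fN p).
Qed.

Lemma disc_int_trunc (k : mR * mR -> mR) F F' : measurable_fun setT k ->
  (forall p, sqmod (of_coord p) < 1 -> F (of_coord p) = f (of_coord p) * k p) ->
  (forall p, sqmod (of_coord p) < 1 -> F' (of_coord p) = trunc (of_coord p) * k p) ->
  disc_int F = disc_int F'.
Proof.
move=> mk FE F'E; rewrite /disc_int /Rintegral.
rewrite (eq_integral (fun p => (f (of_coord p) * k p)%:E)); last by move=> p; rewrite mem_disc => /FE ->.
rewrite [in RHS](eq_integral (fun p => (trunc (of_coord p) * k p)%:E)); last by move=> p; rewrite mem_disc => /F'E ->.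
by rewrite integral_trunc.
Qed.

Lemma trunc_integrable : in_L1_lambda f ->
  (\int[area]_p (trunc (of_coord p) * lambda_weight (of_coord p))%:E < +oo)%E.
Proof.
move=> [_ /integrableP[mi]]; apply: le_lt_trans.
rewrite [leRHS]integral_mkcond; apply: ge0_le_integral => //.
- by move=> p _; rewrite lee_fin mulr_ge0 ?trunc_ge0 ?lambda_weight_ge0.
- apply/measurable_EFinP; apply: measurable_funM; first exact: measurable_trunc.
  by apply: measurable_lambda_weight; exact: cmeas_id.
- by apply/(measurable_restrictT _ (@measurable_disc_coord R)); exact: measurableT_comp.
move=> p _; rewrite patchE mem_disc /lambda_weight; case: ifP => p1; last by rewrite mulr0.
rewrite /= lee_fin /trunc p1 /=; case: ifP => _; last by rewrite mul0r.
exact: ler_norm.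
Qed.

Section Op.
Variables (alpha : R) (psi : R[i] -> R[i]).
Hypothesis a0 : 0 <= alpha.
Hypothesis Lp : L2 alpha psi.

Lemma localization_form_trunc g h : L2 alpha g -> L2 alpha h ->
  localization_form alpha psi f g h = localization_form alpha psi trunc g h.
Proof.
move=> Lg Lh; rewrite /localization_form; congr (_ * angle_mean _); apply/funext => t.
have Lt z : sqmod z < 1 -> L2 alpha (U alpha z (rotate t psi)).
  by move=> z1; apply: (L2_U a0 z1); exact: L2_rotate.
pose k (p : mR * mR) := pf alpha g psi t (of_coord p) * (pf alpha h psi t (of_coord p))^* * (lambda_weight (of_coord p))%:C.
have mk : cmeas k.
  have mp u : L2 alpha u -> cmeas (fun p : mR * mR => pf alpha u psi t (of_coord p)).
    by move=> Lu; apply: (@cmeas_pf R alpha a0 _ _ (fun=> t) (@of_coord R)) => //; exact: cmeas_id.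
  apply: cmeasM; first by apply: cmeasM; [exact: mp|apply: cmeasJ; exact: mp].
  by apply: cmeas_real; apply: measurable_lambda_weight; exact: cmeas_id.
have E (y : R) p : sqmod (of_coord p) < 1 ->
  y%:C * bergman_inner alpha g (U alpha (of_coord p) (rotate t psi)) *
  bergman_inner alpha (U alpha (of_coord p) (rotate t psi)) h * (lambda_density (of_coord p))%:C = y%:C * k p.
  move=> p1; rewrite (inner_sym a0 Lh (Lt _ p1)) /k /pf /Uc p1 /lambda_weight p1.
  by rewrite !mulrA.
have [mkR mkI] := mk.
by congr (_ +i* _); [apply: (disc_int_trunc mkR)|apply: (disc_int_trunc mkI)] => p p1; rewrite E//;
  case: (k p) => x y /=; ring.
Qed.

(** The forms of [f] and [trunc] agree, so [xget] chooses from the same set and returns the same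
    function. *)
Lemma localization_op_trunc g : bergman alpha g ->
  localization_op alpha psi f g = localization_op alpha psi trunc g.
Proof.
move=> /(bergmanP _ _)[ag Lg]; apply: (congr1 (xget (fun=> 0))).
have E h : bergman alpha h -> localization_form alpha psi f g h = localization_form alpha psi trunc g h.
  by move=> /(bergmanP _ _)[_ Lh]; exact: localization_form_trunc.
apply/seteqP; split => u H.
  exact: (conj H.1 (fun h bh => etrans (H.2 h bh) (E h bh))).
exact: (conj H.1 (fun h bh => etrans (H.2 h bh) (esym (E h bh)))).
Qed.

Lemma opnorm_trunc : bergman_opnorm alpha (localization_op alpha psi f) =
  bergman_opnorm alpha (localization_op alpha psi trunc).
Proof.
apply: (congr1 (@ereal_sup R)).
apply/seteqP; split => _ [g [bg g1] <-].
  by exists g; [exact: conj bg g1|rewrite localization_op_trunc].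
by exists g; [exact: conj bg g1|rewrite localization_op_trunc].
Qed.

End Op.
End Truncation.

(** * Upper and lower bounds for the operator norm *)

Section OperatorNorm.
Variable R : realType.
Local Notation mR := (measurableTypeR R).
Local Notation area := (@area R).
Variables (f : R[i] -> R) (M : R).
Hypothesis mf : measurable_fun setT (fun p : mR * mR => f (of_coord p) : mR).
Hypothesis f0 : forall z, 0 <= f z.
Hypothesis fM : forall z, f z <= M.
Hypothesis M0 : 0 < M.
Hypothesis iW : (\int[area]_p (f (of_coord p) * lambda_weight (of_coord p))%:E < +oo)%E.

Section UnitWindow.
Variables (alpha : R) (psi : R[i] -> R[i]).
Hypothesis a0 : 0 <= alpha.
Hypothesis ap : analytic_on_disc psi.
Hypothesis Lp : L2 alpha psi.
Hypothesis np : nr alpha psi = 1.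

Lemma opnorm_le : (bergman_opnorm alpha (localization_op alpha psi f) <= M%:E)%E.
Proof.
apply: ge_ereal_sup => _ [g [/(bergmanP _ _)[ag Lg] g1] <-].
rewrite lee_fin bergman_normE -(ger0_norm (ltW M0)) -sqrtr_sqr ler_sqrt ?sqr_ge0//.
apply: le_trans (localization_op_le a0 ap Lp np mf f0 fM M0 iW ag Lg) _.
rewrite ler_piMr ?sqr_ge0//; move: g1; rewrite bergman_normE => g1.
by rewrite -[nr alpha g]sqr_sqrtr ?nr_ge0// expr_le1 ?sqrtr_ge0.
Qed.

Lemma formR_le_opnorm (L : R) g : 0 < L ->
  (bergman_opnorm alpha (localization_op alpha psi f) <= L%:E)%E ->
  analytic_on_disc g -> L2 alpha g -> nr alpha g = 1 -> formR alpha psi f g g <= L.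
Proof.
move=> L0 opL ag Lg g1; apply: (localization_op_ge a0 ap Lp np mf f0 fM M0 iW L0 ag Lg g1).
have : ((bergman_norm alpha (localization_op alpha psi f g))%:E <= L%:E)%E.
  apply: le_trans opL; apply: ereal_sup_ubound; exists g => //.
  by split; [exact/bergmanP|rewrite bergman_normE g1 sqrtr1].
rewrite lee_fin bergman_normE => H.
by rewrite -[nr _ _]sqr_sqrtr ?nr_ge0// lerXn2r ?nnegrE ?sqrtr_ge0 ?(ltW L0).
Qed.

End UnitWindow.

(** [good_sets] is applied to the superlevel set, and [near_mass] with the radius it yields. Both
    are independent of [alpha], hence so is the threshold [A] for given [e]. *)
Lemma opnorm_liminf (psi : R[i] -> R[i]) (m e : R) : analytic_on_disc psi -> L2 0 psi -> nr 0 psi = 1 ->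
  0 < m -> 0 < e -> (0 < area [set p : mR * mR | (sqmod (of_coord p) < 1)%R /\ (m - e / 2 < f (of_coord p))%R])%E ->
  exists2 A : R, 0 <= A & forall alpha, A <= alpha -> forall L : R, 0 < L ->
    (bergman_opnorm alpha (localization_op alpha (V alpha psi) f) <= L%:E)%E -> m - e <= L.
Proof.
move=> ap Lp np m0 e0; set S := [set p | _] => S0.
have [em|em] := leP m e.
  by exists 0 => // alpha _ L L0 _; apply: le_trans (ltW L0); rewrite subr_le0.
have mS : measurable S.
  have h : measurable_fun setT (fun p : mR * mR => (sqmod (of_coord p) < 1) && (m - e / 2 < f (of_coord p))).
    by apply: measurable_and; [exact: measurable_near|exact: measurable_fun_ltr].
  have := h measurableT [set true] I; rewrite setTI; congr measurable.
  by apply/seteqP; split => p /=; [move=> /andP|move=> [-> ->]].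
have SD : S `<=` @disc_coord R by move=> p [].
(* As [d m = e / 4], one has [(1 - d)^2 (m - e / 2) >= m - e]. One factor [1 - d] is the loss of
   mass away from [0], the other the loss from [E] to [F]. *)
pose d : R := e / (4 * m); have m4 : 0 < 4 * m by rewrite mulr_gt0.
have d0 : 0 < d by rewrite divr_gt0.
have dm : d * m = e / 4 by rewrite /d; field; rewrite gt_eqF.
have d1 : d < 1 by rewrite /d ltr_pdivrMr//; lra.
have [F [E [r [r0 [mF mE] [FS ED] [E0 E1 EF] sep]]]] := good_sets mS SD S0 d0.
have [A A0 HA] := near_mass ap Lp np d0 r0.
exists A => // alpha Aa L L0 opL; have a0 := le_trans A0 Aa; have near := HA _ Aa.
have [hV aV LV nV] := V_isometry ap Lp a0; rewrite np in nV.
have HL g := @formR_le_opnorm alpha (V alpha psi) a0 aV LV nV L g L0 opL.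
have := opnorm_lower a0 aV LV nV mf f0 iW (ltW L0) HL mE mF ED sep.
rewrite -/(lambda_mass E) => low.
have mlw : measurable_fun setT (fun p : mR * mR => lambda_weight (of_coord p) : mR).
  by apply: measurable_lambda_weight; exact: cmeas_id.
have lF : ((m - e / 2)%:E * lambda_mass F <= \int[area]_p (f (of_coord p) * lambda_weight (of_coord p) * \1_F p)%:E)%E.
  have k0 : 0 <= m - e / 2 by rewrite subr_ge0 ler_pdivrMr// (le_trans (ltW em))// ler_peMr ?ler1n// ltW.
  have m1 : measurable_fun setT (fun p : mR * mR => (lambda_weight (of_coord p) * \1_F p)%:E).
    by apply/measurable_EFinP; apply: measurable_funM => //; exact: measurable_indic.
  have g1 (p : mR * mR) : setT p -> (0 <= (lambda_weight (of_coord p) * \1_F p)%:E)%E.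
    by move=> _; rewrite lee_fin mulr_ge0 ?lambda_weight_ge0.
  rewrite /lambda_mass -(ge0_integralZl area measurableT m1 g1) ?lee_fin//.
  apply: ge0_le_integral => //.
  - by move=> p Tp; apply: mule_ge0; [rewrite lee_fin|exact: g1].
  - exact: (emeasurable_funM (measurable_cst _) m1).
  - apply/measurable_EFinP; apply: measurable_funM; last exact: measurable_indic.
    exact: measurable_funM.
  move=> p _; rewrite -EFinM lee_fin -mulrA indicE.
  have [Fp|nFp] := pselect (F p); last by rewrite memNset// !mulr0.
  rewrite mem_set// !mulr1 ler_wpM2r ?lambda_weight_ge0//; have [_ /ltW //] := FS _ Fp.
have k0 : 0 <= m - e / 2 by rewrite subr_ge0 ler_pdivrMr// (le_trans (ltW em))// ler_peMr ?ler1n// ltW.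
have chain : ((1 - d)%:E * ((m - e / 2)%:E * ((1 - d)%:E * lambda_mass E)) <= L%:E * lambda_mass E)%E.
  apply: le_trans low; apply: lee_pmul.
  - by rewrite lee_fin subr_ge0 ltW.
  - by rewrite !mule_ge0// ?lee_fin ?subr_ge0 ?ltW.
  - by rewrite lee_fin.
  by apply: le_trans lF; apply: lee_wpmul2l.
move: chain; rewrite !muleA -!EFinM.
have -> : lambda_mass E = (fine (lambda_mass E))%:E by rewrite fineK// ge0_fin_numE// ltW.
rewrite -!EFinM lee_fin ler_pM2r; last by rewrite fine_gt0// E0.
apply: le_trans; have := sqr_ge0 d; have : 0 < d * e by rewrite mulr_gt0.
by clear HL low near lF opL sep FS ED hV aV LV nV mlw S0 mS SD E0 E1 EF HA; nra.
Qed.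

End OperatorNorm.

(** * The essential supremum *)

Section EssentialBound.
Variable R : realType.
Local Notation mR := (measurableTypeR R).
Local Notation area := (@area R).
Variable f : R[i] -> R.
Hypothesis f0 : nonneg_on_disc f.
Hypothesis fL : in_Linfty f.

Lemma Linfty_normE : Linfty_norm f = ess_sup (@disc_area R) (abse \o (EFin \o (f \o @of_coord R))).
Proof. by rewrite /Linfty_norm unlock /= disc_area_setT lte_fin pi_gt0. Qed.

Lemma Linfty_norm_fine : (fine (Linfty_norm f))%:E = Linfty_norm f.
Proof. by have [_ fL'] := fL; rewrite fineK// ge0_fin_numE// Lnorm_ge0. Qed.

Lemma fine_Linfty_norm_ge0 : 0 <= fine (Linfty_norm f).
Proof. by rewrite fine_ge0// Lnorm_ge0. Qed.

Lemma Linfty_bound : {ae @disc_area R, forall p, 0 <= f (of_coord p) <= fine (Linfty_norm f)}.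
Proof.
have H := ess_sup_ge (@disc_area R) (abse \o (EFin \o (f \o @of_coord R))).
rewrite -Linfty_normE -Linfty_norm_fine in H.
apply: filterS2 f0 H => p /= p0; rewrite lee_fin p0 /=; apply: le_trans; exact: ler_norm.
Qed.

(** Otherwise [M - e] would bound [f] on the disc outside a null set, against the definition of [M]
    as the essential supremum. *)
Lemma trunc_superlevel (e : R) : 0 < e ->
  (0 < area [set p : mR * mR | (sqmod (of_coord p) < 1)%R /\ (fine (Linfty_norm f) - e < trunc f (fine (Linfty_norm f)) (of_coord p))%R])%E.
Proof.
set M := fine (Linfty_norm f) => e0; set S := [set p | _]; rewrite lt0e measure_ge0 andbT; apply/eqP => S0.
have [mf _] := fL.
have mS : measurable S.
  have h : measurable_fun setT (fun p : mR * mR => (sqmod (of_coord p) < 1) && (M - e < trunc f M (of_coord p))).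
    apply: measurable_and; first exact: measurable_near.
    by apply: measurable_fun_ltr => //; apply: measurable_trunc.
  have := h measurableT [set true] I; rewrite setTI; congr measurable.
  by apply/seteqP; split => p /=; [move=> /andP|move=> [-> ->]].
have [N [mN N0 fN]] := trunc_ae Linfty_bound.
suff : (Linfty_norm f <= (M - e)%:E)%E by rewrite -Linfty_norm_fine -/M lee_fin; lra.
rewrite Linfty_normE; apply/ess_supP; exists (S `|` N `|` ~` @disc_coord R); split.
- apply: measurableU; first exact: measurableU.
  by apply: measurableC; exact: measurable_disc_coord.
- rewrite (_ : @disc_area R _ = area ((S `|` N `|` ~` @disc_coord R) `&` @disc_coord R))//.
  apply/eqP; rewrite -measure_le0.
  apply: le_trans (_ : (area (S `|` N) <= 0)%E); last first.
    have := measureU2 area mS mN; rewrite [X in (_ <= X + _)%E]S0 [X in (_ <= _ + X)%E]N0 adde0.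
    exact.
  apply: le_measure; rewrite ?inE; last by move=> p [[|nD] D].
    apply: measurableI; last exact: measurable_disc_coord.
    apply: measurableU; first exact: measurableU.
    by apply: measurableC; exact: measurable_disc_coord.
  exact: measurableU.
move=> p /= H; apply: contrapT => nS; apply: H.
have p1 : sqmod (of_coord p) < 1 by apply: contrapT => p1; apply: nS; right.
have -> : f (of_coord p) = trunc f M (of_coord p).
  by apply: fN => // Np; apply: nS; left; right.
rewrite lee_fin ger0_norm ?trunc_ge0// leNgt; apply/negP => H; apply: nS; left; left; split => //.
Qed.

End EssentialBound.

(** * Convergence of the operator norms *)

Theorem corollary1p8 (R : realType) (psi : R[i] -> R[i]) (f : R[i] -> R)
    (psi_A2 : bergman 0 psi) (psi_unit : bergman_norm 0 psi = 1)
    (f_ge0 : nonneg_on_disc f)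
    (f_L1 : in_L1_lambda f) (f_Linfty : in_Linfty f) :
  bergman_opnorm alpha (localization_op alpha (V alpha psi) f)
    @[alpha --> +oo] --> Linfty_norm f.
Proof.
have /(bergmanP _ _)[ap Lp] := psi_A2.
have np : nr 0 psi = 1 by rewrite -[nr 0 psi]sqr_sqrtr ?nr_ge0// -bergman_normE psi_unit expr1n.
have [mf _] := f_Linfty; pose M := fine (Linfty_norm f).
have M0 : 0 <= M := fine_Linfty_norm_ge0 f.
have fM := Linfty_bound f_ge0 f_Linfty; rewrite -/M in fM.
pose T := trunc f M.
have mT := measurable_trunc M mf; have iW := trunc_integrable M mf f_L1.
have T0 := trunc_ge0 f M; have TM z := trunc_le f z M0.
have opE alpha : 0 <= alpha -> bergman_opnorm alpha (localization_op alpha (V alpha psi) f) =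
    bergman_opnorm alpha (localization_op alpha (V alpha psi) T).
  by move=> a0; have [_ _ LV _] := V_isometry ap Lp a0; exact: opnorm_trunc.
have op_ge0 alpha : 0 <= alpha -> (0 <= bergman_opnorm alpha (localization_op alpha (V alpha psi) f))%E.
  move=> a0; apply: le_trans (_ : ((bergman_norm alpha (localization_op alpha (V alpha psi) f (fun=> 0)))%:E <= _)%E).
    by rewrite lee_fin sqrtr_ge0.
  have b0 : bergman alpha (fun=> 0 : R[i]).
    by apply/bergmanP; split; [exact: (@analytic_cst R 0)|exact: (L2_cst a0 0)].
  have n0 : bergman_norm alpha (fun=> 0 : R[i]) <= 1.
    by rewrite bergman_normE nr_cst// sqmod0 sqrtr0.
  exact: (ereal_sup_ubound (ex_intro2 _ _ _ (conj b0 n0) erefl)).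
(* [M] may be [0], while the bounds on the form are stated for a positive constant; [M + e] serves
   for every [e > 0]. *)
have op_le (e alpha : R) : 0 < e -> 0 <= alpha ->
    (bergman_opnorm alpha (localization_op alpha (V alpha psi) f) <= (M + e)%:E)%E.
  move=> e0 a0; rewrite opE//; have [_ aV LV nV] := V_isometry ap Lp a0; rewrite np in nV.
  apply: (opnorm_le mT T0 _ _ iW a0 aV LV nV); last by rewrite ltr_wpDl.
  by move=> z; apply: le_trans (TM z) _; rewrite lerDl ltW.
have op_fin alpha : 0 <= alpha -> bergman_opnorm alpha (localization_op alpha (V alpha psi) f) \is a fin_num.
  by move=> a0; rewrite ge0_fin_numE ?op_ge0//; apply: le_lt_trans (op_le 1 alpha ltr01 a0) _; exact: ltry.
rewrite -(Linfty_norm_fine f_Linfty) -/M; apply/fine_cvgP; split.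
  by apply: filterS (nbhs_pinfty_ge (num_real 0)) => alpha a0; exact: op_fin.
apply/cvgrPdist_le => e e0.
have [A A0 HA] : exists2 A : R, 0 <= A & forall alpha, A <= alpha ->
    M - e <= fine (bergman_opnorm alpha (localization_op alpha (V alpha psi) f)).
  have [M00|M1] := leP M 0.
    by exists 0 => // alpha a0; apply: (@le_trans _ _ 0); [lra|exact/fine_ge0/op_ge0].
  have e2 : 0 < e / 2 / 2 by rewrite !divr_gt0.
  have S0 := trunc_superlevel f_ge0 f_Linfty e2.
  have [A A0 HA] := opnorm_liminf mT T0 TM M1 iW ap Lp np M1 (divr_gt0 e0 (ltr0n _ 2)) S0.
  (* Were the norm below [M - e], then [L = M - e] would be an admissible bound, positive since the
     norm is nonnegative, and [opnorm_liminf] for [e / 2] would give [M - e / 2 <= M - e]. *)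
  exists A => // alpha Aa; have a0 := le_trans A0 Aa; rewrite leNgt; apply/negP => lt.
  have fin := op_fin alpha a0.
  have L0 : 0 < M - e by apply: le_lt_trans lt; exact/fine_ge0/op_ge0.
  have := HA alpha Aa (M - e) L0; rewrite -opE// -(fineK fin) lee_fin => /(_ (ltW lt)).
  lra.
apply: filterS (nbhs_pinfty_ge (num_real A)) => alpha Aa; have a0 := le_trans A0 Aa.
rewrite /= ler_norml; have := HA alpha Aa; have := op_le e alpha e0 a0.
rewrite -(fineK (op_fin alpha a0)) lee_fin /= => h1 h2; apply/andP; split; lra.
Qed.
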